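(* Let $x$ be a complex number with $0<|x|<1$, and set $z={}_2F_1\left(\frac12,\frac12;1;x\right)$ and $y=\pi\,\frac{{}_2F_1\left(\frac12,\frac12;1;1-x\right)}{{}_2F_1\left(\frac12,\frac12;1;x\right)}$. Then $$\sum_{n=1}^{\infty}\frac{(-1)^{n-1}n^3}{\sinh(ny)}=\frac18x(1-x)z^4,$$ $$\sum_{n=1}^{\infty}\frac{(-1)^{n-1}n^5}{\sinh(ny)}=\frac18x(1-x)(1-2x)z^6,$$ $$\sum_{n=1}^{\infty}\frac{(-1)^{n-1}n^7}{\sinh(ny)}=\frac1{16}x(1-x)(2-17x+17x^2)z^8.$$
   Context: ${}_2F_1$ is the Gaussian hypergeometric function, with ${}_2F_1\left(\frac12,\frac12;1;1-x\right)$ given by the principal branch of its analytic continuation; for real $x\in(-1,0)$, where $1-x$ lies on the branch cut, either boundary value may be used, since they change $y$ only by an integer multiple of $2\pi i$ and leave $e^{y}$ unchanged. *)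

(* Defs.v *)
From Stdlib Require Export Factorial Reals.
From Coquelicot Require Export Coquelicot.

Open Scope C_scope.

(** * Elementary functions on [C] *)

Definition Cexp (u : C) : C := exp (Re u) * (cos (Im u), sin (Im u)).

Definition Csinh (u : C) : C := (Cexp u - Cexp (- u)) / 2.

(** * The Gaussian hypergeometric function *)

(** Pochhammer symbol [(a)_n = a (a + 1) ... (a + n - 1)]. *)
Fixpoint Cpochhammer (a : C) (n : nat) : C :=
  match n with
  | O => 1
  | S m => Cpochhammer a m * (a + INR m)
  end.

Definition hyp2F1_coeff (a b c : C) (n : nat) : C :=
  Cpochhammer a n * Cpochhammer b n / (Cpochhammer c n * INR (fact n)).

Definition off_cut (u : C) : Prop := ~ (Im u = 0%R /\ (1 <= Re u)%R).

(** The slit plane is connected and contains the unit disc, so these two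
    conditions determine [F] everywhere off the cut; the values that [F], a
    total function, takes on the cut [[1, +oo)] are arbitrary and must not be
    used (see [principal_value]). *)
Definition is_hyp2F1 (a b c : C) (F : C -> C) : Prop :=
  (forall u : C, (Cmod u < 1)%R ->
     is_pseries (K := C_AbsRing) (V := C_NormedModule)
       (hyp2F1_coeff a b c) u (F u)) /\
  (forall u : C, off_cut u ->
     ex_derive (K := C_AbsRing) (V := C_NormedModule) F u).

Definition upper_boundary_value (F : C -> C) (u w : C) : Prop :=
  filterlim F (within (fun v : C => (0 < Im v)%R) (locally u)) (locally w).

Definition lower_boundary_value (F : C -> C) (u w : C) : Prop :=
  filterlim F (within (fun v : C => (Im v < 0)%R) (locally u)) (locally w).

(** [w] is a value at [u] of a function [F] that is holomorphic off the cut: it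
    is [F u] if [u] is off the cut, and either of the two boundary values of
    [F] if [u] is on it. *)
Definition principal_value (F : C -> C) (u w : C) : Prop :=
  (off_cut u /\ w = F u) \/
  (~ off_cut u /\ (upper_boundary_value F u w \/ lower_boundary_value F u w)).

(** * The series *)

Definition alt_sinh_term (p : nat) (y : C) (n : nat) : C :=
  (- (1)) ^ (n - 1) * INR n ^ p / Csinh (INR n * y).

(** [sum_{n >= 1} (-1)^(n-1) n^p / sinh (n y)] converges, with sum [l]. *)
Definition is_alt_sinh_sum (p : nat) (y l : C) : Prop :=
  is_series (K := C_AbsRing) (V := C_NormedModule)
    (fun m : nat => alt_sinh_term p y (S m)) l.

(* Main.v *)
(** Write [r = x^(1/4)] on the sector [Re r > 0]. Landen's transformation, applied
    twice, gives [F (1 - r^4) = (4 / (1 + r)^2) F (((1 - r) / (1 + r))^4)]; the right-hand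
    side also covers the branch cut. The same transformation is a step of the
    arithmetic-geometric mean, which stays in a sector, so [Re y > 0] and the Lambert
    series converge.

    The Wronskian of the hypergeometric equation gives [dy/dx = - 1 / (x (1 - x) z^2)],
    the constant being read off at [x = -1], and Landen's doubling of [y] gives
    [y + log x -> log 16] as [x -> 0].

    Convolving the series by means of [csch A csch B = csch (A + B) (coth A + coth B)]
    shows that [S_p = sum (-1)^(n-1) n^p / sinh (n y)] and
    [k = 1 - 24 sum n q^(2n) / (1 - q^(2n)) - 12 S_1], where [q = exp (- y)], satisfy, with
    [D = - d/dy], [D S_1 = 2 S_1^2 + S_3], [D S_3 = S_3 (8 S_1 + k)] and
    [D k = 4 S_1 k - 16 S_3], together with [S_5 = k S_3] and [S_7 = k S_5 - 36 S_3^2]. The functions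
    [x (1 - x) z z' / 2], [x (1 - x) z^4 / 8] and [(1 - 2 x) z^2] satisfy the same
    differential system. The two solutions have the same leading terms at [x = 0], and a
    Gronwall estimate along each ray, across that singular point, identifies them. *)

Require Import Defs.
From Stdlib Require Import Lra Lia Psatz.

(** The differential system is autonomous in y, so every translate of a solution is again a
    solution: the constant log 16 is what selects the right one, and this is why y itself must be
    known near x = 0 and not only dy/dx. In a radial variable t, with x proportional to t^4, the
    system is singular at 0. The only mode of its linearization that vanishes there has size t^4,
    and it is the infinitesimal translation. Agreement of the two solutions to first order in x
    excludes it: the differences are O(t^8), their squared norm is O(t^16), while the estimate near
    0 needs only more than t^12. The Cauchy theory serves one purpose. Power series prove Landen's
    formula only near 0, and the identity theorem on the disc carries it to the whole slit plane.
    Positivity of Re y is an angle count. The arguments of 1/w and 1/z, as limits of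
    arithmetic-geometric means, lie in explicit sectors, and the angle sum of the triangle 0, x, 1
    keeps the difference of these arguments below a right angle. *)

(** * Elementary facts about the modulus *)

Lemma Cmod_minus_sym (u v : C) : Cmod (u - v) = Cmod (v - u).
Proof. rewrite <- Cmod_opp. f_equal. ring. Qed.

Lemma Cmod_triangle_minus (u v : C) : Cmod (u - v) <= Cmod u + Cmod v.
Proof. unfold Cminus. rewrite <- (Cmod_opp v). apply Cmod_triangle. Qed.

Lemma Cmod_triangle_rev (u v : C) : Cmod u - Cmod v <= Cmod (u - v).
Proof.
  pose proof (Cmod_triangle (u - v) v) as H.
  replace (u - v + v) with u in H by ring. lra.
Qed.

Lemma Im_le_Cmod (c : C) : Rabs (Im c) <= Cmod c.
Proof. eapply Rle_trans; [|apply Rmax_Cmod]. apply Rmax_r. Qed.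

Lemma Cmod_le_Re_Im (c : C) : Cmod c <= Rabs (Re c) + Rabs (Im c).
Proof.
  destruct c as [a b]. unfold Cmod, Re, Im; simpl.
  pose proof (Rabs_pos a). pose proof (Rabs_pos b).
  apply Rsqr_incr_0_var; [|lra].
  rewrite Rsqr_sqrt by nra. unfold Rsqr.
  replace (a * (a * 1) + b * (b * 1))%R with (Rabs a * Rabs a + Rabs b * Rabs b)%R.
  - nra.
  - rewrite <- !Rabs_mult. rewrite !Rabs_pos_eq by nra. ring.
Qed.

Lemma C_ext (u v : C) : Re u = Re v -> Im u = Im v -> u = v.
Proof. destruct u, v; unfold Re, Im; simpl; congruence. Qed.

Lemma Cmod_small_0 (u : C) : (forall eps, 0 < eps -> Cmod u <= eps)%R -> u = 0.
Proof.
  intros H. apply Cmod_eq_0.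
  destruct (Rle_lt_or_eq_dec _ _ (Cmod_ge_0 u)) as [L|]; [|auto].
  specialize (H (Cmod u / 2)%R ltac:(lra)). lra.
Qed.

Lemma Cmod_sq (u : C) : (Cmod u * Cmod u = Re u * Re u + Im u * Im u)%R.
Proof. pose proof (Cmod2_alt u). nra. Qed.

(** * Complex differentiability *)

Definition CC (f : C -> C) (u : C) : Prop :=
  forall eps, (0 < eps)%R -> exists d, (0 < d)%R /\
    forall v, (Cmod (v - u) < d)%R -> (Cmod (f v - f u) < eps)%R.

(** Stated through the remainder and not through a difference quotient, so that [v = u] needs no
    exclusion and compositions need no case split. *)
Definition CD (f : C -> C) (u l : C) : Prop :=
  forall eps, (0 < eps)%R -> exists d, (0 < d)%R /\
    forall v, (Cmod (v - u) < d)%R ->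
      (Cmod (f v - f u - l * (v - u)) <= eps * Cmod (v - u))%R.

Lemma CC_const (c u : C) : CC (fun _ => c) u.
Proof.
  intros e He. exists 1%R. split; [lra|]. intros v _.
  replace (c - c) with (RtoC 0) by ring. rewrite Cmod_0. auto.
Qed.

Lemma CC_id (u : C) : CC (fun v => v) u.
Proof. intros e He. exists e. auto. Qed.

Lemma CC_plus f g u : CC f u -> CC g u -> CC (fun v => f v + g v) u.
Proof.
  intros Hf Hg e He.
  destruct (Hf (e / 2)%R ltac:(lra)) as [d1 [? H1]].
  destruct (Hg (e / 2)%R ltac:(lra)) as [d2 [? H2]].
  exists (Rmin d1 d2). split; [apply Rmin_pos; auto|]. intros v Hv.
  pose proof (Rmin_l d1 d2). pose proof (Rmin_r d1 d2).
  specialize (H1 v ltac:(lra)). specialize (H2 v ltac:(lra)).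
  replace (f v + g v - (f u + g u)) with ((f v - f u) + (g v - g u)) by ring.
  eapply Rle_lt_trans; [apply Cmod_triangle|]. lra.
Qed.

Lemma CC_mult f g u : CC f u -> CC g u -> CC (fun v => f v * g v) u.
Proof.
  intros Hf Hg e He.
  set (A := (Cmod (f u) + 1)%R). set (B := (Cmod (g u) + 1)%R).
  assert (HA : (1 <= A)%R) by (pose proof (Cmod_ge_0 (f u)); unfold A; lra).
  assert (HB : (1 <= B)%R) by (pose proof (Cmod_ge_0 (g u)); unfold B; lra).
  destruct (Hf (Rmin 1 (e / (2 * B)))%R) as [d1 [? H1]].
  { apply Rmin_pos; [lra|]. apply Rdiv_lt_0_compat; lra. }
  destruct (Hg (e / (2 * A))%R) as [d2 [? H2]].
  { apply Rdiv_lt_0_compat; lra. }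
  exists (Rmin d1 d2). split; [apply Rmin_pos; auto|]. intros v Hv.
  pose proof (Rmin_l d1 d2). pose proof (Rmin_r d1 d2).
  specialize (H1 v ltac:(lra)). specialize (H2 v ltac:(lra)).
  pose proof (Rmin_l 1 (e / (2 * B))). pose proof (Rmin_r 1 (e / (2 * B))).
  replace (f v * g v - f u * g u)
    with (f v * (g v - g u) + (f v - f u) * g u) by ring.
  eapply Rle_lt_trans; [apply Cmod_triangle|]. rewrite !Cmod_mult.
  assert (Cmod (f v) <= A)%R.
  { pose proof (Cmod_triangle_rev (f v) (f u)). unfold A. lra. }
  assert (Cmod (f v) * Cmod (g v - g u) <= A * (e / (2 * A)))%R.
  { apply Rmult_le_compat; try apply Cmod_ge_0; lra. }
  assert (Cmod (f v - f u) * Cmod (g u) <= (e / (2 * B)) * (B - 1))%R.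
  { apply Rmult_le_compat; try apply Cmod_ge_0; unfold B in *; lra. }
  replace (A * (e / (2 * A)))%R with (e / 2)%R in * by (field; lra).
  replace ((e / (2 * B)) * (B - 1))%R with (e / 2 - e / (2 * B))%R in * by (field; lra).
  assert (0 < e / (2 * B))%R by (apply Rdiv_lt_0_compat; lra). lra.
Qed.

Lemma CC_comp f g u : CC f u -> CC g (f u) -> CC (fun v => g (f v)) u.
Proof.
  intros Hf Hg e He. destruct (Hg e He) as [d1 [P1 H1]].
  destruct (Hf d1 P1) as [d [P H]]. exists d. split; auto.
Qed.

(** Carathéodory's criterion: the slope function [phi] absorbs the limit, so that the product and
    chain rules become algebra together with continuity of [phi]. *)
Lemma CD_caratheodory f u l :
  CD f u l <-> exists phi, CC phi u /\ phi u = l /\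
    forall v, f v = f u + phi v * (v - u).
Proof.
  split.
  - intros H.
    exists (fun v => if Ceq_dec v u then l else (f v - f u) / (v - u)).
    split; [|split].
    + intros e He. destruct (H (e / 2)%R ltac:(lra)) as [d [P Hd]].
      exists d. split; auto. intros v Hv.
      destruct (Ceq_dec u u) as [_|]; [|congruence].
      destruct (Ceq_dec v u) as [->|N].
      * replace (l - l) with (RtoC 0) by ring. rewrite Cmod_0. auto.
      * assert (v - u <> 0) by (apply Cminus_eq_contra; auto).
        replace ((f v - f u) / (v - u) - l) with ((f v - f u - l * (v - u)) / (v - u))
          by (field; auto).
        rewrite Cmod_div by auto.
        assert (0 < Cmod (v - u))%R by (apply Cmod_gt_0; auto).
        apply Rle_lt_trans with (e / 2)%R; [|lra].
        apply Rle_div_l; auto.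
    + destruct (Ceq_dec u u); congruence.
    + intros v. destruct (Ceq_dec v u) as [->|N]; [ring|].
      field. apply Cminus_eq_contra; auto.
  - intros [phi [H1 [<- H2]]] e He. destruct (H1 e He) as [d [P Hd]].
    exists d. split; auto. intros v Hv. rewrite (H2 v).
    replace (f u + phi v * (v - u) - f u - phi u * (v - u))
      with ((phi v - phi u) * (v - u)) by ring.
    rewrite Cmod_mult. apply Rmult_le_compat_r; [apply Cmod_ge_0|].
    left; auto.
Qed.

Lemma CD_CC f u l : CD f u l -> CC f u.
Proof.
  intros H. apply CD_caratheodory in H. destruct H as [phi [H1 [_ H2]]].
  assert (K : CC (fun v => f u + phi v * (v + - u)) u).
  { apply CC_plus; [apply CC_const|]. apply CC_mult; auto.
    apply CC_plus; [apply CC_id | apply CC_const]. }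
  intros e He. destruct (K e He) as [d [P Hd]]. exists d; split; auto.
  intros v Hv. specialize (Hd v Hv). rewrite (H2 v).
  replace (f u + phi v * (v - u) - f u)
    with (f u + phi v * (v + - u) - (f u + phi u * (u + - u))) by ring. auto.
Qed.

Lemma CD_eq f u l l' : CD f u l -> l = l' -> CD f u l'.
Proof. intros H <-; auto. Qed.

Lemma CD_ext_loc f g u l d : (0 < d)%R ->
  (forall v, (Cmod (v - u) < d)%R -> f v = g v) -> CD f u l -> CD g u l.
Proof.
  intros Hd E H e He. destruct (H e He) as [d1 [P K]].
  exists (Rmin d d1). split; [apply Rmin_pos; auto|].
  intros v Hv. pose proof (Rmin_l d d1). pose proof (Rmin_r d d1).
  rewrite <- (E v), <- (E u); [apply K; lra| |lra].
  replace (u - u) with (RtoC 0) by ring. rewrite Cmod_0. auto.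
Qed.

Lemma CD_ext f g u l : (forall v, f v = g v) -> CD f u l -> CD g u l.
Proof. intros E. apply (CD_ext_loc f g u l 1); auto; lra. Qed.

Lemma CD_const c u : CD (fun _ => c) u 0.
Proof.
  apply CD_caratheodory. exists (fun _ => RtoC 0).
  split; [apply CC_const|]. split; auto. intros; ring.
Qed.

Lemma CD_id u : CD (fun v => v) u 1.
Proof.
  apply CD_caratheodory. exists (fun _ => RtoC 1).
  split; [apply CC_const|]. split; auto. intros; ring.
Qed.

Lemma CD_plus f g u a b : CD f u a -> CD g u b -> CD (fun v => f v + g v) u (a + b).
Proof.
  rewrite !CD_caratheodory. intros [p [P1 [<- P2]]] [q [Q1 [<- Q2]]].
  exists (fun v => p v + q v). split; [apply CC_plus; auto|]. split; auto.
  intros v. rewrite (P2 v), (Q2 v). ring.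
Qed.

Lemma CD_mult f g u a b :
  CD f u a -> CD g u b -> CD (fun v => f v * g v) u (a * g u + f u * b).
Proof.
  intros Hf Hg. pose proof (CD_CC _ _ _ Hg) as Cg.
  apply CD_caratheodory in Hf. apply CD_caratheodory in Hg.
  apply CD_caratheodory. destruct Hf as [p [P1 [<- P2]]]. destruct Hg as [q [Q1 [<- Q2]]].
  exists (fun v => p v * g v + f u * q v).
  split.
  - apply CC_plus; apply CC_mult; auto. apply CC_const.
  - split; auto. intros v. cbv beta. rewrite (P2 v), (Q2 v). ring.
Qed.

Lemma CD_opp f u a : CD f u a -> CD (fun v => - f v) u (- a).
Proof.
  intros H. apply CD_ext with (fun v => (-(1)) * f v); [intros; ring|].
  eapply CD_eq; [apply CD_mult; [apply CD_const | apply H]|]. cbv beta; ring.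
Qed.

Lemma CD_minus f g u a b : CD f u a -> CD g u b -> CD (fun v => f v - g v) u (a - b).
Proof. intros. apply CD_plus; auto. apply CD_opp; auto. Qed.

Lemma CD_comp f g u a b :
  CD f u a -> CD g (f u) b -> CD (fun v => g (f v)) u (b * a).
Proof.
  intros Hf Hg. pose proof (CD_CC _ _ _ Hf) as Cf.
  apply CD_caratheodory in Hf. apply CD_caratheodory in Hg.
  apply CD_caratheodory. destruct Hf as [p [P1 [<- P2]]]. destruct Hg as [q [Q1 [<- Q2]]].
  exists (fun v => q (f v) * p v). split; [|split]; auto.
  - apply CC_mult; auto. apply (CC_comp f q); auto.
  - intros v. cbv beta. rewrite (Q2 (f v)) at 1. rewrite (P2 v) at 2. ring.
Qed.

Lemma CD_Cinv (u : C) : u <> 0 -> CD Cinv u (- / (u * u)).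
Proof.
  intros Hu e He.
  assert (Pu : (0 < Cmod u)%R) by (apply Cmod_gt_0; auto).
  set (m := Cmod u) in *.
  exists (Rmin (m / 2) (e * (m * m * m) / 2)). split.
  { apply Rmin_pos; [lra|]. assert (0 < m * m * m)%R by (repeat apply Rmult_lt_0_compat; auto).
    assert (0 < e * (m * m * m))%R by (apply Rmult_lt_0_compat; auto). lra. }
  intros v Hv. pose proof (Rmin_l (m / 2) (e * (m * m * m) / 2)).
  pose proof (Rmin_r (m / 2) (e * (m * m * m) / 2)).
  assert (Mv : (m / 2 <= Cmod v)%R).
  { pose proof (Cmod_triangle_rev u v). rewrite Cmod_minus_sym in H1. fold m in H1. lra. }
  assert (Nv : v <> 0) by (apply Cmod_gt_0; lra).
  replace (/ v - / u - - / (u * u) * (v - u)) with ((v - u) / (v * (u * u)) * (v - u))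
    by (field; auto).
  rewrite Cmod_mult. apply Rmult_le_compat_r; [apply Cmod_ge_0|].
  assert (v * (u * u) <> 0) by (repeat apply Cmult_neq_0; auto).
  rewrite Cmod_div by auto. rewrite !Cmod_mult. fold m.
  apply Rle_div_l.
  { apply Rlt_gt. apply Rmult_lt_0_compat; nra. }
  apply Rle_trans with (e * (m / 2 * (m * m)))%R; [lra|].
  apply Rmult_le_compat_l; [lra|]. apply Rmult_le_compat_r; [nra|lra].
Qed.

Lemma CD_inv f u a : CD f u a -> f u <> 0 -> CD (fun v => / f v) u (- a / (f u * f u)).
Proof.
  intros H N. eapply CD_eq; [apply (CD_comp f Cinv); [apply H | apply CD_Cinv; auto]|].
  cbv beta. field. auto.
Qed.

Lemma CD_div f g u a b : CD f u a -> CD g u b -> g u <> 0 ->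
  CD (fun v => f v / g v) u ((a * g u - f u * b) / (g u * g u)).
Proof.
  intros Hf Hg N. eapply CD_eq.
  - apply CD_mult; [apply Hf | apply CD_inv; [apply Hg | auto]].
  - cbv beta; field; auto.
Qed.

Lemma CD_pow f u a n : CD f u a -> CD (fun v => f v ^ n) u (INR n * f u ^ (n - 1) * a).
Proof.
  intros H. induction n as [|n IH].
  - apply CD_ext with (fun _ => RtoC 1); [reflexivity|].
    eapply CD_eq; [apply CD_const|]. simpl. ring.
  - apply CD_ext with (fun v => f v * f v ^ n); [reflexivity|].
    eapply CD_eq; [apply (CD_mult f (fun v => f v ^ n)); eauto|].
    rewrite S_INR, RtoC_plus. replace (S n - 1)%nat with n by lia.
    destruct n; [simpl; ring|]. replace (S n - 1)%nat with n by lia. simpl. ring.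
Qed.

(** This and the next two serve the eta-contracted forms of [fun v => c * v] and its like, which
    [cd_step] tries first. *)
Lemma CD_Cmult c u : CD (Cmult c) u c.
Proof.
  apply CD_eq with (0 * u + c * 1); [|ring].
  apply (CD_mult (fun _ => c) (fun v => v)); [apply CD_const | apply CD_id].
Qed.

Lemma CD_Cplus c u : CD (Cplus c) u 1.
Proof.
  apply CD_eq with (0 + 1); [|ring].
  apply (CD_plus (fun _ => c) (fun v => v)); [apply CD_const | apply CD_id].
Qed.

Lemma CD_Cminus c u : CD (Cminus c) u (-(1)).
Proof.
  apply CD_eq with (0 - 1); [|ring].
  apply (CD_minus (fun _ => c) (fun v => v)); [apply CD_const | apply CD_id].
Qed.

Ltac cd_step :=
  match goal with
  | |- CD (Cmult _) _ _ => apply CD_Cmult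
  | |- CD (Cplus _) _ _ => apply CD_Cplus
  | |- CD (Cminus _) _ _ => apply CD_Cminus
  | |- CD (fun _ => ?c) _ _ => apply CD_const
  | |- CD (fun v => v) _ _ => apply CD_id
  | |- CD (fun v => _ + _) _ _ => eapply CD_plus
  | |- CD (fun v => _ - _) _ _ => eapply CD_minus
  | |- CD (fun v => _ / _) _ _ => eapply CD_div
  | |- CD (fun v => _ * _) _ _ => eapply CD_mult
  | |- CD (fun v => - _) _ _ => eapply CD_opp
  | |- CD (fun v => / _) _ _ => eapply CD_inv
  | |- CD (fun v => _ ^ _) _ _ => eapply CD_pow
  end.
Ltac cd := repeat (cd_step; cbv beta).

Lemma CD_real_Re f t l : CD f (RtoC t) l -> is_derive (fun t => Re (f (RtoC t))) t (Re l).
Proof.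
  intros H. apply is_derive_Reals. intros e He.
  destruct (H (e / 2)%R ltac:(lra)) as [d [P Hd]]. exists (mkposreal d P).
  intros h Nh Hh. simpl in Hh.
  specialize (Hd (RtoC (t + h))).
  replace (RtoC (t + h) - RtoC t) with (RtoC h) in Hd by (rewrite RtoC_plus; ring).
  rewrite Cmod_R in Hd. specialize (Hd Hh).
  assert (Q : ((Re (f (RtoC (t + h))) - Re (f (RtoC t))) / h - Re l =
     Re (f (RtoC (t + h)) - f (RtoC t) - l * RtoC h) / h)%R).
  { unfold Re, Cminus, Cplus, Copp, Cmult, RtoC; simpl. field. auto. }
  rewrite Q. rewrite Rabs_div by auto.
  assert (0 < Rabs h)%R by (apply Rabs_pos_lt; auto).
  apply Rle_lt_trans with (e / 2)%R; [|lra].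
  apply Rle_div_l; auto. eapply Rle_trans; [apply re_le_Cmod|]. auto.
Qed.

Lemma CD_real_Im f t l : CD f (RtoC t) l -> is_derive (fun t => Im (f (RtoC t))) t (Im l).
Proof.
  intros H.
  apply is_derive_ext with (fun t => Re ((fun v => (- Ci) * f v) (RtoC t))).
  { intros s. unfold Re, Im, Ci, Copp, Cmult, RtoC; simpl. ring. }
  replace (Im l) with (Re (0 * f (RtoC t) + - Ci * l)).
  - apply (CD_real_Re (fun v => (- Ci) * f v)). apply (CD_mult (fun _ => - Ci) f); auto. apply CD_const.
  - unfold Re, Im, Ci, Copp, Cmult, Cplus, RtoC; simpl. ring.
Qed.

Lemma CD_affine (u h v : C) : CD (fun t => u + t * h) v h.
Proof. eapply CD_eq; [cd|]. cbv beta; ring. Qed.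

Lemma Re_RtoC_mult_conj (d : C) : Re (Cconj d * d) = (Cmod d * Cmod d)%R.
Proof. rewrite Cmod_sq. destruct d; unfold Re, Im, Cconj, Cmult; simpl. ring. Qed.

(** Mean value inequality: apply the real mean value theorem to
    [t |-> Re (conj d * f (u + t h))] with [d = f (u + h) - f u]. *)
Lemma C_mean_value (f f' : C -> C) (u h : C) (B : R) :
  (forall t, (0 <= t <= 1)%R -> CD f (u + t * h) (f' (u + t * h))) ->
  (forall t, (0 <= t <= 1)%R -> (Cmod (f' (u + t * h)%C) <= B)%R) ->
  (Cmod (f (u + h)%C - f u)%C <= B * Cmod h)%R.
Proof.
  intros H1 H2. set (d := f (u + h) - f u).
  assert (D : forall t, (0 <= t <= 1)%R ->
    is_derive (fun t : R => Re (Cconj d * f (u + t * h))) t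
      (Re (Cconj d * (f' (u + t * h) * h)))).
  { intros t Ht.
    apply (CD_real_Re (fun v => Cconj d * f (u + v * h))).
    eapply CD_eq.
    - cd. apply (CD_comp (fun v => u + v * h) f); [apply CD_affine | apply H1; auto].
    - cbv beta; ring. }
  destruct (MVT_gen (fun t : R => Re (Cconj d * f (u + t * h))) 0 1
     (fun t : R => Re (Cconj d * (f' (u + t * h) * h)))) as [c [Hc E]].
  - intros t Ht. rewrite Rmin_left, Rmax_right in Ht by lra. apply D; lra.
  - intros t Ht. rewrite Rmin_left, Rmax_right in Ht by lra.
    apply continuity_pt_filterlim. apply (ex_derive_continuous (V := R_NormedModule)).
    eexists. apply D; lra.
  - rewrite Rmin_left, Rmax_right in Hc by lra.
    assert (E2 : (Cmod d * Cmod d = Re (Cconj d * (f' (u + c * h)%C * h)))%R).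
    { rewrite <- Re_RtoC_mult_conj.
      rewrite Rminus_0_r, Rmult_1_r in E. rewrite <- E.
      unfold d at 2. replace (u + 1 * h) with (u + h) by ring.
      replace (u + 0 * h) with u by ring.
      unfold Re, Cminus, Cplus, Copp, Cmult; simpl. ring. }
    assert (E3 : (Cmod d * Cmod d <= Cmod d * (B * Cmod h))%R).
    { rewrite E2. eapply Rle_trans; [apply Rle_abs|].
      eapply Rle_trans; [apply re_le_Cmod|]. rewrite !Cmod_mult, Cmod_conj.
      apply Rmult_le_compat_l; [apply Cmod_ge_0|].
      apply Rmult_le_compat_r; [apply Cmod_ge_0|]. apply H2; auto. }
    destruct (Req_dec (Cmod d) 0) as [Z|N].
    + rewrite Z. specialize (H2 0%R ltac:(lra)).
      apply Rmult_le_pos; [|apply Cmod_ge_0].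
      eapply Rle_trans; [|apply H2]. apply Cmod_ge_0.
    + pose proof (Cmod_ge_0 d). apply Rmult_le_reg_l with (Cmod d); lra.
Qed.

(** * Complex sequences and series *)

(** Encoded by the real sequence of distances, so that squeezing arguments are those for real
    limits. *)
Definition Clim (s : nat -> C) (l : C) : Prop :=
  is_lim_seq (fun n => Cmod (s n - l)) 0.

Lemma Clim_spec s l : Clim s l <->
  forall eps, (0 < eps)%R -> exists N, forall n, (N <= n)%nat -> (Cmod (s n - l) < eps)%R.
Proof.
  split.
  - intros H eps He. apply is_lim_seq_spec in H. destruct (H (mkposreal eps He)) as [N HN].
    exists N. intros n Hn. specialize (HN n Hn). simpl in HN.
    rewrite Rminus_0_r, Rabs_pos_eq in HN by apply Cmod_ge_0. auto.
  - intros H. apply is_lim_seq_spec. intros [eps He]. destruct (H eps He) as [N HN].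
    exists N. intros n Hn. simpl. rewrite Rminus_0_r, Rabs_pos_eq by apply Cmod_ge_0. auto.
Qed.

Lemma Clim_le s l (b : nat -> R) :
  (forall n, (Cmod (s n - l) <= b n)%R) -> is_lim_seq b 0 -> Clim s l.
Proof.
  intros H Hb. apply is_lim_seq_le_le with (fun _ => 0%R) b; auto.
  - intros n. split; [apply Cmod_ge_0 | apply H].
  - apply is_lim_seq_const.
Qed.

Lemma Clim_const c : Clim (fun _ => c) c.
Proof.
  apply Clim_le with (fun _ => 0%R); [|apply is_lim_seq_const].
  intros _. replace (c - c) with (RtoC 0) by ring. rewrite Cmod_0. lra.
Qed.

Lemma Clim_plus s t a b : Clim s a -> Clim t b -> Clim (fun n => s n + t n) (a + b).
Proof.
  intros H1 H2. apply Clim_le with (fun n => Cmod (s n - a) + Cmod (t n - b))%R.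
  - intros n. replace (s n + t n - (a + b)) with ((s n - a) + (t n - b)) by ring.
    apply Cmod_triangle.
  - replace 0%R with (0 + 0)%R by ring. apply is_lim_seq_plus'; auto.
Qed.

Lemma Clim_mult s t a b : Clim s a -> Clim t b -> Clim (fun n => s n * t n) (a * b).
Proof.
  intros H1 H2.
  apply Clim_le with (fun n => Cmod (s n - a) * Cmod (t n - b) + Cmod a * Cmod (t n - b)
     + Cmod (s n - a) * Cmod b)%R.
  - intros n. replace (s n * t n - (a * b))
      with ((s n - a) * (t n - b) + a * (t n - b) + (s n - a) * b) by ring.
    eapply Rle_trans; [apply Cmod_triangle|]. rewrite Cmod_mult.
    apply Rplus_le_compat_r. eapply Rle_trans; [apply Cmod_triangle|].
    rewrite !Cmod_mult. lra.
  - replace 0%R with (0 * 0 + Cmod a * 0 + 0 * Cmod b)%R by ring.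
    repeat apply is_lim_seq_plus'; apply is_lim_seq_mult'; auto; apply is_lim_seq_const.
Qed.

Lemma Clim_scal c s a : Clim s a -> Clim (fun n => c * s n) (c * a).
Proof. apply (Clim_mult (fun _ => c)). apply Clim_const. Qed.

Lemma Clim_minus s t a b : Clim s a -> Clim t b -> Clim (fun n => s n - t n) (a - b).
Proof.
  intros H1 H2. apply Clim_plus; auto.
  apply Clim_le with (fun n => Cmod (t n - b)); auto. intros n.
  replace (- t n - - b) with (- (t n - b)) by ring. rewrite Cmod_opp. lra.
Qed.

Lemma Clim_ext s t a : (forall n, s n = t n) -> Clim s a -> Clim t a.
Proof. intros E. apply is_lim_seq_ext. intros n. rewrite E. auto. Qed.

Lemma Clim_unique s a b : Clim s a -> Clim s b -> a = b.
Proof.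
  intros Ha Hb. pose proof (Clim_minus _ _ _ _ Ha Hb) as H.
  assert (K : is_lim_seq (fun _ => Cmod (a - b)) 0).
  { eapply is_lim_seq_ext; [|apply H]. intros n. cbv beta.
    replace (s n - s n - (a - b)) with (- (a - b)) by ring. apply Cmod_opp. }
  pose proof (is_lim_seq_unique _ _ K) as K1. rewrite Lim_seq_const in K1.
  injection K1 as K1. apply Cmod_eq_0 in K1. apply Ceq_minus. auto.
Qed.

Lemma Clim_incr_1 s a : Clim s a <-> Clim (fun n => s (S n)) a.
Proof. apply (is_lim_seq_incr_1 (fun n => Cmod (s n - a))). Qed.

Lemma Clim_Cmod_le s a (B : R) : Clim s a -> (forall n, (Cmod (s n) <= B)%R) -> (Cmod a <= B)%R.
Proof.
  intros H1 H2. apply Rnot_lt_le. intros L.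
  apply Clim_spec with (eps := (Cmod a - B)%R) in H1; [|lra].
  destruct H1 as [N HN]. specialize (HN N (Nat.le_refl _)). specialize (H2 N).
  rewrite Cmod_minus_sym in HN. pose proof (Cmod_triangle_rev a (s N)). lra.
Qed.

Lemma Clim_CC f s a : CC f a -> Clim s a -> Clim (fun n => f (s n)) (f a).
Proof.
  rewrite !Clim_spec. intros H1 H2 e He. destruct (H1 e He) as [d [P Hd]].
  destruct (H2 d P) as [N HN]. exists N. intros n Hn. auto.
Qed.

Lemma Clim_Re s a : Clim s a -> is_lim_seq (fun n => Re (s n)) (Re a).
Proof.
  intros H. apply is_lim_seq_spec. intros [e He]. apply Clim_spec with (eps := e) in H; auto.
  destruct H as [N HN]. exists N. intros n Hn. simpl. specialize (HN n Hn).
  eapply Rle_lt_trans; [|apply HN]. eapply Rle_trans; [|apply re_le_Cmod].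
  unfold Re, Cminus, Cplus, Copp; simpl. apply Req_le. f_equal.
Qed.

Lemma Clim_Im s a : Clim s a -> is_lim_seq (fun n => Im (s n)) (Im a).
Proof.
  intros H. apply is_lim_seq_spec. intros [e He]. apply Clim_spec with (eps := e) in H; auto.
  destruct H as [N HN]. exists N. intros n Hn. simpl. specialize (HN n Hn).
  eapply Rle_lt_trans; [|apply HN]. eapply Rle_trans; [|apply Im_le_Cmod].
  unfold Im, Cminus, Cplus, Copp; simpl. apply Req_le. f_equal.
Qed.

Lemma Clim_of_Re_Im s a : is_lim_seq (fun n => Re (s n)) (Re a) ->
  is_lim_seq (fun n => Im (s n)) (Im a) -> Clim s a.
Proof.
  intros H1 H2.
  apply Clim_le with (fun n => Rabs (Re (s n) - Re a) + Rabs (Im (s n) - Im a))%R.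
  - intros n. apply (Cmod_le_Re_Im (s n - a)).
  - replace 0%R with (Rabs (Re a - Re a) + Rabs (Im a - Im a))%R
      by (rewrite !Rminus_diag, Rabs_R0; ring).
    apply is_lim_seq_plus'.
    + apply (is_lim_seq_abs _ (Re a - Re a)%R). apply is_lim_seq_minus'; auto.
      apply is_lim_seq_const.
    + apply (is_lim_seq_abs _ (Im a - Im a)%R). apply is_lim_seq_minus'; auto.
      apply is_lim_seq_const.
Qed.

(** The index [n] is excluded, unlike in [sum_n]; the empty sum makes the inductions below start at
    0, and [csum_sum_n] accounts for the shift. *)
Fixpoint csum (f : nat -> C) (n : nat) : C :=
  match n with O => 0 | S m => csum f m + f m end.

Lemma csum_ext f g n : (forall i, (i < n)%nat -> f i = g i) -> csum f n = csum g n.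
Proof.
  induction n as [|n IH]; intros H; simpl; auto. rewrite IH, H by auto. auto.
Qed.

Lemma csum_sum_n f n : csum f (S n) = sum_n f n.
Proof.
  induction n as [|n IH].
  - rewrite sum_O. simpl. ring.
  - rewrite sum_Sn. rewrite <- IH. reflexivity.
Qed.

Lemma is_series_csum f l :
  is_series (K := C_AbsRing) (V := C_NormedModule) f l <-> Clim (csum f) l.
Proof.
  rewrite (Clim_incr_1 (csum f)). rewrite Clim_spec.
  split.
  - intros H e He.
    destruct (proj1 (filterlim_locally_ball_norm (K := C_AbsRing) (U := C_NormedModule)
      _ _) H (mkposreal e He)) as [N HN].
    exists N. intros n Hn. rewrite csum_sum_n. apply (HN n Hn).
  - intros H. apply (filterlim_locally_ball_norm (K := C_AbsRing) (U := C_NormedModule)).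
    intros [e He]. destruct (H e He) as [N HN]. exists N. intros n Hn.
    specialize (HN n Hn). rewrite csum_sum_n in HN. exact HN.
Qed.

Lemma csum_scal c f n : csum (fun i => c * f i) n = c * csum f n.
Proof. induction n as [|n IH]; simpl; [ring|]. rewrite IH. ring. Qed.

Lemma csum_Cmod f n (K : nat -> R) : (forall i, (Cmod (f i) <= K i)%R) ->
  (Cmod (csum f (S n)) <= sum_n K n)%R.
Proof.
  intros H. induction n as [|n IH].
  - rewrite sum_O. simpl. replace (0 + f 0%nat) with (f 0%nat) by ring. auto.
  - rewrite sum_Sn. change (csum f (S (S n))) with (csum f (S n) + f (S n)).
    eapply Rle_trans; [apply Cmod_triangle|]. apply Rplus_le_compat; auto.
Qed.

(** A total function, so that a series depending on a parameter is a plain function of it; its value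
    means something only together with [CSer_correct] or [CSer_unique]. *)
Definition CSer (f : nat -> C) : C := (Series (fun n => Re (f n)), Series (fun n => Im (f n))).

Lemma CSer_ext f g : (forall n, f n = g n) -> CSer f = CSer g.
Proof.
  intros H. unfold CSer. f_equal; apply Series_ext; intros n; rewrite H; auto.
Qed.

Lemma CSer_correct f K : (forall n, (Cmod (f n) <= K n)%R) -> ex_series K ->
  Clim (csum f) (CSer f).
Proof.
  intros H HK. apply Clim_incr_1. apply Clim_of_Re_Im.
  - apply is_lim_seq_ext with (sum_n (fun n => Re (f n))).
    { intros n. induction n as [|n IH].
      - rewrite sum_O. simpl. unfold Re, Cplus; simpl. ring.
      - rewrite sum_Sn, IH. reflexivity. }
    apply Series_correct. apply (ex_series_le (V := R_CompleteNormedModule)) with K; auto.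
    intros n. eapply Rle_trans; [apply re_le_Cmod|]. auto.
  - apply is_lim_seq_ext with (sum_n (fun n => Im (f n))).
    { intros n. induction n as [|n IH].
      - rewrite sum_O. simpl. unfold Im, Cplus; simpl. ring.
      - rewrite sum_Sn, IH. reflexivity. }
    apply Series_correct. apply (ex_series_le (V := R_CompleteNormedModule)) with K; auto.
    intros n. eapply Rle_trans; [apply Im_le_Cmod|]. auto.
Qed.

Lemma CSer_unique f l : Clim (csum f) l -> CSer f = l.
Proof.
  intros H. apply Clim_incr_1 in H. apply C_ext.
  - apply is_series_unique.
    change (is_lim_seq (sum_n (fun n => Re (f n))) (Re l)).
    apply (is_lim_seq_ext (fun n => Re (csum f (S n)))); [|apply Clim_Re, H].
    intros n. induction n as [|n IH].
    + rewrite sum_O. simpl. unfold Re, Cplus; simpl. ring.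
    + rewrite sum_Sn, <- IH. reflexivity.
  - apply is_series_unique.
    change (is_lim_seq (sum_n (fun n => Im (f n))) (Im l)).
    apply (is_lim_seq_ext (fun n => Im (csum f (S n)))); [|apply Clim_Im, H].
    intros n. induction n as [|n IH].
    + rewrite sum_O. simpl. unfold Im, Cplus; simpl. ring.
    + rewrite sum_Sn, <- IH. reflexivity.
Qed.

Lemma CSer_Cmod f K : (forall n, (Cmod (f n) <= K n)%R) -> ex_series K ->
  (Cmod (CSer f) <= Series K)%R.
Proof.
  intros H HK. pose proof (CSer_correct f K H HK) as L. apply Clim_incr_1 in L.
  eapply Clim_Cmod_le; [apply L|]. intros n.
  eapply Rle_trans; [apply csum_Cmod, H|].
  assert (P : forall i, (0 <= K i)%R)
    by (intros i; eapply Rle_trans; [apply Cmod_ge_0 | apply H]).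
  apply (is_lim_seq_incr_compare (sum_n K) (Series K)).
  - apply Series_correct; auto.
  - intros m. rewrite sum_Sn. unfold plus; simpl. specialize (P (S m)). lra.
Qed.

Lemma CSer_shift f K : (forall n, (Cmod (f n) <= K n)%R) -> ex_series K ->
  CSer f = f 0%nat + CSer (fun n => f (S n)).
Proof.
  intros H HK. apply CSer_unique. apply Clim_incr_1.
  apply Clim_ext with (fun n => f 0%nat + csum (fun n => f (S n)) n).
  - intros n. induction n as [|n IH]; simpl; [ring|]. rewrite Cplus_assoc, IH. reflexivity.
  - apply Clim_plus; [apply Clim_const|].
    apply CSer_correct with (fun n => K (S n)); [intros; apply H|].
    apply (ex_series_incr_1 K). auto.
Qed.

Lemma CSer_scal f K c : (forall n, (Cmod (f n) <= K n)%R) -> ex_series K ->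
  CSer (fun n => c * f n) = c * CSer f.
Proof.
  intros H HK. apply CSer_unique.
  apply Clim_ext with (fun n => c * csum f n); [intros; symmetry; apply csum_scal|].
  apply Clim_scal. eapply CSer_correct; eauto.
Qed.

(** The second derivatives [f''] control the Taylor remainders uniformly in [n]. *)
Lemma CSer_CD (f f' f'' : nat -> C -> C) (K : nat -> R) (u : C) (d : R) :
  (0 < d)%R -> ex_series K ->
  (forall n v, (Cmod (v - u) < d)%R -> CD (f n) v (f' n v)) ->
  (forall n v, (Cmod (v - u) < d)%R -> CD (f' n) v (f'' n v)) ->
  (forall n v, (Cmod (v - u) < d)%R -> (Cmod (f n v) <= K n)%R) ->
  (forall n v, (Cmod (v - u) < d)%R -> (Cmod (f' n v) <= K n)%R) ->
  (forall n v, (Cmod (v - u) < d)%R -> (Cmod (f'' n v) <= K n)%R) ->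
  CD (fun v => CSer (fun n => f n v)) u (CSer (fun n => f' n u)).
Proof.
  intros Hd HK D1 D2 B0 B1 B2.
  assert (U : (Cmod (u - u) < d)%R)
    by (replace (u - u) with (RtoC 0) by ring; rewrite Cmod_0; auto).
  assert (Seg : forall v t, (Cmod (v - u) < d)%R -> (0 <= t <= 1)%R ->
     (Cmod (u + t * (v - u) - u) < d)%R).
  { intros v t Hv Ht. replace (u + t * (v - u) - u) with (t * (v - u)) by ring.
    rewrite Cmod_mult, Cmod_R, Rabs_pos_eq by lra.
    pose proof (Cmod_ge_0 (v - u)). nra. }
  assert (Rem : forall n v, (Cmod (v - u) < d)%R ->
     (Cmod (f n v - f n u - f' n u * (v - u)) <= K n * (Cmod (v - u) * Cmod (v - u)))%R).
  { intros n v Hv.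
    assert (H1 : forall t, (0 <= t <= 1)%R ->
      (Cmod (f' n (u + t * (v - u))%C - f' n u) <= K n * Cmod (v - u))%R).
    { intros t Ht. set (w := u + t * (v - u)).
      assert (Hw : (Cmod (w - u) <= Cmod (v - u))%R).
      { unfold w. replace (u + t * (v - u) - u) with (t * (v - u)) by ring.
        rewrite Cmod_mult, Cmod_R, Rabs_pos_eq by lra.
        pose proof (Cmod_ge_0 (v - u)). nra. }
      pose proof (C_mean_value (f' n) (f'' n) u (w - u) (K n)) as M.
      replace (u + (w - u)) with w in M by ring.
      eapply Rle_trans; [apply M|].
      - intros s Hs. apply D2. apply Seg; auto. lra.
      - intros s Hs. apply B2. apply Seg; auto. lra.
      - apply Rmult_le_compat_l; auto. eapply Rle_trans; [|apply (B0 n u U)]. apply Cmod_ge_0. }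
    pose proof (C_mean_value (fun x => f n x - f' n u * x) (fun x => f' n x - f' n u)
      u (v - u) (K n * Cmod (v - u))) as M.
    replace (u + (v - u)) with v in M by ring.
    replace (f n v - f n u - f' n u * (v - u))
      with (f n v - f' n u * v - (f n u - f' n u * u)) by ring.
    rewrite <- Rmult_assoc. apply M.
    - intros t Ht. eapply CD_eq.
      + apply CD_minus; [apply D1, Seg; auto|]. cd.
      + cbv beta; ring.
    - intros t Ht. apply H1; auto. }
  intros e He.
  assert (S0 : (0 <= Series K)%R).
  { eapply Rle_trans; [|apply (CSer_Cmod (fun n => f n u) K)]; auto. apply Cmod_ge_0. }
  exists (Rmin d (e / (Series K + 1))). split.
  { apply Rmin_pos; auto. apply Rdiv_lt_0_compat; lra. }
  intros v Hv. pose proof (Rmin_l d (e / (Series K + 1))).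
  pose proof (Rmin_r d (e / (Series K + 1))).
  assert (Hvd : (Cmod (v - u) < d)%R) by lra.
  replace (CSer (fun n => f n v) - CSer (fun n => f n u) - CSer (fun n => f' n u) * (v - u))
    with (CSer (fun n => f n v - f n u - f' n u * (v - u))).
  - eapply Rle_trans.
    + apply CSer_Cmod with (K := fun n => (K n * (Cmod (v - u) * Cmod (v - u)))%R).
      * intros n. apply Rem; auto.
      * apply ex_series_scal_r; auto.
    + rewrite Series_scal_r, <- Rmult_assoc.
      apply Rmult_le_compat_r; [apply Cmod_ge_0|].
      apply Rle_trans with ((Series K + 1) * (e / (Series K + 1)))%R.
      * pose proof (Cmod_ge_0 (v - u)). apply Rmult_le_compat; lra.
      * apply Req_le. field. lra.
  - apply CSer_unique.
    apply Clim_ext with (fun n => csum (fun n => f n v) n - csum (fun n => f n u) n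
        - csum (fun n => f' n u) n * (v - u)).
    + intros n. induction n as [|n IH]; simpl; [ring|]. rewrite <- IH. ring.
    + apply Clim_minus; [apply Clim_minus|apply Clim_mult; [|apply Clim_const]];
      eapply CSer_correct; eauto.
Qed.

(** * The complex exponential *)

Lemma Cexp_0 : Cexp 0 = 1.
Proof.
  unfold Cexp, Re, Im, RtoC; simpl. rewrite exp_0, cos_0, sin_0.
  apply C_ext; unfold Re, Im, Cmult, RtoC; simpl; ring.
Qed.

Lemma Cexp_plus u v : Cexp (u + v) = Cexp u * Cexp v.
Proof.
  destruct u as [a b], v as [c d].
  unfold Cexp, Re, Im, Cplus, RtoC; simpl. rewrite exp_plus, cos_plus, sin_plus.
  apply C_ext; unfold Re, Im, Cmult; simpl; ring.
Qed.

Lemma Cmod_Cexp u : Cmod (Cexp u) = exp (Re u).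
Proof.
  unfold Cexp. rewrite Cmod_mult, Cmod_R, Rabs_pos_eq by (left; apply exp_pos).
  unfold Cmod; simpl.
  replace (cos (Im u) * (cos (Im u) * 1) + sin (Im u) * (sin (Im u) * 1))%R with 1%R.
  - rewrite sqrt_1. ring.
  - pose proof (sin2_cos2 (Im u)). unfold Rsqr in *. lra.
Qed.

Lemma Cexp_neq_0 u : Cexp u <> 0.
Proof. apply Cmod_gt_0. rewrite Cmod_Cexp. apply exp_pos. Qed.

Lemma Cexp_opp u : Cexp (- u) = / Cexp u.
Proof.
  assert (H : Cexp u * Cexp (- u) = 1).
  { rewrite <- Cexp_plus. replace (u + - u) with (RtoC 0) by ring. apply Cexp_0. }
  pose proof (Cexp_neq_0 u).
  replace (/ Cexp u) with (/ Cexp u * 1) by ring. rewrite <- H. field. auto.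
Qed.

Lemma Cexp_INR n u : Cexp (INR n * u) = Cexp u ^ n.
Proof.
  induction n as [|n IH].
  - simpl. replace (0 * u) with (RtoC 0) by ring. apply Cexp_0.
  - rewrite S_INR, RtoC_plus. replace ((INR n + 1) * u) with (u + INR n * u) by ring.
    rewrite Cexp_plus, IH. reflexivity.
Qed.

Lemma derivable_pt_lim_linear_bound f x l eps : derivable_pt_lim f x l -> (0 < eps)%R ->
  exists d, (0 < d)%R /\ forall h, (Rabs h < d)%R ->
    (Rabs (f (x + h) - f x - l * h) <= eps * Rabs h)%R.
Proof.
  intros H He. destruct (H eps He) as [[d Pd] K]. exists d. split; auto.
  intros h Hh. destruct (Req_dec h 0) as [->|N].
  - rewrite Rplus_0_r, Rmult_0_r, Rabs_R0. replace (f x - f x - 0)%R with 0%R by ring.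
    rewrite Rabs_R0. lra.
  - specialize (K h N Hh). replace (f (x + h) - f x - l * h)%R
      with (((f (x + h) - f x) / h - l) * h)%R by (field; auto).
    rewrite Rabs_mult. apply Rmult_le_compat_r; [apply Rabs_pos|]. lra.
Qed.

Lemma CD_Cexp_0 : CD Cexp 0 1.
Proof.
  (* The real part of the remainder is at most [3 * r * m] and the imaginary part at most
     [5 * r * m], where [m] is the modulus of [v]; this is the origin of the 8. *)
  intros e He. set (r := Rmin (e / 8) (1 / 8)).
  assert (Hr : (0 < r)%R) by (apply Rmin_pos; lra).
  assert (r <= e / 8 /\ r <= 1 / 8)%R as [R1 R2] by (split; [apply Rmin_l | apply Rmin_r]).
  clearbody r.
  destruct (derivable_pt_lim_linear_bound exp 0 1 r) as [d1 [P1 H1]]; auto.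
  { rewrite <- exp_0. apply derivable_pt_lim_exp. }
  destruct (derivable_pt_lim_linear_bound cos 0 0 r) as [d2 [P2 H2]]; auto.
  { replace 0%R with (- sin 0)%R at 2 by (rewrite sin_0; ring). apply derivable_pt_lim_cos. }
  destruct (derivable_pt_lim_linear_bound sin 0 1 r) as [d3 [P3 H3]]; auto.
  { rewrite <- cos_0. apply derivable_pt_lim_sin. }
  exists (Rmin r (Rmin d1 (Rmin d2 d3))). split; [repeat apply Rmin_pos; auto|].
  intros v Hv.
  replace (v - 0) with v in * by ring.
  rewrite Cexp_0. replace (Cexp v - 1 - 1 * v) with (Cexp v - 1 - v) by ring.
  set (a := Re v). set (b := Im v). set (m := Cmod v) in *.
  pose proof (Rmin_l r (Rmin d1 (Rmin d2 d3))). pose proof (Rmin_r r (Rmin d1 (Rmin d2 d3))).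
  pose proof (Rmin_l d1 (Rmin d2 d3)). pose proof (Rmin_r d1 (Rmin d2 d3)).
  pose proof (Rmin_l d2 d3). pose proof (Rmin_r d2 d3).
  pose proof (re_le_Cmod v) as Ha. fold a m in Ha.
  pose proof (Im_le_Cmod v) as Hb. fold b m in Hb.
  assert (E1 : (Rabs (exp a - 1 - a) <= r * m)%R).
  { specialize (H1 a ltac:(lra)). rewrite Rplus_0_l, exp_0, Rmult_1_l in H1.
    eapply Rle_trans; [apply H1|]. apply Rmult_le_compat_l; lra. }
  assert (E2 : (Rabs (cos b - 1) <= r * m)%R).
  { specialize (H2 b ltac:(lra)). rewrite Rplus_0_l, cos_0, Rmult_0_l, Rminus_0_r in H2.
    eapply Rle_trans; [apply H2|]. apply Rmult_le_compat_l; lra. }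
  assert (E3 : (Rabs (sin b - b) <= r * m)%R).
  { specialize (H3 b ltac:(lra)). rewrite Rplus_0_l, sin_0, Rmult_1_l, Rminus_0_r in H3.
    eapply Rle_trans; [apply H3|]. apply Rmult_le_compat_l; lra. }
  assert (Pm : (0 <= m)%R) by apply Cmod_ge_0.
  assert (E4 : (Rabs (exp a - 1) <= 2 * r)%R).
  { replace (exp a - 1)%R with ((exp a - 1 - a) + a)%R by ring.
    eapply Rle_trans; [apply Rabs_triang|]. nra. }
  assert (E5 : (Rabs (sin b) <= 2 * m)%R).
  { replace (sin b) with ((sin b - b) + b)%R by ring.
    eapply Rle_trans; [apply Rabs_triang|]. nra. }
  eapply Rle_trans; [apply Cmod_le_Re_Im|].
  replace (Re (Cexp v - 1 - v)) with (exp a * (cos b - 1) + (exp a - 1 - a))%R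
    by (unfold a, b, Cexp, Re, Im, Cminus, Cplus, Copp, Cmult, RtoC; simpl; ring).
  replace (Im (Cexp v - 1 - v)) with ((exp a - 1) * sin b + (sin b - b))%R
    by (unfold a, b, Cexp, Re, Im, Cminus, Cplus, Copp, Cmult, RtoC; simpl; ring).
  assert (E6 : (Rabs (exp a) <= 2)%R).
  { replace (exp a) with ((exp a - 1) + 1)%R by ring.
    eapply Rle_trans; [apply Rabs_triang|]. rewrite Rabs_R1. lra. }
  pose proof (Rabs_triang (exp a * (cos b - 1)) (exp a - 1 - a)) as T1.
  pose proof (Rabs_triang ((exp a - 1) * sin b) (sin b - b)) as T2.
  rewrite Rabs_mult in T1, T2.
  pose proof (Rmult_le_compat _ _ _ _ (Rabs_pos _) (Rabs_pos _) E6 E2).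
  pose proof (Rmult_le_compat _ _ _ _ (Rabs_pos _) (Rabs_pos _) E4 E5).
  nra.
Qed.

Lemma CD_Cexp u : CD Cexp u (Cexp u).
Proof.
  apply CD_ext with (fun v => Cexp u * Cexp (v - u)).
  { intros v. rewrite <- Cexp_plus. f_equal. ring. }
  eapply CD_eq.
  - apply (CD_mult (fun _ => Cexp u)); [apply CD_const|].
    apply (CD_comp (fun v => v - u) Cexp); [cd|].
    replace (u - u) with (RtoC 0) by ring. apply CD_Cexp_0.
  - cbv beta. ring.
Qed.

Lemma CD_Cexp_comp f u l : CD f u l -> CD (fun v => Cexp (f v)) u (Cexp (f u) * l).
Proof. intros H. apply (CD_comp f Cexp); auto. apply CD_Cexp. Qed.

(** * Polar form *)

Definition cis (t : R) : C := (cos t, sin t).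

Lemma cis_plus s t : cis (s + t) = cis s * cis t.
Proof.
  unfold cis. rewrite cos_plus, sin_plus. apply C_ext; unfold Re, Im, Cmult; simpl; ring.
Qed.

Lemma cis_0 : cis 0 = 1.
Proof. unfold cis. rewrite cos_0, sin_0. reflexivity. Qed.

Lemma Cmod_cis t : Cmod (cis t) = 1%R.
Proof.
  unfold Cmod, cis; simpl.
  replace (cos t * (cos t * 1) + sin t * (sin t * 1))%R with 1%R by
    (pose proof (sin2_cos2 t); unfold Rsqr in *; lra).
  apply sqrt_1.
Qed.

Lemma cis_pow t n : cis t ^ n = cis (INR n * t).
Proof.
  induction n as [|n IH].
  - simpl. rewrite Rmult_0_l, cis_0. reflexivity.
  - rewrite S_INR. replace ((INR n + 1) * t)%R with (t + INR n * t)%R by ring.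
    rewrite cis_plus, <- IH. reflexivity.
Qed.

Lemma cis_Cexp t : cis t = Cexp (t * Ci).
Proof.
  replace (t * Ci) with ((0, t)%R : C).
  - unfold Cexp, cis, Re, Im; simpl. rewrite exp_0. apply C_ext; unfold Re, Im, Cmult, RtoC; simpl; ring.
  - apply C_ext; unfold Re, Im, Ci, Cmult, RtoC; simpl; ring.
Qed.

Lemma polar_form (u : C) : exists rho t, (0 <= rho)%R /\ (- PI < t <= PI)%R /\
  u = rho * cis t /\ (0 <= Im u -> 0 <= t)%R /\ (Im u < 0 -> t < 0)%R.
Proof.
  pose proof PI_RGT_0.
  destruct (Ceq_dec u 0) as [->|N].
  { exists 0%R, 0%R. split; [lra|]. split; [lra|]. split; [ring|].
    unfold Im, RtoC; simpl; lra. }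
  set (rho := Cmod u). assert (Pr : (0 < rho)%R) by (apply Cmod_gt_0; auto).
  set (c := (Re u / rho)%R). set (s := (Im u / rho)%R).
  assert (E : (c * c + s * s = 1)%R).
  { unfold c, s. pose proof (Cmod_sq u) as Q. fold rho in Q.
    apply Rmult_eq_reg_r with (rho * rho)%R; [|nra].
    transitivity (Re u * Re u + Im u * Im u)%R; [field; lra | lra]. }
  assert (Bc : (-1 <= c <= 1)%R) by nra.
  pose proof (acos_bound c) as Ba.
  assert (Sa : sin (acos c) = sqrt (1 - c²)) by (apply sin_acos; lra).
  assert (Us : u = rho * (c, s)).
  { apply C_ext; unfold Re, Im, Cmult, RtoC; simpl; fold (Re u) (Im u); unfold c, s;
    unfold Re, Im in *; field; lra. }
  assert (Q : (1 - c² = s * s)%R) by (unfold Rsqr; lra).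
  rewrite Q in Sa.
  assert (Is : Im u = (rho * s)%R) by (unfold s; field; lra).
  destruct (Rle_dec 0 s) as [L|L].
  - exists rho, (acos c). repeat split; try lra; try nra.
    unfold cis. rewrite cos_acos, Sa, sqrt_square by lra. auto.
  - assert (Sp : (0 < acos c)%R).
    { destruct (Req_dec (acos c) 0) as [Z|]; [|lra]. rewrite Z, sin_0 in Sa.
      symmetry in Sa. apply sqrt_eq_0 in Sa; nra. }
    assert (Spi : (acos c < PI)%R).
    { destruct (Req_dec (acos c) PI) as [Z|]; [|lra]. rewrite Z, sin_PI in Sa.
      symmetry in Sa. apply sqrt_eq_0 in Sa; nra. }
    exists rho, (- acos c)%R. repeat split; try lra; try nra.
    unfold cis. rewrite cos_neg, sin_neg, cos_acos, Sa by lra.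
    replace (s * s)%R with ((- s) * (- s))%R by ring. rewrite sqrt_square by lra.
    rewrite Ropp_involutive. auto.
Qed.

(** * Cauchy theory *)

Definition RC (f : R -> C) (t : R) : Prop :=
  continuous (fun t => Re (f t)) t /\ continuous (fun t => Im (f t)) t.

Definition CInt (f : R -> C) (a b : R) : C :=
  (RInt (fun t => Re (f t)) a b, RInt (fun t => Im (f t)) a b).

Lemma RC_spec (f : R -> C) t :
  (forall e, (0 < e)%R -> exists d, (0 < d)%R /\ forall s, (Rabs (s - t) < d)%R ->
    (Cmod (f s - f t) < e)%R) -> RC f t.
Proof.
  intros H. split.
  - apply (filterlim_locally (F := locally t)). intros [e He].
    destruct (H e He) as [d [Pd Hd]]. exists (mkposreal d Pd). intros s Hs.
    eapply Rle_lt_trans; [|apply (Hd s Hs)].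
    eapply Rle_trans; [|apply re_le_Cmod]. apply Req_le. reflexivity.
  - apply (filterlim_locally (F := locally t)). intros [e He].
    destruct (H e He) as [d [Pd Hd]]. exists (mkposreal d Pd). intros s Hs.
    eapply Rle_lt_trans; [|apply (Hd s Hs)].
    eapply Rle_trans; [|apply Im_le_Cmod]. apply Req_le. reflexivity.
Qed.

Lemma CC_RC_h f t c : CC f (t, c) -> RC (fun s => f (s, c)) t.
Proof.
  intros H. apply RC_spec. intros e He. destruct (H e He) as [d [Pd Hd]].
  exists d. split; auto. intros s Hs. apply Hd.
  replace ((s, c) - (t, c)) with (RtoC (s - t)).
  - rewrite Cmod_R. auto.
  - apply C_ext; unfold Re, Im, Cminus, Cplus, Copp, RtoC; simpl; ring.
Qed.

Lemma CC_RC_v f a t : CC f (a, t) -> RC (fun s => f (a, s)) t.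
Proof.
  intros H. apply RC_spec. intros e He. destruct (H e He) as [d [Pd Hd]].
  exists d. split; auto. intros s Hs. apply Hd.
  replace ((a, s) - (a, t)) with (Ci * RtoC (s - t)).
  - rewrite Cmod_mult, Cmod_Ci, Cmod_R, Rmult_1_l. auto.
  - apply C_ext; unfold Re, Im, Ci, Cminus, Cplus, Copp, Cmult, RtoC; simpl; ring.
Qed.

Lemma RC_const c t : RC (fun _ => c) t.
Proof. split; apply continuous_const. Qed.

Lemma RC_mult f g t : RC f t -> RC g t -> RC (fun s => f s * g s) t.
Proof.
  intros [H1 H2] [H3 H4]. split; simpl.
  - apply (continuous_minus (V := R_NormedModule) (fun s => Re (f s) * Re (g s))%R
      (fun s => Im (f s) * Im (g s))%R);
    apply (continuous_mult (K := R_AbsRing)); auto.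
  - apply (continuous_plus (V := R_NormedModule) (fun s => Re (f s) * Im (g s))%R
      (fun s => Im (f s) * Re (g s))%R);
    apply (continuous_mult (K := R_AbsRing)); auto.
Qed.

Lemma RC_minus f g t : RC f t -> RC g t -> RC (fun s => f s - g s) t.
Proof.
  intros [H1 H2] [H3 H4]. split; simpl.
  - apply (continuous_minus (V := R_NormedModule) (fun s => Re (f s)) (fun s => Re (g s))); auto.
  - apply (continuous_minus (V := R_NormedModule) (fun s => Im (f s)) (fun s => Im (g s))); auto.
Qed.

Lemma RC_ex_RInt f a b : (a <= b)%R -> (forall t, (a <= t <= b)%R -> RC f t) ->
  ex_RInt (fun t => Re (f t)) a b /\ ex_RInt (fun t => Im (f t)) a b.
Proof.
  intros H K. split; apply (ex_RInt_continuous (V := R_CompleteNormedModule));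
    intros z Hz; rewrite Rmin_left, Rmax_right in Hz by auto; apply K; auto.
Qed.

Lemma CInt_Chasles f a b c : (a <= b)%R -> (b <= c)%R ->
  (forall t, (a <= t <= c)%R -> RC f t) -> CInt f a b + CInt f b c = CInt f a c.
Proof.
  intros H1 H2 K.
  destruct (RC_ex_RInt f a b H1) as [E1 E2]; [intros; apply K; lra|].
  destruct (RC_ex_RInt f b c H2) as [E3 E4]; [intros; apply K; lra|].
  unfold CInt, Cplus; simpl. f_equal.
  - apply (RInt_Chasles (V := R_CompleteNormedModule)); auto.
  - apply (RInt_Chasles (V := R_CompleteNormedModule)); auto.
Qed.

Lemma CInt_minus f g a b : (a <= b)%R -> (forall t, (a <= t <= b)%R -> RC f t) ->
  (forall t, (a <= t <= b)%R -> RC g t) ->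
  CInt (fun t => f t - g t) a b = CInt f a b - CInt g a b.
Proof.
  intros H K1 K2.
  destruct (RC_ex_RInt f a b H K1) as [E1 E2]. destruct (RC_ex_RInt g a b H K2) as [E3 E4].
  apply C_ext; unfold CInt, Re, Im, Cminus, Cplus, Copp; simpl.
  - apply (RInt_minus (V := R_CompleteNormedModule)); auto.
  - apply (RInt_minus (V := R_CompleteNormedModule)); auto.
Qed.

Lemma CInt_ext f g a b : (a <= b)%R -> (forall t, (a <= t <= b)%R -> f t = g t) ->
  CInt f a b = CInt g a b.
Proof.
  intros H K. unfold CInt. f_equal; apply RInt_ext; intros t Ht;
    rewrite Rmin_left, Rmax_right in Ht by auto; rewrite K by lra; auto.
Qed.

Lemma CInt_const c a b : CInt (fun _ => c) a b = (b - a)%R * c.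
Proof.
  unfold CInt. rewrite !RInt_const. apply C_ext; unfold Re, Im, Cmult, RtoC; simpl;
  unfold scal; simpl; unfold mult; simpl; ring.
Qed.

(** The factor [conj I] with [I = CInt f a b] turns [|I|^2] into a real integral. *)
Lemma CInt_bound f a b M : (a <= b)%R -> (forall t, (a <= t <= b)%R -> RC f t) ->
  (forall t, (a <= t <= b)%R -> (Cmod (f t) <= M)%R) ->
  (Cmod (CInt f a b) <= (b - a) * M)%R.
Proof.
  intros H K B.
  destruct (RC_ex_RInt f a b H K) as [E1 E2].
  set (J := CInt f a b).
  assert (E : (Cmod J * Cmod J = RInt (fun t => Re (Cconj J * f t)) a b)%R).
  { transitivity (RInt (fun t => Re J * Re (f t) + Im J * Im (f t))%R a b).
    - rewrite Cmod_sq.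
      etransitivity; [|symmetry; apply (RInt_plus (V := R_CompleteNormedModule)
         (fun t => Re J * Re (f t))%R (fun t => Im J * Im (f t))%R a b)].
      2, 3: apply (ex_RInt_scal (V := R_NormedModule)); auto.
      pose proof (RInt_scal (V := R_CompleteNormedModule) (fun t => Re (f t)) a b (Re J) E1) as Q1.
      pose proof (RInt_scal (V := R_CompleteNormedModule) (fun t => Im (f t)) a b (Im J) E2) as Q2.
      transitivity (Re J * RInt (fun t => Re (f t)) a b + Im J * RInt (fun t => Im (f t)) a b)%R;
        [reflexivity|].
      apply (f_equal2 Rplus); symmetry; assumption.
    - apply RInt_ext. intros t _. destruct J; unfold Re, Im, Cconj, Cmult; simpl. ring. }
  assert (Bd : (Cmod J * Cmod J <= (b - a) * (Cmod J * M))%R).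
  { rewrite E. eapply Rle_trans; [apply Rle_abs|].
    apply (norm_RInt_le_const (V := R_NormedModule)
       (fun t => Re (Cconj J * f t)) a b); auto.
    - intros t Ht. eapply Rle_trans; [apply re_le_Cmod|].
      rewrite Cmod_mult, Cmod_conj. apply Rmult_le_compat_l; [apply Cmod_ge_0|auto].
    - apply (RInt_correct (V := R_CompleteNormedModule)).
      destruct (RC_ex_RInt (fun t => Cconj J * f t) a b H) as [X _]; auto.
      intros t Ht. apply RC_mult; auto. apply RC_const. }
  assert (PM : (0 <= M)%R).
  { eapply Rle_trans; [|apply (B a)]; [apply Cmod_ge_0|lra]. }
  destruct (Req_dec (Cmod J) 0) as [Z|N].
  - rewrite Z. apply Rmult_le_pos; lra.
  - pose proof (Cmod_ge_0 J). apply Rmult_le_reg_l with (Cmod J); lra.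
Qed.

Lemma CInt_FTC (G g : R -> C) a b : (a <= b)%R ->
  (forall t, (a <= t <= b)%R -> is_derive (fun t => Re (G t)) t (Re (g t))) ->
  (forall t, (a <= t <= b)%R -> is_derive (fun t => Im (G t)) t (Im (g t))) ->
  (forall t, (a <= t <= b)%R -> RC g t) -> CInt g a b = G b - G a.
Proof.
  intros H D1 D2 K. unfold CInt. apply C_ext.
  - change (RInt (fun t => Re (g t)) a b = Re (G b) - Re (G a))%R.
    apply is_RInt_unique.
    apply (is_RInt_derive (V := R_CompleteNormedModule) (fun t => Re (G t)) (fun t => Re (g t)));
    intros x Hx; rewrite Rmin_left, Rmax_right in Hx by auto; [apply D1 | apply K]; auto.
  - change (RInt (fun t => Im (g t)) a b = Im (G b) - Im (G a))%R.
    apply is_RInt_unique.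
    apply (is_RInt_derive (V := R_CompleteNormedModule) (fun t => Im (G t)) (fun t => Im (g t)));
    intros x Hx; rewrite Rmin_left, Rmax_right in Hx by auto; [apply D2 | apply K]; auto.
Qed.

(** * Goursat's theorem on rectangles *)

(** The counterclockwise contour integral over the boundary of the rectangle with lower left corner
    [(a, c)]; on vertical sides the line element contributes the factor [Ci]. *)
Definition rect_int (f : C -> C) (a c w h : R) : C :=
  CInt (fun t => f (t, c)) a (a + w) + Ci * CInt (fun t => f ((a + w)%R, t)) c (c + h)
  - CInt (fun t => f (t, (c + h)%R)) a (a + w) - Ci * CInt (fun t => f (a, t)) c (c + h).

Definition in_rect (a c w h : R) (v : C) : Prop :=
  (a <= Re v <= a + w)%R /\ (c <= Im v <= c + h)%R.

Lemma rect_int_split f a c w h : (0 <= w)%R -> (0 <= h)%R ->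
  (forall v, in_rect a c w h v -> CC f v) ->
  rect_int f a c w h =
    rect_int f a c (w / 2) (h / 2) + rect_int f (a + w / 2) c (w / 2) (h / 2)
    + rect_int f a (c + h / 2) (w / 2) (h / 2)
    + rect_int f (a + w / 2) (c + h / 2) (w / 2) (h / 2).
Proof.
  intros Hw Hh K. unfold rect_int.
  replace (a + w / 2 + w / 2)%R with (a + w)%R by field.
  replace (c + h / 2 + h / 2)%R with (c + h)%R by field.
  assert (Kh : forall t s, (a <= t <= a + w)%R -> (c <= s <= c + h)%R ->
     RC (fun t => f (t, s)) t) by (intros; apply CC_RC_h, K; split; auto).
  assert (Kv : forall t s, (a <= t <= a + w)%R -> (c <= s <= c + h)%R ->
     RC (fun s => f (t, s)) s) by (intros; apply CC_RC_v, K; split; auto).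
  rewrite <- (CInt_Chasles (fun t => f (t, c)) a (a + w / 2) (a + w))
    by (try lra; intros; apply Kh; lra).
  rewrite <- (CInt_Chasles (fun t => f (t, (c + h)%R)) a (a + w / 2) (a + w))
    by (try lra; intros; apply Kh; lra).
  rewrite <- (CInt_Chasles (fun s => f (a, s)) c (c + h / 2) (c + h))
    by (try lra; intros; apply Kv; lra).
  rewrite <- (CInt_Chasles (fun s => f ((a + w)%R, s)) c (c + h / 2) (c + h))
    by (try lra; intros; apply Kv; lra).
  ring.
Qed.

Lemma rect_int_bound f a c w h M : (0 <= w)%R -> (0 <= h)%R ->
  (forall v, in_rect a c w h v -> CC f v) ->
  (forall v, in_rect a c w h v -> (Cmod (f v) <= M)%R) ->
  (Cmod (rect_int f a c w h) <= 2 * (w + h) * M)%R.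
Proof.
  intros Hw Hh K B. unfold rect_int.
  assert (B1 : forall s, (c <= s <= c + h)%R ->
    (Cmod (CInt (fun t => f (t, s)) a (a + w)) <= w * M)%R).
  { intros s Hs. eapply Rle_trans; [apply CInt_bound with (M := M); try lra|].
    - intros t Ht. apply CC_RC_h, K. split; auto.
    - intros t Ht. apply B. split; auto.
    - apply Req_le. ring. }
  assert (B2 : forall s, (a <= s <= a + w)%R ->
    (Cmod (CInt (fun t => f (s, t)) c (c + h)) <= h * M)%R).
  { intros s Hs. eapply Rle_trans; [apply CInt_bound with (M := M); try lra|].
    - intros t Ht. apply CC_RC_v, K. split; auto.
    - intros t Ht. apply B. split; auto.
    - apply Req_le. ring. }
  eapply Rle_trans; [apply Cmod_triangle_minus|].
  eapply Rle_trans; [apply Rplus_le_compat_r, Cmod_triangle_minus|].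
  eapply Rle_trans; [apply Rplus_le_compat_r, Rplus_le_compat_r, Cmod_triangle|].
  rewrite !Cmod_mult, Cmod_Ci, !Rmult_1_l.
  pose proof (B1 c ltac:(lra)). pose proof (B1 (c + h)%R ltac:(lra)).
  pose proof (B2 a ltac:(lra)). pose proof (B2 (a + w)%R ltac:(lra)). lra.
Qed.

Lemma rect_int_minus f g a c w h : (0 <= w)%R -> (0 <= h)%R ->
  (forall v, in_rect a c w h v -> CC f v) -> (forall v, in_rect a c w h v -> CC g v) ->
  rect_int (fun v => f v - g v) a c w h = rect_int f a c w h - rect_int g a c w h.
Proof.
  intros Hw Hh Kf Kg. unfold rect_int.
  rewrite !CInt_minus; try lra;
  try (intros; apply CC_RC_h; auto; (apply Kf || apply Kg); split; simpl; lra);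
  try (intros; apply CC_RC_v; auto; (apply Kf || apply Kg); split; simpl; lra).
  ring.
Qed.

(** The primitive [P] turns each side into a difference of corner values, and the four differences
    cancel. *)
Lemma rect_int_affine p q a c w h : (0 <= w)%R -> (0 <= h)%R ->
  rect_int (fun v => p + q * v) a c w h = 0.
Proof.
  intros Hw Hh. set (P := fun v => p * v + q * v * v / 2).
  assert (DP : forall v, CD P v (p + q * v)).
  { intros v. unfold P. eapply CD_eq; [cd|].
    - apply Cmod_gt_0. rewrite Cmod_R. apply Rabs_pos_lt. lra.
    - cbv beta. field. }
  assert (CA : forall v, CC (fun v => p + q * v) v).
  { intros v. apply CC_plus; [apply CC_const|]. apply CC_mult; [apply CC_const | apply CC_id]. }
  assert (Hh' : forall s b1 b2, (b1 <= b2)%R ->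
     CInt (fun t => p + q * (t, s)) b1 b2 = P (b2, s) - P (b1, s)).
  { intros s b1 b2 Hb.
    assert (D : forall t : R, CD (fun v => P (v + (0, s))) t (p + q * (t, s))).
    { intros t. eapply CD_eq.
      - apply (CD_comp (fun v => v + (0%R, s)) P); [cd|]. apply DP.
      - replace (t + (0%R, s)) with ((t, s) : C); [ring|].
        apply C_ext; unfold Re, Im, Cplus, RtoC; simpl; ring. }
    rewrite (CInt_FTC (fun t => P (t + (0%R, s)))); auto.
    - f_equal; f_equal; try f_equal; apply C_ext; unfold Re, Im, Cplus, RtoC; simpl; ring.
    - intros t _. apply (CD_real_Re (fun v => P (v + (0%R, s)))). apply D.
    - intros t _. apply (CD_real_Im (fun v => P (v + (0%R, s)))). apply D.
    - intros t _. apply (CC_RC_h (fun v => p + q * v)). auto. }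
  assert (Hv' : forall s b1 b2, (b1 <= b2)%R ->
     CInt (fun t => p + q * (s, t)) b1 b2 = - Ci * (P (s, b2) - P (s, b1))).
  { intros s b1 b2 Hb.
    assert (D : forall t : R, CD (fun v => - Ci * P (s + Ci * v)) t (p + q * (s, t))).
    { intros t. eapply CD_eq.
      - apply (CD_mult (fun _ => - Ci)); [cd|].
        apply (CD_comp (fun v => s + Ci * v) P); [cd|]. apply DP.
      - replace (s + Ci * t) with ((s, t) : C).
        + apply C_ext; unfold Re, Im, Ci, Cplus, Copp, Cmult, RtoC; simpl; ring.
        + apply C_ext; unfold Re, Im, Ci, Cplus, Cmult, RtoC; simpl; ring. }
    rewrite (CInt_FTC (fun t => - Ci * P (s + Ci * t))); auto.
    - replace (RtoC s + Ci * RtoC b2) with ((s, b2) : C).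
      + replace (RtoC s + Ci * RtoC b1) with ((s, b1) : C); [ring|].
        apply C_ext; unfold Re, Im, Ci, Cplus, Cmult, RtoC; simpl; ring.
      + apply C_ext; unfold Re, Im, Ci, Cplus, Cmult, RtoC; simpl; ring.
    - intros t _. apply (CD_real_Re (fun v => - Ci * P (s + Ci * v))). apply D.
    - intros t _. apply (CD_real_Im (fun v => - Ci * P (s + Ci * v))). apply D.
    - intros t _. apply (CC_RC_v (fun v => p + q * v)). auto. }
  unfold rect_int. rewrite !Hh', !Hv' by lra.
  apply C_ext; unfold Re, Im, Ci, Cminus, Cplus, Copp, Cmult, RtoC; simpl; ring.
Qed.

Section Goursat.
Variables (f : C -> C) (a0 c0 w h : R).
Hypotheses (Hw : (0 <= w)%R) (Hh : (0 <= h)%R).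
Hypothesis Df : forall v, in_rect a0 c0 w h v -> exists l, CD f v l.

(** The fourth quarter is taken by default: if the integrals over the other three are below [k] and
    the total is at least [4 * k], the triangle inequality forces it to be large. *)
Definition quarter (k : R) (n : nat) (p : R * R) : R * R :=
  let w' := (w / 2 ^ S n)%R in let h' := (h / 2 ^ S n)%R in
  let (a, c) := p in
  if Rle_dec k (Cmod (rect_int f a c w' h')) then (a, c) else
  if Rle_dec k (Cmod (rect_int f (a + w') c w' h')) then ((a + w')%R, c) else
  if Rle_dec k (Cmod (rect_int f a (c + h') w' h')) then (a, (c + h')%R) else
  ((a + w')%R, (c + h')%R).

Fixpoint nest (k : R) (n : nat) : R * R :=
  match n with
  | O => (a0, c0)
  | S m => quarter (k / 4 ^ S m) m (nest k m)
  end.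

Lemma nest_step k n :
  (fst (nest k n) <= fst (nest k (S n)) <= fst (nest k n) + w / 2 ^ S n)%R /\
  (snd (nest k n) <= snd (nest k (S n)) <= snd (nest k n) + h / 2 ^ S n)%R.
Proof.
  assert (P : (0 < 2 ^ S n)%R) by (apply pow_lt; lra).
  assert (0 <= w / 2 ^ S n)%R by (apply Rmult_le_pos; [auto|left; apply Rinv_0_lt_compat; auto]).
  assert (0 <= h / 2 ^ S n)%R by (apply Rmult_le_pos; [auto|left; apply Rinv_0_lt_compat; auto]).
  change (nest k (S n)) with (quarter (k / 4 ^ S n) n (nest k n)).
  destruct (nest k n) as [a c]. unfold quarter; cbv zeta.
  repeat destruct Rle_dec; cbn [fst snd]; lra.
Qed.

Lemma half_pow x n : (x / 2 ^ n = x / 2 ^ S n + x / 2 ^ S n)%R.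
Proof. simpl. field. apply pow_nonzero. lra. Qed.

Lemma nest_in_rect k n :
  (a0 <= fst (nest k n) /\ fst (nest k n) + w / 2 ^ n <= a0 + w)%R /\
  (c0 <= snd (nest k n) /\ snd (nest k n) + h / 2 ^ n <= c0 + h)%R.
Proof.
  induction n as [|n IH].
  - simpl. lra.
  - pose proof (nest_step k n). rewrite (half_pow w n), (half_pow h n) in IH. lra.
Qed.

Lemma nest_big k n : (k <= Cmod (rect_int f a0 c0 w h))%R ->
  (k / 4 ^ n <= Cmod (rect_int f (fst (nest k n)) (snd (nest k n)) (w / 2 ^ n) (h / 2 ^ n)))%R.
Proof.
  intros Hk. induction n as [|n IH].
  - simpl. replace (k / 1)%R with k by field.
    replace (w / 1)%R with w by field. replace (h / 1)%R with h by field. auto.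
  - pose proof (nest_in_rect k n) as In.
    change (nest k (S n)) with (quarter (k / 4 ^ S n) n (nest k n)).
    destruct (nest k n) as [a c]. cbn [fst snd] in *. unfold quarter; cbv zeta.
    assert (P : (0 < 2 ^ n)%R) by (apply pow_lt; lra).
    assert (0 <= w / 2 ^ n)%R by (apply Rmult_le_pos; [auto|left; apply Rinv_0_lt_compat; auto]).
    assert (0 <= h / 2 ^ n)%R by (apply Rmult_le_pos; [auto|left; apply Rinv_0_lt_compat; auto]).
    rewrite rect_int_split in IH; auto.
    2:{ intros v [V1 V2]. destruct (Df v) as [l Hl]; [split; lra|]. eapply CD_CC; eauto. }
    replace (w / 2 ^ n / 2)%R with (w / 2 ^ S n)%R in IH by (simpl; field; lra).
    replace (h / 2 ^ n / 2)%R with (h / 2 ^ S n)%R in IH by (simpl; field; lra).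
    replace (k / 4 ^ n)%R with (4 * (k / 4 ^ S n))%R in IH
      by (simpl; field; apply pow_nonzero; lra).
    destruct Rle_dec as [|N1]; auto. destruct Rle_dec as [|N2]; auto.
    destruct Rle_dec as [|N3]; auto. cbn [fst snd].
    match type of IH with (_ <= Cmod (?A + ?B + ?D + ?E))%R =>
      pose proof (Cmod_triangle (A + B + D) E);
      pose proof (Cmod_triangle (A + B) D); pose proof (Cmod_triangle A B) end.
    lra.
Qed.

Lemma nest_limit k : exists p q, forall n,
  (fst (nest k n) <= p <= fst (nest k n) + w / 2 ^ n)%R /\
  (snd (nest k n) <= q <= snd (nest k n) + h / 2 ^ n)%R.
Proof.
  assert (G : forall (s : nat -> R) (x : R),
    (forall n, s n <= s (S n) <= s n + x / 2 ^ S n)%R ->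
    exists p, forall n, (s n <= p <= s n + x / 2 ^ n)%R).
  { intros s x H.
    assert (Up : forall n m, (s n <= s (n + m)%nat)%R).
    { intros n m. induction m as [|m IH]; [rewrite Nat.add_0_r; lra|].
      rewrite Nat.add_succ_r. destruct (H (n + m)%nat). lra. }
    assert (Dn : forall n m, (s (n + m)%nat + x / 2 ^ (n + m) <= s n + x / 2 ^ n)%R).
    { intros n m. induction m as [|m IH]; [rewrite Nat.add_0_r; lra|].
      rewrite Nat.add_succ_r. destruct (H (n + m)%nat).
      rewrite (half_pow x (n + m)) in IH. lra. }
    assert (Px : (0 <= x)%R).
    { specialize (H 0%nat). simpl in H. lra. }
    assert (Pn : forall n, (0 <= x / 2 ^ n)%R).
    { intros n. apply Rmult_le_pos; auto. left. apply Rinv_0_lt_compat, pow_lt. lra. }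
    assert (Bd : forall n m, (s m <= s n + x / 2 ^ n)%R).
    { intros n m. destruct (Nat.le_ge_cases n m) as [L|L].
      - specialize (Dn n (m - n)%nat). replace (n + (m - n))%nat with m in Dn by lia.
        specialize (Pn m). lra.
      - specialize (Up m (n - m)%nat). replace (m + (n - m))%nat with n in Up by lia.
        specialize (Pn n). lra. }
    destruct (completeness (fun y => exists n, y = s n)) as [p [U L]].
    - exists (s 0%nat + x / 2 ^ 0)%R. intros y [n ->]. apply Bd.
    - exists (s 0%nat), 0%nat. auto.
    - exists p. intros n. split; [apply U; eauto|].
      apply L. intros y [m ->]. apply Bd. }
  destruct (G (fun n => fst (nest k n)) w) as [p Hp]; [intros; apply nest_step|].
  destruct (G (fun n => snd (nest k n)) h) as [q Hq]; [intros; apply nest_step|].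
  exists p, q. auto.
Qed.

Lemma Goursat : rect_int f a0 c0 w h = 0.
Proof.
  set (k := Cmod (rect_int f a0 c0 w h)).
  destruct (nest_limit k) as [p [q Hpq]].
  assert (Inp : in_rect a0 c0 w h (p, q)).
  { specialize (Hpq 0%nat). simpl in Hpq. replace (w / 1)%R with w in Hpq by field.
    replace (h / 1)%R with h in Hpq by field. auto. }
  destruct (Df _ Inp) as [l Hl].
  set (D := (w + h)%R).
  assert (Est : forall e, (0 < e)%R -> (k <= 2 * D * (e * D))%R).
  { intros e He. destruct (Hl e He) as [d [Pd Hd]].
    destruct (is_lim_seq_spec (fun n => D * (/ 2) ^ n)%R 0) as [_ S1].
    assert (L : is_lim_seq (fun n => D * (/ 2) ^ n)%R 0).
    { replace (Finite 0) with (Rbar_mult D 0) by (simpl; f_equal; ring).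
      apply is_lim_seq_scal_l. apply is_lim_seq_geom. rewrite Rabs_pos_eq; lra. }
    destruct (S1 L (mkposreal d Pd)) as [n Hn]. specialize (Hn n (Nat.le_refl _)).
    simpl in Hn. rewrite Rminus_0_r, pow_inv in Hn.
    assert (P2 : (0 < 2 ^ n)%R) by (apply pow_lt; lra).
    pose proof (Rinv_0_lt_compat _ P2) as P2i.
    assert (PD : (0 <= D)%R) by (unfold D; lra).
    rewrite Rabs_pos_eq in Hn by (apply Rmult_le_pos; lra).
    pose proof (nest_big k n (Rle_refl _)) as Big.
    pose proof (nest_in_rect k n) as In.
    specialize (Hpq n). set (a := fst (nest k n)) in *. set (c := snd (nest k n)) in *.
    clearbody a c.
    assert (Pw : (0 <= w / 2 ^ n)%R) by (apply Rmult_le_pos; lra).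
    assert (Ph : (0 <= h / 2 ^ n)%R) by (apply Rmult_le_pos; lra).
    assert (Cf : forall v, in_rect a c (w / 2 ^ n) (h / 2 ^ n) v -> CC f v).
    { intros v [V1 V2]. destruct (Df v) as [l' Hl']; [split; lra|]. eapply CD_CC; eauto. }
    (* The affine approximation of [f] at the limit point has integral 0. What remains is at most
       [e] times the diameter on a boundary of comparable length, so the integral is at most a
       constant times [e / 4 ^ n], while [nest_big] keeps it at least [k / 4 ^ n]. *)
    set (A := fun v => (f (p, q) - l * (p, q)) + l * v).
    assert (CA : forall v, CC A v).
    { intros v. apply CC_plus; [apply CC_const|]. apply CC_mult; [apply CC_const|apply CC_id]. }
    assert (E : rect_int f a c (w / 2 ^ n) (h / 2 ^ n)
       = rect_int (fun v => f v - A v) a c (w / 2 ^ n) (h / 2 ^ n)).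
    { rewrite rect_int_minus by auto. unfold A. rewrite rect_int_affine by auto. ring. }
    assert (Dist : forall v, in_rect a c (w / 2 ^ n) (h / 2 ^ n) v ->
      (Cmod (v - (p, q)) <= D * / 2 ^ n)%R).
    { intros v [V1 V2]. eapply Rle_trans; [apply Cmod_le_Re_Im|].
      assert (Rabs (Re v - p) <= w / 2 ^ n)%R by (apply Rabs_le; lra).
      assert (Rabs (Im v - q) <= h / 2 ^ n)%R by (apply Rabs_le; lra).
      change (Rabs (Re v - p) + Rabs (Im v - q) <= D * / 2 ^ n)%R.
      unfold D. unfold Rdiv in *. lra. }
    rewrite E in Big.
    assert (Bd := rect_int_bound (fun v => f v - A v) a c (w / 2 ^ n) (h / 2 ^ n)
      (e * (D * / 2 ^ n)) Pw Ph).
    assert (Big2 : (k / 4 ^ n <= 2 * (w / 2 ^ n + h / 2 ^ n) * (e * (D * / 2 ^ n)))%R).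
    { eapply Rle_trans; [apply Big | apply Bd].
      - intros v Hv. apply CC_plus; [apply Cf; auto|].
        apply CC_comp with (g := Copp); auto.
        intros e' He'. exists e'. split; auto. intros u Hu.
        replace (- u - - A v) with (- (u - A v)) by ring. rewrite Cmod_opp. auto.
      - intros v Hv. unfold A.
        replace (f v - (f (p, q) - l * (p, q) + l * v))
          with (f v - f (p, q) - l * (v - (p, q))) by ring.
        eapply Rle_trans; [apply Hd|].
        + eapply Rle_lt_trans; [apply Dist; auto|]. auto.
        + apply Rmult_le_compat_l; [lra|]. apply Dist; auto. }
    assert (F4 : (4 ^ n = 2 ^ n * 2 ^ n)%R).
    { rewrite <- Rpow_mult_distr. replace (2 * 2)%R with 4%R by ring. reflexivity. }
    apply Rmult_le_reg_r with (/ 4 ^ n)%R.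
    { apply Rinv_0_lt_compat. rewrite F4. nra. }
    eapply Rle_trans; [apply Big2|]. apply Req_le. rewrite F4. unfold D. field. lra. }
  apply Cmod_eq_0. fold k. apply Rle_antisym; [|apply Cmod_ge_0].
  apply Rnot_lt_le. intros Pk.
  assert (PD : (0 <= D)%R) by (unfold D; lra).
  (* With this [e] the estimate gives [k] less than [k / 2]; the summand 1 keeps the denominator
     positive when the rectangle is a point. *)
  specialize (Est (k / (2 * (2 * D * D + 1)))%R).
  assert (PE : (0 < 2 * (2 * D * D + 1))%R) by nra.
  specialize (Est (Rdiv_lt_0_compat _ _ Pk PE)).
  replace (2 * D * (k / (2 * (2 * D * D + 1)) * D))%R
    with ((k / (2 * (2 * D * D + 1))) * (2 * D * D))%R in Est by ring.
  assert (k / (2 * (2 * D * D + 1)) * (2 * D * D + 1) = k / 2)%R by (field; nra).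
  assert (0 < k / (2 * (2 * D * D + 1)))%R by (apply Rdiv_lt_0_compat; auto).
  nra.
Qed.

End Goursat.

(** * Maximum principle and identity theorem on the unit disc *)

Lemma Cmod_Cexp_pair s t : Cmod (Cexp (s, t)) = exp s.
Proof. rewrite Cmod_Cexp. reflexivity. Qed.

(** In the coordinate [exp], concentric circles become vertical segments, and the
    two horizontal sides of the rectangle between them cancel by periodicity. *)
Lemma max_modulus_center (f : C -> C) (rho M : R) : (0 < rho < 1)%R ->
  (forall v, (Cmod v < 1)%R -> exists l, CD f v l) ->
  (forall v, Cmod v = rho -> (Cmod (f v) <= M)%R) -> (Cmod (f 0) <= M)%R.
Proof.
  intros Hr Df HM. pose proof PI_RGT_0 as Ppi.
  set (g := fun s => f (Cexp s)).
  assert (Dg : forall s, (Re s < 0)%R -> exists l, CD g s l).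
  { intros s Hs. destruct (Df (Cexp s)) as [l Hl].
    - rewrite Cmod_Cexp, <- exp_0. apply exp_increasing; auto.
    - eexists. apply (CD_comp Cexp f); [apply CD_Cexp | apply Hl]. }
  assert (Cg : forall s, (Re s < 0)%R -> CC g s).
  { intros s Hs. destruct (Dg s Hs) as [l Hl]. eapply CD_CC; eauto. }
  set (A := fun s => CInt (fun t => g (s, t)) 0 (2 * PI)).
  assert (Per : forall t, g (t, (2 * PI)%R) = g (t, 0%R)).
  { intros t. unfold g. f_equal. unfold Cexp, Re, Im; simpl.
    rewrite cos_2PI, sin_2PI, cos_0, sin_0. auto. }
  assert (EqA : forall s0 s1, (s0 <= s1 < 0)%R -> A s0 = A s1).
  { intros s0 s1 Hs.
    assert (G : rect_int g s0 0 (s1 - s0) (2 * PI) = 0).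
    { apply Goursat; try lra. intros v [V1 V2]. apply Dg. lra. }
    unfold rect_int in G. replace (s0 + (s1 - s0))%R with s1 in G by ring.
    replace (0 + 2 * PI)%R with (2 * PI)%R in G by ring.
    rewrite (CInt_ext (fun t => g (t, (2 * PI)%R)) (fun t => g (t, 0%R)) s0 s1) in G
      by (try lra; intros; apply Per).
    fold (A s1) (A s0) in G.
    assert (E : Ci * (A s1 - A s0) = 0) by (rewrite <- G; ring).
    apply Ceq_minus.
    replace (A s0 - A s1) with (Ci * (Ci * (A s1 - A s0))).
    - rewrite E. ring.
    - apply C_ext; unfold Re, Im, Ci, Cminus, Cplus, Copp, Cmult, RtoC; simpl; ring. }
  assert (RCg : forall s t, (s < 0)%R -> RC (fun t => g (s, t)) t).
  { intros s t Hs. apply CC_RC_v, Cg. auto. }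
  set (s1 := ln rho).
  assert (Hs1 : (s1 < 0)%R) by (unfold s1; rewrite <- ln_1; apply ln_increasing; lra).
  assert (BA : (Cmod (A s1) <= 2 * PI * M)%R).
  { unfold A. eapply Rle_trans; [apply CInt_bound with (M := M); try lra|].
    - intros; apply RCg; auto.
    - intros t _. apply HM. rewrite Cmod_Cexp_pair. apply exp_ln; lra.
    - apply Req_le. ring. }
  (* Moving the vertical segment to the far left shrinks the circle to the centre, where [f] is
     within [e] of [f 0]. *)
  assert (Lim : forall e, (0 < e)%R -> (Cmod (A s1 - (2 * PI)%R * f 0) <= 2 * PI * e)%R).
  { intros e He.
    destruct (Df 0) as [l0 Hl0]; [rewrite Cmod_0; lra|].
    destruct (CD_CC _ _ _ Hl0 e He) as [d [Pd Hd]].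
    (* The circle over [s0] has radius [exp s0], smaller than [d]. *)
    set (s0 := Rmin s1 (ln d - 1)).
    assert (s0 <= s1)%R by apply Rmin_l. assert (s0 <= ln d - 1)%R by apply Rmin_r.
    rewrite <- (EqA s0 s1) by lra.
    replace ((2 * PI)%R * f 0) with (CInt (fun _ => f 0) 0 (2 * PI))
      by (rewrite CInt_const; f_equal; f_equal; ring).
    unfold A. rewrite <- CInt_minus; try lra.
    - eapply Rle_trans; [apply CInt_bound with (M := e); try lra|].
      + intros t _. apply RC_minus; [apply RCg; lra | apply RC_const].
      + intros t _. left. apply Hd. replace (Cexp (s0, t) - 0) with (Cexp (s0, t)) by ring.
        rewrite Cmod_Cexp_pair. rewrite <- (exp_ln d) by auto. apply exp_increasing. lra.
      + apply Req_le. ring.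
    - intros t _. apply RCg. lra.
    - intros t _. apply RC_const. }
  apply le_epsilon. intros e He. specialize (Lim e He).
  apply Rmult_le_reg_l with (2 * PI)%R; [lra|].
  replace (2 * PI * Cmod (f 0))%R with (Cmod ((2 * PI)%R * f 0))
    by (rewrite Cmod_mult, Cmod_R, Rabs_pos_eq by lra; auto).
  pose proof (Cmod_triangle_rev ((2 * PI)%R * f 0) (A s1)) as T.
  rewrite Cmod_minus_sym in T. lra.
Qed.

Lemma moebius_identity (c v : C) :
  (Cmod (1 + Cconj c * v) * Cmod (1 + Cconj c * v) - Cmod (v + c) * Cmod (v + c) =
   (1 - Cmod v * Cmod v) * (1 - Cmod c * Cmod c))%R.
Proof.
  rewrite !Cmod_sq. destruct c, v; unfold Re, Im, Cconj, Cplus, Cmult, RtoC; simpl. ring.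
Qed.

Lemma moebius_den (c v : C) : (Cmod c < 1)%R -> (Cmod v < 1)%R ->
  (1 - Cmod c <= Cmod (1 + Cconj c * v))%R.
Proof.
  intros Hc Hv. pose proof (Cmod_triangle_rev 1 (- (Cconj c * v))) as T.
  rewrite Cmod_1, Cmod_opp, Cmod_mult, Cmod_conj in T.
  replace (1 - - (Cconj c * v)) with (1 + Cconj c * v) in T by ring.
  pose proof (Cmod_ge_0 c). pose proof (Cmod_ge_0 v). nra.
Qed.

(** Compactness of the circle, obtained from the extreme value theorem for the angle in
    [[-PI, PI]]. *)
Lemma circle_bounded (f : C -> C) (rho : R) : (0 < rho < 1)%R ->
  (forall v, (Cmod v < 1)%R -> exists l, CD f v l) ->
  exists M, forall v, Cmod v = rho -> (Cmod (f v) <= M)%R.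
Proof.
  intros Hr Df.
  assert (K : forall t, CC (fun t => f (rho * Cexp (t * Ci))) (RtoC t)).
  { intros t. destruct (Df (rho * Cexp (t * Ci))) as [l Hl].
    - rewrite Cmod_mult, Cmod_R, Rabs_pos_eq by lra. rewrite <- cis_Cexp, Cmod_cis. lra.
    - eapply CD_CC. apply (CD_comp (fun t => rho * Cexp (t * Ci)) f); [|apply Hl].
      cd. apply CD_Cexp_comp. cd. }
  destruct (continuity_ab_maj (fun t => Cmod (f (rho * Cexp (t * Ci)))) (- PI) PI) as [tm [Hm _]].
  - pose proof PI_RGT_0. lra.
  - intros t _ e He. destruct (K t e He) as [d [Pd Hd]]. exists d. split; auto.
    intros s [_ Hs]. simpl in *. unfold Rdist in *.
    specialize (Hd (RtoC s)). rewrite <- RtoC_minus, Cmod_R in Hd. specialize (Hd Hs).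
    eapply Rle_lt_trans; [|apply Hd]. apply Rabs_le.
    pose proof (Cmod_triangle_rev (f (rho * Cexp (s * Ci))) (f (rho * Cexp (t * Ci)))).
    pose proof (Cmod_triangle_rev (f (rho * Cexp (t * Ci))) (f (rho * Cexp (s * Ci)))).
    rewrite (Cmod_minus_sym (f (rho * Cexp (t * Ci)))) in H0. lra.
  - eexists. intros v Hv. destruct (polar_form v) as [r [t [Pr [Ht [E _]]]]].
    assert (r = rho).
    { rewrite <- Hv, E, Cmod_mult, Cmod_R, Rabs_pos_eq, Cmod_cis by auto. ring. }
    subst r. specialize (Hm t ltac:(lra)). rewrite <- cis_Cexp, <- E in Hm. apply Hm.
Qed.

(** For [h] vanishing near [0] each [h v / v^n] is holomorphic, and the maximum
    principle after a Moebius map sending [0] to [c] bounds [h c] by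
    [M (|c| / r)^n] for some [r > |c|]. *)
Lemma identity_disc (h : C -> C) (d : R) : (0 < d)%R ->
  (forall v, (Cmod v < 1)%R -> exists l, CD h v l) ->
  (forall v, (Cmod v < d)%R -> h v = 0) ->
  forall c, (Cmod c < 1)%R -> h c = 0.
Proof.
  intros Hd Dh Zh c Hc.
  set (m := Cmod c) in *. assert (Pm : (0 <= m)%R) by apply Cmod_ge_0.
  set (phi := fun v => (v + c) / (1 + Cconj c * v)).
  assert (Den : forall v, (Cmod v < 1)%R -> 1 + Cconj c * v <> 0).
  { intros v Hv. apply Cmod_gt_0. pose proof (moebius_den c v Hc Hv). fold m in H. lra. }
  assert (Dphi : forall v, (Cmod v < 1)%R -> exists l, CD phi v l).
  { intros v Hv. eexists. unfold phi. cd. apply Den; auto. }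
  assert (Mphi : forall v, (Cmod v < 1)%R ->
    ((1 - Cmod (phi v) * Cmod (phi v)) * (Cmod (1 + Cconj c * v) * Cmod (1 + Cconj c * v)) =
    (1 - Cmod v * Cmod v) * (1 - m * m))%R).
  { intros v Hv. unfold phi. rewrite Cmod_div by (apply Den; auto).
    unfold m. rewrite <- moebius_identity.
    assert (Cmod (1 + Cconj c * v) <> 0%R).
    { pose proof (moebius_den c v Hc Hv). fold m in H. lra. }
    field. auto. }
  assert (In : forall v, (Cmod v < 1)%R -> (Cmod (phi v) < 1)%R).
  { intros v Hv. pose proof (Mphi v Hv) as E. pose proof (moebius_den c v Hc Hv). fold m in H.
    pose proof (Cmod_ge_0 v). pose proof (Cmod_ge_0 (phi v)).
    assert (0 < (1 - Cmod v * Cmod v) * (1 - m * m))%R by (apply Rmult_lt_0_compat; nra).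
    set (X := Cmod (1 + Cconj c * v)) in *. set (Y := Cmod (phi v)) in *.
    apply Rnot_le_lt. intros L.
    assert (0 <= (Y * Y - 1) * (X * X))%R by (apply Rmult_le_pos; nra). lra. }
  (* These radii make [phi] map the circle of radius [rho] outside the disc of radius [r]: there
     [1 - |phi v|^2] is at most [q * (1 - m * m) / (1 - m)^2 = (1 - m * m) / 2], which equals
     [1 - r * r], and [r] exceeds [m]. *)
  set (q := ((1 - m) * (1 - m) / 2)%R).
  assert (Pq : (0 < q <= 1 / 2)%R) by (unfold q; nra).
  set (rho := sqrt (1 - q)).
  assert (Rho2 : (rho * rho = 1 - q)%R) by (apply sqrt_sqrt; lra).
  assert (Rho : (0 < rho < 1)%R).
  { assert (0 < rho)%R by (apply sqrt_lt_R0; lra). nra. }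
  set (r := sqrt ((1 + m * m) / 2)).
  assert (R2 : (r * r = (1 + m * m) / 2)%R) by (apply sqrt_sqrt; nra).
  assert (Pr : (0 < r)%R) by (apply sqrt_lt_R0; nra).
  assert (Rm : (m < r)%R) by nra.
  assert (Low : forall v, Cmod v = rho -> (r <= Cmod (phi v))%R).
  { intros v Hv. assert (Hv1 : (Cmod v < 1)%R) by lra.
    pose proof (Mphi v Hv1) as E. pose proof (moebius_den c v Hc Hv1) as D. fold m in D.
    rewrite Hv, Rho2 in E. set (X := Cmod (1 + Cconj c * v)) in *.
    set (Y := Cmod (phi v)) in *. assert (0 <= Y)%R by apply Cmod_ge_0.
    assert ((1 - Y * Y) * ((1 - m) * (1 - m)) <= q * (1 - m * m))%R.
    { destruct (Rle_dec 0 (1 - Y * Y)).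
      - replace (q * (1 - m * m))%R with ((1 - (1 - q)) * (1 - m * m))%R by ring.
        rewrite <- E. apply Rmult_le_compat_l; auto. nra.
      - assert (0 < q * (1 - m * m))%R by (apply Rmult_lt_0_compat; nra). nra. }
    assert (1 - Y * Y <= (1 - m * m) / 2)%R.
    { apply Rmult_le_reg_r with ((1 - m) * (1 - m))%R; [nra|]. unfold q in *. lra. }
    apply Rnot_lt_le. intros L. nra. }
  destruct (circle_bounded (fun v => h (phi v)) rho Rho) as [M HM].
  { intros v Hv. destruct (Dphi v Hv) as [l1 Hl1]. destruct (Dh (phi v) (In v Hv)) as [l2 Hl2].
    eexists. apply (CD_comp phi h); eauto. }
  destruct (Req_dec m 0) as [Z|Nz].
  { apply Cmod_eq_0 in Z. rewrite Z. apply Zh. rewrite Cmod_0. auto. }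
  assert (Nc : c <> 0) by (apply Cmod_gt_0; fold m; lra).
  assert (P0 : phi 0 = c) by (unfold phi; field; replace (1 + Cconj c * 0) with (RtoC 1) by ring; apply C1_nz).
  assert (Key : forall n, (Cmod (h c) <= M * (m / r) ^ n)%R).
  { intros n.
    set (G := fun v => h v / v ^ n).
    assert (DG : forall v, (Cmod v < 1)%R -> exists l, CD G v l).
    { intros v Hv. destruct (Ceq_dec v 0) as [->|N].
      - exists 0. apply CD_ext_loc with (fun _ => 0) d; auto; [|apply CD_const].
        intros w Hw. unfold G. rewrite Zh; [unfold Cdiv; ring|].
        replace (w - 0) with w in Hw by ring. auto.
      - destruct (Dh v Hv) as [l Hl]. eexists. unfold G.
        apply CD_div; [apply Hl | apply CD_pow, CD_id |]. apply Cpow_nz; auto. }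
    assert (K : (Cmod (G (phi 0)) <= M / r ^ n)%R).
    { apply (max_modulus_center (fun v => G (phi v)) rho); auto.
      - intros v Hv. destruct (Dphi v Hv) as [l1 Hl1].
        destruct (DG (phi v) (In v Hv)) as [l2 Hl2].
        eexists. apply (CD_comp phi G); eauto.
      - intros v Hv. unfold G. specialize (Low v Hv). specialize (HM v Hv).
        assert (Np : phi v <> 0) by (apply Cmod_gt_0; lra).
        rewrite Cmod_div by (apply Cpow_nz; auto). rewrite Cmod_pow.
        apply Rmult_le_compat; auto.
        + apply Cmod_ge_0.
        + left. apply Rinv_0_lt_compat, pow_lt. lra.
        + apply Rinv_le_contravar; [apply pow_lt; lra|]. apply pow_incr; lra. }
    rewrite P0 in K. unfold G in K. rewrite Cmod_div in K by (apply Cpow_nz; auto).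
    rewrite Cmod_pow in K. fold m in K.
    assert (Pmn : (0 < m ^ n)%R) by (apply pow_lt; lra).
    assert (Prn : (0 < r ^ n)%R) by (apply pow_lt; lra).
    unfold Rdiv. rewrite Rpow_mult_distr, pow_inv.
    replace (Cmod (h c)) with (Cmod (h c) / m ^ n * m ^ n)%R by (field; lra).
    eapply Rle_trans; [apply Rmult_le_compat_r; [lra | exact K]|]. apply Req_le. unfold Rdiv. ring. }
  apply Cmod_small_0. intros e He.
  assert (L : is_lim_seq (fun n => M * (m / r) ^ n)%R 0).
  { replace (Finite 0) with (Rbar_mult M 0) by (simpl; f_equal; ring).
    apply is_lim_seq_scal_l. apply is_lim_seq_geom. rewrite Rabs_pos_eq.
    - apply Rlt_div_l; lra.
    - apply Rmult_le_pos; [auto|left; apply Rinv_0_lt_compat; auto]. }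
  apply is_lim_seq_spec in L. destruct (L (mkposreal e He)) as [N HN].
  specialize (HN N (Nat.le_refl _)). simpl in HN. rewrite Rminus_0_r in HN.
  specialize (Key N). apply Rabs_def2 in HN. lra.
Qed.

(** * Power series on the unit disc *)

(** The left side is at most [1 + x + ... + x^n], since [x^n] is the smallest of these [n + 1]
    terms. *)
Lemma linear_geom_bound x n : (0 <= x < 1)%R -> ((INR n + 1) * x ^ n <= / (1 - x))%R.
Proof.
  intros Hx.
  assert (S : ((INR n + 1) * x ^ n * (1 - x) <= 1 - x ^ S n)%R).
  { induction n as [|n IH]; [simpl; lra|].
    rewrite S_INR.
    change (x ^ S (S n))%R with (x * (x * x ^ n))%R.
    change (x ^ S n)%R with (x * x ^ n)%R in *.
    assert (X0 : (0 <= x ^ n)%R) by (apply pow_le; lra).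
    assert (X1 : (x ^ n <= 1)%R) by (rewrite <- (pow1 n); apply pow_incr; lra).
    set (X := (x ^ n)%R) in *. clearbody X.
    assert (x * ((INR n + 1) * X * (1 - x)) <= x * (1 - x * X))%R
      by (apply Rmult_le_compat_l; lra).
    assert (0 <= (1 - x) * (1 - x * X))%R by (apply Rmult_le_pos; nra).
    lra. }
  apply Rmult_le_reg_r with (1 - x)%R; [lra|]. rewrite Rinv_l by lra.
  assert (0 <= x ^ Datatypes.S n)%R by (apply pow_le; lra). lra.
Qed.

(** Each factor [INR n + 1] is absorbed by a small increase of the ratio; the induction inserts the
    midpoint [t] between [r] and [s]. *)
Lemma poly_geom_bound p : forall r s, (0 <= r < s)%R ->
  exists K, (0 <= K)%R /\ forall n, ((INR n + 1) ^ p * r ^ n <= K * s ^ n)%R.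
Proof.
  induction p as [|p IH]; intros r s Hrs.
  - exists 1%R. split; [lra|]. intros n. simpl. rewrite !Rmult_1_l. apply pow_incr. lra.
  - set (t := ((r + s) / 2)%R). destruct (IH r t) as [K [PK HK]]; [unfold t; lra|].
    assert (Ht : (0 <= t / s < 1)%R).
    { split; [apply Rmult_le_pos; [unfold t; lra | left; apply Rinv_0_lt_compat; lra]|].
      apply Rlt_div_l; unfold t; lra. }
    exists (K * / (1 - t / s))%R.
    assert (0 < / (1 - t / s))%R by (apply Rinv_0_lt_compat; lra).
    split; [apply Rmult_le_pos; lra|]. intros n.
    pose proof (linear_geom_bound (t / s) n Ht) as L.
    change ((INR n + 1) ^ S p)%R with ((INR n + 1) * (INR n + 1) ^ p)%R.
    pose proof (pos_INR n).
    assert (E : (t ^ n = (t / s) ^ n * s ^ n)%R).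
    { rewrite <- Rpow_mult_distr. f_equal. field. lra. }
    apply Rle_trans with ((INR n + 1) * (K * t ^ n))%R.
    { rewrite Rmult_assoc. apply Rmult_le_compat_l; [lra|]. apply HK. }
    rewrite E. replace ((INR n + 1) * (K * ((t / s) ^ n * s ^ n)))%R
      with (K * (((INR n + 1) * (t / s) ^ n)) * s ^ n)%R by ring.
    apply Rmult_le_compat_r; [apply pow_le; lra|]. apply Rmult_le_compat_l; auto.
Qed.

Lemma ex_series_poly_geom p K r : (0 <= r < 1)%R ->
  ex_series (fun n => K * ((INR n + 1) ^ p * r ^ n))%R.
Proof.
  intros Hr. apply (ex_series_scal_l (K := R_AbsRing) (V := R_NormedModule)).
  destruct (poly_geom_bound p r ((r + 1) / 2)) as [C [PC HC]]; [lra|].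
  apply (ex_series_le (V := R_CompleteNormedModule) _ (fun n => C * ((r + 1) / 2) ^ n)%R).
  - intros n. unfold norm; simpl. unfold abs; simpl. rewrite Rabs_pos_eq; auto.
    apply Rmult_le_pos; apply pow_le; [pose proof (pos_INR n)|]; lra.
  - apply (ex_series_scal_l (K := R_AbsRing) (V := R_NormedModule)). apply ex_series_geom.
    rewrite Rabs_pos_eq; lra.
Qed.

Definition PS (a : nat -> R) (u : C) : C := CSer (fun n => a n * u ^ n).

(** A crude condition that gives convergence on the whole open unit disc, with no discussion of
    radii; the hypergeometric coefficients, those of the derivative and those of [hM] all satisfy
    it. *)
Definition bounded1 (a : nat -> R) : Prop := forall n, (Rabs (a n) <= 1)%R.

Lemma PS_dom a u r n : bounded1 a -> (Cmod u <= r)%R ->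
  (Cmod (a n * u ^ n) <= 1 * ((INR n + 1) ^ 0 * r ^ n))%R.
Proof.
  intros Ha Hu. rewrite Cmod_mult, Cmod_R, Cmod_pow. simpl. rewrite Rmult_1_l, Rmult_1_l.
  pose proof (Cmod_ge_0 u).
  assert (Cmod u ^ n <= r ^ n)%R by (apply pow_incr; lra).
  assert (0 <= Cmod u ^ n)%R by (apply pow_le; lra).
  specialize (Ha n). pose proof (Rabs_pos (a n)). nra.
Qed.

Lemma PS_correct a u : bounded1 a -> (Cmod u < 1)%R ->
  Clim (csum (fun n => a n * u ^ n)) (PS a u).
Proof.
  intros Ha Hu. eapply CSer_correct.
  - intros n. apply (PS_dom a u (Cmod u)); auto. lra.
  - apply ex_series_poly_geom. pose proof (Cmod_ge_0 u). lra.
Qed.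

Lemma PS_CD a u : bounded1 a -> (Cmod u < 1)%R ->
  CD (PS a) u (CSer (fun n => (a (S n) * INR (S n))%R * u ^ n)).
Proof.
  intros Ha Hu. pose proof (Cmod_ge_0 u) as Pu.
  set (r := ((Cmod u + 1) / 2)%R). assert (Hr : (0 < r < 1)%R) by (unfold r; lra).
  (* One majorant for the series and its first two term-by-term derivatives; the factor [/ (r * r)]
     pays for the exponents [n - 1] and [n - 2]. *)
  set (K := fun n => (/ (r * r) * ((INR n + 1) ^ 2 * r ^ n))%R).
  assert (Pr : (1 <= / (r * r))%R).
  { rewrite <- Rinv_1. apply Rinv_le_contravar; nra. }
  assert (In : forall v, (Cmod (v - u) < (1 - Cmod u) / 2)%R -> (Cmod v <= r)%R).
  { intros v Hv. pose proof (Cmod_triangle_rev v u). unfold r. lra. }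
  assert (Pow : forall v n k, (Cmod v <= r)%R -> (k <= 2)%nat ->
     (Cmod (v ^ (n - k)) <= / (r * r) * r ^ n)%R).
  { intros v n k Hv Hk. rewrite Cmod_pow.
    apply Rle_trans with (r ^ (n - k))%R; [apply pow_incr; split; auto; apply Cmod_ge_0|].
    assert (Pn : (0 < r ^ n)%R) by (apply pow_lt; lra).
    destruct (Nat.le_gt_cases k n) as [L|L].
    - replace (r ^ (n - k))%R with (/ r ^ k * r ^ n)%R.
      + apply Rmult_le_compat_r; [lra|]. apply Rinv_le_contravar; [nra|].
        destruct k as [|[|[|k]]]; [simpl; nra | simpl; nra | simpl; nra | lia].
      + replace n with (k + (n - k))%nat at 1 by lia. rewrite pow_add. field.
        apply pow_nonzero. lra.
    (* Truncated subtraction: for [n < k] the power is 1, still below [r ^ n / (r * r)] because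
       [n < 2]. *)
    - replace (n - k)%nat with 0%nat by lia. simpl.
      assert (n < 2)%nat by lia.
      apply Rmult_le_reg_l with (r * r)%R; [nra|].
      rewrite <- Rmult_assoc, Rinv_r by nra.
      destruct n as [|[|n]]; [simpl; nra | simpl; nra | lia]. }
  assert (Kb : forall (c : R) v n k, (Rabs c <= (INR n + 1) ^ 2)%R -> (Cmod v <= r)%R -> (k <= 2)%nat ->
     (Cmod (c * v ^ (n - k)) <= K n)%R).
  { intros c v n k Hc Hv Hk. rewrite Cmod_mult, Cmod_R. unfold K.
    replace (/ (r * r) * ((INR n + 1) ^ 2 * r ^ n))%R
      with ((INR n + 1) ^ 2 * (/ (r * r) * r ^ n))%R by ring.
    apply Rmult_le_compat; auto; [apply Rabs_pos | apply Cmod_ge_0]. }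
  assert (Cb : forall n (c : R), (0 <= c <= (INR n + 1) ^ 2)%R ->
     (Rabs (a n * c) <= (INR n + 1) ^ 2)%R).
  { intros n c Hc. rewrite Rabs_mult, (Rabs_pos_eq c) by lra.
    specialize (Ha n). pose proof (Rabs_pos (a n)). nra. }
  assert (Ex : ex_series K) by (apply ex_series_poly_geom; lra).
  eapply CD_eq.
  - apply (CSer_CD (fun n v => a n * v ^ n) (fun n v => (a n * INR n)%R * v ^ (n - 1))
      (fun n v => (a n * (INR n * INR (n - 1)))%R * v ^ (n - 2)) K u ((1 - Cmod u) / 2)); auto.
    + lra.
    + intros n v _. eapply CD_eq; [cd|]. cbv beta. rewrite RtoC_mult. ring.
    + intros n v _. eapply CD_eq; [cd|]. cbv beta. rewrite !RtoC_mult.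
      replace (n - 1 - 1)%nat with (n - 2)%nat by lia. ring.
    + intros n v Hv. pose proof (Kb (a n * 1)%R v n 0%nat) as Q.
      rewrite Rmult_1_r, Nat.sub_0_r in Q. apply Q; auto.
      specialize (Ha n). pose proof (pos_INR n). nra.
    + intros n v Hv. apply Kb; auto. apply Cb. pose proof (pos_INR n). nra.
    + intros n v Hv. apply Kb; auto. apply Cb. pose proof (pos_INR n).
      assert (0 <= INR (n - 1) <= INR n)%R by (split; [apply pos_INR | apply le_INR; lia]). nra.
  - cbv beta. rewrite (CSer_shift _ K).
    + simpl INR at 1. rewrite Rmult_0_r, Cmult_0_l, Cplus_0_l.
      apply CSer_ext. intros n. rewrite Nat.sub_succ, Nat.sub_0_r. reflexivity.
    + intros n. apply Kb; auto; [|unfold r; lra]. apply Cb. pose proof (pos_INR n). nra.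
    + auto.
Qed.

Definition pshift (a : nat -> R) (n : nat) : R := match n with O => 0%R | S m => a m end.

Lemma bounded1_pshift a : bounded1 a -> bounded1 (pshift a).
Proof. intros H [|n]; simpl; auto. rewrite Rabs_R0. lra. Qed.

Lemma PS_pshift a u : bounded1 a -> (Cmod u < 1)%R -> PS (pshift a) u = u * PS a u.
Proof.
  intros Ha Hu. apply CSer_unique. apply Clim_incr_1.
  apply Clim_ext with (fun n => u * csum (fun n => a n * u ^ n) n).
  - intros n. induction n as [|n IH]; simpl; [ring|].
    rewrite Cmult_plus_distr_l, IH. simpl. ring.
  - apply Clim_scal. apply PS_correct; auto.
Qed.

Lemma PS_minus a b u : bounded1 a -> bounded1 b -> (Cmod u < 1)%R ->
  PS (fun n => (a n - b n)%R) u = PS a u - PS b u.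
Proof.
  intros Ha Hb Hu. apply CSer_unique.
  apply Clim_ext with (fun n => csum (fun n => a n * u ^ n) n - csum (fun n => b n * u ^ n) n).
  - intros n. induction n as [|n IH]; simpl; [ring|]. rewrite <- IH, RtoC_minus. ring.
  - apply Clim_minus; apply PS_correct; auto.
Qed.

Lemma PS_ext a b u : (forall n, a n = b n) -> PS a u = PS b u.
Proof. intros H. apply CSer_ext. intros n. rewrite H. auto. Qed.

Lemma PS_0 a : bounded1 a -> PS a 0 = a 0%nat.
Proof.
  intros Ha. apply CSer_unique. apply Clim_incr_1.
  apply Clim_ext with (fun _ => RtoC (a 0%nat)); [|apply Clim_const].
  intros n. induction n as [|n IH]; simpl; [ring|]. rewrite IH. simpl. ring.
Qed.

Lemma PS_conj a u : PS a (Cconj u) = Cconj (PS a u).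
Proof.
  assert (E : forall n, a n * Cconj u ^ n = Cconj (a n * u ^ n)).
  { intros n. rewrite Cmult_conj, Cpow_conj. f_equal.
    apply C_ext; unfold Re, Im, Cconj, RtoC; simpl; ring. }
  unfold PS. rewrite (CSer_ext _ _ E). unfold CSer.
  apply C_ext; unfold Re, Im, Cconj; simpl; auto.
  rewrite <- Series_opp. reflexivity.
Qed.

(** * The function 2F1(1/2,1/2;1;u) *)

(** The square of [(1/2)_n / n!], given by its ratio recurrence so that estimates go by induction
    without factorials. *)
Fixpoint hyp_c (n : nat) : R :=
  match n with O => 1 | S m => hyp_c m * ((2 * INR m + 1) / (2 * INR m + 2)) ^ 2 end%R.

Lemma hyp_c_pos n : (0 < hyp_c n)%R.
Proof.
  induction n as [|n IH]; simpl; [lra|]. pose proof (pos_INR n).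
  assert (0 < (2 * INR n + 1) / (2 * INR n + 2))%R by (apply Rdiv_lt_0_compat; lra).
  apply Rmult_lt_0_compat; auto. nra.
Qed.

(** The coefficients behave like [1 / (PI * n)]; this explicit form of the decay bounds the
    coefficients [n * hyp_c n] of the derivative by 1. *)
Lemma hyp_c_le n : ((INR n + 1) * hyp_c n <= 1)%R.
Proof.
  induction n as [|n IH]; [simpl; lra|].
  change (hyp_c (S n)) with (hyp_c n * ((2 * INR n + 1) / (2 * INR n + 2)) ^ 2)%R.
  rewrite S_INR. pose proof (pos_INR n). pose proof (hyp_c_pos n).
  eapply Rle_trans; [|apply IH].
  replace ((INR n + 1 + 1) * (hyp_c n * ((2 * INR n + 1) / (2 * INR n + 2)) ^ 2))%R
    with ((INR n + 2) * (2 * INR n + 1) ^ 2 / (2 * INR n + 2) ^ 2 * hyp_c n)%R by (field; lra).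
  apply Rmult_le_compat_r; [lra|]. apply Rle_div_l; nra.
Qed.

Lemma hyp_c_eq n : hyp2F1_coeff (1 / 2) (1 / 2) 1 n = hyp_c n.
Proof.
  assert (P1 : forall n, Cpochhammer 1 n = INR (fact n)).
  { intros m. induction m as [|m IH]; [reflexivity|].
    change (fact (S m)) with (S m * fact m)%nat. rewrite mult_INR, RtoC_mult.
    simpl Cpochhammer. rewrite IH, S_INR, RtoC_plus. ring. }
  unfold hyp2F1_coeff. rewrite P1. induction n as [|n IH].
  - simpl. field.
  - change (hyp_c (S n)) with (hyp_c n * ((2 * INR n + 1) / (2 * INR n + 2)) ^ 2)%R.
    rewrite RtoC_mult, <- IH.
    change (fact (S n)) with (S n * fact n)%nat. rewrite mult_INR, RtoC_mult, S_INR.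
    simpl Cpochhammer. pose proof (pos_INR n).
    rewrite RtoC_pow, RtoC_div by lra. rewrite !RtoC_plus, !RtoC_mult.
    assert (INR (fact n) <> 0)%R by (apply INR_fact_neq_0).
    assert (N1 : RtoC (INR (fact n)) <> 0) by (intros E; apply RtoC_inj in E; auto).
    assert (N2 : RtoC (INR n) + 1 <> 0).
    { rewrite <- RtoC_plus. intros E; apply RtoC_inj in E; lra. }
    assert (N3 : 2 * RtoC (INR n) + 2 <> 0).
    { rewrite <- RtoC_mult, <- RtoC_plus. intros E; apply RtoC_inj in E; lra. }
    field. auto.
Qed.

Lemma hyp_c_bounded : bounded1 hyp_c.
Proof.
  intros n. pose proof (hyp_c_pos n). pose proof (hyp_c_le n). pose proof (pos_INR n).
  rewrite Rabs_pos_eq by lra. nra.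
Qed.

Definition hF : C -> C := PS hyp_c.

(** The power series of [u (1 - u) hF']. With it the hypergeometric equation becomes the first-order
    system [u (1 - u) hF' = hM], [hM' = hF / 4], and no second derivatives occur later. *)
Definition hM : C -> C := PS (pshift (fun n => (hyp_c n / (4 * (INR n + 1)))%R)).

Lemma hM_c_bounded : bounded1 (fun n => (hyp_c n / (4 * (INR n + 1)))%R).
Proof.
  intros n. pose proof (hyp_c_pos n). pose proof (hyp_c_le n). pose proof (pos_INR n).
  rewrite Rabs_pos_eq.
  - apply Rle_div_l; nra.
  - apply Rmult_le_pos; [lra|]. left. apply Rinv_0_lt_compat. lra.
Qed.

Lemma hF_0 : hF 0 = 1.
Proof. apply PS_0, hyp_c_bounded. Qed.

Lemma hM_0 : hM 0 = 0.
Proof. apply PS_0, bounded1_pshift, hM_c_bounded. Qed.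

Lemma hF_conj u : hF (Cconj u) = Cconj (hF u).
Proof. apply PS_conj. Qed.

Lemma hM_conj u : hM (Cconj u) = Cconj (hM u).
Proof. apply PS_conj. Qed.

Lemma hM_CD u : (Cmod u < 1)%R -> CD hM u (hF u / 4).
Proof.
  intros Hu. eapply CD_eq.
  - apply PS_CD; auto. apply bounded1_pshift, hM_c_bounded.
  - unfold hF, PS, Cdiv. rewrite Cmult_comm.
    rewrite <- CSer_scal with (K := fun n => (1 * ((INR n + 1) ^ 0 * Cmod u ^ n))%R).
    + apply CSer_ext. intros n. simpl pshift. rewrite S_INR. pose proof (pos_INR n).
      replace (hyp_c n / (4 * (INR n + 1)) * (INR n + 1))%R with (/ 4 * hyp_c n)%R
        by (field; lra).
      rewrite RtoC_mult, RtoC_inv by lra. ring.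
    + intros n. apply PS_dom; [apply hyp_c_bounded | lra].
    + apply ex_series_poly_geom. pose proof (Cmod_ge_0 u). lra.
Qed.

(** The product form stays valid at [u = 0], where the quotient in [hF_CD] is meaningless; the proof
    compares coefficients, multiplication by [u] being [pshift]. *)
Lemma hF_CD_ex u : (Cmod u < 1)%R -> exists l, CD hF u l /\ u * (1 - u) * l = hM u.
Proof.
  intros Hu. eexists. split; [apply PS_CD; auto; apply hyp_c_bounded|].
  set (d := fun n => (hyp_c (S n) * INR (S n))%R).
  assert (Bd : bounded1 d).
  { intros n. unfold d. pose proof (hyp_c_pos (S n)). pose proof (hyp_c_le (S n)).
    pose proof (pos_INR (S n)). rewrite Rabs_pos_eq by nra. nra. }
  change (u * (1 - u) * PS d u = hM u).
  replace (u * (1 - u) * PS d u) with (u * PS d u - u * (u * PS d u)) by ring.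
  rewrite <- (PS_pshift d) by auto.
  rewrite <- (PS_pshift (pshift d)) by (auto; apply bounded1_pshift; auto).
  rewrite <- PS_minus; auto; try (repeat apply bounded1_pshift; auto).
  apply PS_ext. intros n. unfold d. destruct n as [|[|n]].
  - simpl. ring.
  - simpl. field.
  - unfold pshift.
    change (hyp_c (S (S n))) with
      (hyp_c (S n) * ((2 * INR (S n) + 1) / (2 * INR (S n) + 2)) ^ 2)%R.
    rewrite !S_INR. pose proof (pos_INR n). field. lra.
Qed.

Lemma hF_CD (u : C) : u <> 0 -> (Cmod u < 1)%R -> CD hF u (hM u / (u * (1 - u))).
Proof.
  intros N Hu. destruct (hF_CD_ex u Hu) as [l [Hl <-]].
  assert (1 - u <> 0).
  { apply Cmod_gt_0. pose proof (Cmod_triangle_rev 1 u). rewrite Cmod_1 in H. lra. }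
  eapply CD_eq; [apply Hl|]. field. auto.
Qed.

Lemma C_neq_Re (u v : C) : Re u <> Re v -> u <> v.
Proof. intros H ->. auto. Qed.

Lemma one_plus_neq_0 (v : C) : (Cmod v < 1)%R -> 1 + v <> 0.
Proof.
  intros H. apply Cmod_gt_0. pose proof (Cmod_triangle_rev 1 (- v)) as T.
  rewrite Cmod_1, Cmod_opp in T. replace (1 - - v) with (1 + v) in T by ring. lra.
Qed.

Lemma one_minus_neq_0 (v : C) : (Cmod v < 1)%R -> 1 - v <> 0.
Proof. intros H. apply (one_plus_neq_0 (- v)). rewrite Cmod_opp. auto. Qed.

Lemma Cmod_sq_lt_1 (v : C) : (Cmod v < 1)%R -> (Cmod (v * v) < 1)%R.
Proof. intros H. rewrite Cmod_mult. pose proof (Cmod_ge_0 v). nra. Qed.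

Lemma constant_of_CD_0 (f : C -> C) (d : R) :
  (forall v, (Cmod v < d)%R -> CD f v 0) -> forall v, (Cmod v < d)%R -> f v = f 0.
Proof.
  intros H v Hv.
  assert (E : (Cmod (f (0 + v)%C - f 0%C)%C <= 0 * Cmod v)%R).
  { apply (C_mean_value f (fun _ => 0)).
    - intros t Ht. apply H. replace (0 + t * v) with (t * v) by ring.
      rewrite Cmod_mult, Cmod_R, Rabs_pos_eq by lra. pose proof (Cmod_ge_0 v). nra.
    - intros t Ht. rewrite Cmod_0. lra. }
  replace (0 + v) with v in E by ring. apply Ceq_minus. apply Cmod_eq_0.
  pose proof (Cmod_ge_0 (f v - f 0)). lra.
Qed.

(** * Landen's transformation *)

(** A rotated and rescaled Koebe function: it maps the unit disc onto the plane slit along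
    [[1, +oo)], so a formula in [k] on the disc reaches the whole domain of the continued
    function. *)
Definition koebe (k : C) : C := 4 * k / ((1 + k) * (1 + k)).

Lemma koebe_CD k : (Cmod k < 1)%R ->
  CD koebe k (4 * (1 - k) / ((1 + k) * (1 + k) * (1 + k))).
Proof.
  intros Hk. pose proof (one_plus_neq_0 k Hk) as N. unfold koebe. eapply CD_eq.
  - cd. apply Cmult_neq_0; auto.
  - cbv beta. field. auto.
Qed.

Lemma koebe_small k : (Cmod k < 1 / 8)%R -> (Cmod (koebe k) < 1)%R.
Proof.
  intros Hk. assert (N : 1 + k <> 0) by (apply one_plus_neq_0; lra).
  unfold koebe. rewrite Cmod_div by (apply Cmult_neq_0; auto).
  rewrite !Cmod_mult, Cmod_R, Rabs_pos_eq by lra.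
  pose proof (Cmod_triangle_rev 1 (- k)) as T.
  rewrite Cmod_1, Cmod_opp in T. replace (1 - - k) with (1 + k) in T by ring.
  apply Rlt_div_l; nra.
Qed.

Lemma hF_CD_0 : CD hF 0 (1 / 4).
Proof.
  eapply CD_eq; [apply PS_CD; [apply hyp_c_bounded | rewrite Cmod_0; lra]|].
  apply CSer_unique. apply Clim_incr_1. apply Clim_ext with (fun _ => 1 / 4); [|apply Clim_const].
  intros n. induction n as [|n IH].
  - change (INR 1) with 1%R. simpl csum. simpl hyp_c. change (INR 0) with 0%R.
    rewrite <- !RtoC_div by lra. simpl. rewrite Cplus_0_l, Cmult_1_r. f_equal. field.
  - change (csum ?f (S (S n))) with (csum f (S n) + f (S n)). rewrite <- IH.
    simpl Cpow. ring.
Qed.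

(** Both sides solve [(P f')' = Q f] with [P 0 = 0], so [P] times their Wronskian
    is constant, hence zero. *)
Lemma landen_local : exists d, (0 < d)%R /\ forall k, (Cmod k < d)%R ->
  hF (koebe k) = (1 + k) * hF (k * k).
Proof.
  set (g := fun k => (1 + k) * hF (k * k)). set (h := fun k => hF (koebe k)).
  assert (K0 : koebe 0 = 0) by (unfold koebe; field; intros E; injection E; lra).
  assert (G0 : g 0 = 1).
  { unfold g. replace (0 * 0) with (RtoC 0) by ring. rewrite hF_0. ring. }
  assert (H0 : h 0 = 1) by (unfold h; rewrite K0, hF_0; auto).
  assert (D : forall k, (Cmod k < 1 / 8)%R -> exists g' h',
    CD g k g' /\ CD h k h' /\ (k = 0 -> g' = h') /\
    hM (koebe k) = k * (1 - k) / (1 + k) * h' /\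
    k * (1 - k) / (1 + k) * hF (k * k) + 2 * hM (k * k) / (1 + k) = k * (1 - k) / (1 + k) * g').
  { intros k Hk. assert (Hk1 : (Cmod k < 1)%R) by lra.
    pose proof (one_plus_neq_0 k Hk1) as N.
    destruct (Ceq_dec k 0) as [->|Nk].
    - exists 1, 1. split; [|split; [|split]].
      + unfold g. eapply CD_eq.
        * cd. apply (CD_comp (fun k => k * k) hF); [cd|].
          replace (0 * 0) with (RtoC 0) by ring. apply hF_CD_0.
        * cbv beta. replace (0 * 0) with (RtoC 0) by ring. rewrite hF_0. ring.
      + unfold h. eapply CD_eq.
        * apply (CD_comp koebe hF); [apply koebe_CD; auto|]. rewrite K0. apply hF_CD_0.
        * field. auto.
      + auto.
      + rewrite K0. replace (0 * 0) with (RtoC 0) by ring. rewrite hM_0.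
        split; field; auto.
    - assert (Nkk : koebe k <> 0).
      { unfold koebe. intros E. apply Nk.
        replace k with (4 * k / ((1 + k) * (1 + k)) * ((1 + k) * (1 + k) / 4)) by (field; auto).
        rewrite E. ring. }
      pose proof (one_minus_neq_0 k Hk1) as N1.
      do 2 eexists. split; [|split; [|split]].
      + unfold g. cd. apply (CD_comp (fun k => k * k) hF); [cd|].
        apply hF_CD; [apply Cmult_neq_0; auto | apply Cmod_sq_lt_1; auto].
      + unfold h. apply (CD_comp koebe hF); [apply koebe_CD; auto|].
        apply hF_CD; auto. apply koebe_small; auto.
      + intros; contradiction.
      + cbv beta. assert (1 - koebe k = (1 - k) * (1 - k) / ((1 + k) * (1 + k)))
          by (unfold koebe; field; auto).
        rewrite H. split.
        * set (M := hM (koebe k)). unfold koebe. field. auto.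
        * assert (1 - k * k <> 0) by (replace (1 - k * k) with ((1 - k) * (1 + k)) by ring;
            apply Cmult_neq_0; auto).
          field. auto. }
  (* With [P = k (1 - k) / (1 + k)], the assertion [D] identifies [hM (koebe k)] with [P h'] and the
     bracket after [h k] with [P g'], so [Om] is [P (g h' - h g')]. *)
  set (Om := fun k => g k * hM (koebe k)
     - h k * (k * (1 - k) / (1 + k) * hF (k * k) + 2 * hM (k * k) / (1 + k))).
  assert (DOm : forall k, (Cmod k < 1 / 8)%R -> CD Om k 0).
  { intros k Hk. assert (Hk1 : (Cmod k < 1)%R) by lra.
    pose proof (one_plus_neq_0 k Hk1) as N.
    destruct (D k Hk) as [g' [h' [Dg [Dh [_ [E1 E2]]]]]].
    destruct (hF_CD_ex (k * k) (Cmod_sq_lt_1 k Hk1)) as [a [Da Ea]].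
    unfold Om. eapply CD_eq.
    - apply CD_minus.
      + apply CD_mult; [apply Dg|]. apply (CD_comp koebe hM); [apply koebe_CD; auto|].
        apply hM_CD, koebe_small; auto.
      + apply CD_mult; [apply Dh|]. cd; auto.
        * apply (CD_comp (fun k => k * k) hF); [cd | apply Da].
        * apply (CD_comp (fun k => k * k) hM); [cd | apply hM_CD, Cmod_sq_lt_1; auto].
    - cbv beta. rewrite E2, E1. rewrite <- Ea. unfold h, g.
      set (X := hF (koebe k)). set (Y := hF (k * k)). field. auto. }
  assert (Z : forall k, (Cmod k < 1 / 8)%R -> Om k = 0).
  { intros k Hk. rewrite (constant_of_CD_0 Om (1 / 8) DOm k Hk). unfold Om.
    rewrite K0. replace (0 * 0) with (RtoC 0) by ring. rewrite hM_0. field. }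
  assert (Cg : CC g 0).
  { destruct (D 0) as [g' [h' [Dg _]]]; [rewrite Cmod_0; lra|]. eapply CD_CC; eauto. }
  destruct (Cg 1%R ltac:(lra)) as [d [Pd Hd]].
  assert (Ng : forall k, (Cmod k < d)%R -> g k <> 0).
  { intros k Hk E. specialize (Hd k). replace (k - 0) with k in Hd by ring.
    specialize (Hd Hk). rewrite E, G0 in Hd. replace (0 - 1) with (- (1)) in Hd by ring.
    rewrite Cmod_m1 in Hd. lra. }
  exists (Rmin d (1 / 8)). split; [apply Rmin_pos; lra|]. intros k Hk.
  (* A vanishing Wronskian makes the quotient constant where [g] is nonzero. *)
  assert (C0 : h k / g k = h 0 / g 0).
  { apply (constant_of_CD_0 (fun k => h k / g k) (Rmin d (1 / 8))); auto.
    intros v Hv. pose proof (Rmin_l d (1 / 8)). pose proof (Rmin_r d (1 / 8)).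
    assert (Hv1 : (Cmod v < 1)%R) by lra.
    pose proof (one_plus_neq_0 v Hv1) as N. pose proof (one_minus_neq_0 v Hv1) as N1.
    destruct (D v ltac:(lra)) as [g' [h' [Dg [Dh [E0 [E1 E2]]]]]].
    assert (Nv : g v <> 0) by (apply Ng; lra).
    eapply CD_eq; [apply CD_div; eauto|].
    assert (W : h' * g v - h v * g' = 0).
    (* [P] vanishes at 0, so [Om = 0] says nothing there; the values and derivatives of [g] and [h]
       at 0 agree by [G0], [H0] and [E0]. *)
    { destruct (Ceq_dec v 0) as [->|Nv0].
      - rewrite G0, H0, E0 by auto. ring.
      - pose proof (Z v ltac:(lra)) as ZZ. unfold Om in ZZ. rewrite E2, E1 in ZZ.
        replace (h' * g v - h v * g') with
          ((g v * (v * (1 - v) / (1 + v) * h') - h v * (v * (1 - v) / (1 + v) * g'))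
            * ((1 + v) / (v * (1 - v)))) by (field; auto).
        rewrite ZZ. ring. }
    rewrite W. field. auto. }
  rewrite G0, H0 in C0. pose proof (Rmin_l d (1 / 8)).
  assert (Nk : g k <> 0) by (apply Ng; lra).
  change (h k = g k). replace (h k) with (h k / g k * g k) by (field; auto).
  rewrite C0. field.
Qed.

(** * The continued hypergeometric function off the cut *)

Lemma is_derive_CD (F : C -> C) (u : C) :
  ex_derive (K := C_AbsRing) (V := C_NormedModule) F u -> exists l, CD F u l.
Proof.
  intros [l [_ H]]. exists l. intros e He.
  specialize (H u (fun P HP => HP) (mkposreal e He)).
  destruct H as [d Hd]. exists d. split; [apply cond_pos|]. intros v Hv.
  specialize (Hd v Hv).

  eapply Rle_trans; [|apply Hd]. apply Req_le.
  change (Cmod (F v - F u - l * (v - u)) = Cmod (F v - F u - (v - u) * l)). f_equal. ring.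
Qed.

Lemma hyp2F1_disc F : is_hyp2F1 (1 / 2) (1 / 2) 1 F ->
  forall u, (Cmod u < 1)%R -> F u = hF u.
Proof.
  intros [H _] u Hu. specialize (H u Hu). symmetry. apply CSer_unique.
  apply is_series_csum. unfold is_pseries in H. refine (is_series_ext _ _ _ _ H). intros n.
  rewrite hyp_c_eq. change (pow_n u n * RtoC (hyp_c n) = hyp_c n * u ^ n).
  rewrite Cmult_comm. f_equal.
Qed.

Lemma hyp2F1_CD F : is_hyp2F1 (1 / 2) (1 / 2) 1 F ->
  forall u, off_cut u -> exists l, CD F u l.
Proof. intros [_ H] u Hu. apply is_derive_CD. auto. Qed.

Lemma off_cut_one_minus_sq (s : C) : (0 < Re s)%R -> off_cut (1 - s * s).
Proof.
  intros Hs [H1 H2]. destruct s as [a b].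
  unfold Re, Im, Cminus, Cplus, Copp, Cmult, RtoC in *; simpl in *.
  assert (a * b = 0)%R by lra. assert (b = 0)%R by nra. subst b. nra.
Qed.

Lemma Re_cayley (s : C) : 1 + s <> 0 ->
  (Re ((1 - s) / (1 + s)) * (Cmod (1 + s) * Cmod (1 + s)) = 1 - Cmod s * Cmod s)%R.
Proof.
  intros N. set (c := (1 - s) / (1 + s)).
  assert (E : c * (1 + s) = 1 - s) by (unfold c; field; auto).
  rewrite !Cmod_sq. destruct c as [p q], s as [a b].
  unfold Re, Im, Cminus, Cplus, Copp, Cmult, RtoC in *; simpl in *.
  injection E as E1 E2.
  transitivity ((p * (1 + a) - q * (0 + b)) * (1 + a) + (p * (0 + b) + q * (1 + a)) * b)%R;
    [ring|]. rewrite E1, E2. ring.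
Qed.

Lemma Cmod_cayley (s : C) : (0 < Re s)%R -> 1 + s <> 0 /\ (Cmod ((1 - s) / (1 + s)) < 1)%R.
Proof.
  intros Hs. assert (N : 1 + s <> 0).
  { apply C_neq_Re. destruct s as [a b]. unfold Re, Cplus, RtoC in *; simpl in *. lra. }
  split; auto. rewrite Cmod_div by auto.
  assert (P : (0 < Cmod (1 + s))%R) by (apply Cmod_gt_0; auto).
  apply Rlt_div_l; auto. rewrite Rmult_1_l.
  pose proof (Cmod_sq (1 + s)). pose proof (Cmod_sq (1 - s)).
  pose proof (Cmod_ge_0 (1 - s)). destruct s as [a b].
  unfold Re, Im, Cminus, Cplus, Copp, RtoC in *; simpl in *. nra.
Qed.

(** [1 - koebe k] is the square of the Cayley image of [k], which lies in the right half-plane. *)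
Lemma off_cut_koebe k : (Cmod k < 1)%R -> off_cut (koebe k).
Proof.
  intros Hk. pose proof (one_plus_neq_0 k Hk) as N.
  replace (koebe k) with (1 - ((1 - k) / (1 + k)) * ((1 - k) / (1 + k)))
    by (unfold koebe; field; auto).
  apply off_cut_one_minus_sq. pose proof (Re_cayley k N) as E.
  assert (0 < Cmod (1 + k))%R by (apply Cmod_gt_0; auto). pose proof (Cmod_ge_0 k).
  assert (0 < 1 - Cmod k * Cmod k)%R by nra. rewrite <- E in H1.
  apply Rnot_le_lt. intros L.
  assert (0 < Cmod (1 + k) * Cmod (1 + k))%R by nra. nra.
Qed.

Section Continuation.
Variable F : C -> C.
Hypothesis HF : is_hyp2F1 (1 / 2) (1 / 2) 1 F.

(** Both sides are holomorphic in [k] on the whole disc, although [koebe k] leaves the disc of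
    convergence; the local identity therefore extends by [identity_disc]. *)
Lemma landen k : (Cmod k < 1)%R -> F (koebe k) = (1 + k) * hF (k * k).
Proof.
  intros Hk. destruct landen_local as [d [Pd Hd]]. apply Ceq_minus.
  apply (identity_disc (fun k => F (koebe k) - (1 + k) * hF (k * k)) (Rmin d (1 / 8))); auto.
  - apply Rmin_pos; lra.
  - intros v Hv. destruct (hyp2F1_CD F HF (koebe v) (off_cut_koebe v Hv)) as [l Hl].
    destruct (hF_CD_ex (v * v) (Cmod_sq_lt_1 v Hv)) as [l2 [Hl2 _]].
    eexists. apply CD_minus.
    + apply (CD_comp koebe F); [apply koebe_CD; auto | apply Hl].
    + cd. apply (CD_comp (fun k => k * k) hF); [cd | apply Hl2].
  - intros v Hv. pose proof (Rmin_l d (1 / 8)). pose proof (Rmin_r d (1 / 8)).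
    rewrite (hyp2F1_disc F HF) by (apply koebe_small; lra).
    rewrite Hd by lra. ring.
Qed.

Lemma landen_sq (s : C) : (0 < Re s)%R ->
  F (1 - s * s) = 2 / (1 + s) * hF ((1 - s) / (1 + s) * ((1 - s) / (1 + s))).
Proof.
  intros Hs. destruct (Cmod_cayley s Hs) as [N L].
  replace (1 - s * s) with (koebe ((1 - s) / (1 + s))).
  - rewrite landen by auto. replace (1 + (1 - s) / (1 + s)) with (2 / (1 + s)) by (field; auto).
    reflexivity.
  - unfold koebe. field. split; auto.
    replace (1 + s + (1 - s)) with (RtoC 2) by ring. intros E; injection E; lra.
Qed.

Definition hG (r : C) : C := 4 / ((1 + r) * (1 + r)) * hF (((1 - r) / (1 + r)) ^ 4).

Lemma Re_inv_pos (u : C) : (0 < Re u)%R -> (0 < Re (/ u))%R.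
Proof.
  intros H. destruct u as [a b]. unfold Re, Cinv in *; simpl in *.
  apply Rdiv_lt_0_compat; nra.
Qed.

Lemma landen_twice (r : C) : (0 < Re r)%R -> (0 < Re (r * r))%R -> F (1 - (r * r) * (r * r)) = hG r.
Proof.
  intros Hr Hr2. rewrite landen_sq by auto.
  destruct (Cmod_cayley (r * r) Hr2) as [N L].
  destruct (Cmod_cayley r Hr) as [N1 L1].
  assert (Nr : r <> 0) by (apply C_neq_Re; unfold RtoC; simpl; lra).
  rewrite <- (hyp2F1_disc F HF) by (apply Cmod_sq_lt_1; auto).
  (* This [s] satisfies [1 - s^2 = ((1 - r^2) / (1 + r^2))^2], which permits the second Landen step.
     As [2 / (r + 1 / r)] it lies in the right half-plane, which is closed under sums and
     inverses. *)
  set (s := 2 * r / (1 + r * r)).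
  assert (Hs : (0 < Re s)%R).
  { assert (Nri : r + / r <> 0).
    { replace (r + / r) with ((1 + r * r) / r) by (field; auto).
      apply Cmult_neq_0; auto. intros E. apply Nr.
      replace r with (/ (/ r)) by (field; auto). rewrite E.
      exfalso. apply (C1_nz). transitivity (/ r * r); [field; auto|]. rewrite E; ring. }
    replace s with (2%R * / (r + / r)) by (unfold s; field; auto).
    rewrite re_scal_l. apply Rmult_lt_0_compat; [lra|]. apply Re_inv_pos.
    pose proof (Re_inv_pos r Hr). destruct r as [a b].
    change (0 < a + Re (/ (a, b)))%R. unfold Re in Hr; simpl in Hr. lra. }
  replace ((1 - r * r) / (1 + r * r) * ((1 - r * r) / (1 + r * r))) with (1 - s * s)
    by (unfold s; field; auto).
  rewrite landen_sq by auto. unfold hG.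
  assert (E : (1 - s) / (1 + s) = (1 - r) / (1 + r) * ((1 - r) / (1 + r))).
  { unfold s. field. split; auto. split; auto.
    replace (1 + r * r + 2 * r) with ((1 + r) * (1 + r)) by ring. apply Cmult_neq_0; auto. }
  rewrite E. rewrite Cmult_assoc. f_equal.
  - unfold s. field. split; auto. split; auto.
    replace (1 + r * r + 2 * r) with ((1 + r) * (1 + r)) by ring. apply Cmult_neq_0; auto.
  - f_equal. ring.
Qed.

End Continuation.

(** * The arithmetic-geometric mean in a sector *)

Definition in_sector (A B : R) (v : C) : Prop :=
  exists rho t, (0 < rho)%R /\ (A <= t <= B)%R /\ v = rho * cis t.

Lemma polar_mult (r s t u : R) : (r * cis t) * (s * cis u) = (r * s)%R * cis (t + u).
Proof. rewrite cis_plus, RtoC_mult. ring. Qed.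

Lemma Re_polar (r t : R) : Re (r * cis t) = (r * cos t)%R.
Proof. rewrite re_scal_l. reflexivity. Qed.

Lemma Im_polar (r t : R) : Im (r * cis t) = (r * sin t)%R.
Proof. rewrite im_scal_l. reflexivity. Qed.

(** A sector of opening below pi is a convex cone. After the bisector is rotated to the positive
    axis, membership becomes three linear sign conditions, and these are additive; [d] is half the
    opening. *)
Lemma in_sector_plus A B u v : (A <= B)%R -> (B - A < PI)%R ->
  in_sector A B u -> in_sector A B v -> in_sector A B (u + v).
Proof.
  intros HAB HP Hu Hv. set (m := ((A + B) / 2)%R). set (d := ((B - A) / 2)%R).
  assert (Tst : forall x, in_sector A B x -> (0 < Re (x * cis (- m)))%R /\
     (Im (x * cis (- m) * cis (- d)) <= 0)%R /\ (0 <= Im (x * cis (- m) * cis d))%R).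
  { intros x [r [t [P [T ->]]]].
    replace (r * cis t * cis (- m)) with (r * cis (t + - m)) by (rewrite cis_plus; ring).
    replace (r * cis (t + - m) * cis (- d)) with (r * cis (t + - m + - d))
      by (rewrite (cis_plus (t + - m)); ring).
    replace (r * cis (t + - m) * cis d) with (r * cis (t + - m + d))
      by (rewrite (cis_plus (t + - m)); ring).
    rewrite Re_polar, !Im_polar. unfold m, d.
    split; [|split].
    - apply Rmult_lt_0_compat; auto. apply cos_gt_0; lra.
    - assert (0 <= sin (- (t + - ((A + B) / 2) + - ((B - A) / 2))))%R
        by (apply sin_ge_0; lra).
      rewrite sin_neg in H. nra.
    - apply Rmult_le_pos; [lra|]. apply sin_ge_0; lra. }
  destruct (Tst u Hu) as [U1 [U2 U3]]. destruct (Tst v Hv) as [V1 [V2 V3]].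
  destruct (polar_form ((u + v) * cis (- m))) as [r [t [Pr [Ht [E _]]]]].
  assert (R1 : (0 < Re ((u + v) * cis (- m)))%R).
  { rewrite Cmult_plus_distr_r. change (0 < Re (u * cis (- m)) + Re (v * cis (- m)))%R. lra. }
  assert (R2 : (Im ((u + v) * cis (- m) * cis (- d)) <= 0)%R).
  { rewrite !Cmult_plus_distr_r.
    change (Im (u * cis (- m) * cis (- d)) + Im (v * cis (- m) * cis (- d)) <= 0)%R. lra. }
  assert (R3 : (0 <= Im ((u + v) * cis (- m) * cis d))%R).
  { rewrite !Cmult_plus_distr_r.
    change (0 <= Im (u * cis (- m) * cis d) + Im (v * cis (- m) * cis d))%R. lra. }
  rewrite E in R1, R2, R3.
  replace (r * cis t * cis (- d)) with (r * cis (t + - d)) in R2 by (rewrite cis_plus; ring).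
  replace (r * cis t * cis d) with (r * cis (t + d)) in R3 by (rewrite cis_plus; ring).
  rewrite Re_polar in R1. rewrite Im_polar in R2, R3.
  assert (Pr' : (0 < r)%R) by (destruct Pr as [|Z]; [auto | rewrite <- Z in R1; lra]).
  assert (Ct : (0 < cos t)%R) by nra.
  assert (T1 : (- (PI / 2) < t < PI / 2)%R).
  { split; apply Rnot_le_lt; intros L.
    - assert (cos t <= 0)%R; [|lra]. rewrite <- cos_neg. apply cos_le_0; lra.
    - assert (cos t <= 0)%R; [|lra]. apply cos_le_0; lra. }
  assert (T2 : (t <= d)%R).
  { apply Rnot_lt_le. intros L.
    assert (0 < sin (t + - d))%R by (apply sin_gt_0; unfold d in *; lra). nra. }
  assert (T3 : (- d <= t)%R).
  { apply Rnot_lt_le. intros L.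
    assert (0 < sin (- (t + d)))%R by (apply sin_gt_0; unfold d in *; lra).
    rewrite sin_neg in H. nra. }
  exists r, (t + m)%R. split; auto. split; [unfold m, d in *; lra|].
  rewrite cis_plus, Cmult_assoc, <- E.
  rewrite <- Cmult_assoc, <- cis_plus. replace (- m + m)%R with 0%R by ring.
  rewrite cis_0. ring.
Qed.

Lemma polar_neq_0 (r t : R) : (0 < r)%R -> r * cis t <> 0.
Proof.
  intros H. apply Cmod_gt_0. rewrite Cmod_mult, Cmod_R, Cmod_cis, Rabs_pos_eq by lra. lra.
Qed.

Lemma Re_sector_quotient A B a s : (B - A < PI / 2)%R ->
  in_sector A B a -> in_sector A B (a * s) -> (0 < Re s)%R.
Proof.
  intros H [r [t [P [T E]]]] [r' [t' [P' [T' E']]]].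
  assert (Es : s = (r' / r)%R * cis (t' - t)).
  { assert (N : a <> 0) by (rewrite E; apply polar_neq_0; auto).
    replace s with (a * s / a) by (field; auto). rewrite E'.
    replace (r' * cis t') with (a * ((r' / r)%R * cis (t' - t))).
    - field. auto.
    - rewrite E, polar_mult. f_equal; f_equal; [field; lra | ring]. }
  rewrite Es, Re_polar. apply Rmult_lt_0_compat; [apply Rdiv_lt_0_compat; auto|].
  apply cos_gt_0; lra.
Qed.

Section AGM.
Variable F : C -> C.
Hypothesis HF : is_hyp2F1 (1 / 2) (1 / 2) 1 F.

(** For the pair [a], [b = a s], the step takes the mean [(a + b) / 2] and the root of [a b] at the
    mean argument, so both remain in the sector. Landen's formula carries the relation with [w] to
    the new pair, and [1 - s'^2 = ((1 - s) / (1 + s))^2] gives quadratic convergence. *)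
Lemma agm_step (A B : R) (w a s : C) : (A <= B)%R -> (B - A < PI / 2)%R ->
  in_sector A B a -> in_sector A B (a * s) -> (Cmod (1 - s * s) < 1)%R ->
  w * a = hF (1 - s * s) ->
  exists a' s', in_sector A B a' /\ in_sector A B (a' * s') /\
    (Cmod (1 - s' * s') <= Cmod (1 - s * s) * Cmod (1 - s * s))%R /\
    w * a' = hF (1 - s' * s').
Proof.
  intros HAB HB Ha Hb Hm Hw. pose proof PI_RGT_0.
  assert (Hs : (0 < Re s)%R) by (apply (Re_sector_quotient A B a s); auto).
  destruct (Cmod_cayley s Hs) as [N L].
  destruct Ha as [r [t [P [T E]]]]. destruct Hb as [r' [t' [P' [T' E']]]].
  assert (Na : a <> 0) by (rewrite E; apply polar_neq_0; auto).
  set (q := sqrt (r' / r) * cis ((t' - t) / 2)).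
  assert (Pq : (0 < r' / r)%R) by (apply Rdiv_lt_0_compat; auto).
  assert (Eq : q * q = s).
  { unfold q. rewrite polar_mult. rewrite sqrt_sqrt by lra.
    replace s with (a * s / a) by (field; auto). rewrite E'.
    replace (r' * cis t') with (a * ((r' / r)%R * cis ((t' - t) / 2 + (t' - t) / 2))).
    - field. auto.
    - rewrite E, polar_mult. f_equal; f_equal; field; lra. }
  set (a' := a * (1 + s) / 2). set (s' := 2 * q / (1 + s)).
  assert (Ss : 1 - s' * s' = (1 - s) / (1 + s) * ((1 - s) / (1 + s))).
  { unfold s'. rewrite <- Eq. rewrite <- Eq in N. field. auto. }
  exists a', s'. split; [|split; [|split]].
  - assert (K : in_sector A B (a + a * s)).
    { apply in_sector_plus; auto; [lra| |].
      - exists r, t. auto.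
      - exists r', t'. auto. }
    destruct K as [k [x [Pk [Tx Ek]]]]. exists (k / 2)%R, x. split; [lra|]. split; auto.
    unfold a'. replace (a * (1 + s)) with (a + a * s) by ring. rewrite Ek.
    rewrite RtoC_div by lra. field.
  - replace (a' * s') with (a * q) by (unfold a', s'; field; auto).
    exists (r * sqrt (r' / r))%R, ((t + t') / 2)%R. split; [|split].
    + apply Rmult_lt_0_compat; auto. apply sqrt_lt_R0; auto.
    + lra.
    + rewrite E. unfold q. rewrite polar_mult. f_equal. f_equal. field.
  - rewrite Ss, Cmod_mult.
    assert (K : (Cmod ((1 - s) / (1 + s)) <= Cmod (1 - s * s))%R).
    { replace (1 - s * s) with ((1 - s) / (1 + s) * ((1 + s) * (1 + s))) by (field; auto).
      rewrite (Cmod_mult ((1 - s) / (1 + s))), (Cmod_mult (1 + s)).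
      pose proof (Cmod_ge_0 ((1 - s) / (1 + s))).
      assert (1 <= Cmod (1 + s))%R.
      { pose proof (re_le_Cmod (1 + s)) as Q.
        change (Rabs (1 + Re s) <= Cmod (1 + s))%R in Q.
        pose proof (Rle_abs (1 + Re s)). lra. }
      assert (1 <= Cmod (1 + s) * Cmod (1 + s))%R by nra. nra. }
    pose proof (Cmod_ge_0 ((1 - s) / (1 + s))). nra.
  - rewrite Ss. unfold a'.
    replace (w * (a * (1 + s) / 2)) with ((w * a) * ((1 + s) / 2)) by field.
    rewrite Hw. rewrite <- (hyp2F1_disc F HF) by auto. rewrite (landen_sq F HF) by auto.
    field. auto.
Qed.

(** The iteration converges to [1 / w], so [1 / w] lies in the closed sector. *)
Lemma agm_limit (A B : R) (w a s : C) : (A <= B)%R -> (B - A < PI / 2)%R ->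
  in_sector A B a -> in_sector A B (a * s) -> (Cmod (1 - s * s) < 1)%R ->
  w * a = hF (1 - s * s) ->
  forall e, (0 < e)%R -> exists a', in_sector A B a' /\ (Cmod (w * a' - 1) < e)%R.
Proof.
  intros HAB HB Ha Hb Hm Hw e He.
  set (m := Cmod (1 - s * s)) in *. assert (Pm : (0 <= m)%R) by apply Cmod_ge_0.
  assert (It : forall n, exists a' s', in_sector A B a' /\ in_sector A B (a' * s') /\
    (Cmod (1 - s' * s') <= m ^ S n)%R /\ w * a' = hF (1 - s' * s')).
  { induction n as [|n [a' [s' [H1 [H2 [H3 H4]]]]]].
    - exists a, s. repeat split; auto. simpl. fold m. lra.
    - assert (0 <= m ^ S n)%R by (apply pow_le; auto).
      assert (m ^ S n <= m)%R.
      { simpl. assert (m ^ n <= 1)%R by (rewrite <- (pow1 n); apply pow_incr; lra).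
        assert (0 <= m ^ n)%R by (apply pow_le; auto). nra. }
      destruct (agm_step A B w a' s' HAB HB H1 H2) as [a2 [s2 [K1 [K2 [K3 K4]]]]]; auto.
      + lra.
      + exists a2, s2. repeat split; auto. eapply Rle_trans; [apply K3|].
        change (m ^ S (S n))%R with (m * m ^ S n)%R.
        pose proof (Cmod_ge_0 (1 - s' * s')). nra. }
  pose proof (CD_CC _ _ _ hF_CD_0 e He) as [d [Pd Hd]].
  assert (L : is_lim_seq (fun n => m ^ n)%R 0) by (apply is_lim_seq_geom; rewrite Rabs_pos_eq; auto).
  apply is_lim_seq_incr_1 in L. apply is_lim_seq_spec in L.
  destruct (L (mkposreal d Pd)) as [n Hn]. specialize (Hn n (Nat.le_refl _)).
  change (Rabs (m ^ S n - 0) < d)%R in Hn. destruct (It n) as [a' [s' [H1 [H2 [H3 H4]]]]].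
  exists a'. split; auto. rewrite H4. specialize (Hd (1 - s' * s')).
  rewrite hF_0 in Hd. apply Hd.
  replace (1 - s' * s' - 0) with (1 - s' * s') by ring.
  eapply Rle_lt_trans; [apply H3|].
  rewrite Rminus_0_r, Rabs_pos_eq in Hn; auto. apply pow_le; auto.
Qed.

(** Approximately [w / z] is [b / a] with [a] and [b] in the two sectors, so its argument lies
    between [A' - B] and [B' - A]. The bound [c = cos T] is uniform in the approximation, which
    keeps the inequality strict in the limit. *)
Lemma Re_quotient_pos (A B A' B' : R) (w z : C) :
  (- (PI / 2) < A' - B)%R -> (B' - A < PI / 2)%R ->
  (forall e, (0 < e)%R -> exists a, in_sector A B a /\ (Cmod (w * a - 1) < e)%R) ->
  (forall e, (0 < e)%R -> exists a, in_sector A' B' a /\ (Cmod (z * a - 1) < e)%R) ->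
  w <> 0 /\ z <> 0 /\ (0 < Re (w / z))%R.
Proof.
  intros L1 L2 Hw Hz.
  assert (NZ : forall (v : C) A B, (forall e, (0 < e)%R ->
     exists a, in_sector A B a /\ (Cmod (v * a - 1) < e)%R) -> v <> 0).
  { intros v A0 B0 H ->. destruct (H (1 / 2)%R ltac:(lra)) as [a [_ K]].
    replace (0 * a - 1) with (- (1)) in K by ring. rewrite Cmod_m1 in K. lra. }
  assert (Nw : w <> 0) by (eapply NZ; eauto). assert (Nz : z <> 0) by (eapply NZ; eauto).
  split; auto. split; auto.
  set (T := Rmax (B - A') (B' - A)). pose proof PI_RGT_0.
  assert (T1 : (T < PI / 2)%R) by (apply Rmax_lub_lt; lra).
  destruct (Hw 1%R ltac:(lra)) as [a1 [[_ [t1 [_ [Ht1 _]]]] _]].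
  destruct (Hz 1%R ltac:(lra)) as [a2 [[_ [t2 [_ [Ht2 _]]]] _]].
  assert (T0 : (0 <= T)%R).
  { pose proof (Rmax_l (B - A') (B' - A)). pose proof (Rmax_r (B - A') (B' - A)).
    unfold T. lra. }
  set (c := cos T). assert (Pc : (0 < c)%R) by (apply cos_gt_0; lra).
  assert (Pc1 : (c <= 1)%R) by apply COS_bound.
  (* The error of [b / a] against [X] is at most [4 * e = c / 4] times the modulus of [X]; hence
     [Re X] is at least half of [c] times that modulus. *)
  set (e := (c / 16)%R). assert (Pe : (0 < e)%R) by (unfold e; lra).
  destruct (Hw e Pe) as [a [[r [t [P [Ht E]]]] Ka]].
  destruct (Hz e Pe) as [b [[r' [t' [P' [Ht' E']]]] Kb]].
  set (X := w / z).
  assert (NX : X <> 0) by (unfold X; intros Q; apply Nw;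
    replace w with (w / z * z) by (field; auto); rewrite Q; ring).
  assert (Na : a <> 0) by (rewrite E; apply polar_neq_0; auto).
  set (u := w * a) in *. set (v := z * b) in *.
  assert (Nu : u <> 0) by (apply Cmult_neq_0; auto).
  assert (Q : b / a = X * (v / u)) by (unfold X, u, v; field; auto).
  assert (Qp : b / a = (r' / r)%R * cis (t' - t)).
  { replace b with (a * ((r' / r)%R * cis (t' - t))); [field; auto|].
    rewrite E, E', polar_mult. f_equal; f_equal; [field; lra | ring]. }
  assert (Prr : (0 < r' / r)%R) by (apply Rdiv_lt_0_compat; auto).
  assert (Cb : (Cmod (b / a) = r' / r)%R).
  { rewrite Qp, Cmod_mult, Cmod_R, Cmod_cis, Rabs_pos_eq by lra. ring. }
  assert (Cc : (c <= cos (t' - t))%R).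
  { unfold c. destruct (Rle_dec 0 (t' - t)).
    - apply cos_decr_1; try lra. unfold T.
      pose proof (Rmax_r (B - A') (B' - A)). lra.
    - rewrite <- (cos_neg (t' - t)). apply cos_decr_1; try lra; unfold T;
      pose proof (Rmax_l (B - A') (B' - A)); lra. }
  assert (Re1 : (c * Cmod (b / a) <= Re (b / a))%R).
  { rewrite Cb, Qp, Re_polar. nra. }
  assert (Mu : (1 / 2 <= Cmod u)%R).
  { pose proof (Cmod_triangle_rev 1 (1 - u)) as Z. rewrite Cmod_1 in Z.
    replace (1 - (1 - u)) with u in Z by ring. rewrite (Cmod_minus_sym 1 u) in Z.
    unfold e in Ka. lra. }
  assert (D : (Cmod (b / a - X) <= Cmod X * (4 * e))%R).
  { rewrite Q. replace (X * (v / u) - X) with (X * ((v - 1 - (u - 1)) / u)) by (field; auto).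
    rewrite Cmod_mult. apply Rmult_le_compat_l; [apply Cmod_ge_0|].
    rewrite Cmod_div by auto. apply Rle_div_l; [lra|].
    eapply Rle_trans; [apply Cmod_triangle_minus|]. nra. }
  assert (PX : (0 < Cmod X)%R) by (apply Cmod_gt_0; auto).
  assert (M1 : (Cmod X - Cmod X * (4 * e) <= Cmod (b / a))%R).
  { pose proof (Cmod_triangle_rev X (b / a)) as Z. rewrite Cmod_minus_sym in Z. lra. }
  assert (M2 : (Re (b / a) - Cmod X * (4 * e) <= Re X)%R).
  { pose proof (re_le_Cmod (b / a - X)) as Z.
    change (Rabs (Re (b / a) - Re X) <= Cmod (b / a - X))%R in Z.
    pose proof (Rle_abs (Re (b / a) - Re X)). lra. }
  assert (M3 : (c * (Cmod X - Cmod X * (4 * e)) <= c * Cmod (b / a))%R)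
    by (apply Rmult_le_compat_l; lra).
  unfold e in *. assert (0 < Cmod X * c)%R by (apply Rmult_lt_0_compat; auto).
  assert (Cmod X * c * c <= Cmod X * c * 1)%R by (apply Rmult_le_compat_l; lra).
  lra.
Qed.

(** Adding 1 strictly lowers the argument. The strictness is what keeps the total angle in
    [hG_hF_pos_upper] below [PI / 2]. *)
Lemma in_sector_strict (r t : R) (v : C) : (0 < r)%R -> (0 < t <= PI / 2)%R -> v = r * cis t ->
  exists s u, (0 < s)%R /\ (0 <= u < t)%R /\ 1 + v = s * cis u.
Proof.
  intros Hr Ht Hv. pose proof PI_RGT_0.
  assert (S : in_sector 0 t (1 + v)).
  { apply in_sector_plus; try lra.
    - exists 1%R, 0%R. rewrite cis_0. repeat split; try lra. ring.
    - exists r, t. repeat split; auto; lra. }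
  destruct S as [s [u [Ps [Tu Eu]]]]. exists s, u. split; auto. split; auto.
  split; [lra|]. destruct (Req_dec u t) as [->|]; [|lra]. exfalso.
  assert (Z : Im ((1 + v) * cis (- t)) = 0%R).
  { rewrite Eu. replace (s * cis t * cis (- t)) with (s * cis (t + - t))
      by (rewrite cis_plus; ring).
    rewrite Im_polar. replace (t + - t)%R with 0%R by ring. rewrite sin_0. ring. }
  rewrite Hv in Z. replace ((1 + r * cis t) * cis (- t)) with (cis (- t) + r * cis (t + - t)) in Z
    by (rewrite cis_plus; ring).
  replace (t + - t)%R with 0%R in Z by ring. rewrite cis_0 in Z.
  assert (sin (- t) = 0%R).
  { unfold cis, Im, Cplus, Cmult, RtoC in Z; simpl in Z. lra. }
  rewrite sin_neg in H0. assert (0 < sin t)%R by (apply sin_gt_0; lra). lra.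
Qed.

Lemma hG_conj (r : C) : 1 + r <> 0 -> hG (Cconj r) = Cconj (hG r).
Proof.
  intros N. unfold hG.
  assert (C1 : Cconj 1 = 1) by (apply C_ext; unfold Re, Im, Cconj, RtoC; simpl; ring).
  assert (C4 : Cconj 4 = 4) by (apply C_ext; unfold Re, Im, Cconj, RtoC; simpl; ring).
  rewrite Cmult_conj, <- hF_conj, Cpow_conj, !Cdiv_conj, Cmult_conj, Cplus_conj, Cminus_conj, C1, C4;
  auto. apply Cmult_neq_0; auto.
Qed.

(** Here [1 / hG r] is the arithmetic-geometric mean of 1 and [r^2], and [1 / hF (r^4)] that of 1
    and the square root of [1 - r^4]. The first lies in a sector from 0 to some [B], with
    [B < 2 phi] when [phi > 0], the second in a sector from [- psi] to 0, and [2 phi + psi] is at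
    most [PI / 2]. *)
Lemma hG_hF_pos_upper (rho phi : R) : (0 < rho < 1)%R -> (0 <= phi <= PI / 4)%R ->
  hG (rho * cis phi) <> 0 /\ hF ((rho * cis phi) ^ 4) <> 0 /\
  (0 < Re (hG (rho * cis phi) / hF ((rho * cis phi) ^ 4)))%R.
Proof.
  intros Hr Hp. pose proof PI_RGT_0 as Ppi.
  set (r := rho * cis phi).
  assert (Er2 : r * r = (rho * rho)%R * cis (2 * phi)).
  { unfold r. rewrite polar_mult. f_equal. f_equal. ring. }
  assert (Er4 : r ^ 4 = (rho * rho * (rho * rho))%R * cis (4 * phi)).
  { replace (r ^ 4) with ((r * r) * (r * r)) by ring. rewrite Er2, polar_mult.
    f_equal. f_equal. ring. }
  set (R4 := (rho * rho * (rho * rho))%R) in *.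
  assert (HR4 : (0 < R4 < 1)%R) by (unfold R4; split; [repeat apply Rmult_lt_0_compat; lra|];
    assert (0 < rho * rho < 1)%R by nra; nra).
  assert (Hre : (0 < Re r)%R).
  { unfold r. rewrite Re_polar. apply Rmult_lt_0_compat; [lra|]. apply cos_gt_0; lra. }
  destruct (Cmod_cayley r Hre) as [N L].
  assert (SB : exists s u s2 u2 B, (0 < s)%R /\ (0 < s2)%R /\
    1 + r = s * cis u /\ 1 + r * r = s2 * cis u2 /\
    (0 <= 2 * u <= B)%R /\ (0 <= (phi + u2) / 2 <= B)%R /\ (B <= 2 * phi)%R /\
    (0 < phi -> B < 2 * phi)%R).
  { destruct (Req_dec phi 0) as [Z|NZ].
    - exists (1 + rho)%R, 0%R, (1 + rho * rho)%R, 0%R, 0%R.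
      rewrite Er2. unfold r. rewrite Z. replace (2 * 0)%R with 0%R by ring.
      rewrite cis_0, !RtoC_plus. repeat split; try nra; ring.
    - destruct (in_sector_strict rho phi r) as [s [u [Ps [Tu Eu]]]]; auto; try lra.
      destruct (in_sector_strict (rho * rho) (2 * phi) (r * r)) as [s2 [u2 [Ps2 [Tu2 Eu2]]]];
        auto; try nra.
      exists s, u, s2, u2, (Rmax (2 * u) ((phi + u2) / 2)).
      pose proof (Rmax_l (2 * u) ((phi + u2) / 2)).
      pose proof (Rmax_r (2 * u) ((phi + u2) / 2)).
      assert (Rmax (2 * u) ((phi + u2) / 2) < 2 * phi)%R by (apply Rmax_lub_lt; lra).
      repeat split; auto; lra. }
  destruct SB as [s [u [s2 [u2 [B [Ps [Ps2 [E1 [E2 [B1 [B2 [B3 B4]]]]]]]]]]]].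
  (* In the triangle with vertices 0, 1 and [r^4] the angle at 0 is [4 phi] and the angle at 1 is
     [2 psi]; their sum is at most [PI]. *)
  assert (PSI : exists rho1 psi, (0 < rho1)%R /\ (0 <= psi < PI / 4)%R /\
     1 - r ^ 4 = rho1 * cis (- (2 * psi)) /\ (4 * phi + 2 * psi <= PI)%R).
  { destruct (polar_form (1 - r ^ 4)) as [r1 [t [Pr1 [Ht [E [_ Hneg]]]]]].
    assert (ReP : (0 < Re (1 - r ^ 4))%R).
    { pose proof (re_le_Cmod (r ^ 4)) as Q.
      assert (M4 : Cmod (r ^ 4) = R4)
        by (rewrite Er4, Cmod_mult, Cmod_R, Cmod_cis, Rabs_pos_eq by lra; ring).
      rewrite M4 in Q. pose proof (Rle_abs (Re (r ^ 4))).
      change (0 < 1 - Re (r ^ 4))%R. lra. }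
    assert (ImP : Im (1 - r ^ 4) = (- (R4 * sin (4 * phi)))%R).
    { rewrite Er4. rewrite <- Im_polar. unfold Im, Cminus, Cplus, Copp, RtoC; simpl. ring. }
    assert (S4 : (0 <= sin (4 * phi))%R) by (apply sin_ge_0; lra).
    rewrite E, Re_polar in ReP.
    assert (Pr1' : (0 < r1)%R) by (destruct Pr1 as [|Z]; [auto | rewrite <- Z in ReP; lra]).
    assert (Ct : (0 < cos t)%R) by nra.
    assert (T1 : (- (PI / 2) < t < PI / 2)%R).
    { split; apply Rnot_le_lt; intros Lt.
      - assert (cos t <= 0)%R; [|lra]. rewrite <- cos_neg. apply cos_le_0; lra.
      - assert (cos t <= 0)%R; [|lra]. apply cos_le_0; lra. }
    rewrite E, Im_polar in ImP.
    assert (T2 : (t <= 0)%R).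
    { apply Rnot_lt_le. intros Lt. assert (0 < sin t)%R by (apply sin_gt_0; lra).
      assert (0 < r1 * sin t)%R by (apply Rmult_lt_0_compat; auto). nra. }
    exists r1, (- t / 2)%R. split; auto. split; [lra|]. split.
    - rewrite E. f_equal. f_equal. field.
    - replace (2 * (- t / 2))%R with (- t)%R by field.
      apply Rnot_lt_le. intros Lt.
      assert (Q : Im ((1 - r ^ 4) * cis (PI - 4 * phi)) = sin (4 * phi)).
      { rewrite Er4. replace ((1 - R4 * cis (4 * phi)) * cis (PI - 4 * phi))
          with (cis (PI - 4 * phi) - R4 * cis (4 * phi + (PI - 4 * phi)))
          by (rewrite cis_plus; ring).
        replace (4 * phi + (PI - 4 * phi))%R with PI by ring.
        unfold cis at 2. rewrite cos_PI, sin_PI.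
        unfold Im, cis, Cminus, Cplus, Copp, Cmult, RtoC; simpl.
        rewrite sin_minus, sin_PI, cos_PI. ring. }
      rewrite E in Q. replace (r1 * cis t * cis (PI - 4 * phi))
        with (r1 * cis (t + (PI - 4 * phi))) in Q by (rewrite cis_plus; ring).
      rewrite Im_polar in Q.
      assert (0 < sin (- (t + (PI - 4 * phi))))%R by (apply sin_gt_0; lra).
      rewrite sin_neg in H. nra. }
  destruct PSI as [rho1 [psi [Pr1 [Hpsi [E3 Hsum]]]]].
  apply (Re_quotient_pos 0 B (- psi) 0).
  - destruct (Req_dec phi 0) as [Z|NZ]; [|assert (B < 2 * phi)%R by (apply B4; lra)]; lra.
  - lra.
  (* The second iterates of the mean of 1 and [r^2]. Starting so late makes [1 - s^2] equal to
     [((1 - r) / (1 + r))^4], inside the disc as [agm_limit] demands, and puts both arguments at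
     most [B]. *)
  - set (a0 := (s * s / 4)%R * cis (2 * u)).
    set (b0 := sqrt (rho * s2 / 2) * cis ((phi + u2) / 2)).
    assert (Ps4 : (0 < s * s / 4)%R) by nra.
    assert (Prs : (0 < rho * s2 / 2)%R) by (assert (0 < rho * s2)%R by nra; lra).
    assert (Na0 : a0 <> 0) by (apply polar_neq_0; auto).
    assert (Ea0 : a0 = (1 + r) * (1 + r) / 4).
    { rewrite E1, polar_mult. unfold a0. rewrite RtoC_div by lra.
      replace (u + u)%R with (2 * u)%R by ring. field. }
    assert (Eb0 : b0 * b0 = r * (1 + r * r) / 2).
    { unfold b0. rewrite polar_mult, sqrt_sqrt by lra. rewrite E2. unfold r.
      rewrite polar_mult. rewrite RtoC_div by lra.
      replace ((phi + u2) / 2 + (phi + u2) / 2)%R with (phi + u2)%R by field. field. }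
    assert (Es : 1 - b0 / a0 * (b0 / a0) = ((1 - r) / (1 + r)) ^ 4).
    { replace (b0 / a0 * (b0 / a0)) with (b0 * b0 / (a0 * a0)) by (field; auto).
      rewrite Eb0, Ea0. field. auto. }
    apply (agm_limit 0 B (hG r) a0 (b0 / a0)).
    + lra.
    + destruct (Req_dec phi 0) as [Z|NZ]; [|assert (B < 2 * phi)%R by (apply B4; lra)]; lra.
    + exists (s * s / 4)%R, (2 * u)%R. repeat split; auto; lra.
    + replace (a0 * (b0 / a0)) with b0 by (field; auto).
      exists (sqrt (rho * s2 / 2)), ((phi + u2) / 2)%R. repeat split; try lra.
      apply sqrt_lt_R0; auto.
    + rewrite Es, Cmod_pow.
      pose proof (Cmod_ge_0 ((1 - r) / (1 + r))) as Q.
      set (X := Cmod ((1 - r) / (1 + r))) in *. clearbody X.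
      replace (X ^ 4)%R with (X * X * (X * X))%R by ring.
      assert (0 <= X * X < 1)%R by nra. nra.
    + rewrite Es. unfold hG. rewrite Ea0. field. auto.
  - set (sq := sqrt rho1 * cis (- psi)).
    assert (Esq : sq * sq = 1 - r ^ 4).
    { unfold sq. rewrite polar_mult, sqrt_sqrt, E3 by lra. f_equal. f_equal. ring. }
    apply (agm_limit (- psi) 0 (hF (r ^ 4)) 1 sq).
    + lra.
    + lra.
    + exists 1%R, 0%R. rewrite cis_0. repeat split; try lra. ring.
    + replace (1 * sq) with sq by ring. exists (sqrt rho1), (- psi)%R.
      repeat split; try lra. apply sqrt_lt_R0; auto.
    + rewrite Esq. replace (1 - (1 - r ^ 4)) with (r ^ 4) by ring. rewrite Er4.
      rewrite Cmod_mult, Cmod_R, Cmod_cis, Rabs_pos_eq by lra. lra.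
    + rewrite Esq. replace (1 - (1 - r ^ 4)) with (r ^ 4) by ring. ring.
Qed.

Lemma cis_conj t : Cconj (cis t) = cis (- t).
Proof. unfold cis, Cconj; simpl. rewrite cos_neg, sin_neg. reflexivity. Qed.

Lemma polar_conj (r t : R) : Cconj (r * cis t) = r * cis (- t).
Proof.
  rewrite Cmult_conj, cis_conj. f_equal. apply C_ext; unfold Re, Im, Cconj, RtoC; simpl; ring.
Qed.

Lemma hG_hF_pos (rho phi : R) : (0 < rho < 1)%R -> (- (PI / 4) <= phi <= PI / 4)%R ->
  hF ((rho * cis phi) ^ 4) <> 0 /\
  (0 < Re (hG (rho * cis phi) / hF ((rho * cis phi) ^ 4)))%R.
Proof.
  intros Hr Hp. pose proof PI_RGT_0.
  destruct (Rle_dec 0 phi) as [L|L]; [apply hG_hF_pos_upper; lra|].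
  destruct (hG_hF_pos_upper rho (- phi) Hr) as [N1 [N2 P]]; [lra|].
  rewrite <- polar_conj in N1, N2, P. set (r := rho * cis phi) in *.
  assert (N : 1 + r <> 0).
  { apply one_plus_neq_0. unfold r. rewrite Cmod_mult, Cmod_R, Cmod_cis, Rabs_pos_eq by lra. lra. }
  rewrite <- Cpow_conj, hF_conj in N2, P. rewrite hG_conj in P by auto.
  assert (N3 : hF (r ^ 4) <> 0).
  { intros E. apply N2. rewrite E. apply C_ext; unfold Re, Im, Cconj, RtoC; simpl; ring. }
  split; auto. rewrite <- Cdiv_conj in P by auto. exact P.
Qed.

End AGM.

(** * Values on the branch cut *)

Lemma hG_CD_ex (r : C) : (0 < Re r)%R -> exists l, CD hG r l.
Proof.
  intros Hr. destruct (Cmod_cayley r Hr) as [N L].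
  assert (L4 : (Cmod (((1 - r) / (1 + r)) ^ 4) < 1)%R).
  { rewrite Cmod_pow. pose proof (Cmod_ge_0 ((1 - r) / (1 + r))) as Q.
    set (X := Cmod ((1 - r) / (1 + r))) in *. clearbody X.
    replace (X ^ 4)%R with (X * X * (X * X))%R by ring.
    assert (0 <= X * X < 1)%R by nra. nra. }
  destruct (hF_CD_ex _ L4) as [l [Hl _]].
  eexists. unfold hG. cd.
  - apply Cmult_neq_0; auto.
  - apply (CD_comp (fun r => ((1 - r) / (1 + r)) ^ 4) hF); [cd; auto | apply Hl].
Qed.

Lemma CC_cis_scaled (rho t : R) (f : C -> C) : CC f (rho * cis t) ->
  forall (tn : nat -> R), is_lim_seq tn t -> Clim (fun n => f (rho * cis (tn n))) (f (rho * cis t)).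
Proof.
  intros H tn Ht.
  apply Clim_CC; auto. apply Clim_scal. apply Clim_of_Re_Im.
  - apply (is_lim_seq_continuous cos tn t); auto. apply continuity_cos.
  - apply (is_lim_seq_continuous sin tn t); auto. apply continuity_sin.
Qed.

Section PrincipalValue.
Variable F : C -> C.
Hypothesis HF : is_hyp2F1 (1 / 2) (1 / 2) 1 F.

Lemma polar_pow4 (rho phi : R) :
  (rho * cis phi) ^ 4 = (rho * rho * (rho * rho))%R * cis (4 * phi).
Proof.
  replace ((rho * cis phi) ^ 4)
    with (((rho * cis phi) * (rho * cis phi)) * ((rho * cis phi) * (rho * cis phi))) by ring.
  rewrite !polar_mult. f_equal. f_equal. ring.
Qed.

Lemma fourth_root (a : R) : (0 < a < 1)%R ->
  exists rho, (0 < rho < 1)%R /\ (rho * rho * (rho * rho) = a)%R.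
Proof.
  intros Ha. exists (sqrt (sqrt a)).
  assert (0 < sqrt a)%R by (apply sqrt_lt_R0; lra).
  assert (0 < sqrt (sqrt a))%R by (apply sqrt_lt_R0; auto).
  assert (E1 : (sqrt a * sqrt a = a)%R) by (apply sqrt_sqrt; lra).
  assert (E2 : (sqrt (sqrt a) * sqrt (sqrt a) = sqrt a)%R) by (apply sqrt_sqrt; lra).
  split; [|rewrite E2; auto]. assert (sqrt a < 1)%R by nra. nra.
Qed.

Lemma F_hG (rho phi : R) : (0 < rho)%R -> (- (PI / 4) < phi < PI / 4)%R ->
  F (1 - (rho * cis phi) ^ 4) = hG (rho * cis phi).
Proof.
  intros Hr Hp. rewrite <- (landen_twice F HF).
  - f_equal. ring.
  - rewrite Re_polar. apply Rmult_lt_0_compat; auto. apply cos_gt_0; lra.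
  - rewrite polar_mult, Re_polar. apply Rmult_lt_0_compat; [nra|]. apply cos_gt_0; lra.
Qed.

(** On the cut, [w] is the limit of [F] along the curve [1 - r^4], where [r] tends to
    [rho * cis phi] with [phi = -pi/4] from above or [phi = pi/4] from below. *)
Lemma boundary_value_hG (rho phi : R) (tn : nat -> R) (P : C -> Prop) (w : C) :
  (0 < rho)%R -> (- (PI / 2) < phi < PI / 2)%R -> is_lim_seq tn phi ->
  (forall n, (- (PI / 4) < tn n < PI / 4)%R) ->
  (forall n, P (1 - (rho * cis (tn n)) ^ 4)) ->
  filterlim F (within P (locally (1 - (rho * cis phi) ^ 4))) (locally w) ->
  w = hG (rho * cis phi).
Proof.
  intros Hr Hp Ht Hin HP Hlim.
  assert (Hre : (0 < Re (rho * cis phi))%R).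
  { rewrite Re_polar. apply Rmult_lt_0_compat; auto. apply cos_gt_0; lra. }
  destruct (hG_CD_ex _ Hre) as [l Hl].
  pose proof (CC_cis_scaled rho phi hG (CD_CC _ _ _ Hl) tn Ht) as L1.
  assert (L2 : Clim (fun n => 1 - (rho * cis (tn n)) ^ 4) (1 - (rho * cis phi) ^ 4)).
  { apply (CC_cis_scaled rho phi (fun r => 1 - r ^ 4)); auto.
    eapply CD_CC. cd. }
  assert (L3 : Clim (fun n => F (1 - (rho * cis (tn n)) ^ 4)) w).
  { apply Clim_spec. intros e He.
    assert (Loc : locally w (fun v : C => (Cmod (v - w) < e)%R)).
    { apply (locally_le_locally_norm (V := C_NormedModule)).
      exists (mkposreal e He). intros v Hv. exact Hv. }
    specialize (Hlim _ Loc). unfold filtermap, within in Hlim.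
    apply (locally_norm_le_locally (V := C_NormedModule)) in Hlim.
    destruct Hlim as [d Hd]. rewrite Clim_spec in L2.
    destruct (L2 d (cond_pos d)) as [N HN]. exists N. intros n Hn.
    apply Hd; auto. exact (HN n Hn). }
  apply (Clim_unique _ _ _ L3).
  eapply Clim_ext; [|apply L1]. intros n. cbv beta. symmetry. apply F_hG; auto.
Qed.

(** The choice of a boundary value becomes the choice of a fourth root. For negative [x] the upper
    value belongs to the root with argument [- (PI / 4)] and the lower one to the root with argument
    [PI / 4]; otherwise the principal root is taken. *)
Lemma principal_value_hG (x w : C) : (0 < Cmod x)%R -> (Cmod x < 1)%R ->
  principal_value F (1 - x) w ->
  exists rho phi, (0 < rho < 1)%R /\ (- (PI / 4) <= phi <= PI / 4)%R /\
    x = (rho * cis phi) ^ 4 /\ w = hG (rho * cis phi).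
Proof.
  intros H0 H1 Hw. pose proof PI_RGT_0.
  destruct (polar_form x) as [a [t [Pa [Ht [E _]]]]].
  assert (Ea : Cmod x = a).
  { rewrite E, Cmod_mult, Cmod_R, Cmod_cis, Rabs_pos_eq by auto. ring. }
  destruct (fourth_root a ltac:(lra)) as [rho [Hr Er]].
  assert (Ex : x = (rho * cis (t / 4)) ^ 4).
  { rewrite polar_pow4, Er. rewrite E. f_equal. f_equal. field. }
  destruct (Req_dec t PI) as [Et|Nt].
  - assert (Cut : ~ off_cut (1 - x)).
    { intros K. apply K. rewrite E, Et. unfold cis. rewrite cos_PI, sin_PI.
      unfold Re, Im, Cminus, Cplus, Copp, Cmult, RtoC; simpl. lra. }
    destruct Hw as [[K _]|[_ Hw]]; [contradiction|].
    set (dn := fun n => (PI / 4 * / (INR n + 2))%R).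
    assert (Hdn : forall n, (0 < dn n < PI / 4)%R).
    { intros n. unfold dn. pose proof (pos_INR n).
      assert (0 < / (INR n + 2))%R by (apply Rinv_0_lt_compat; lra).
      assert (/ (INR n + 2) < 1)%R by (rewrite <- Rinv_1; apply Rinv_lt_contravar; lra). nra. }
    assert (Ldn : is_lim_seq dn 0).
    { unfold dn. replace (Finite 0) with (Rbar_mult (PI / 4)%R 0) by (simpl; f_equal; ring).
      apply is_lim_seq_scal_l. replace (Finite 0) with (Rbar_inv p_infty) by reflexivity.
      apply is_lim_seq_inv; [|discriminate].
      eapply is_lim_seq_plus; [apply is_lim_seq_INR | apply is_lim_seq_const | reflexivity]. }
    assert (ImP : forall u, Im (1 - (rho * cis u) ^ 4) = (- (a * sin (4 * u)))%R).
    { intros u. rewrite polar_pow4, Er. rewrite <- Im_polar.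
      unfold Im, Cminus, Cplus, Copp, RtoC; simpl. ring. }
    assert (Ex' : x = (rho * cis (- (PI / 4))) ^ 4).
    { rewrite polar_pow4, Er, E, Et. f_equal. unfold cis.
      replace (4 * - (PI / 4))%R with (- PI)%R by field.
      rewrite cos_neg, sin_neg, sin_PI. f_equal. ring. }
    destruct Hw as [Hw|Hw].
    + exists rho, (- (PI / 4))%R. split; auto. split; [lra|]. split; auto.
      apply (boundary_value_hG rho (- (PI / 4)) (fun n => - (PI / 4) + dn n)%R
        (fun v => (0 < Im v)%R)); try lra.
      * replace (- (PI / 4))%R with (- (PI / 4) + 0)%R at 1 by ring.
        apply is_lim_seq_plus'; auto. apply is_lim_seq_const.
      * intros n. specialize (Hdn n). lra.
      * intros n. specialize (Hdn n). rewrite ImP.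
        replace (4 * (- (PI / 4) + dn n))%R with (- (PI - 4 * dn n))%R by field.
        rewrite sin_neg. assert (0 < sin (PI - 4 * dn n))%R by (apply sin_gt_0; lra). nra.
      * rewrite <- Ex'. exact Hw.
    + exists rho, (PI / 4)%R. rewrite Et in Ex. split; auto. split; [lra|]. split; auto.
      apply (boundary_value_hG rho (PI / 4) (fun n => PI / 4 - dn n)%R
        (fun v => (Im v < 0)%R)); try lra.
      * replace (PI / 4)%R with (PI / 4 - 0)%R at 1 by ring.
        apply is_lim_seq_minus'; auto. apply is_lim_seq_const.
      * intros n. specialize (Hdn n). lra.
      * intros n. specialize (Hdn n). rewrite ImP.
        replace (4 * (PI / 4 - dn n))%R with (PI - 4 * dn n)%R by field.
        assert (0 < sin (PI - 4 * dn n))%R by (apply sin_gt_0; lra). nra.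
      * rewrite <- Ex. exact Hw.
  - assert (Hoff : off_cut (1 - x)).
    { intros [K1 K2]. rewrite E in K1, K2.
      assert (S : (a * sin t = 0)%R).
      { rewrite <- Im_polar. unfold Im, Cminus, Cplus, Copp, RtoC in *; simpl in *. lra. }
      assert (Co : (a * cos t <= 0)%R).
      { rewrite <- Re_polar. unfold Re, Cminus, Cplus, Copp, RtoC in *; simpl in *. lra. }
      assert (S0 : sin t = 0%R) by nra.
      assert (C0 : (cos t <= 0)%R) by nra.
      destruct (Rtotal_order t 0) as [L|[L|L]].
      - assert (0 < sin (- t))%R by (apply sin_gt_0; lra). rewrite sin_neg in H2. lra.
      - rewrite L, cos_0 in C0. lra.
      - assert (0 < sin t)%R by (apply sin_gt_0; lra). lra. }
    destruct Hw as [[_ Hw]|[K _]]; [|contradiction].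
    exists rho, (t / 4)%R. split; auto. split; [lra|]. split; auto.
    rewrite Hw, Ex. apply F_hG; lra.
Qed.

End PrincipalValue.

(** * The nome *)

Definition half_disc (r : C) : Prop := (0 < Re r)%R /\ (Cmod r < 1)%R.

Definition hv (r : C) : C := ((1 - r) / (1 + r)) ^ 4.

(** [hN r = x (1 - x) dw/dx] for [w = hG r] and [x = r^4]. *)
Definition hN (r : C) : C :=
  - (2 * r * (1 - r) * (1 + r * r) / ((1 + r) * (1 + r))) * hF (hv r)
  - (1 + r) * (1 + r) * hM (hv r).

Lemma half_disc_facts r : half_disc r ->
  r <> 0 /\ 1 + r <> 0 /\ 1 - r <> 0 /\ 1 + r * r <> 0 /\ 1 - r ^ 4 <> 0 /\
  hv r <> 0 /\ (Cmod (hv r) < 1)%R /\ (Cmod (r ^ 4) < 1)%R /\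
  1 - hv r = 8 * r * (1 + r * r) / (1 + r) ^ 4.
Proof.
  intros [H1 H2].
  assert (N0 : r <> 0) by (apply C_neq_Re; unfold RtoC; simpl; lra).
  pose proof (one_plus_neq_0 r H2) as N1. pose proof (one_minus_neq_0 r H2) as N2.
  pose proof (one_plus_neq_0 (r * r) (Cmod_sq_lt_1 r H2)) as N3.
  destruct (Cmod_cayley r H1) as [_ L].
  repeat split; auto.
  - replace (1 - r ^ 4) with ((1 - r) * (1 + r) * (1 + r * r)) by ring.
    repeat apply Cmult_neq_0; auto.
  - unfold hv. apply Cpow_nz. apply Cmult_neq_0; auto. apply Cmod_gt_0.
    rewrite Cmod_inv by auto. apply Rinv_0_lt_compat, Cmod_gt_0; auto.
  - unfold hv. replace (((1 - r) / (1 + r)) ^ 4) with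
      (((1 - r) / (1 + r) * ((1 - r) / (1 + r))) * ((1 - r) / (1 + r) * ((1 - r) / (1 + r)))) by ring.
    apply Cmod_sq_lt_1, Cmod_sq_lt_1; auto.
  - replace (r ^ 4) with ((r * r) * (r * r)) by ring. apply Cmod_sq_lt_1, Cmod_sq_lt_1; auto.
  - unfold hv. field. auto.
Qed.

Lemma hv_CD r : half_disc r -> CD hv r (- (8 * (1 - r) ^ 3 / (1 + r) ^ 5)).
Proof.
  intros H. destruct (half_disc_facts r H) as [N0 [N1 _]].
  unfold hv. eapply CD_eq; [cd; auto|]. cbv beta. simpl INR.
  replace (1 + 1 + 1 + 1)%R with 4%R by ring. simpl Nat.sub. field. auto.
Qed.

Lemma hG_CD r : half_disc r -> CD hG r (4 * hN r / (r * (1 - r ^ 4))).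
Proof.
  intros H. destruct (half_disc_facts r H) as [N0 [N1 [N2 [N3 [N4 [N5 [L1 [L2 E]]]]]]]].
  unfold hG. eapply CD_eq.
  - cd; [apply Cmult_neq_0; auto|].
    apply (CD_comp hv hF); [apply hv_CD; auto | apply hF_CD; auto].
  - cbv beta. fold (hv r). rewrite E. unfold hN.
    set (X := hF (hv r)). set (Y := hM (hv r)). unfold hv.
    replace (1 - r ^ 4) with ((1 - r) * (1 + r) * (1 + r * r)) by ring.
    field. repeat split; auto.
Qed.

Lemma hN_CD r : half_disc r -> CD hN r (r ^ 3 * hG r).
Proof.
  intros H. destruct (half_disc_facts r H) as [N0 [N1 [N2 [N3 [N4 [N5 [L1 [L2 E]]]]]]]].
  unfold hN. eapply CD_eq.
  - cd; try (apply Cmult_neq_0; auto).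
    + apply (CD_comp hv hF); [apply hv_CD; auto | apply hF_CD; auto].
    + apply (CD_comp hv hM); [apply hv_CD; auto | apply hM_CD; auto].
  - cbv beta. rewrite E. unfold hG. fold (hv r).
    set (X := hF (hv r)). set (Y := hM (hv r)). unfold hv.
    field. repeat split; auto.
Qed.

Lemma hF4_CD r : half_disc r -> CD (fun r => hF (r ^ 4)) r (4 * hM (r ^ 4) / (r * (1 - r ^ 4))).
Proof.
  intros H. destruct (half_disc_facts r H) as [N0 [N1 [N2 [N3 [N4 [N5 [L1 [L2 E]]]]]]]].
  eapply CD_eq.
  - apply (CD_comp (fun r => r ^ 4) hF); [cd|]. apply hF_CD; auto. apply Cpow_nz; auto.
  - cbv beta. simpl INR. replace (1 + 1 + 1 + 1)%R with 4%R by ring. simpl Nat.sub. field. auto.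
Qed.

Lemma hM4_CD r : half_disc r -> CD (fun r => hM (r ^ 4)) r (r ^ 3 * hF (r ^ 4)).
Proof.
  intros H. destruct (half_disc_facts r H) as [N0 [N1 [N2 [N3 [N4 [N5 [L1 [L2 E]]]]]]]].
  eapply CD_eq.
  - apply (CD_comp (fun r => r ^ 4) hM); [cd|]. apply hM_CD; auto.
  - cbv beta. simpl INR. replace (1 + 1 + 1 + 1)%R with 4%R by ring. simpl Nat.sub. field.
Qed.

Lemma half_disc_segment r s t : half_disc r -> half_disc s -> (0 <= t <= 1)%R ->
  half_disc (r + t * (s - r)).
Proof.
  intros [R1 R2] [S1 S2] Ht. split.
  - change (0 < Re r + Re (t * (s - r)))%R. rewrite re_scal_l.
    change (0 < Re r + t * (Re s - Re r))%R.
    assert (0 <= (1 - t) * Re r)%R by (apply Rmult_le_pos; lra).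
    destruct (Req_dec t 0) as [->|]; [lra|].
    assert (0 < t * Re s)%R by (apply Rmult_lt_0_compat; lra). lra.
  - replace (r + t * (s - r)) with ((1 - t)%R * r + t * s) by (rewrite RtoC_minus; ring).
    eapply Rle_lt_trans; [apply Cmod_triangle|]. rewrite !Cmod_mult, !Cmod_R.
    rewrite !Rabs_pos_eq by lra.
    assert (0 <= (1 - t) * (1 - Cmod r))%R by (apply Rmult_le_pos; lra).
    destruct (Req_dec t 0) as [->|]; [lra|].
    assert (0 < t * (1 - Cmod s))%R by (apply Rmult_lt_0_compat; lra). lra.
Qed.

(** In terms of [x = r^4], [z = hF x] and [w = hG r] this is [x (1 - x) (w z' - z w')], constant
    because both functions solve the same equation. *)
Definition hW (r : C) : C := hG r * hM (r ^ 4) - hF (r ^ 4) * hN r.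

Lemma half_disc_half : half_disc (/ 2)%R.
Proof. split; [rewrite re_RtoC; lra | rewrite Cmod_R, Rabs_pos_eq; lra]. Qed.

Lemma hW_const r : half_disc r -> hW r = hW (/ 2)%R.
Proof.
  intros H. pose proof half_disc_half as H2.
  assert (E : (Cmod (hW (r + ((/ 2)%R - r))%C - hW r) <= 0 * Cmod ((/ 2)%R - r)%C)%R).
  { apply (C_mean_value hW (fun _ => 0)).
    - intros t Ht. pose proof (half_disc_segment r (/ 2)%R t H H2 Ht) as K.
      set (s := r + t * ((/ 2)%R - r)) in *.
      destruct (half_disc_facts s K) as [N0 [_ [_ [_ [N4 _]]]]].
      unfold hW. eapply CD_eq.
      + apply CD_minus; apply CD_mult;
        [apply hG_CD | apply hM4_CD | apply hF4_CD | apply hN_CD]; auto.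
      + cbv beta. field. auto.
    - intros t _. rewrite Cmod_0. lra. }
  replace (r + ((/ 2)%R - r)) with (RtoC (/ 2)) in E by ring.
  symmetry. apply Ceq_minus, Cmod_eq_0. pose proof (Cmod_ge_0 (hW (/ 2)%R - hW r)). lra.
Qed.

Lemma hF_real t : Im (hF (RtoC t)) = 0%R.
Proof.
  pose proof (hF_conj (RtoC t)) as H.
  replace (Cconj (RtoC t)) with (RtoC t) in H
    by (apply C_ext; unfold Re, Im, Cconj, RtoC; simpl; ring).
  assert (E : Im (hF t) = Im (Cconj (hF t))) by (rewrite <- H; auto).
  unfold Cconj, Im in *; simpl in *. lra.
Qed.

Lemma hM_real t : Im (hM (RtoC t)) = 0%R.
Proof.
  pose proof (hM_conj (RtoC t)) as H.
  replace (Cconj (RtoC t)) with (RtoC t) in H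
    by (apply C_ext; unfold Re, Im, Cconj, RtoC; simpl; ring).
  assert (E : Im (hM t) = Im (Cconj (hM t))) by (rewrite <- H; auto).
  unfold Cconj, Im in *; simpl in *. lra.
Qed.

Lemma Im_0_RtoC u : Im u = 0%R -> u = RtoC (Re u).
Proof. intros H. apply C_ext; auto. Qed.

Lemma RtoC_neq_0 (t : R) : t <> 0%R -> RtoC t <> 0.
Proof. intros H E. apply RtoC_inj in E. auto. Qed.

Lemma Im0_plus u v : Im u = 0%R -> Im v = 0%R -> Im (u + v) = 0%R.
Proof. intros H1 H2. change (Im u + Im v = 0)%R. lra. Qed.

Lemma Im0_minus u v : Im u = 0%R -> Im v = 0%R -> Im (u - v) = 0%R.
Proof. intros H1 H2. change (Im u + - Im v = 0)%R. lra. Qed.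

Lemma Im0_opp u : Im u = 0%R -> Im (- u) = 0%R.
Proof. intros H. change (- Im u = 0)%R. lra. Qed.

Lemma Im0_mult u v : Im u = 0%R -> Im v = 0%R -> Im (u * v) = 0%R.
Proof.
  intros H1 H2. change (Re u * Im v + Im u * Re v = 0)%R. rewrite H1, H2. ring.
Qed.

Lemma Im0_inv u : Im u = 0%R -> Im (/ u) = 0%R.
Proof.
  intros H. change (- Im u / (Re u ^ 2 + Im u ^ 2) = 0)%R. rewrite H. unfold Rdiv. ring.
Qed.

Lemma Im0_div u v : Im u = 0%R -> Im v = 0%R -> Im (u / v) = 0%R.
Proof. intros. apply Im0_mult; auto. apply Im0_inv; auto. Qed.

Lemma Im0_pow u n : Im u = 0%R -> Im (u ^ n) = 0%R.
Proof. intros H. induction n as [|n IH]; [reflexivity|]. apply Im0_mult; auto. Qed.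

Lemma Im0_hF u : Im u = 0%R -> Im (hF u) = 0%R.
Proof. intros H. rewrite (Im_0_RtoC u H). apply hF_real. Qed.

Lemma Im0_hM u : Im u = 0%R -> Im (hM u) = 0%R.
Proof. intros H. rewrite (Im_0_RtoC u H). apply hM_real. Qed.

Ltac im0 := repeat first
  [ apply im_RtoC | apply Im0_plus | apply Im0_minus | apply Im0_div | apply Im0_mult
  | apply Im0_opp | apply Im0_inv | apply Im0_pow | apply Im0_hF | apply Im0_hM ].

Lemma hW_real : hW (/ 2)%R = Re (hW (/ 2)%R).
Proof.
  apply Im_0_RtoC. unfold hW.
  im0.
Qed.

(** * The logarithmic behaviour of y at x = 0 *)

(** The derivative of y in [x] is [- nome_const * hmu x / x]; as [hmu] is regular with value 1 at 0,
    the logarithm splits off. *)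
Definition hmu (u : C) : C := / ((1 - u) * (hF u * hF u)).

Definition hY (r : C) : C := PI * (hG r / hF (r ^ 4)).

Section Nome.
Variable F : C -> C.
Hypothesis HF : is_hyp2F1 (1 / 2) (1 / 2) 1 F.

(** The nonvanishing is a by-product of the sector argument, applied to a fourth root of [u]. *)
Lemma hF_neq_0 u : (Cmod u < 1)%R -> hF u <> 0.
Proof.
  intros Hu. pose proof PI_RGT_0.
  destruct (Ceq_dec u 0) as [->|N]; [rewrite hF_0; apply C1_nz|].
  destruct (polar_form u) as [a [t [Pa [Ht [E _]]]]].
  assert (Ea : Cmod u = a).
  { rewrite E, Cmod_mult, Cmod_R, Cmod_cis, Rabs_pos_eq by auto. ring. }
  assert (0 < Cmod u)%R by (apply Cmod_gt_0; auto).
  destruct (fourth_root a ltac:(lra)) as [rho [Hr Er]].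
  replace u with ((rho * cis (t / 4)) ^ 4).
  - apply (hG_hF_pos F HF); auto. lra.
  - rewrite polar_pow4, Er. rewrite E. f_equal. f_equal. field.
Qed.

Definition nome_const : R := (PI * Re (hW (/ 2)%R))%R.

Lemma hY_CD r : half_disc r -> CD hY r (- (4 * nome_const * hmu (r ^ 4)) / r).
Proof.
  intros H. destruct (half_disc_facts r H) as [N0 [N1 [N2 [N3 [N4 [N5 [L1 [L2 E]]]]]]]].
  pose proof (hF_neq_0 _ L2) as NF.
  unfold hY. eapply CD_eq.
  - cd; [apply hG_CD; auto | apply hF4_CD; auto | auto].
  - cbv beta. unfold nome_const, hmu. rewrite RtoC_mult, <- hW_real, <- (hW_const r H).
    unfold hW. field. auto.
Qed.

Lemma hmu_bound : exists K d, (0 < K)%R /\ (0 < d < 1)%R /\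
  forall u, (Cmod u < d)%R -> (Cmod (hmu u - 1) <= K * Cmod u)%R.
Proof.
  assert (D : exists l, CD hmu 0 l).
  { eexists. unfold hmu. cd; try apply hF_CD_0. rewrite hF_0.
    replace ((1 - 0) * (1 * 1)) with (RtoC 1) by ring. apply C1_nz. }
  destruct D as [l Hl]. destruct (Hl 1%R ltac:(lra)) as [d [Pd Hd]].
  assert (E : hmu 0 = 1) by (unfold hmu; rewrite hF_0; field).
  exists (Cmod l + 1)%R, (Rmin d (1 / 2)). pose proof (Cmod_ge_0 l).
  pose proof (Rmin_l d (1 / 2)). pose proof (Rmin_r d (1 / 2)).
  assert (0 < Rmin d (1 / 2))%R by (apply Rmin_pos; lra).
  split; [lra|]. split; [lra|]. intros u Hu. specialize (Hd u).
  replace (u - 0) with u in Hd by ring. rewrite E in Hd. specialize (Hd ltac:(lra)).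
  pose proof (Cmod_triangle (hmu u - 1 - l * u) (l * u)) as T.
  replace (hmu u - 1 - l * u + l * u) with (hmu u - 1) in T by ring.
  rewrite Cmod_mult in T. lra.
Qed.

Lemma Cexp_half_disc s : (Re s < 0)%R -> (- (PI / 2) < Im s < PI / 2)%R -> half_disc (Cexp s).
Proof.
  intros H1 H2. split.
  - unfold Cexp. rewrite re_scal_l. apply Rmult_lt_0_compat; [apply exp_pos|].
    simpl. apply cos_gt_0; lra.
  - rewrite Cmod_Cexp. rewrite <- exp_0. apply exp_increasing. auto.
Qed.

(** In the coordinate [s = log r] the pole of the derivative disappears, and what is left is of
    order [r^4]. *)
Lemma hY_log_CD s : (Re s < 0)%R -> (- (PI / 2) < Im s < PI / 2)%R ->
  CD (fun s => hY (Cexp s) + 4 * nome_const * s) s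
    (- (4 * nome_const * (hmu (Cexp s ^ 4) - 1))).
Proof.
  intros H1 H2. pose proof (Cexp_half_disc s H1 H2) as K.
  eapply CD_eq.
  - cd. apply (CD_comp Cexp hY); [apply CD_Cexp | apply hY_CD; auto].
  - cbv beta. field. apply Cexp_neq_0.
Qed.

Lemma Cexp_polar (rho phi : R) : (0 < rho)%R -> Cexp (ln rho, phi) = rho * cis phi.
Proof. intros H. unfold Cexp, Re, Im; simpl. rewrite exp_ln by auto. reflexivity. Qed.

(** The arc from [rho] to [rho * cis phi] is a vertical segment in the coordinate [log r], and the
    mean value inequality applies to it. *)
Lemma hY_vertical K d (rho phi : R) : (0 <= K)%R -> (0 < d < 1)%R ->
  (forall u, (Cmod u < d)%R -> (Cmod (hmu u - 1) <= K * Cmod u)%R) ->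
  (0 < rho < 1)%R -> (rho ^ 4 < d)%R -> (- (PI / 4) <= phi <= PI / 4)%R ->
  (Cmod (hY (rho * cis phi) + 4 * nome_const * (Ci * phi) - hY rho)
    <= 4 * Rabs nome_const * K * rho ^ 4 * Rabs phi)%R.
Proof.
  intros HK Hd Hmu Hr Hr4 Hp. pose proof PI_RGT_0.
  assert (Hln : (ln rho < 0)%R) by (rewrite <- ln_1; apply ln_increasing; lra).
  pose proof (C_mean_value (fun s => hY (Cexp s) + 4 * nome_const * s)
    (fun s => - (4 * nome_const * (hmu (Cexp s ^ 4) - 1))) (ln rho, 0%R) (Ci * phi)
    (4 * Rabs nome_const * (K * rho ^ 4))) as M.
  assert (E : forall t : R, (ln rho, 0%R) + t * (Ci * phi) = (ln rho, (t * phi)%R)).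
  { intros t. apply C_ext; unfold Re, Im, Ci, Cplus, Cmult, RtoC; simpl; ring. }
  assert (E1 : (ln rho, 0%R) + Ci * phi = (ln rho, phi)).
  { apply C_ext; unfold Re, Im, Ci, Cplus, Cmult, RtoC; simpl; ring. }
  cbv beta in M. rewrite E1 in M. rewrite !Cexp_polar in M by lra. rewrite cis_0 in M.
  assert (Bt : forall t, (0 <= t <= 1)%R -> (- (PI / 2) < t * phi < PI / 2)%R).
  { intros t Ht. assert (Rabs (t * phi) <= PI / 4)%R.
    { rewrite Rabs_mult, (Rabs_pos_eq t) by lra.
      assert (Rabs phi <= PI / 4)%R by (apply Rabs_le; lra). pose proof (Rabs_pos phi). nra. }
    apply Rabs_le_between in H0. lra. }
  replace (hY (rho * cis phi) + 4 * nome_const * (Ci * phi) - hY rho) with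
    (hY (rho * cis phi) + 4 * nome_const * ((ln rho, phi) : C)
     - (hY (rho * 1) + 4 * nome_const * ((ln rho, 0%R) : C))).
  - eapply Rle_trans; [apply M|].
    + intros t Ht. rewrite E. apply hY_log_CD; [exact Hln | apply Bt; auto].
    + intros t Ht. rewrite E, Cexp_polar by lra.
      rewrite Cmod_opp, !Cmod_mult, !Cmod_R, (Rabs_pos_eq 4) by lra.
      apply Rmult_le_compat_l; [pose proof (Rabs_pos nome_const); lra|].
      assert (M4 : (Cmod ((rho * cis (t * phi)) ^ 4) = rho ^ 4)%R).
      { rewrite Cmod_pow, Cmod_mult, Cmod_R, Cmod_cis, Rabs_pos_eq by lra. ring. }
      rewrite <- M4. apply Hmu. rewrite M4. auto.
    + rewrite Cmod_mult, Cmod_Ci, Cmod_R. apply Req_le. ring.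
  - rewrite Cmult_1_r. rewrite <- E1. ring.
Qed.

Lemma hY_real (t : R) : hY t = Re (hY t).
Proof.
  apply Im_0_RtoC. unfold hY. im0.
Qed.

Lemma half_disc_real (t : R) : (0 < t < 1)%R -> half_disc t.
Proof. intros H. split; [rewrite re_RtoC; lra | rewrite Cmod_R, Rabs_pos_eq; lra]. Qed.

(** The bound involves [r2] alone: the derivative is of order [t^3], so the length of the
    logarithmic interval, unbounded as [r1] tends to 0, does not enter. *)
Lemma hY_radial K d (r1 r2 : R) : (0 <= K)%R -> (0 < d < 1)%R ->
  (forall u, (Cmod u < d)%R -> (Cmod (hmu u - 1) <= K * Cmod u)%R) ->
  (0 < r1 < r2)%R -> (r2 < 1)%R -> (r2 ^ 4 < d)%R ->
  (Rabs ((Re (hY r2) + 4 * nome_const * ln r2) - (Re (hY r1) + 4 * nome_const * ln r1))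
   <= 4 * Rabs nome_const * K * r2 ^ 4)%R.
Proof.
  intros HK Hd Hmu Hr Hr2 Hr4.
  set (df := fun t => (Re (- (4 * nome_const * hmu (RtoC t ^ 4)) / t) + 4 * nome_const * / t)%R).
  assert (D : forall t, (r1 <= t <= r2)%R ->
    is_derive (fun t => Re (hY (RtoC t)) + 4 * nome_const * ln t)%R t (df t)).
  { intros t Ht.
    apply (is_derive_plus (V := R_NormedModule) (fun t => Re (hY (RtoC t)))
      (fun t => 4 * nome_const * ln t)%R).
    - apply CD_real_Re. apply hY_CD, half_disc_real. lra.
    - auto_derive; lra. }
  destruct (MVT_gen (fun t => Re (hY (RtoC t)) + 4 * nome_const * ln t)%R r1 r2 df) as [t [Ht E]].
  - intros t Ht. rewrite Rmin_left, Rmax_right in Ht by lra. apply D. lra.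
  - intros t Ht. rewrite Rmin_left, Rmax_right in Ht by lra.
    apply continuity_pt_filterlim.
    apply (ex_derive_continuous (V := R_NormedModule)
      (fun t => Re (hY (RtoC t)) + 4 * nome_const * ln t)%R).
    exists (df t). apply D. lra.
  - rewrite Rmin_left, Rmax_right in Ht by lra. rewrite E. unfold df.
    assert (Q : (Re (- (4 * nome_const * hmu (RtoC t ^ 4)) / t) + 4 * nome_const * / t
       = Re ((- 4 * nome_const / t)%R * (hmu (RtoC t ^ 4) - 1)))%R).
    { rewrite re_scal_l.
      replace (- (4 * nome_const * hmu (RtoC t ^ 4)) / t)
        with ((- 4 * nome_const / t)%R * hmu (RtoC t ^ 4)).
      - rewrite re_scal_l. change (Re (hmu (t ^ 4) - 1)) with (Re (hmu (t ^ 4)) - 1)%R.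
        field. lra.
      - rewrite RtoC_div, RtoC_mult by lra. field. apply RtoC_neq_0. lra. }
    rewrite Q, Rabs_mult. rewrite (Rabs_pos_eq (r2 - r1)) by lra.
    assert (T4 : (t ^ 4 <= r2 ^ 4)%R) by (apply pow_incr; lra).
    assert (T0 : (0 < t ^ 4)%R) by (apply pow_lt; lra).
    assert (M4 : Cmod (RtoC t ^ 4) = (t ^ 4)%R).
    { rewrite <- RtoC_pow, Cmod_R, Rabs_pos_eq; lra. }
    apply Rle_trans with ((4 * Rabs nome_const / t * (K * t ^ 4)) * (r2 - r1))%R.
    + apply Rmult_le_compat_r; [lra|]. eapply Rle_trans; [apply re_le_Cmod|].
      rewrite Cmod_mult, Cmod_R. unfold Rdiv. rewrite !Rabs_mult. rewrite (Rabs_left (-4)) by lra. replace (- -4)%R with 4%R by ring.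
      rewrite (Rabs_pos_eq (/ t)) by (try lra; left; apply Rinv_0_lt_compat; lra).
      apply Rmult_le_compat_l.
      * repeat apply Rmult_le_pos; try lra; [apply Rabs_pos|left; apply Rinv_0_lt_compat; lra].
      * rewrite <- M4. apply Hmu. rewrite M4. lra.
    + replace (4 * Rabs nome_const / t * (K * t ^ 4) * (r2 - r1))%R
        with (4 * Rabs nome_const * K * (t ^ 3 * (r2 - r1)))%R by (field; lra).
      apply Rmult_le_compat_l.
      * repeat apply Rmult_le_pos; try lra. apply Rabs_pos.
      * change (r2 ^ 4)%R with (r2 * r2 ^ 3)%R. rewrite (Rmult_comm r2).
        apply Rmult_le_compat; try lra; [apply pow_le; lra | apply pow_incr; lra].
Qed.

(** Landen's transformation squares the nome. *)
Lemma hY_double (r : R) : (0 < r < 1)%R ->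
  let t := sqrt (1 - r ^ 4) in let r1 := sqrt ((1 - t) / (1 + t)) in
  (0 < r1 < r)%R /\ (r1 ^ 4 = (r ^ 4) ^ 2 / (1 + t) ^ 4)%R /\ hY r1 = 2 * hY r.
Proof.
  intros Hr t r1.
  assert (Hx : (0 < r ^ 4 < 1)%R) by (split; [apply pow_lt; lra | apply pow_lt_1_compat; [lra | lia]]).
  assert (T2 : (t * t = 1 - r ^ 4)%R) by (apply sqrt_sqrt; lra).
  assert (Ht : (0 < t)%R) by (apply sqrt_lt_R0; lra).
  assert (Ht1 : (t < 1)%R) by nra.
  assert (Q0 : (0 < (1 - t) / (1 + t))%R) by (apply Rdiv_lt_0_compat; lra).
  assert (R1 : (0 < r1)%R) by (apply sqrt_lt_R0; auto).
  assert (R2 : (r1 * r1 = (1 - t) / (1 + t))%R) by (apply sqrt_sqrt; lra).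
  assert (R4 : (r1 ^ 4 = (r ^ 4) ^ 2 / (1 + t) ^ 4)%R).
  { replace (r1 ^ 4)%R with ((r1 * r1) * (r1 * r1))%R by ring. rewrite R2.
    replace (r ^ 4)%R with (1 - t * t)%R by lra. field. lra. }
  assert (Rr : (r1 < r)%R).
  { apply Rnot_le_lt. intros L. assert (r ^ 4 <= r1 ^ 4)%R by (apply pow_incr; lra).
    rewrite R4 in H. apply Rle_div_r in H; [|apply pow_lt; lra].
    assert (1 <= (1 + t) ^ 4)%R by (apply pow_R1_Rle; lra). nra. }
  split; [lra|]. split; auto.
  assert (Lr : half_disc r) by (apply half_disc_real; lra).
  destruct (half_disc_facts r Lr) as [N0 [N1 [N2 [N3 [N4 [N5 [L1 [L2 E]]]]]]]].
  assert (Tc : RtoC t * t = 1 - RtoC r ^ 4).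
  { rewrite <- RtoC_mult, T2, RtoC_minus, RtoC_pow. auto. }
  assert (Nt : 1 + RtoC t <> 0) by (rewrite <- RtoC_plus; apply RtoC_neq_0; lra).
  assert (Rc : RtoC r1 * r1 = (1 - t) / (1 + t)).
  { rewrite <- RtoC_mult, R2, RtoC_div, RtoC_minus, RtoC_plus by lra. auto. }
  assert (EF : hF (RtoC r ^ 4) = 2 / (1 + t) * hF (RtoC r1 ^ 4)).
  { rewrite <- (hyp2F1_disc F HF) by auto. replace (RtoC r ^ 4) with (1 - RtoC t * t)
      by (rewrite Tc; ring).
    rewrite (landen_sq F HF) by (rewrite re_RtoC; auto). f_equal. f_equal.
    rewrite <- Rc. ring. }
  assert (EG : hG r1 = (1 + t) * hG r).
  { rewrite <- (landen_twice F HF r1), <- (landen_twice F HF r);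
      try (rewrite <- ?RtoC_mult, re_RtoC; nra).
    replace (1 - RtoC r1 * r1 * (RtoC r1 * r1)) with (koebe t)
      by (rewrite Rc; unfold koebe; field; auto).
    replace (1 - RtoC r * r * (RtoC r * r)) with (RtoC t * t) by (rewrite Tc; ring).
    rewrite (landen F HF) by (rewrite Cmod_R, Rabs_pos_eq; lra).
    f_equal. symmetry. apply (hyp2F1_disc F HF).
    rewrite Cmod_mult, Cmod_R, Rabs_pos_eq; nra. }
  assert (NF : hF (RtoC r1 ^ 4) <> 0).
  { apply hF_neq_0. rewrite <- RtoC_pow, Cmod_R, Rabs_pos_eq; [|apply pow_le; lra].
    apply pow_lt_1_compat; [lra | lia]. }
  unfold hY. rewrite EF, EG. field. split; auto.
Qed.

Lemma ln_le_minus_1 x : (0 < x)%R -> (ln x <= x - 1)%R.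
Proof.
  intros H. pose proof (exp_ineq1_le (ln x)) as E. rewrite exp_ln in E by auto. lra.
Qed.

(** Comparing [e r1 = 2 e r + O(r^4)] with [e r1 - e r = O(r^4)], for
    [e = Y + c ln (x / 16)], gives [e r = O(r^4)]. *)
Lemma hY_real_asymptotics : exists K d, (0 < K)%R /\ (0 < d < 1)%R /\
  forall r, (0 < r < 1)%R -> (r ^ 4 < d)%R ->
   (Rabs (Re (hY r) + 4 * nome_const * ln r - nome_const * ln 16) <= K * r ^ 4)%R.
Proof.
  destruct hmu_bound as [K [d [PK [Hd Hmu]]]].
  exists (4 * Rabs nome_const * (K + 1) + 1)%R, d. pose proof (Rabs_pos nome_const).
  split; [nra|]. split; auto. intros r Hr Hr4.
  destruct (hY_double r Hr) as [H1 [H2 H3]].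
  set (t := sqrt (1 - r ^ 4)) in *. set (r1 := sqrt ((1 - t) / (1 + t))) in *.
  assert (Hx : (0 < r ^ 4 < 1)%R) by (split; [apply pow_lt; lra | lra]).
  assert (T2 : (t * t = 1 - r ^ 4)%R) by (apply sqrt_sqrt; lra).
  assert (Ht : (0 < t)%R) by (apply sqrt_lt_R0; lra).
  assert (Ht1 : (t < 1)%R) by nra.
  pose proof (hY_radial K d r1 r ltac:(lra) Hd Hmu H1 ltac:(lra) Hr4) as L.
  assert (E : (Re (hY r1) = 2 * Re (hY r))%R) by (rewrite H3, re_scal_l; auto).
  assert (Eln : (4 * ln r1 = 8 * ln r - 4 * ln (1 + t))%R).
  { assert (Q : ln (r1 ^ 4) = ln ((r ^ 4) ^ 2 / (1 + t) ^ 4)) by (rewrite H2; auto).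
    rewrite ln_div in Q by (apply pow_lt; lra).
    rewrite !ln_pow in Q by (try apply pow_lt; lra). simpl INR in Q. lra. }
  assert (E16 : (ln 16 = 4 * ln 2)%R).
  { replace 16%R with (2 ^ 4)%R by ring. rewrite ln_pow by lra. simpl. ring. }
  set (e := (Re (hY r) + 4 * nome_const * ln r - nome_const * ln 16)%R).
  assert (Eq : (e = - ((Re (hY r) + 4 * nome_const * ln r) - (Re (hY r1) + 4 * nome_const * ln r1))
     - nome_const * (4 * ln (2 / (1 + t))))%R).
  { rewrite ln_div by lra. unfold e. rewrite E.
    replace (4 * nome_const * ln r1)%R with (nome_const * (4 * ln r1))%R by ring.
    rewrite Eln, E16. ring. }
  assert (Bl : (0 <= 4 * ln (2 / (1 + t)) <= 4 * r ^ 4)%R).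
  { assert (P : (1 <= 2 / (1 + t))%R) by (apply Rle_div_r; lra).
    split.
    - rewrite <- ln_1. destruct P as [P|P].
      + pose proof (ln_increasing 1 (2 / (1 + t)) ltac:(lra) P). rewrite ln_1 in *. lra.
      + rewrite <- P, ln_1. lra.
    - pose proof (ln_le_minus_1 (2 / (1 + t)) ltac:(lra)).
      assert (2 / (1 + t) - 1 <= r ^ 4)%R; [|lra].
      replace (2 / (1 + t) - 1)%R with ((1 - t) / (1 + t))%R by (field; lra).
      apply Rle_div_l; nra. }
  rewrite Eq. eapply Rle_trans; [apply Rabs_triang|]. rewrite !Rabs_Ropp, Rabs_mult.
  rewrite (Rabs_pos_eq (4 * _)) by lra.
  assert (Rabs nome_const * (4 * ln (2 / (1 + t))) <= Rabs nome_const * (4 * r ^ 4))%R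
    by (apply Rmult_le_compat_l; lra).
  lra.
Qed.

(** Along the negative axis [Im Y] is constant; its value is read off at [x = -1],
    where Landen's transformation gives [w / z = 1 - i]. *)
Lemma hY_negative_axis (rho : R) : (0 < rho < 1)%R -> Im (hY (rho * cis (PI / 4))) = (- PI)%R.
Proof.
  intros Hr. pose proof PI_RGT_0.
  set (e := cis (PI / 4)).
  assert (E4 : e ^ 4 = -(1)).
  { unfold e. rewrite cis_pow. simpl INR. replace ((1 + 1 + 1 + 1) * (PI / 4))%R with PI by field.
    unfold cis. rewrite cos_PI, sin_PI. apply C_ext; unfold Re, Im, Copp, RtoC; simpl; ring. }
  (* [F] replaces [hF] because at [t = 1] the point -1 lies on the unit circle, where the power
     series is not controlled but [F] is holomorphic. *)
  set (G := fun t : C => PI * (hG (t * e) / F ((t * e) ^ 4))).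
  assert (Off : forall t : R, (0 < t)%R -> off_cut ((t * e) ^ 4)).
  { intros t Ht [_ K]. replace ((t * e) ^ 4) with (t ^ 4 * (e ^ 4)) in K by ring.
    rewrite E4, <- RtoC_pow in K. rewrite re_scal_l in K.
    assert (0 < t ^ 4)%R by (apply pow_lt; auto).
    unfold Re, Copp, RtoC in K; simpl in K. simpl in H0. lra. }
  assert (HD : forall t : R, (0 < t < 1)%R -> half_disc (t * e)).
  { intros t Ht. split.
    - unfold e. rewrite Re_polar. apply Rmult_lt_0_compat; [lra|]. apply cos_gt_0; lra.
    - unfold e. rewrite Cmod_mult, Cmod_R, Cmod_cis, Rabs_pos_eq; lra. }
  assert (GY : forall t : R, (0 < t < 1)%R -> G t = hY (t * e)).
  { intros t Ht. unfold G, hY. rewrite (hyp2F1_disc F HF); auto.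
    apply (half_disc_facts (t * e) (HD t Ht)). }
  (* For negative argument [hF] and hence [hmu] are real, so the derivative of y along the axis is
     real. *)
  assert (DG : forall t : R, (0 < t < 1)%R ->
    is_derive (fun t : R => Im (hY (t * e))) t 0%R).
  { intros t Ht. pose proof (HD t Ht) as Ht'.
    replace 0%R with (Im (- (4 * nome_const * hmu ((t * e) ^ 4)) / (t * e) * e)).
    - apply (CD_real_Im (fun t => hY (t * e))). apply (CD_comp (fun t => t * e) hY); [|apply hY_CD; auto].
      eapply CD_eq; [cd|]. cbv beta; ring.
    - replace ((t * e) ^ 4) with (t ^ 4 * (e ^ 4)) by ring. rewrite E4.
      replace (t ^ 4 * - (1)) with (RtoC (- (t ^ 4))) by (rewrite RtoC_opp, RtoC_pow; ring).
      assert (Nt : RtoC t <> 0) by (apply RtoC_neq_0; lra).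
      assert (Ne : e <> 0) by (apply Cmod_gt_0; unfold e; rewrite Cmod_cis; lra).
      replace (- (4 * nome_const * hmu (- t ^ 4)%R) / (t * e) * e)
        with ((- 4 * nome_const / t)%R * hmu (- t ^ 4)%R)
        by (rewrite RtoC_div, RtoC_mult by lra; field; auto).
      rewrite im_scal_l. unfold hmu.
      assert (NF : hF (- t ^ 4)%R <> 0).
      { apply hF_neq_0. rewrite Cmod_R, Rabs_Ropp, Rabs_pos_eq by (apply pow_le; lra).
        apply pow_lt_1_compat; [lra | lia]. }
      rewrite (Im_0_RtoC _ (hF_real _)) in *.
      assert (NF' : (Re (hF (- t ^ 4)%R) <> 0)%R) by (intros Q; apply NF; rewrite Q; auto).
      assert (0 < t ^ 4)%R by (apply pow_lt; lra).
      rewrite <- RtoC_minus, <- !RtoC_mult, <- RtoC_inv.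
      + rewrite im_RtoC. ring.
      + apply Rmult_integral_contrapositive_currified; [lra|].
        apply Rmult_integral_contrapositive_currified; auto. }
  assert (Const : forall t : R, (0 < t < 1)%R -> Im (hY (t * e)) = Im (hY (rho * e))).
  { intros t Ht.
    destruct (MVT_gen (fun t : R => Im (hY (t * e))) rho t (fun _ => 0%R)) as [c [_ Q]].
    - intros s Hs. apply DG.
      assert (0 < Rmin rho t)%R by (apply Rmin_pos; lra).
      assert (Rmax rho t < 1)%R by (apply Rmax_lub_lt; lra). lra.
    - intros s Hs. apply continuity_pt_filterlim.
      apply (ex_derive_continuous (V := R_NormedModule)). exists 0%R. apply DG.
      assert (0 < Rmin rho t)%R by (apply Rmin_pos; lra).
      assert (Rmax rho t < 1)%R by (apply Rmax_lub_lt; lra). lra.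
    - lra. }
  assert (S2 : (sqrt 2 * sqrt 2 = 2)%R) by (apply sqrt_sqrt; lra).
  assert (S0 : (0 < sqrt 2)%R) by (apply sqrt_lt_R0; lra).
  (* The point -1 is [1 - q * q], which brings its value within reach of [landen_sq]. *)
  set (q := RtoC (sqrt 2)).
  assert (Q2 : q * q = 2) by (unfold q; rewrite <- RtoC_mult, S2; auto).
  assert (Nq : q <> 0) by (apply RtoC_neq_0; lra).
  assert (Nq1 : 1 + q <> 0) by (unfold q; rewrite <- RtoC_plus; apply RtoC_neq_0; lra).
  set (H1 := hF ((1 - q) / (1 + q) * ((1 - q) / (1 + q)))).
  assert (FV : F ((1 * e) ^ 4) = 2 / (1 + q) * H1).
  { replace ((1 * e) ^ 4) with (1 - q * q).
    - apply (landen_sq F HF). unfold q. rewrite re_RtoC. auto.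
    - rewrite Q2. replace ((1 * e) ^ 4) with (e ^ 4) by ring. rewrite E4. ring. }
  assert (NH : H1 <> 0).
  { apply hF_neq_0. apply Cmod_sq_lt_1. apply Cmod_cayley. unfold q. rewrite re_RtoC. auto. }
  assert (Ee : q * e = 1 + Ci).
  { unfold q, e, cis. rewrite cos_PI4, sin_PI4.
    apply C_ext; unfold Re, Im, Ci, Cplus, Cmult, RtoC; simpl; field; lra. }
  assert (Ii : Ci * Ci = -(1)) by (apply C_ext; unfold Re, Im, Ci, Copp, Cmult, RtoC; simpl; ring).
  (* This is [e + 1 / e = 2 cos (PI / 4)]. It makes both hypergeometric arguments at -1 equal, so
     that [H1] cancels from the quotient. *)
  assert (Eee : 1 + e * e = q * e).
  { assert (X : 2 * (e * e) = 2 * Ci).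
    { replace (2 * (e * e)) with ((q * e) * (q * e)) by (rewrite <- Q2; ring).
      rewrite Ee. replace ((1 + Ci) * (1 + Ci)) with (1 + 2 * Ci + Ci * Ci) by ring.
      rewrite Ii. ring. }
    replace (e * e) with (2 * (e * e) / 2) by field. rewrite X, Ee. field. }
  assert (Ne : e <> 0) by (apply Cmod_gt_0; unfold e; rewrite Cmod_cis; lra).
  assert (N1e : 1 + e <> 0).
  { apply C_neq_Re. assert (0 < cos (PI / 4))%R by (apply cos_gt_0; lra).
    unfold e, cis, Re, Cplus, RtoC; simpl. lra. }
  assert (Pe : (1 + e) * (1 + e) = e * (q + 2)).
  { replace ((1 + e) * (1 + e)) with (1 + e * e + 2 * e) by ring. rewrite Eee. ring. }
  assert (Me : (1 - e) * (1 - e) = e * (q - 2)).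
  { replace ((1 - e) * (1 - e)) with (1 + e * e - 2 * e) by ring. rewrite Eee. ring. }
  assert (Nq2 : q + 2 <> 0) by (unfold q; rewrite <- RtoC_plus; apply RtoC_neq_0; lra).
  assert (GV : hG (1 * e) = 4 / (e * (q + 2)) * H1).
  { replace (1 * e) with e by ring. unfold hG. rewrite Pe. f_equal. unfold H1. f_equal.
    replace (((1 - e) / (1 + e)) ^ 4)
      with (((1 - e) * (1 - e)) / ((1 + e) * (1 + e)) * (((1 - e) * (1 - e)) / ((1 + e) * (1 + e))))
      by (field; auto).
    rewrite Pe, Me.
    replace (e * (q - 2) / (e * (q + 2))) with ((1 - q) / (1 + q)); [reflexivity|].
    apply Ceq_minus.
    replace ((1 - q) / (1 + q) - e * (q - 2) / (e * (q + 2)))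
      with ((4 - 2 * (q * q)) / ((1 + q) * (q + 2))) by (field; auto).
    rewrite Q2. field. auto. }
  assert (V1 : G 1 = PI * (1 - Ci)).
  { unfold G. rewrite FV, GV. f_equal.
    replace (4 / (e * (q + 2)) * H1 / (2 / (1 + q) * H1))
      with (2 * (1 + q) / (e * (q + 2))) by (field; auto).
    replace (2 * (1 + q)) with (q * (q + 2)) by
      (replace (q * (q + 2)) with (q * q + 2 * q) by ring; rewrite Q2; ring).
    replace (q * (q + 2) / (e * (q + 2))) with (q * q / (q * e)) by (field; auto).
    rewrite Q2, Ee.
    assert (Nci : 1 + Ci <> 0) by (apply C_neq_Re; unfold Re, Ci, Cplus, RtoC; simpl; lra).
    replace (1 - Ci) with ((1 - Ci * Ci) / (1 + Ci)) by (field; auto).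
    rewrite Ii. field. auto. }
  assert (CG : CC G 1).
  { destruct (hyp2F1_CD F HF ((1 * e) ^ 4) (Off 1%R ltac:(lra))) as [l1 Hl1].
    assert (Re1 : (0 < Re (1 * e))%R).
    { unfold e. rewrite Re_polar. apply Rmult_lt_0_compat; [lra|]. apply cos_gt_0; lra. }
    destruct (hG_CD_ex (1 * e) Re1) as [l2 Hl2].
    assert (Dm : CD (fun t => t * e) 1 e) by (eapply CD_eq; [cd|]; cbv beta; ring).
    eapply CD_CC. unfold G. cd.
    - apply (CD_comp (fun t => t * e) hG); [apply Dm | apply Hl2].
    - apply (CD_comp (fun t => (t * e) ^ 4) F); [apply CD_pow; apply Dm | apply Hl1].
    - rewrite FV. apply Cmult_neq_0; auto. apply Cmult_neq_0; [apply RtoC_neq_0; lra|].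
      apply Cmod_gt_0. rewrite Cmod_inv by auto. apply Rinv_0_lt_compat, Cmod_gt_0; auto. }
  set (tn := fun n => (1 - / (INR n + 2))%R).
  assert (Htn : forall n, (0 < tn n < 1)%R).
  { intros n. unfold tn. pose proof (pos_INR n).
    assert (0 < / (INR n + 2))%R by (apply Rinv_0_lt_compat; lra).
    assert (/ (INR n + 2) < 1)%R by (rewrite <- Rinv_1; apply Rinv_lt_contravar; lra). lra. }
  assert (Ltn : Clim (fun n => RtoC (tn n)) 1).
  { apply Clim_le with (fun n => / (INR n + 2))%R.
    - intros n. rewrite <- RtoC_minus, Cmod_R. unfold tn. pose proof (pos_INR n).
      replace (1 - / (INR n + 2) - 1)%R with (- / (INR n + 2))%R by ring.
      rewrite Rabs_Ropp, Rabs_pos_eq; [lra|]. left. apply Rinv_0_lt_compat. lra.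
    - replace (Finite 0) with (Rbar_inv p_infty) by reflexivity.
      apply is_lim_seq_inv; [|discriminate].
      eapply is_lim_seq_plus; [apply is_lim_seq_INR | apply is_lim_seq_const | reflexivity]. }
  pose proof (Clim_Im _ _ (Clim_CC G _ 1 CG Ltn)) as L. rewrite V1 in L.
  replace (Im (PI * (1 - Ci))) with (- PI)%R in L
    by (unfold Im, Ci, Cminus, Cplus, Copp, Cmult, RtoC; simpl; ring).
  assert (L' : is_lim_seq (fun _ => Im (hY (rho * e))) (- PI)%R).
  { eapply is_lim_seq_ext; [|apply L]. intros n. cbv beta. rewrite GY by auto.
    apply Const; auto. }
  apply is_lim_seq_unique in L'. rewrite Lim_seq_const in L'. injection L' as L'. exact L'.
Qed.

(** Along the arc from the positive to the negative axis [Im y] changes by [- PI] exactly, by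
    [hY_negative_axis], and by [- PI * nome_const] up to O(rho^4), by [hY_vertical]; then [rho]
    tends to 0. *)
Lemma nome_const_1 : nome_const = 1%R.
Proof.
  pose proof PI_RGT_0. destruct hmu_bound as [K [d [PK [Hd Hmu]]]].
  set (c := nome_const). pose proof (Rabs_pos c).
  assert (B : forall rho, (0 < rho < 1)%R -> (rho ^ 4 < d)%R ->
    (PI * Rabs (c - 1) <= Rabs c * K * PI * rho ^ 4)%R).
  { intros rho Hr Hr4.
    pose proof (hY_vertical K d rho (PI / 4) ltac:(lra) Hd Hmu Hr Hr4 ltac:(lra)) as V.
    pose proof (Im_le_Cmod (hY (rho * cis (PI / 4)) + 4 * c * (Ci * (PI / 4)%R) - hY rho)) as I.
    assert (E : Im (hY (rho * cis (PI / 4)) + 4 * c * (Ci * (PI / 4)%R) - hY rho)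
      = (PI * (c - 1))%R).
    { rewrite (hY_real rho).
      change (Im (hY (rho * cis (PI / 4))) + Im (4 * c * (Ci * (PI / 4)%R)) - 0 = PI * (c - 1))%R.
      rewrite hY_negative_axis by auto.
      replace (4 * c * (Ci * (PI / 4)%R)) with ((4 * c * (PI / 4))%R * Ci).
      - rewrite im_scal_l. unfold Ci, Im; simpl. field.
      - rewrite !RtoC_mult. ring. }
    rewrite E, Rabs_mult, (Rabs_pos_eq PI) in I by lra.
    rewrite (Rabs_pos_eq (PI / 4)) in V by lra. fold c in V. lra. }
  assert (Z : (Rabs (c - 1) <= 0)%R).
  { apply Rnot_lt_le. intros L.
    set (x := Rmin (d / 2) (Rabs (c - 1) / (2 * (Rabs c * K + 1)))).
    assert (P : (0 < Rabs c * K + 1)%R) by nra.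
    assert (X0 : (0 < x)%R) by (apply Rmin_pos; [lra | apply Rdiv_lt_0_compat; lra]).
    assert (X1 : (x <= d / 2)%R) by apply Rmin_l.
    assert (X2 : (x <= Rabs (c - 1) / (2 * (Rabs c * K + 1)))%R) by apply Rmin_r.
    destruct (fourth_root x ltac:(lra)) as [rho [Hr Er]].
    assert (Er' : (rho ^ 4 = x)%R) by (rewrite <- Er; ring).
    specialize (B rho Hr ltac:(lra)). rewrite Er' in B.
    assert (Rabs (c - 1) <= Rabs c * K * x)%R.
    { apply Rmult_le_reg_l with PI; [lra|]. lra. }
    assert ((Rabs c * K + 1) * x <= Rabs (c - 1) / 2)%R.
    { replace (Rabs (c - 1) / 2)%R
        with ((Rabs c * K + 1) * (Rabs (c - 1) / (2 * (Rabs c * K + 1))))%R by (field; lra).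
      apply Rmult_le_compat_l; lra. }
    lra. }
  pose proof (Rabs_pos (c - 1)).
  assert (Rabs (c - 1) = 0)%R by lra. destruct (Req_dec (c - 1) 0) as [Q|Q]; [lra|].
  apply Rabs_no_R0 in Q. contradiction.
Qed.

(** The pair added to [hY] is [log (x / 16)] on the branch with argument [4 phi]. *)
Lemma hY_asymptotics : exists K d, (0 < K)%R /\ (0 < d < 1)%R /\
  forall rho phi, (0 < rho < 1)%R -> (rho ^ 4 < d)%R -> (- (PI / 4) <= phi <= PI / 4)%R ->
   (Cmod (hY (rho * cis phi) + ((4 * ln rho - ln 16)%R, (4 * phi)%R)) <= K * rho ^ 4)%R.
Proof.
  destruct hmu_bound as [K1 [d1 [PK1 [Hd1 Hmu]]]].
  destruct hY_real_asymptotics as [K2 [d2 [PK2 [Hd2 Has]]]].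
  pose proof PI_RGT_0. rewrite nome_const_1 in Has.
  exists (4 * K1 * (PI / 4) + K2)%R, (Rmin d1 d2).
  pose proof (Rmin_l d1 d2). pose proof (Rmin_r d1 d2).
  assert (0 < Rmin d1 d2)%R by (apply Rmin_pos; lra).
  split; [nra|]. split; [lra|]. intros rho phi Hr Hr4 Hp.
  pose proof (hY_vertical K1 d1 rho phi ltac:(lra) Hd1 Hmu Hr ltac:(lra) Hp) as V.
  rewrite nome_const_1 in V. rewrite Rabs_R1 in V.
  specialize (Has rho Hr ltac:(lra)).
  replace (hY (rho * cis phi) + ((4 * ln rho - ln 16)%R, (4 * phi)%R)) with
    ((hY (rho * cis phi) + 4 * 1%R * (Ci * phi) - hY rho)
     + RtoC (Re (hY rho) + 4 * 1 * ln rho - 1 * ln 16)%R).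
  - eapply Rle_trans; [apply Cmod_triangle|]. rewrite Cmod_R.
    assert (Rabs phi <= PI / 4)%R by (apply Rabs_le; lra).
    assert (0 < rho ^ 4)%R by (apply pow_lt; lra).
    assert (4 * 1 * K1 * rho ^ 4 * Rabs phi <= 4 * 1 * K1 * rho ^ 4 * (PI / 4))%R
      by (apply Rmult_le_compat_l; nra). lra.
  - rewrite (hY_real rho).
    apply C_ext; unfold Re, Im, Ci, Cminus, Cplus, Copp, Cmult, RtoC; simpl; ring.
Qed.

End Nome.

(** * Symmetric sums over the integers *)

(** The symmetric window makes odd summands cancel exactly at every truncation, so sums of
    hyperbolic cotangents, which do not converge absolutely, leave only boundary terms. *)
Fixpoint zsum (f : Z -> C) (N : nat) : C :=
  match N with
  | O => f 0%Z
  | S m => zsum f m + (f (Z.of_nat (S m)) + f (- Z.of_nat (S m))%Z)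
  end.

Lemma zsum_ext f g N : (forall k, (Z.abs k <= Z.of_nat N)%Z -> f k = g k) -> zsum f N = zsum g N.
Proof.
  induction N as [|N IH]; intros H; cbn [zsum].
  - apply H. simpl. lia.
  - rewrite IH by (intros; apply H; lia). rewrite !H by lia. reflexivity.
Qed.

Lemma zsum_plus f g N : zsum (fun k => f k + g k) N = zsum f N + zsum g N.
Proof. induction N as [|N IH]; cbn [zsum]; [ring|]. rewrite IH. ring. Qed.

Lemma zsum_scal c f N : zsum (fun k => c * f k) N = c * zsum f N.
Proof. induction N as [|N IH]; cbn [zsum]; [ring|]. rewrite IH. ring. Qed.

Lemma zsum_reflect f N : zsum (fun k => f (- k)%Z) N = zsum f N.
Proof.
  induction N as [|N IH]; cbn [zsum]; [reflexivity|]. rewrite IH, Z.opp_involutive. ring.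
Qed.

Lemma zsum_odd f N : (forall k, f (- k)%Z = - f k) -> zsum f N = 0.
Proof.
  intros H. pose proof (zsum_reflect f N) as E.
  rewrite (zsum_ext _ (fun k => (-(1)) * f k)) in E by (intros; rewrite H; ring).
  rewrite zsum_scal in E.
  replace (zsum f N) with ((zsum f N - (-(1)) * zsum f N) / 2) by field. rewrite E. field.
Qed.

Lemma zsum_even f N : (forall k, f (- k)%Z = f k) ->
  zsum f N = f 0%Z + 2 * csum (fun i => f (Z.of_nat (S i))) N.
Proof.
  intros H. induction N as [|N IH]; cbn [zsum csum]; [ring|]. rewrite IH, H. ring.
Qed.

Lemma zsum_shift1 f N :
  zsum (fun k => f (k + 1)%Z) N = zsum f N + f (Z.of_nat N + 1)%Z - f (- Z.of_nat N)%Z.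
Proof.
  induction N as [|N IH]; cbn [zsum].
  - simpl. ring.
  - rewrite IH. replace (Z.of_nat N + 1)%Z with (Z.of_nat (S N)) by lia.
    replace (- Z.of_nat (S N) + 1)%Z with (- Z.of_nat N)%Z by lia. ring.
Qed.

Lemma zsum_shift f N n :
  zsum (fun k => f (k + Z.of_nat n)%Z) N = zsum f N +
    csum (fun i => f (Z.of_nat N + 1 + Z.of_nat i)%Z - f (- Z.of_nat N + Z.of_nat i)%Z) n.
Proof.
  revert f. induction n as [|n IH]; intros f; cbn [csum].
  - rewrite (zsum_ext _ f) by (intros; f_equal; lia). ring.
  - rewrite (zsum_ext _ (fun k => (fun j => f (j + Z.of_nat n)%Z) (k + 1)%Z))
      by (intros; f_equal; lia).
    rewrite (zsum_shift1 (fun j => f (j + Z.of_nat n)%Z)), IH.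
    ring.
Qed.

Lemma zsum_Cmod f N (B : R) : (forall k, (Z.abs k <= Z.of_nat N)%Z -> (Cmod (f k) <= B)%R) ->
  (Cmod (zsum f N) <= (2 * INR N + 1) * B)%R.
Proof.
  induction N as [|N IH]; intros H; cbn [zsum].
  - simpl. rewrite Rmult_0_r, Rplus_0_l, Rmult_1_l. apply H. simpl. lia.
  - eapply Rle_trans; [apply Cmod_triangle|].
    eapply Rle_trans; [apply Rplus_le_compat_l, Cmod_triangle|].
    pose proof (IH ltac:(intros; apply H; lia)).
    pose proof (H (Z.of_nat (S N)) ltac:(lia)). pose proof (H (- Z.of_nat (S N))%Z ltac:(lia)).
    rewrite S_INR. lra.
Qed.

Lemma csum_Cmod_le f n (B : R) : (forall i, (i < n)%nat -> (Cmod (f i) <= B)%R) ->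
  (Cmod (csum f n) <= INR n * B)%R.
Proof.
  induction n as [|n IH]; intros H; cbn [csum].
  - simpl. rewrite Cmod_0. lra.
  - eapply Rle_trans; [apply Cmod_triangle|].
    pose proof (IH ltac:(intros; apply H; lia)). pose proof (H n ltac:(lia)).
    rewrite S_INR. lra.
Qed.

Lemma zsum_swap (f : Z -> Z -> C) M N :
  zsum (fun j => zsum (fun k => f j k) N) M = zsum (fun k => zsum (fun j => f j k) M) N.
Proof.
  induction M as [|M IH]; cbn [zsum]; [reflexivity|]. rewrite IH, !zsum_plus. reflexivity.
Qed.

Lemma zsum_minus f g N : zsum (fun k => f k - g k) N = zsum f N - zsum g N.
Proof. induction N as [|N IH]; cbn [zsum]; [ring|]. rewrite IH. ring. Qed.

Lemma zsum_indicator (f : Z -> C) (n : Z) N : (Z.abs n <= Z.of_nat N)%Z ->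
  zsum (fun k => if Z.eq_dec k n then f k else 0) N = f n.
Proof.
  revert n. induction N as [|N IH]; intros n H; cbn [zsum].
  - destruct (Z.eq_dec 0 n); [subst; auto | lia].
  - destruct (Z.eq_dec (Z.of_nat (S N)) n) as [E1|E1];
    destruct (Z.eq_dec (- Z.of_nat (S N))%Z n) as [E2|E2]; try lia.
    + rewrite (zsum_ext _ (fun _ => 0 * 0)), zsum_scal.
      * rewrite E1. ring.
      * intros k Hk. destruct (Z.eq_dec k n); [lia|ring].
    + rewrite (zsum_ext _ (fun _ => 0 * 0)), zsum_scal.
      * rewrite E2. ring.
      * intros k Hk. destruct (Z.eq_dec k n); [lia|ring].
    + rewrite IH by lia. ring.
Qed.

(** Shifting the window by [k] exchanges [|k|] terms at either end, and the indices concerned are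
    larger than [N - |k|] in absolute value. *)
Lemma zsum_shift_Z_bound (f : Z -> C) N (k : Z) (B : R) : (0 <= B)%R ->
  (Z.abs k <= Z.of_nat N)%Z ->
  (forall j, (Z.of_nat N - Z.abs k < Z.abs j <= 2 * Z.of_nat N)%Z -> (Cmod (f j) <= B)%R) ->
  (Cmod (zsum (fun j => f (j - k)%Z) N - zsum f N) <= 2 * INR N * B)%R.
Proof.
  intros HB Hk Hf.
  assert (P : forall (g : Z -> C) n, (n <= N)%nat ->
     (forall j, (Z.of_nat N - Z.of_nat n < Z.abs j <= 2 * Z.of_nat N)%Z -> (Cmod (g j) <= B)%R) ->
     (Cmod (zsum (fun j => g (j + Z.of_nat n)%Z) N - zsum g N) <= 2 * INR N * B)%R).
  { intros g n Hn Hg. rewrite zsum_shift.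
    match goal with |- (Cmod (?a + ?b - ?a) <= _)%R => replace (a + b - a) with b by ring end.
    eapply Rle_trans; [apply csum_Cmod_le with (B := (2 * B)%R)|].
    - intros i Hi. eapply Rle_trans; [apply Cmod_triangle_minus|].
      pose proof (Hg (Z.of_nat N + 1 + Z.of_nat i)%Z ltac:(lia)).
      pose proof (Hg (- Z.of_nat N + Z.of_nat i)%Z ltac:(lia)). lra.
    - apply le_INR in Hn. nra. }
  destruct (Z.le_gt_cases 0 k) as [L|L].
  - rewrite <- (zsum_reflect f), <- zsum_reflect.
    rewrite (zsum_ext _ (fun j => (fun i => f (- i)%Z) (j + Z.of_nat (Z.to_nat k))%Z))
      by (intros; f_equal; lia).
    apply (P (fun i => f (- i)%Z)); [lia|]. intros j Hj. apply Hf. lia.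
  - rewrite (zsum_ext _ (fun j => f (j + Z.of_nat (Z.to_nat (- k)))%Z))
      by (intros; f_equal; lia).
    apply (P f); [lia|]. intros j Hj. apply Hf. lia.
Qed.

Lemma Clim_poly_geom p K r : (0 <= r < 1)%R ->
  is_lim_seq (fun N => K * ((INR N + 1) ^ p * r ^ N))%R 0.
Proof. intros Hr. apply ex_series_lim_0. apply ex_series_poly_geom. auto. Qed.

Lemma Cmod_IZR_le k N : (Z.abs k <= Z.of_nat N)%Z -> (Rabs (IZR k) <= INR N)%R.
Proof.
  intros H. rewrite <- abs_IZR, INR_IZR_INZ. apply IZR_le. auto.
Qed.

(** The box [|j|, |k| <= N] and the sheared box [|j + k|, |k| <= N] differ only where
    [|j| + |k| > N]. *)
Lemma shear_limit (w P : Z -> C) (K r : R) : (0 <= K)%R -> (0 <= r < 1)%R ->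
  (forall j, (Cmod (w j) <= K * (Rabs (IZR j) + 1) * r ^ Z.abs_nat j)%R) ->
  (forall n, (Cmod (P n) <= (Rabs (IZR n) + 1) ^ 4)%R) ->
  Clim (fun N => zsum (fun j => zsum (fun k => P (j + k)%Z * (w j * w k)) N) N
     - zsum (fun n => P n * zsum (fun k => w (n - k)%Z * w k) N) N) 0.
Proof.
  intros HK Hr Hw HP.
  (* The bound [B] has the constant [3 * 3 * 4^4 = 2304] and the power [X^6]; the number of
     exchanged terms is at most [4 * X^2], and 9216 is rounded up. *)
  apply Clim_le with (fun N => 10000 * K * K * ((INR N + 1) ^ 8 * r ^ N))%R;
    [|apply Clim_poly_geom; auto].
  intros N. pose proof (pos_INR N) as PN.
  set (X := (INR N + 1)%R). assert (HX : (1 <= X)%R) by (unfold X; lra).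
  assert (Rn : (0 <= r ^ N)%R) by (apply pow_le; lra).
  rewrite (zsum_ext (fun n => P n * zsum (fun k => w (n - k)%Z * w k) N)
    (fun n => zsum (fun k => P n * (w (n - k)%Z * w k)) N))
    by (intros; symmetry; apply zsum_scal).
  rewrite (zsum_swap (fun j k => P (j + k)%Z * (w j * w k))).
  rewrite (zsum_swap (fun n k => P n * (w (n - k)%Z * w k))).
  rewrite <- zsum_minus.
  match goal with |- (Cmod (?a - ?b) <= _)%R => replace (a - b) with a by ring end.
  set (B := (K * (3 * X) * (K * (3 * X)) * (4 * X) ^ 4 * r ^ N)%R).
  assert (HB : (0 <= B)%R) by (unfold B; repeat apply Rmult_le_pos; try lra; apply pow_le; lra).
  eapply Rle_trans; [apply zsum_Cmod with (B := (2 * INR N * B)%R)|].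
  - intros k Hk. rewrite Cmod_minus_sym.
    rewrite (zsum_ext (fun n => P n * (w (n - k)%Z * w k))
      (fun n => (fun j => P (j + k)%Z * (w j * w k)) (n - k)%Z))
      by (intros n _; f_equal; f_equal; lia).
    apply (zsum_shift_Z_bound (fun j => P (j + k)%Z * (w j * w k))); auto. intros j Hj.
    assert (Ej : (Rabs (IZR j) <= 2 * INR N)%R).
    { rewrite <- abs_IZR, INR_IZR_INZ, <- mult_IZR. apply IZR_le. lia. }
    assert (Ek : (Rabs (IZR k) <= INR N)%R) by (apply Cmod_IZR_le; auto).
    rewrite !Cmod_mult. unfold B.
    assert (Ep : (Cmod (P (j + k)%Z) <= (4 * X) ^ 4)%R).
    { eapply Rle_trans; [apply HP|]. apply pow_incr.
      rewrite plus_IZR. pose proof (Rabs_triang (IZR j) (IZR k)).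
      pose proof (Rabs_pos (IZR j + IZR k)). unfold X. lra. }
    assert (Ew : (Cmod (w j) * Cmod (w k) <= K * (3 * X) * (K * (3 * X)) * r ^ N)%R).
    { apply Rle_trans with ((K * (3 * X) * r ^ Z.abs_nat j) * (K * (3 * X) * r ^ Z.abs_nat k))%R.
      - assert (forall i, (Rabs (IZR i) <= 2 * INR N)%R ->
          (Cmod (w i) <= K * (3 * X) * r ^ Z.abs_nat i)%R).
        { intros i Hi. eapply Rle_trans; [apply Hw|].
          apply Rmult_le_compat_r; [apply pow_le; lra|].
          apply Rmult_le_compat_l; auto. unfold X. lra. }
        apply Rmult_le_compat; try apply Cmod_ge_0; apply H; lra.
      - replace ((K * (3 * X) * r ^ Z.abs_nat j) * (K * (3 * X) * r ^ Z.abs_nat k))%R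
          with (K * (3 * X) * (K * (3 * X)) * r ^ (Z.abs_nat j + Z.abs_nat k))%R
          by (rewrite pow_add; ring).
        apply Rmult_le_compat_l; [repeat apply Rmult_le_pos; lra|].
        replace (Z.abs_nat j + Z.abs_nat k)%nat with (N + (Z.abs_nat j + Z.abs_nat k - N))%nat by lia.
        rewrite pow_add.
        assert (r ^ (Z.abs_nat j + Z.abs_nat k - N) <= 1)%R
          by (rewrite <- (pow1 (Z.abs_nat j + Z.abs_nat k - N)); apply pow_incr; lra).
        assert (0 <= r ^ (Z.abs_nat j + Z.abs_nat k - N))%R by (apply pow_le; lra). nra. }
    rewrite (Rmult_comm (Cmod (P _))).
    replace (K * (3 * X) * (K * (3 * X)) * (4 * X) ^ 4 * r ^ N)%R
      with (K * (3 * X) * (K * (3 * X)) * r ^ N * (4 * X) ^ 4)%R by ring.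
    apply Rmult_le_compat; auto; [|apply Cmod_ge_0].
    apply Rmult_le_pos; apply Cmod_ge_0.
  - unfold B.
    replace ((2 * INR N + 1) * (2 * INR N * (K * (3 * X) * (K * (3 * X)) * (4 * X) ^ 4 * r ^ N)))%R
      with (K * K * r ^ N * X ^ 6 * (2304 * (2 * INR N + 1) * (2 * INR N)))%R by ring.
    replace (10000 * K * K * (X ^ 8 * r ^ N))%R with (K * K * r ^ N * X ^ 6 * (10000 * X * X))%R by ring.
    assert (0 <= X ^ 6)%R by (apply pow_le; lra). apply Rmult_le_compat_l; [repeat apply Rmult_le_pos; lra|].
    unfold X. nra.
Qed.

(** * Lambert series *)

Definition Ccosh (u : C) : C := (Cexp u + Cexp (- u)) / 2.

Lemma Csinh_plus u v : Csinh (u + v) = Csinh u * Ccosh v + Ccosh u * Csinh v.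
Proof.
  unfold Csinh, Ccosh. replace (- (u + v)) with (- u + - v) by ring. rewrite !Cexp_plus. field.
Qed.

Lemma Csinh_opp u : Csinh (- u) = - Csinh u.
Proof. unfold Csinh. replace (- - u) with u by ring. field. Qed.

Lemma Ccosh_opp u : Ccosh (- u) = Ccosh u.
Proof. unfold Ccosh. replace (- - u) with u by ring. field. Qed.

Lemma coth_minus_1 u : Csinh u <> 0 -> Ccosh u / Csinh u - 1 = Cexp (- u) * / Csinh u.
Proof.
  intros H. replace (Ccosh u) with (Csinh u + Cexp (- u)) by (unfold Ccosh, Csinh; field).
  field. auto.
Qed.

(** The fraction bounds [csch (n v)] relative to [exp (- s) ^ n]; the extra 1 lets the same constant
    bound [coth (n v)] and be at least 1. *)
Definition csch_const (s : R) : R := (2 / (1 - exp (- s) * exp (- s)) + 1)%R.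

Lemma csch_coth_bounds (s : R) : (0 < s)%R -> let K := csch_const s in (1 <= K)%R /\
  forall n v, (1 <= n)%nat -> (s <= Re v)%R ->
    Csinh (INR n * v) <> 0 /\
    (Cmod (/ Csinh (INR n * v)) <= K * exp (- s) ^ n)%R /\
    (Cmod (Ccosh (INR n * v) / Csinh (INR n * v) - 1) <= K * exp (- s) ^ n)%R /\
    (Cmod (Ccosh (INR n * v) / Csinh (INR n * v)) <= K)%R.
Proof.
  intros Hs K. unfold K, csch_const. set (r := exp (- s)).
  assert (Hr : (0 < r < 1)%R).
  { split; [apply exp_pos|]. unfold r. rewrite <- exp_0. apply exp_increasing. lra. }
  assert (P2 : (0 < 2 / (1 - r * r))%R) by (apply Rdiv_lt_0_compat; nra).
  split; [lra|]. intros n v Hn Hv. set (u := INR n * v).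
  assert (Eu : (Cmod (Cexp (- u)) <= r ^ n)%R).
  { unfold u. replace (- (INR n * v)) with (INR n * (- v)) by ring.
    rewrite Cexp_INR, Cmod_pow, Cmod_Cexp. apply pow_incr. split; [left; apply exp_pos|].
    unfold r. change (Re (- v)) with (- Re v)%R.
    destruct Hv as [Hv|Hv]; [left; apply exp_increasing; lra | rewrite Hv; lra]. }
  assert (Rn : (0 < r ^ n <= r)%R).
  { split; [apply pow_lt; lra|]. destruct n as [|n]; [lia|]. simpl.
    assert (0 < r ^ n)%R by (apply pow_lt; lra).
    assert (r ^ n <= 1)%R by (rewrite <- (pow1 n); apply pow_incr; lra). nra. }
  set (E := Cexp (- u)) in *.
  assert (Ne : E <> 0) by apply Cexp_neq_0.
  assert (EE : (Cmod (E * E) <= r * r)%R).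
  { rewrite Cmod_mult. pose proof (Cmod_ge_0 E). nra. }
  assert (D : (1 - r * r <= Cmod (1 - E * E))%R).
  { pose proof (Cmod_triangle_rev 1 (E * E)) as T. rewrite Cmod_1 in T. lra. }
  assert (ND : 1 - E * E <> 0) by (apply Cmod_gt_0; nra).
  assert (Sh : Csinh u = (1 - E * E) / (2 * E)).
  { unfold Csinh. replace (Cexp u) with (/ E).
    - fold E. field. auto.
    - unfold E. rewrite Cexp_opp. field. apply Cexp_neq_0. }
  assert (N2 : RtoC 2 <> 0) by (intros Q; injection Q; lra).
  assert (NS : Csinh u <> 0).
  { rewrite Sh. apply Cmult_neq_0; auto. apply Cmod_gt_0. rewrite Cmod_inv.
    - apply Rinv_0_lt_compat, Cmod_gt_0. apply Cmult_neq_0; auto.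
    - apply Cmult_neq_0; auto. }
  assert (B1 : (Cmod (/ Csinh u) <= 2 / (1 - r * r) * r ^ n)%R).
  { rewrite Sh. replace (/ ((1 - E * E) / (2 * E))) with (2 * E / (1 - E * E)) by (field; auto).
    rewrite Cmod_div, Cmod_mult, Cmod_R, Rabs_pos_eq by (auto; lra).
    replace (2 / (1 - r * r) * r ^ n)%R with (2 * r ^ n * / (1 - r * r))%R by (field; nra).
    pose proof (Cmod_ge_0 E).
    apply Rmult_le_compat; [lra| |lra|].
    - left. apply Rinv_0_lt_compat. nra.
    - apply Rinv_le_contravar; nra. }
  assert (B2 : (Cmod (Ccosh u / Csinh u - 1) <= 2 / (1 - r * r) * r ^ n)%R).
  { rewrite coth_minus_1 by auto. rewrite Cmod_mult. fold E.
    pose proof (Cmod_ge_0 (/ Csinh u)). pose proof (Cmod_ge_0 E). nra. }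
  split; auto. split; [|split].
  - nra.
  - nra.
  - pose proof (Cmod_triangle (Ccosh u / Csinh u - 1) 1) as T.
    replace (Ccosh u / Csinh u - 1 + 1) with (Ccosh u / Csinh u) in T by ring.
    rewrite Cmod_1 in T. nra.
Qed.

Definition pm (k : Z) : C := if Z.even k then 1 else -(1).

Lemma pm_plus j k : pm (j + k) = pm j * pm k.
Proof.
  unfold pm. rewrite Z.even_add. destruct (Z.even j), (Z.even k); simpl; ring.
Qed.

Lemma pm_opp k : pm (- k) = pm k.
Proof. unfold pm. rewrite Z.even_opp. auto. Qed.

Lemma Cmod_pm k : Cmod (pm k) = 1%R.
Proof. unfold pm. destruct (Z.even k); [apply Cmod_1 | apply Cmod_m1]. Qed.

Lemma pm_nat m : pm (Z.of_nat m) = (-(1)) ^ m.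
Proof.
  induction m as [|m IH]; [reflexivity|].
  replace (Z.of_nat (S m)) with (1 + Z.of_nat m)%Z by lia. rewrite pm_plus, IH. reflexivity.
Qed.

(** The coefficient [(-1)^(k-1) / sinh (k y)] continued to all integers as an odd function, with the
    value 0 at the pole [k = 0]. *)
Definition zb (y : C) (k : Z) : C :=
  if Z.eq_dec k 0 then 0 else - pm k / Csinh (IZR k * y).

Definition zc (y : C) (k : Z) : C :=
  if Z.eq_dec k 0 then 0 else Ccosh (IZR k * y) / Csinh (IZR k * y).

(** [LS p] is S_p. Differentiation sends [LS p] to minus [LU (S p)] and [LT] to minus [LV]; in [LT]
    the limit 1 of the hyperbolic cotangent is subtracted to obtain convergence. *)
Definition LS (p : nat) (y : C) : C :=
  CSer (fun i => INR (S i) ^ p * zb y (Z.of_nat (S i))).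
Definition LU (p : nat) (y : C) : C :=
  CSer (fun i => INR (S i) ^ p * (zb y (Z.of_nat (S i)) * zc y (Z.of_nat (S i)))).
Definition LT (y : C) : C := CSer (fun i => INR (S i) * (zc y (Z.of_nat (S i)) - 1)).
Definition LV (y : C) : C :=
  CSer (fun i => INR (S i) ^ 2 * (zb y (Z.of_nat (S i)) * zb y (Z.of_nat (S i)))).

Lemma zb_nat y i : zb y (Z.of_nat (S i)) = (-(1)) ^ i / Csinh (INR (S i) * y).
Proof.
  unfold zb. destruct (Z.eq_dec (Z.of_nat (S i)) 0); [lia|].
  rewrite pm_nat, <- INR_IZR_INZ. simpl Cpow. unfold Cdiv. ring.
Qed.

Lemma zc_nat y i : zc y (Z.of_nat (S i)) = Ccosh (INR (S i) * y) / Csinh (INR (S i) * y).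
Proof.
  unfold zc. destruct (Z.eq_dec (Z.of_nat (S i)) 0); [lia|]. rewrite <- INR_IZR_INZ. auto.
Qed.

Section Lambert.
Variables (y : C) (K r : R).
Hypotheses (HK : (1 <= K)%R) (Hr : (0 < r < 1)%R).
Hypothesis Hsinh : forall n, (1 <= n)%nat -> Csinh (INR n * y) <> 0.
Hypothesis Hb : forall n, (1 <= n)%nat -> (Cmod (/ Csinh (INR n * y)) <= K * r ^ n)%R.
Hypothesis Hc1 : forall n, (1 <= n)%nat ->
  (Cmod (Ccosh (INR n * y) / Csinh (INR n * y) - 1) <= K * r ^ n)%R.
Hypothesis Hc : forall n, (1 <= n)%nat -> (Cmod (Ccosh (INR n * y) / Csinh (INR n * y)) <= K)%R.

Lemma Csinh_IZR_neq_0 k : k <> 0%Z -> Csinh (IZR k * y) <> 0.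
Proof.
  intros Hk. destruct (Z.le_gt_cases 0 k) as [L|L].
  - replace k with (Z.of_nat (Z.to_nat k)) by lia. rewrite <- INR_IZR_INZ. apply Hsinh. lia.
  - replace (IZR k * y) with (- (INR (Z.to_nat (- k)) * y)).
    + rewrite Csinh_opp. intros E. apply (Hsinh (Z.to_nat (- k))); [lia|].
      replace (Csinh (INR (Z.to_nat (- k)) * y)) with (- - Csinh (INR (Z.to_nat (- k)) * y)) by ring.
      rewrite E. ring.
    + rewrite INR_IZR_INZ. replace (Z.of_nat (Z.to_nat (- k))) with (- k)%Z by lia.
      rewrite opp_IZR, RtoC_opp. ring.
Qed.

Lemma zb_opp k : zb y (- k) = - zb y k.
Proof.
  unfold zb. destruct (Z.eq_dec k 0) as [->|N]; [simpl; ring|].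
  destruct (Z.eq_dec (- k) 0); [lia|].
  rewrite pm_opp, opp_IZR, RtoC_opp. replace (- IZR k * y) with (- (IZR k * y)) by ring.
  rewrite Csinh_opp. pose proof (Csinh_IZR_neq_0 k N). field. auto.
Qed.

Lemma zc_opp k : zc y (- k) = - zc y k.
Proof.
  unfold zc. destruct (Z.eq_dec k 0) as [->|N]; [simpl; ring|].
  destruct (Z.eq_dec (- k) 0); [lia|].
  rewrite opp_IZR, RtoC_opp. replace (- IZR k * y) with (- (IZR k * y)) by ring.
  rewrite Csinh_opp, Ccosh_opp. pose proof (Csinh_IZR_neq_0 k N). field. auto.
Qed.

Lemma zb_0 : zb y 0 = 0.
Proof. reflexivity. Qed.

Lemma zc_0 : zc y 0 = 0.
Proof. reflexivity. Qed.

Lemma zb_bound k : (Cmod (zb y k) <= K * r ^ Z.abs_nat k)%R.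
Proof.
  assert (P : forall n, (Cmod (zb y (Z.of_nat n)) <= K * r ^ n)%R).
  { intros [|i].
    - change (Z.of_nat 0) with 0%Z. rewrite zb_0, Cmod_0. simpl. lra.
    - rewrite zb_nat. unfold Cdiv. rewrite Cmod_mult, <- pm_nat, Cmod_pm, Rmult_1_l.
      apply Hb. lia. }
  destruct (Z.le_gt_cases 0 k) as [L|L].
  - replace k with (Z.of_nat (Z.abs_nat k)) at 1 by lia. auto.
  - replace k with (- Z.of_nat (Z.abs_nat k))%Z at 1 by lia. rewrite zb_opp, Cmod_opp. auto.
Qed.

Lemma zc1_bound n : (1 <= n)%nat -> (Cmod (zc y (Z.of_nat n) - 1) <= K * r ^ n)%R.
Proof. intros H. destruct n as [|i]; [lia|]. rewrite zc_nat. auto. Qed.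

Lemma zc_bound n : (1 <= n)%nat -> (Cmod (zc y (Z.of_nat n)) <= K)%R.
Proof. intros H. destruct n as [|i]; [lia|]. rewrite zc_nat. auto. Qed.

(** [csch A csch B = csch (A + B) (coth A + coth B)]; the convention [zb 0 = zc 0 = 0]
    makes the correction terms at [k = 0] and [k = n] explicit. *)
Lemma zb_mult n k : n <> 0%Z ->
  zb y (n - k) * zb y k = - zb y n * (zc y (n - k) + zc y k)
    + (if Z.eq_dec k 0 then zb y n * zc y n else 0)
    + (if Z.eq_dec k n then zb y n * zc y n else 0).
Proof.
  intros Hn. destruct (Z.eq_dec k 0) as [->|N0].
  - destruct (Z.eq_dec 0 n); [lia|]. rewrite Z.sub_0_r, zb_0, zc_0. ring.
  - destruct (Z.eq_dec k n) as [->|Nn].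
    + rewrite Z.sub_diag, zb_0, zc_0. ring.
    + unfold zb, zc. destruct (Z.eq_dec (n - k) 0); [lia|].
      destruct (Z.eq_dec k 0); [lia|]. destruct (Z.eq_dec n 0); [lia|].
      assert (E : IZR n * y = IZR (n - k) * y + IZR k * y)
        by (rewrite minus_IZR, RtoC_minus; ring).
      pose proof (Csinh_IZR_neq_0 (n - k) ltac:(lia)) as S1.
      pose proof (Csinh_IZR_neq_0 k ltac:(lia)) as S2.
      pose proof (Csinh_IZR_neq_0 n ltac:(lia)) as S3.
      replace (pm n) with (pm (n - k) * pm k) by (rewrite <- pm_plus; f_equal; lia).
      rewrite E, Csinh_plus in *. field. auto.
Qed.

(** * Truncated convolutions of the coefficients *)

Definition conv (w : Z -> C) (N : nat) (n : Z) : C := zsum (fun k => w (n - k)%Z * w k) N.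

Definition za (k : Z) : C := IZR k * zb y k.

Lemma za_opp k : za (- k) = za k.
Proof. unfold za. rewrite zb_opp, opp_IZR, RtoC_opp. ring. Qed.

Lemma conv_opp w N n : (forall j k, w (- j)%Z * w (- k)%Z = w j * w k) ->
  conv w N (- n) = conv w N n.
Proof.
  intros H. unfold conv. rewrite <- zsum_reflect. apply zsum_ext. intros k _.
  rewrite <- (H (n - k)%Z k). f_equal. f_equal. lia.
Qed.

(** The boundary terms produced when the symmetric window of a hyperbolic cotangent sum is shifted
    by [n]; each tends to 1, so the sum tends to [2 n]. *)
Definition shift_c (N n : nat) : C :=
  csum (fun i => zc y (Z.of_nat (N + 1 + i)) + zc y (Z.of_nat (N - i))) n.

(** By oddness the interior cotangent sums vanish. What survives is the boundary contribution
    [shift_c] and the two corrections from the poles [k = 0] and [k = n]. *)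
Lemma conv_zb N n : (1 <= n <= N)%nat ->
  conv (zb y) N (Z.of_nat n) = - zb y (Z.of_nat n) * (shift_c N n - 2 * zc y (Z.of_nat n)).
Proof.
  intros Hn. unfold conv. set (m := Z.of_nat n).
  rewrite (zsum_ext _ (fun k => - zb y m * (zc y (m - k)%Z + zc y k)
    + (if Z.eq_dec k 0 then (fun _ => zb y m * zc y m) k else 0)
    + (if Z.eq_dec k m then (fun _ => zb y m * zc y m) k else 0)))
    by (intros; apply zb_mult; lia).
  rewrite !zsum_plus, zsum_scal, zsum_plus.
  rewrite (zsum_indicator (fun _ => zb y m * zc y m) 0) by lia.
  rewrite (zsum_indicator (fun _ => zb y m * zc y m) m) by lia.
  rewrite (zsum_odd (fun k => zc y k)) by apply zc_opp.
  rewrite <- (zsum_reflect (fun k => zc y (m - k)%Z)).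
  rewrite (zsum_ext (fun k => zc y (m - - k)%Z) (fun k => zc y (k + Z.of_nat n)%Z))
    by (intros; f_equal; lia).
  rewrite zsum_shift. rewrite (zsum_odd (fun k => zc y k)) by apply zc_opp.
  rewrite (csum_ext _ (fun i => zc y (Z.of_nat (N + 1 + i)) + zc y (Z.of_nat (N - i)))).
  - fold (shift_c N n). ring.
  - intros i Hi. replace (- Z.of_nat N + Z.of_nat i)%Z with (- Z.of_nat (N - i))%Z by lia.
    rewrite zc_opp. replace (Z.of_nat N + 1 + Z.of_nat i)%Z with (Z.of_nat (N + 1 + i)) by lia. ring.
Qed.

Lemma pow_decr m n : (m <= n)%nat -> (r ^ n <= r ^ m)%R.
Proof.
  intros H. replace n with (m + (n - m))%nat by lia. rewrite pow_add.
  assert (0 <= r ^ m)%R by (apply pow_le; lra).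
  assert (r ^ (n - m) <= 1)%R by (rewrite <- (pow1 (n - m)); apply pow_incr; lra). nra.
Qed.

Lemma csum_const c n : csum (fun _ => c) n = INR n * c.
Proof.
  induction n as [|n IH]; cbn [csum]; [simpl; ring|]. rewrite IH, S_INR, RtoC_plus. ring.
Qed.

Lemma csum_minus f g n : csum (fun i => f i - g i) n = csum f n - csum g n.
Proof. induction n as [|n IH]; simpl; [ring|]. rewrite IH. ring. Qed.

Lemma shift_c_bound N n : (1 <= n <= N)%nat ->
  (Cmod (shift_c N n - 2 * INR n) <= INR n * (2 * (K * r ^ (N - n))))%R.
Proof.
  intros Hn. unfold shift_c.
  replace (2 * INR n) with (csum (fun _ => RtoC 2) n) by (rewrite csum_const; ring).
  rewrite <- csum_minus. apply csum_Cmod_le. intros i Hi.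
  match goal with |- (Cmod (?a + ?b - _) <= _)%R =>
    replace (a + b - 2) with ((a - 1) + (b - 1)) by ring end.
  eapply Rle_trans; [apply Cmod_triangle|].
  pose proof (zc1_bound (N + 1 + i) ltac:(lia)). pose proof (zc1_bound (N - i) ltac:(lia)).
  pose proof (pow_decr (N - n) (N + 1 + i) ltac:(lia)).
  pose proof (pow_decr (N - n) (N - i) ltac:(lia)). nra.
Qed.

Definition shift_k (N n : nat) : C :=
  csum (fun i => INR (N + 1 + i) * (INR n - INR (N + 1 + i)) * zc y (Z.of_nat (N + 1 + i))
     - INR (N - i) * (INR n + INR (N - i)) * zc y (Z.of_nat (N - i))) n.

Definition sum_kc (N : nat) : C := csum (fun i => INR (S i) * (zc y (Z.of_nat (S i)) - 1)) N.

Lemma sum_k N : csum (fun i => RtoC (INR (S i))) N = INR N * (INR N + 1) / 2.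
Proof.
  induction N as [|N IH]; cbn [csum]; [simpl; field|]. rewrite IH, S_INR, RtoC_plus. field.
Qed.

Lemma RtoC_IZR_nat n : RtoC (IZR (Z.of_nat n)) = INR n.
Proof. rewrite INR_IZR_INZ. auto. Qed.

(** The weighted cotangent sums diverge. Subtracting 1 from each cotangent isolates the convergent
    [sum_kc] and the explicit [N (N + 1)], whose growth [shift_k] cancels. *)
Lemma conv_za N n : (1 <= n <= N)%nat ->
  conv za N (Z.of_nat n) = - zb y (Z.of_nat n) *
    (4 * INR n * sum_kc N + 2 * INR n * INR N * (INR N + 1) + shift_k N n).
Proof.
  intros Hn. unfold conv. set (m := Z.of_nat n).
  set (g := fun k => IZR k * (IZR m - IZR k) * zc y k).
  rewrite (zsum_ext _ (fun k => - zb y m * (g (m - k)%Z + g k))).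
  - rewrite zsum_scal, zsum_plus.
    rewrite <- (zsum_reflect (fun k => g (m - k)%Z)).
    rewrite (zsum_ext (fun k => g (m - - k)%Z) (fun k => g (k + Z.of_nat n)%Z))
      by (intros; f_equal; lia).
    rewrite zsum_shift.
    assert (Eg : zsum g N = 2 * INR n * sum_kc N + INR n * INR N * (INR N + 1)).
    { rewrite (zsum_ext g (fun k => IZR m * (IZR k * zc y k) + (-(1)) * (IZR k * IZR k * zc y k)))
        by (intros; unfold g; ring).
      rewrite zsum_plus, !zsum_scal.
      rewrite (zsum_odd (fun k => IZR k * IZR k * zc y k))
        by (intros; rewrite zc_opp, opp_IZR, RtoC_opp; ring).
      rewrite (zsum_even (fun k => IZR k * zc y k))
        by (intros; rewrite zc_opp, opp_IZR, RtoC_opp; ring).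
      rewrite zc_0. unfold sum_kc.
      rewrite (csum_ext (fun i => INR (S i) * (zc y (Z.of_nat (S i)) - 1))
        (fun i => INR (S i) * zc y (Z.of_nat (S i)) - RtoC (INR (S i)))) by (intros; ring).
      rewrite csum_minus, sum_k. unfold m. rewrite RtoC_IZR_nat.
      rewrite (csum_ext (fun i => IZR (Z.of_nat (S i)) * zc y (Z.of_nat (S i)))
        (fun i => INR (S i) * zc y (Z.of_nat (S i)))) by (intros; rewrite RtoC_IZR_nat; auto).
      field. }
    rewrite Eg.
    rewrite (csum_ext _ (fun i => INR (N + 1 + i) * (INR n - INR (N + 1 + i)) * zc y (Z.of_nat (N + 1 + i))
     - INR (N - i) * (INR n + INR (N - i)) * zc y (Z.of_nat (N - i)))).
    + fold (shift_k N n). ring.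
    + intros i Hi. replace (- Z.of_nat N + Z.of_nat i)%Z with (- Z.of_nat (N - i))%Z by lia.
      replace (Z.of_nat N + 1 + Z.of_nat i)%Z with (Z.of_nat (N + 1 + i)) by lia.
      unfold g, m. rewrite zc_opp, opp_IZR, RtoC_opp, !RtoC_IZR_nat. ring.
  - intros k _. unfold za.
    replace (IZR (m - k) * zb y (m - k) * (IZR k * zb y k))
      with (IZR (m - k) * IZR k * (zb y (m - k) * zb y k)) by ring.
    rewrite zb_mult by lia. unfold g.
    replace (IZR m - IZR (m - k)) with (RtoC (IZR k)) by (rewrite minus_IZR, RtoC_minus; ring).
    replace (RtoC (IZR m) - IZR k) with (RtoC (IZR (m - k))) by (rewrite minus_IZR, RtoC_minus; ring).
    (* The weight [(n - k) k] removes both exceptional terms of [zb_mult]. *)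
    destruct (Z.eq_dec k 0) as [E0|N0]; [rewrite E0; destruct (Z.eq_dec 0 m); [lia|]; ring|].
    destruct (Z.eq_dec k m) as [E1|N1]; [rewrite E1, Z.sub_diag; ring | ring].
Qed.

(** This is the boundary sum with every hyperbolic cotangent replaced by its limit 1: all dependence
    on [N] cancels, and the cubic remainder is the source of the denominators 3 in the identities
    below. *)
Lemma shift_k_exact N n : (n <= N)%nat ->
  2 * INR n * INR N * (INR N + 1) +
  csum (fun i => INR (N + 1 + i) * (INR n - INR (N + 1 + i))
     - INR (N - i) * (INR n + INR (N - i))) n = (INR n ^ 3 - INR n) / 3.
Proof.
  intros Hn.
  (* The upper limit [m] is separated from the parameter [n] of the summand, so that induction on
     the length is possible. *)
  assert (P : forall m, (m <= N)%nat ->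
    csum (fun i => INR (N + 1 + i) * (INR n - INR (N + 1 + i))
     - INR (N - i) * (INR n + INR (N - i))) m =
    INR n * INR m ^ 2 - INR m * (2 * INR N * INR N + 2 * INR N + 1)
      - 2 * (INR m ^ 3 - INR m) / 3).
  { induction m as [|m IH]; intros Hm; cbn [csum]; [simpl; field|].
    rewrite IH by lia. rewrite !plus_INR, minus_INR by lia. simpl (INR 1).
    rewrite S_INR, !RtoC_plus, RtoC_minus. field. }
  rewrite P by lia. field.
Qed.

Lemma shift_k_bound N n : (1 <= n <= N)%nat ->
  (Cmod (2 * INR n * INR N * (INR N + 1) + shift_k N n - (INR n ^ 3 - INR n) / 3)%C
   <= INR n * (8 * (INR N + 1) ^ 2 * (K * r ^ (N - n))))%R.
Proof.
  intros Hn. rewrite <- (shift_k_exact N n) by lia. unfold shift_k.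
  match goal with |- (Cmod (?a + ?b - (?a + ?c)) <= _)%R =>
    replace (a + b - (a + c)) with (b - c) by ring end.
  rewrite <- csum_minus. apply csum_Cmod_le. intros i Hi.
  match goal with |- (Cmod (?a * ?b * ?c - ?d * ?e * ?f - (?a * ?b - ?d * ?e)) <= _)%R =>
    replace (a * b * c - d * e * f - (a * b - d * e))
      with (a * b * (c - 1) - d * e * (f - 1)) by ring end.
  eapply Rle_trans; [apply Cmod_triangle_minus|]. rewrite !Cmod_mult.
  pose proof (zc1_bound (N + 1 + i) ltac:(lia)) as Z1. pose proof (zc1_bound (N - i) ltac:(lia)) as Z2.
  pose proof (pow_decr (N - n) (N + 1 + i) ltac:(lia)).
  pose proof (pow_decr (N - n) (N - i) ltac:(lia)).
  assert (Pr : (0 <= r ^ (N - n))%R) by (apply pow_le; lra).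
  rewrite <- !RtoC_minus, <- !RtoC_plus, !Cmod_R.
  set (X := (INR N + 1)%R). pose proof (pos_INR N).
  assert (INR n <= INR N)%R by (apply le_INR; lia). pose proof (pos_INR n).
  assert (INR i <= INR N)%R by (apply le_INR; lia). pose proof (pos_INR i).
  assert (A1 : (Rabs (INR (N + 1 + i)) <= 2 * X)%R).
  { rewrite Rabs_pos_eq by apply pos_INR. rewrite !plus_INR. simpl (INR 1). unfold X. lra. }
  assert (A2 : (Rabs (INR n - INR (N + 1 + i)) <= 2 * X)%R).
  { apply Rabs_le. rewrite !plus_INR. simpl (INR 1). unfold X. lra. }
  assert (A3 : (Rabs (INR (N - i)) <= X)%R).
  { rewrite Rabs_pos_eq by apply pos_INR. rewrite minus_INR by lia. unfold X. lra. }
  assert (A4 : (Rabs (INR n + INR (N - i)) <= 2 * X)%R).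
  { apply Rabs_le. rewrite minus_INR by lia. unfold X. lra. }
  assert (B1 : (Rabs (INR (N + 1 + i)) * Rabs (INR n - INR (N + 1 + i))
      * Cmod (zc y (Z.of_nat (N + 1 + i)) - 1) <= 2 * X * (2 * X) * (K * r ^ (N - n)))%R).
  { repeat apply Rmult_le_compat; auto; try apply Cmod_ge_0; try apply Rabs_pos;
    [apply Rmult_le_pos; apply Rabs_pos | nra]. }
  assert (B2 : (Rabs (INR (N - i)) * Rabs (INR n + INR (N - i))
      * Cmod (zc y (Z.of_nat (N - i)) - 1) <= X * (2 * X) * (K * r ^ (N - n)))%R).
  { repeat apply Rmult_le_compat; auto; try apply Cmod_ge_0; try apply Rabs_pos;
    [apply Rmult_le_pos; apply Rabs_pos | nra]. }
  assert (0 <= K * r ^ (N - n))%R by (apply Rmult_le_pos; lra).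
  assert (0 <= X * X * (K * r ^ (N - n)))%R by (unfold X; apply Rmult_le_pos; nra).
  replace (8 * X ^ 2 * (K * r ^ (N - n)))%R with (8 * (X * X * (K * r ^ (N - n))))%R by ring.
  nra.
Qed.

(** * Convergence of the Lambert series *)

Lemma abs_nat_of_nat n : Z.abs_nat (Z.of_nat n) = n.
Proof. lia. Qed.

Lemma term_bound p (c : C) n B : (Cmod c <= B * r ^ n)%R -> (1 <= n)%nat -> (0 <= B)%R ->
  (Cmod (INR n ^ p * c) <= B * ((INR (n - 1) + 1) ^ p * r ^ (n - 1)))%R.
Proof.
  intros H Hn HB. rewrite Cmod_mult, Cmod_pow, Cmod_R, Rabs_pos_eq by apply pos_INR.
  destruct n as [|n]; [lia|]. rewrite Nat.sub_succ, Nat.sub_0_r, S_INR.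
  pose proof (pow_decr n (S n) ltac:(lia)).
  assert (0 <= (INR n + 1) ^ p)%R by (apply pow_le; pose proof (pos_INR n); lra).
  apply Rle_trans with ((INR n + 1) ^ p * (B * r ^ S n))%R; [apply Rmult_le_compat_l; auto|].
  replace (B * ((INR n + 1) ^ p * r ^ n))%R with ((INR n + 1) ^ p * (B * r ^ n))%R by ring.
  apply Rmult_le_compat_l; auto. apply Rmult_le_compat_l; auto.
Qed.

Lemma CSer_term_correct p (f : nat -> C) B : (0 <= B)%R ->
  (forall i, (Cmod (f i) <= B * r ^ S i)%R) ->
  Clim (csum (fun i => INR (S i) ^ p * f i)) (CSer (fun i => INR (S i) ^ p * f i)).
Proof.
  intros HB H. eapply CSer_correct; [|apply (ex_series_poly_geom p B r); lra].
  intros i. pose proof (term_bound p (f i) (S i) B (H i) ltac:(lia) HB) as T.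
  rewrite Nat.sub_succ, Nat.sub_0_r in T. exact T.
Qed.

Lemma LS_correct p : Clim (csum (fun i => INR (S i) ^ p * zb y (Z.of_nat (S i)))) (LS p y).
Proof.
  apply (CSer_term_correct p (fun i => zb y (Z.of_nat (S i))) K); [lra|]. intros i.
  pose proof (zb_bound (Z.of_nat (S i))) as B. rewrite abs_nat_of_nat in B. auto.
Qed.

Lemma LU_correct p :
  Clim (csum (fun i => INR (S i) ^ p * (zb y (Z.of_nat (S i)) * zc y (Z.of_nat (S i))))) (LU p y).
Proof.
  apply (CSer_term_correct p (fun i => zb y (Z.of_nat (S i)) * zc y (Z.of_nat (S i))) (K * K)); [nra|].
  intros i. pose proof (zb_bound (Z.of_nat (S i))) as B. rewrite abs_nat_of_nat in B.
  pose proof (zc_bound (S i) ltac:(lia)). rewrite Cmod_mult.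
  replace (K * K * r ^ S i)%R with ((K * r ^ S i) * K)%R by ring.
  apply Rmult_le_compat; auto; apply Cmod_ge_0.
Qed.

Lemma LT_correct : Clim sum_kc (LT y).
Proof.
  pose proof (CSer_term_correct 1 (fun i => zc y (Z.of_nat (S i)) - 1) K ltac:(lra)) as H.
  assert (E : forall i, INR (S i) ^ 1 * (zc y (Z.of_nat (S i)) - 1) = INR (S i) * (zc y (Z.of_nat (S i)) - 1))
    by (intros; ring).
  unfold LT. rewrite <- (CSer_ext _ _ E).
  eapply Clim_ext; [|apply H].
  - intros N. unfold sum_kc. apply csum_ext. intros; apply E.
  - intros i. apply zc1_bound. lia.
Qed.

Lemma LV_correct :
  Clim (csum (fun i => INR (S i) ^ 2 * (zb y (Z.of_nat (S i)) * zb y (Z.of_nat (S i))))) (LV y).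
Proof.
  apply (CSer_term_correct 2 (fun i => zb y (Z.of_nat (S i)) * zb y (Z.of_nat (S i))) (K * K)); [nra|].
  intros i. pose proof (zb_bound (Z.of_nat (S i))) as B. rewrite abs_nat_of_nat in B.
  rewrite Cmod_mult. pose proof (Cmod_ge_0 (zb y (Z.of_nat (S i)))).
  pose proof (pow_decr 0 (S i) ltac:(lia)) as D. simpl (r ^ 0)%R in D.
  assert (0 <= r ^ S i)%R by (apply pow_le; lra).
  replace (K * K * r ^ S i)%R with ((K * r ^ S i) * K)%R by ring.
  apply Rmult_le_compat; auto. nra.
Qed.

(** Replaces a factor [c N n] of the [n]th term by its limit [d n], at the cost of an
    error of size [r^(N - n)], which the factor [zb n] turns into [r^N]. *)
Lemma sum_replace p q B (c : nat -> nat -> C) (d : nat -> nat -> C) : (0 <= B)%R ->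
  (forall N n, (1 <= n <= N)%nat ->
     (Cmod (c N n - d N n) <= B * (INR N + 1) ^ q * r ^ (N - n))%R) ->
  Clim (fun N => csum (fun i => INR (S i) ^ p * (zb y (Z.of_nat (S i)) * c N (S i))) N
    - csum (fun i => INR (S i) ^ p * (zb y (Z.of_nat (S i)) * d N (S i))) N) 0.
Proof.
  intros HB H.
  apply Clim_le with (fun N => K * B * ((INR N + 1) ^ (1 + p + q) * r ^ N))%R;
    [|apply Clim_poly_geom; lra].
  intros N. rewrite <- csum_minus.
  match goal with |- (Cmod (?a - ?b) <= _)%R => replace (a - b) with a by ring end.
  set (X := (INR N + 1)%R). pose proof (pos_INR N).
  assert (0 <= r ^ N)%R by (apply pow_le; lra).
  eapply Rle_trans; [apply csum_Cmod_le with (B := (X ^ p * (K * B * X ^ q * r ^ N))%R)|].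
  - intros i Hi.
    replace (INR (S i) ^ p * (zb y (Z.of_nat (S i)) * c N (S i))
       - INR (S i) ^ p * (zb y (Z.of_nat (S i)) * d N (S i)))
      with (INR (S i) ^ p * (zb y (Z.of_nat (S i)) * (c N (S i) - d N (S i)))) by ring.
    rewrite !Cmod_mult, Cmod_pow, Cmod_R, Rabs_pos_eq by apply pos_INR.
    assert (INR (S i) <= X)%R by (unfold X; apply le_INR in Hi; lra).
    pose proof (pos_INR (S i)).
    apply Rmult_le_compat; auto.
    + apply pow_le; auto.
    + apply Rmult_le_pos; apply Cmod_ge_0.
    + apply pow_incr; auto.
    + pose proof (zb_bound (Z.of_nat (S i))) as Bd. rewrite abs_nat_of_nat in Bd.
      specialize (H N (S i) ltac:(lia)). fold X in H.
      replace (K * B * X ^ q * r ^ N)%R with ((K * r ^ S i) * (B * X ^ q * r ^ (N - S i)))%R.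
      * apply Rmult_le_compat; auto; apply Cmod_ge_0.
      * replace (r ^ N)%R with (r ^ (S i + (N - S i)))%R by (f_equal; lia).
        rewrite pow_add. ring.
  - rewrite !pow_add, pow_1.
    replace (K * B * (X * X ^ p * X ^ q * r ^ N))%R with (X * (X ^ p * (K * B * X ^ q * r ^ N)))%R by ring.
    apply Rmult_le_compat_r; [|unfold X; lra].
    assert (0 <= X ^ p)%R by (apply pow_le; unfold X; lra).
    assert (0 <= X ^ q)%R by (apply pow_le; unfold X; lra).
    repeat apply Rmult_le_pos; lra.
Qed.

Lemma Clim_diff s t a : Clim (fun n => s n - t n) 0 -> Clim t a -> Clim s a.
Proof.
  intros H1 H2. apply Clim_ext with (fun n => (s n - t n) + t n); [intros; ring|].
  replace a with (0 + a) by ring. apply Clim_plus; auto.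
Qed.

Lemma conv_zb_sum p : Clim (fun N => csum (fun i => INR (S i) ^ p * conv (zb y) N (Z.of_nat (S i))) N)
  (2 * LU p y - 2 * LS (S p) y).
Proof.
  apply Clim_ext with (fun N => csum (fun i => INR (S i) ^ p * (zb y (Z.of_nat (S i)) *
     (2 * zc y (Z.of_nat (S i)) - shift_c N (S i)))) N).
  { intros N. apply csum_ext. intros i Hi. rewrite conv_zb by lia. ring. }
  apply (Clim_diff _ (fun N => csum (fun i => INR (S i) ^ p * (zb y (Z.of_nat (S i)) *
     (2 * zc y (Z.of_nat (S i)) - 2 * INR (S i)))) N)).
  - apply (sum_replace p 1 (2 * K) (fun N n => 2 * zc y (Z.of_nat n) - shift_c N n)
      (fun N n => 2 * zc y (Z.of_nat n) - 2 * INR n)); [lra|].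
    intros N n Hn.
    replace (2 * zc y (Z.of_nat n) - shift_c N n - (2 * zc y (Z.of_nat n) - 2 * INR n))
      with (- (shift_c N n - 2 * INR n)) by ring.
    rewrite Cmod_opp. eapply Rle_trans; [apply shift_c_bound; auto|].
    assert (INR n <= INR N)%R by (apply le_INR; lia).
    assert (0 <= r ^ (N - n))%R by (apply pow_le; lra).
    assert (0 <= K * r ^ (N - n))%R by (apply Rmult_le_pos; lra). simpl. nra.
  - apply Clim_ext with (fun N =>
      2 * csum (fun i => INR (S i) ^ p * (zb y (Z.of_nat (S i)) * zc y (Z.of_nat (S i)))) N
      - 2 * csum (fun i => INR (S i) ^ S p * zb y (Z.of_nat (S i))) N).
    + intros N. rewrite <- !csum_scal, <- csum_minus. apply csum_ext. intros i _. cbv beta. rewrite Cpow_S. ring.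
    + apply Clim_minus; apply Clim_scal; [apply LU_correct | apply LS_correct].
Qed.

(** In the limit the convolution at [n] is [- zb n] times [4 n LT + (n^3 - n) / 3]; the weight [n^p]
    then raises the indices. *)
Lemma conv_za_sum p : Clim (fun N => csum (fun i => INR (S i) ^ p * conv za N (Z.of_nat (S i))) N)
  (- ((LS (p + 3) y - LS (p + 1) y) / 3) - 4 * LT y * LS (p + 1) y).
Proof.
  apply Clim_ext with (fun N => csum (fun i => INR (S i) ^ p * (zb y (Z.of_nat (S i)) *
     (- (4 * INR (S i) * sum_kc N + (2 * INR (S i) * INR N * (INR N + 1) + shift_k N (S i)))))) N).
  { intros N. apply csum_ext. intros i Hi. rewrite conv_za by lia. ring. }
  apply (Clim_diff _ (fun N => csum (fun i => INR (S i) ^ p * (zb y (Z.of_nat (S i)) *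
     (- (4 * INR (S i) * sum_kc N + (INR (S i) ^ 3 - INR (S i)) / 3)))) N)).
  - apply (sum_replace p 3 (8 * K)
      (fun N n => - (4 * INR n * sum_kc N + (2 * INR n * INR N * (INR N + 1) + shift_k N n)))
      (fun N n => - (4 * INR n * sum_kc N + (INR n ^ 3 - INR n) / 3))); [lra|].
    intros N n Hn.
    match goal with |- (Cmod (- (?a + ?b) - - (?a + ?c)) <= _)%R =>
      replace (- (a + b) - - (a + c)) with (- (b - c)) by ring end.
    rewrite Cmod_opp. eapply Rle_trans; [apply shift_k_bound; auto|].
    assert (INR n <= INR N)%R by (apply le_INR; lia). pose proof (pos_INR N).
    assert (0 <= r ^ (N - n))%R by (apply pow_le; lra).
    assert (0 <= K * r ^ (N - n))%R by (apply Rmult_le_pos; lra).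
    replace (8 * K * (INR N + 1) ^ 3 * r ^ (N - n))%R
      with ((INR N + 1) * (8 * (INR N + 1) ^ 2 * (K * r ^ (N - n))))%R by ring.
    apply Rmult_le_compat_r; [|lra]. apply Rmult_le_pos; auto.
    apply Rmult_le_pos; [lra|]. apply pow_le. lra.
  - apply Clim_ext with (fun N =>
      - (1 / 3) * (csum (fun i => INR (S i) ^ (p + 3) * zb y (Z.of_nat (S i))) N
          - csum (fun i => INR (S i) ^ (p + 1) * zb y (Z.of_nat (S i))) N)
      - 4 * sum_kc N * csum (fun i => INR (S i) ^ (p + 1) * zb y (Z.of_nat (S i))) N).
    + intros N. rewrite <- csum_minus, <- !csum_scal, <- csum_minus. apply csum_ext. intros i _.
      cbv beta. rewrite !Cpow_add_r. field.
    + replace (- ((LS (p + 3) y - LS (p + 1) y) / 3) - 4 * LT y * LS (p + 1) y)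
        with (- (1 / 3) * (LS (p + 3) y - LS (p + 1) y) - 4 * LT y * LS (p + 1) y) by field.
      apply Clim_minus; [apply Clim_scal, Clim_minus; apply LS_correct|].
      apply Clim_mult; [apply Clim_scal, LT_correct | apply LS_correct].
Qed.

(** * The identities *)

Lemma zsum_prod f g N : zsum (fun j => zsum (fun k => f j * g k) N) N = zsum f N * zsum g N.
Proof.
  rewrite (zsum_ext _ (fun j => zsum g N * f j)).
  - rewrite zsum_scal. ring.
  - intros j _. rewrite zsum_scal. ring.
Qed.

(** Moments of the odd sequence [zb]: the even ones are 0 at each truncation, the odd ones tend to
    twice S_p. *)
Definition zB (p N : nat) : C := zsum (fun k => IZR k ^ p * zb y k) N.

Lemma zB_even p N : Nat.Even p -> zB p N = 0.
Proof.
  intros [q ->]. apply zsum_odd. intros k. rewrite zb_opp, opp_IZR, RtoC_opp.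
  assert (E : forall u : C, u ^ (2 * q) = (u * u) ^ q).
  { intros u. rewrite Cpow_mult_r. f_equal. ring. }
  rewrite !E. replace (- IZR k * - IZR k) with (IZR k * IZR k) by ring. ring.
Qed.

Lemma zB_odd p : Nat.Odd p -> Clim (zB p) (2 * LS p y).
Proof.
  intros [q Hq].
  apply Clim_ext with (fun N => 2 * csum (fun i => INR (S i) ^ p * zb y (Z.of_nat (S i))) N).
  - intros N. unfold zB. rewrite zsum_even.
    + rewrite zb_0, Cmult_0_r, Cplus_0_l. f_equal. apply csum_ext. intros i _.
      rewrite RtoC_IZR_nat. auto.
    + intros k. rewrite zb_opp, opp_IZR, RtoC_opp.
      assert (E : forall u : C, u ^ p = u * (u * u) ^ q).
      { intros u. subst p. rewrite Nat.add_1_r. simpl Cpow. f_equal.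
        change (u ^ (2 * q) = (u * u) ^ q). rewrite Cpow_mult_r. f_equal. ring. }
      rewrite !E. replace (- IZR k * - IZR k) with (IZR k * IZR k) by ring. ring.
  - apply Clim_scal. apply LS_correct.
Qed.

Lemma IZR_pow4_bound p n : (p <= 4)%nat -> (Cmod (IZR n ^ p) <= (Rabs (IZR n) + 1) ^ 4)%R.
Proof.
  intros Hp. rewrite Cmod_pow, Cmod_R. pose proof (Rabs_pos (IZR n)).
  apply Rle_trans with ((Rabs (IZR n) + 1) ^ p)%R; [apply pow_incr; lra|].
  apply Rle_pow; [lra|auto].
Qed.

Lemma conv_even_sum w p N : (forall j k, w (- j)%Z * w (- k)%Z = w j * w k) -> Nat.Even p ->
  zsum (fun n => IZR n ^ p * conv w N n) N =
  IZR 0 ^ p * conv w N 0 + 2 * csum (fun i => INR (S i) ^ p * conv w N (Z.of_nat (S i))) N.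
Proof.
  intros H [q ->]. rewrite zsum_even.
  - f_equal. f_equal. apply csum_ext. intros i _. rewrite RtoC_IZR_nat. auto.
  - intros k. rewrite conv_opp by auto. rewrite opp_IZR, RtoC_opp.
    assert (E : forall u : C, u ^ (2 * q) = (u * u) ^ q).
    { intros u. rewrite Cpow_mult_r. f_equal. ring. }
    rewrite !E. replace (- IZR k * - IZR k) with (IZR k * IZR k) by ring. ring.
Qed.

(** The double sum of [(j + k)^p zb j zb k] is evaluated twice: over the square, where the binomial
    theorem gives products of moments, and along the diagonals [j + k = n], where it is a weighted
    convolution. *)
Lemma shear_zb p L M : (p <= 4)%nat ->
  Clim (fun N => zsum (fun j => zsum (fun k => IZR (j + k) ^ p * (zb y j * zb y k)) N) N) L ->
  Clim (fun N => zsum (fun n => IZR n ^ p * conv (zb y) N n) N) M -> L = M.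
Proof.
  intros Hp HL HM. apply Ceq_minus. symmetry. eapply Clim_unique.
  - apply (shear_limit (zb y) (fun n => IZR n ^ p) K r); try lra.
    + intros j. eapply Rle_trans; [apply zb_bound|].
      apply Rmult_le_compat_r; [apply pow_le; lra|]. pose proof (Rabs_pos (IZR j)). nra.
    + intros n. apply IZR_pow4_bound; auto.
  - apply Clim_minus; auto.
Qed.

Lemma shear_za p L M : (p <= 4)%nat ->
  Clim (fun N => zsum (fun j => zsum (fun k => IZR (j + k) ^ p * (za j * za k)) N) N) L ->
  Clim (fun N => zsum (fun n => IZR n ^ p * conv za N n) N) M -> L = M.
Proof.
  intros Hp HL HM. apply Ceq_minus. symmetry. eapply Clim_unique.
  - apply (shear_limit za (fun n => IZR n ^ p) K r); try lra.
    + intros j. unfold za. rewrite Cmod_mult, Cmod_R.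
      pose proof (zb_bound j). pose proof (Rabs_pos (IZR j)). pose proof (Cmod_ge_0 (zb y j)).
      assert (0 <= r ^ Z.abs_nat j)%R by (apply pow_le; lra).
      assert (0 <= K * r ^ Z.abs_nat j)%R by (apply Rmult_le_pos; lra). nra.
    + intros n. apply IZR_pow4_bound; auto.
  - apply Clim_minus; auto.
Qed.

Lemma zb_prod_even j k : zb y (- j) * zb y (- k) = zb y j * zb y k.
Proof. rewrite !zb_opp. ring. Qed.

Lemma za_prod_even j k : za (- j) * za (- k) = za j * za k.
Proof. rewrite !za_opp. ring. Qed.

Lemma zB_prod i j N : zsum (fun a => zsum (fun b => (IZR a ^ i * zb y a) * (IZR b ^ j * zb y b)) N) N
  = zB i N * zB j N.
Proof. apply (zsum_prod (fun a => IZR a ^ i * zb y a) (fun b => IZR b ^ j * zb y b)). Qed.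

Lemma zsum2_ext f g N : (forall j k, f j k = g j k) ->
  zsum (fun j => zsum (fun k => f j k) N) N = zsum (fun j => zsum (fun k => g j k) N) N.
Proof. intros H. apply zsum_ext. intros j _. apply zsum_ext. intros k _. auto. Qed.

Lemma zsum2_plus f g N :
  zsum (fun j => zsum (fun k => f j k + g j k) N) N =
  zsum (fun j => zsum (fun k => f j k) N) N + zsum (fun j => zsum (fun k => g j k) N) N.
Proof.
  rewrite <- zsum_plus. apply zsum_ext. intros j _. apply zsum_plus.
Qed.

Lemma zsum2_scal c f N :
  zsum (fun j => zsum (fun k => c * f j k) N) N = c * zsum (fun j => zsum (fun k => f j k) N) N.
Proof. rewrite <- zsum_scal. apply zsum_ext. intros j _. apply zsum_scal. Qed.

Ltac even := match goal with |- Nat.Even ?n => exists (Nat.div2 n); reflexivity end.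
Ltac odd := match goal with |- Nat.Odd ?n => exists (Nat.div2 n); reflexivity end.

(** Of the expansion of [(j + k)^2] only the mixed term [2 j k] survives, since even moments vanish;
    the identities below follow the same pattern. *)
Lemma LU_2 : LU 2 y = 2 * LS 1 y * LS 1 y + LS 3 y.
Proof.
  assert (E : 2 * ((2 * LS 1 y) * (2 * LS 1 y)) = 0 + 2 * (2 * LU 2 y - 2 * LS 3 y)).
  { apply (shear_zb 2); [lia| |].
    - apply Clim_ext with (fun N => 2 * (zB 1 N * zB 1 N)).
      + intros N. rewrite (zsum2_ext _ (fun j k =>
          (IZR j ^ 0 * zb y j) * (IZR k ^ 2 * zb y k) + (IZR j ^ 2 * zb y j) * (IZR k ^ 0 * zb y k)
          + 2 * ((IZR j ^ 1 * zb y j) * (IZR k ^ 1 * zb y k))))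
          by (intros; rewrite plus_IZR, RtoC_plus; ring).
        rewrite !zsum2_plus, zsum2_scal, !zB_prod. rewrite (zB_even 0), (zB_even 2) by even. ring.
      + apply Clim_scal, Clim_mult; apply zB_odd; odd.
    - apply Clim_ext with (fun N =>
        0 + 2 * csum (fun i => INR (S i) ^ 2 * conv (zb y) N (Z.of_nat (S i))) N).
      + intros N. rewrite (conv_even_sum (zb y) 2) by (auto using zb_prod_even; even). ring.
      + apply Clim_plus; [apply Clim_const|]. apply Clim_scal, conv_zb_sum. }
  replace (LU 2 y) with ((0 + 2 * (2 * LU 2 y - 2 * LS 3 y)) / 4 + LS 3 y) by field.
  rewrite <- E. field.
Qed.

Lemma LU_4 : LU 4 y = 8 * LS 1 y * LS 3 y + LS 5 y.
Proof.
  assert (E : 8 * ((2 * LS 1 y) * (2 * LS 3 y)) = 0 + 2 * (2 * LU 4 y - 2 * LS 5 y)).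
  { apply (shear_zb 4); [lia| |].
    - apply Clim_ext with (fun N => 8 * (zB 1 N * zB 3 N)).
      + intros N. rewrite (zsum2_ext _ (fun j k =>
          (IZR j ^ 0 * zb y j) * (IZR k ^ 4 * zb y k) + (IZR j ^ 4 * zb y j) * (IZR k ^ 0 * zb y k)
          + 6 * ((IZR j ^ 2 * zb y j) * (IZR k ^ 2 * zb y k))
          + 4 * ((IZR j ^ 1 * zb y j) * (IZR k ^ 3 * zb y k))
          + 4 * ((IZR j ^ 3 * zb y j) * (IZR k ^ 1 * zb y k))))
          by (intros; rewrite plus_IZR, RtoC_plus; ring).
        rewrite !zsum2_plus, !zsum2_scal, !zB_prod.
        rewrite (zB_even 0), (zB_even 2), (zB_even 4) by even. ring.
      + apply Clim_scal, Clim_mult; apply zB_odd; odd.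
    - apply Clim_ext with (fun N =>
        0 + 2 * csum (fun i => INR (S i) ^ 4 * conv (zb y) N (Z.of_nat (S i))) N).
      + intros N. rewrite (conv_even_sum (zb y) 4) by (auto using zb_prod_even; even). ring.
      + apply Clim_plus; [apply Clim_const|]. apply Clim_scal, conv_zb_sum. }
  replace (LU 4 y) with ((0 + 2 * (2 * LU 4 y - 2 * LS 5 y)) / 4 + LS 5 y) by field.
  rewrite <- E. field.
Qed.

Lemma LV_eq : LV y = 2 * LS 1 y * LS 1 y + (LS 3 y - LS 1 y) / 3 + 4 * LT y * LS 1 y.
Proof.
  assert (E : (2 * LS 1 y) * (2 * LS 1 y) =
    2 * LV y + 2 * (- ((LS 3 y - LS 1 y) / 3) - 4 * LT y * LS 1 y)).
  { apply (shear_za 0); [lia| |].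
    - apply Clim_ext with (fun N => zB 1 N * zB 1 N).
      + intros N. rewrite (zsum2_ext _ (fun j k =>
          (IZR j ^ 1 * zb y j) * (IZR k ^ 1 * zb y k))) by (intros; unfold za; ring).
        rewrite zB_prod. auto.
      + apply Clim_mult; apply zB_odd; odd.
    - apply Clim_ext with (fun N =>
        2 * csum (fun i => INR (S i) ^ 2 * (zb y (Z.of_nat (S i)) * zb y (Z.of_nat (S i)))) N
        + 2 * csum (fun i => INR (S i) ^ 0 * conv za N (Z.of_nat (S i))) N).
      (* Only for exponent 0 does the central term [n = 0] remain; there the convolution is the sum
         of the squares of [za], which yields [2 * LV]. *)
      + intros N. rewrite (conv_even_sum za 0) by (auto using za_prod_even; even). f_equal.
        unfold conv. rewrite zsum_even.
        * unfold za at 2. rewrite zb_0.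
          rewrite (csum_ext (fun i => za (0 - Z.of_nat (S i))%Z * za (Z.of_nat (S i))) (fun i => INR (S i) ^ 2 * (zb y (Z.of_nat (S i)) * zb y (Z.of_nat (S i))))).
          -- simpl Cpow at 2. ring.
          -- intros i _. replace (0 - Z.of_nat (S i))%Z with (- Z.of_nat (S i))%Z by lia.
             rewrite za_opp. unfold za. rewrite RtoC_IZR_nat. ring.
        * intros k. replace (0 - - k)%Z with (- (0 - k))%Z by lia. apply za_prod_even.
      + apply Clim_plus; apply Clim_scal; [apply LV_correct | apply (conv_za_sum 0)]. }
  replace (LV y) with ((2 * LV y + 2 * (- ((LS 3 y - LS 1 y) / 3) - 4 * LT y * LS 1 y)) / 2
    + (LS 3 y - LS 1 y) / 3 + 4 * LT y * LS 1 y) by field.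
  rewrite <- E. field.
Qed.

(** With [q = exp (- y)], [1 - 12 LT] is the Eisenstein series E_2, Ramanujan's P, at [q^2]. *)
Definition Lkappa : C := 1 - 12 * LT y - 12 * LS 1 y.

Lemma LS_5 : LS 5 y = Lkappa * LS 3 y.
Proof.
  assert (E : 2 * ((2 * LS 1 y) * (2 * LS 3 y)) =
    0 + 2 * (- ((LS 5 y - LS 3 y) / 3) - 4 * LT y * LS 3 y)).
  { apply (shear_za 2); [lia| |].
    - apply Clim_ext with (fun N => 2 * (zB 1 N * zB 3 N)).
      + intros N. rewrite (zsum2_ext _ (fun j k =>
          2 * ((IZR j ^ 2 * zb y j) * (IZR k ^ 2 * zb y k))
          + ((IZR j ^ 1 * zb y j) * (IZR k ^ 3 * zb y k)
          + (IZR j ^ 3 * zb y j) * (IZR k ^ 1 * zb y k))))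
          by (intros; unfold za; rewrite plus_IZR, RtoC_plus; ring).
        rewrite !zsum2_plus, !zsum2_scal, !zB_prod. rewrite (zB_even 2) by even. ring.
      + apply Clim_scal, Clim_mult; apply zB_odd; odd.
    - apply Clim_ext with (fun N =>
        0 + 2 * csum (fun i => INR (S i) ^ 2 * conv za N (Z.of_nat (S i))) N).
      + intros N. rewrite (conv_even_sum za 2) by (auto using za_prod_even; even). ring.
      + apply Clim_plus; [apply Clim_const|]. apply Clim_scal, (conv_za_sum 2). }
  unfold Lkappa.
  replace (LS 5 y) with (- (3 / 2) * (0 + 2 * (- ((LS 5 y - LS 3 y) / 3) - 4 * LT y * LS 3 y))
    + LS 3 y - 12 * LT y * LS 3 y) by field.
  rewrite <- E. field.
Qed.

Lemma LS_7 : LS 7 y = Lkappa * LS 5 y - 36 * LS 3 y * LS 3 y.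
Proof.
  assert (E : 2 * ((2 * LS 1 y) * (2 * LS 5 y)) + 6 * ((2 * LS 3 y) * (2 * LS 3 y)) =
    0 + 2 * (- ((LS 7 y - LS 5 y) / 3) - 4 * LT y * LS 5 y)).
  { apply (shear_za 4); [lia| |].
    - apply Clim_ext with (fun N => 2 * (zB 1 N * zB 5 N) + 6 * (zB 3 N * zB 3 N)).
      + intros N. rewrite (zsum2_ext _ (fun j k =>
          ((IZR j ^ 1 * zb y j) * (IZR k ^ 5 * zb y k) + (IZR j ^ 5 * zb y j) * (IZR k ^ 1 * zb y k))
          + 6 * ((IZR j ^ 3 * zb y j) * (IZR k ^ 3 * zb y k))
          + 4 * ((IZR j ^ 2 * zb y j) * (IZR k ^ 4 * zb y k))
          + 4 * ((IZR j ^ 4 * zb y j) * (IZR k ^ 2 * zb y k))))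
          by (intros; unfold za; rewrite plus_IZR, RtoC_plus; ring).
        rewrite !zsum2_plus, !zsum2_scal, !zB_prod. rewrite (zB_even 2), (zB_even 4) by even. ring.
      + apply Clim_plus; apply Clim_scal, Clim_mult; apply zB_odd; odd.
    - apply Clim_ext with (fun N =>
        0 + 2 * csum (fun i => INR (S i) ^ 4 * conv za N (Z.of_nat (S i))) N).
      + intros N. rewrite (conv_even_sum za 4) by (auto using za_prod_even; even). ring.
      + apply Clim_plus; [apply Clim_const|]. apply Clim_scal, (conv_za_sum 4). }
  unfold Lkappa.
  replace (LS 7 y) with (- (3 / 2) * (0 + 2 * (- ((LS 7 y - LS 5 y) / 3) - 4 * LT y * LS 5 y))
    + LS 5 y - 12 * LT y * LS 5 y) by field.
  rewrite <- E. field.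
Qed.

End Lambert.

(** * Differentiation of the Lambert series in y *)

Lemma Lambert_setup (y : C) : (0 < Re y)%R ->
  (1 <= csch_const (Re y))%R /\ (0 < exp (- Re y) < 1)%R /\
  (forall n, (1 <= n)%nat -> Csinh (INR n * y) <> 0) /\
  (forall n, (1 <= n)%nat -> (Cmod (/ Csinh (INR n * y)) <= csch_const (Re y) * exp (- Re y) ^ n)%R) /\
  (forall n, (1 <= n)%nat ->
     (Cmod (Ccosh (INR n * y) / Csinh (INR n * y) - 1) <= csch_const (Re y) * exp (- Re y) ^ n)%R) /\
  (forall n, (1 <= n)%nat -> (Cmod (Ccosh (INR n * y) / Csinh (INR n * y)) <= csch_const (Re y))%R).
Proof.
  intros H. destruct (csch_coth_bounds (Re y) H) as [K1 B].
  split; auto. split.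
  { split; [apply exp_pos|]. rewrite <- exp_0. apply exp_increasing. lra. }
  repeat split; intros n Hn; apply (B n y Hn); lra.
Qed.

Lemma LS_sum (p : nat) (y : C) : (0 < Re y)%R -> is_alt_sinh_sum p y (LS p y).
Proof.
  intros H. destruct (Lambert_setup y H) as [A1 [A2 [A3 [A4 [A5 A6]]]]].
  apply is_series_csum.
  apply Clim_ext with (csum (fun i => INR (S i) ^ p * zb y (Z.of_nat (S i)))).
  - intros n. apply csum_ext. intros i _. rewrite zb_nat. unfold alt_sinh_term.
    rewrite Nat.sub_succ, Nat.sub_0_r. unfold Cdiv. ring.
  - eapply LS_correct; eauto.
Qed.

Lemma LS_5_eq y : (0 < Re y)%R -> LS 5 y = Lkappa y * LS 3 y.
Proof.
  intros H. destruct (Lambert_setup y H) as [A1 [A2 [A3 [A4 [A5 A6]]]]]. eapply LS_5; eauto.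
Qed.

Lemma LS_7_eq y : (0 < Re y)%R -> LS 7 y = Lkappa y * LS 5 y - 36 * LS 3 y * LS 3 y.
Proof.
  intros H. destruct (Lambert_setup y H) as [A1 [A2 [A3 [A4 [A5 A6]]]]]. eapply LS_7; eauto.
Qed.

Lemma LU_2_eq y : (0 < Re y)%R -> LU 2 y = 2 * LS 1 y * LS 1 y + LS 3 y.
Proof.
  intros H. destruct (Lambert_setup y H) as [A1 [A2 [A3 [A4 [A5 A6]]]]]. eapply LU_2; eauto.
Qed.

Lemma LU_4_eq y : (0 < Re y)%R -> LU 4 y = 8 * LS 1 y * LS 3 y + LS 5 y.
Proof.
  intros H. destruct (Lambert_setup y H) as [A1 [A2 [A3 [A4 [A5 A6]]]]]. eapply LU_4; eauto.
Qed.

Lemma LV_eq_eq y : (0 < Re y)%R ->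
  LV y = 2 * LS 1 y * LS 1 y + (LS 3 y - LS 1 y) / 3 + 4 * LT y * LS 1 y.
Proof.
  intros H. destruct (Lambert_setup y H) as [A1 [A2 [A3 [A4 [A5 A6]]]]]. eapply LV_eq; eauto.
Qed.

Lemma CD_Csinh u : CD Csinh u (Ccosh u).
Proof.
  unfold Csinh. eapply CD_eq.
  - cd; [apply CD_Cexp | apply (CD_Cexp_comp (fun v => - v)); cd |].
    intros E; injection E; lra.
  - cbv beta. unfold Ccosh. field.
Qed.

Lemma CD_Ccosh u : CD Ccosh u (Csinh u).
Proof.
  unfold Ccosh. eapply CD_eq.
  - cd; [apply CD_Cexp | apply (CD_Cexp_comp (fun v => - v)); cd |].
    intros E; injection E; lra.
  - cbv beta. unfold Csinh. field.
Qed.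

Lemma cosh_sinh u : Ccosh u * Ccosh u = 1 + Csinh u * Csinh u.
Proof.
  assert (E : Cexp u * Cexp (- u) = 1).
  { rewrite <- Cexp_plus. replace (u + - u) with (RtoC 0) by ring. apply Cexp_0. }
  replace (1 + Csinh u * Csinh u) with (Cexp u * Cexp (- u) + Csinh u * Csinh u) by (rewrite E; auto).
  unfold Ccosh, Csinh. field.
Qed.

Definition csch_n (n : C) (v : C) : C := / Csinh (n * v).
Definition coth_n (n : C) (v : C) : C := Ccosh (n * v) / Csinh (n * v).

Lemma csch_n_CD n v : Csinh (n * v) <> 0 -> CD (csch_n n) v (- n * (csch_n n v * coth_n n v)).
Proof.
  intros H. unfold csch_n. eapply CD_eq.
  - cd; [apply (CD_comp (fun v => n * v) Csinh); [cd | apply CD_Csinh] | auto].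
  - cbv beta. unfold coth_n. field. auto.
Qed.

Lemma coth_n_CD n v : Csinh (n * v) <> 0 -> CD (coth_n n) v (- n * (csch_n n v * csch_n n v)).
Proof.
  intros H. unfold coth_n. eapply CD_eq.
  - cd; [apply (CD_comp (fun v => n * v) Ccosh); [cd | apply CD_Ccosh]
        | apply (CD_comp (fun v => n * v) Csinh); [cd | apply CD_Csinh] | auto].
  - cbv beta. unfold csch_n.
    replace ((0 * v + n * 1) * Csinh (n * v)) with (n * Csinh (n * v)) by ring.
    apply Ceq_minus.
    match goal with |- ?a = _ => replace a with
      (n * (1 + Csinh (n * v) * Csinh (n * v) - Ccosh (n * v) * Ccosh (n * v))
        / (Csinh (n * v) * Csinh (n * v))) by (field; auto) end.
    rewrite cosh_sinh. field. auto.
Qed.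

Section Derivative.
Variables (y : C) (K r : R).
Let s := (Re y / 2)%R.
Hypotheses (Hy : (0 < Re y)%R) (HK : (1 <= K)%R) (Hr : (0 < r < 1)%R).
Hypothesis Hb : forall n v, (1 <= n)%nat -> (s <= Re v)%R ->
    Csinh (INR n * v) <> 0 /\
    (Cmod (csch_n (INR n) v) <= K * r ^ n)%R /\
    (Cmod (coth_n (INR n) v - 1) <= K * r ^ n)%R /\
    (Cmod (coth_n (INR n) v) <= K)%R.

Lemma near_Re v : (Cmod (v - y) < s)%R -> (s <= Re v)%R.
Proof.
  intros H. pose proof (re_le_Cmod (v - y)) as Q.
  change (Rabs (Re v - Re y) <= Cmod (v - y))%R in Q.
  pose proof (Rle_abs (- (Re v - Re y))). rewrite Rabs_Ropp in *. unfold s in *. lra.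
Qed.

Lemma poly_geom_step q B (c : C) i (m : nat) : (0 <= B)%R -> (m <= q)%nat ->
  (Cmod c <= B * r ^ S i)%R -> (Cmod (INR (S i) ^ m * c) <= B * ((INR i + 1) ^ q * r ^ i))%R.
Proof.
  intros HB Hm Hc. rewrite Cmod_mult, Cmod_pow, Cmod_R, Rabs_pos_eq by apply pos_INR.
  rewrite S_INR. pose proof (pos_INR i).
  assert ((INR i + 1) ^ m <= (INR i + 1) ^ q)%R by (apply Rle_pow; [lra|auto]).
  assert (0 <= (INR i + 1) ^ m)%R by (apply pow_le; lra).
  assert (0 <= r ^ i)%R by (apply pow_le; lra).
  assert (r ^ S i <= r ^ i)%R by (simpl; nra).
  replace (B * ((INR i + 1) ^ q * r ^ i))%R with ((INR i + 1) ^ q * (B * r ^ i))%R by ring.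
  apply Rmult_le_compat; auto; [apply Cmod_ge_0|].
  eapply Rle_trans; [apply Hc|]. apply Rmult_le_compat_l; auto.
Qed.

Lemma LS_CD_aux p : CD (LS p) y (- LU (S p) y).
Proof.
  assert (Hrs : (0 < s)%R) by (unfold s; lra).
  set (e := fun i : nat => (-(1)) ^ i).
  assert (He : forall i, Cmod (e i) = 1%R) by (intros i; unfold e; rewrite <- pm_nat; apply Cmod_pm).
  set (f := fun i v => INR (S i) ^ p * (e i * csch_n (INR (S i)) v)).
  set (f1 := fun i v => INR (S i) ^ S p * (- e i * (csch_n (INR (S i)) v * coth_n (INR (S i)) v))).
  set (f2 := fun i v => INR (S i) ^ S (S p) * (e i *
    (csch_n (INR (S i)) v * (coth_n (INR (S i)) v * coth_n (INR (S i)) v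
      + csch_n (INR (S i)) v * csch_n (INR (S i)) v)))).
  apply CD_ext with (fun v => CSer (fun i => f i v)).
  { intros v. unfold LS. apply CSer_ext. intros i. rewrite zb_nat. reflexivity. }
  apply CD_eq with (CSer (fun i => f1 i y)).
  - assert (rn : forall n, (0 <= r ^ n <= 1)%R).
    { intros n. split; [apply pow_le; lra|]. rewrite <- (pow1 n). apply pow_incr. lra. }
    (* A single majorant for the terms and two derivatives: each derivative adds one power of the
       index, and the second one involves two products of three hyperbolic factors. The radius [s],
       half of [Re y], keeps the bounds uniform. *)
    apply (CSer_CD f f1 f2 (fun i => (2 * K * K * K) * ((INR i + 1) ^ S (S p) * r ^ i))%R y s); auto.
    + apply ex_series_poly_geom. lra.
    + intros i v Hv. destruct (Hb (S i) v ltac:(lia) (near_Re v Hv)) as [N _].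
      unfold f, f1. eapply CD_eq.
      * cd. apply csch_n_CD; auto.
      * cbv beta. rewrite Cpow_S. ring.
    + intros i v Hv. destruct (Hb (S i) v ltac:(lia) (near_Re v Hv)) as [N _].
      unfold f1, f2. eapply CD_eq.
      * cd; [apply csch_n_CD; auto | apply coth_n_CD; auto].
      * cbv beta. rewrite !Cpow_S. ring.
    + intros i v Hv. destruct (Hb (S i) v ltac:(lia) (near_Re v Hv)) as [N [B1 [B2 B3]]].
      unfold f. apply poly_geom_step; [nra | lia |]. rewrite Cmod_mult, He, Rmult_1_l.
      specialize (rn (S i)). eapply Rle_trans; [apply B1|]. apply Rmult_le_compat_r; nra.
    + intros i v Hv. destruct (Hb (S i) v ltac:(lia) (near_Re v Hv)) as [N [B1 [B2 B3]]].
      unfold f1. apply poly_geom_step; [nra | lia |]. rewrite !Cmod_mult, Cmod_opp, He, Rmult_1_l.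
      specialize (rn (S i)).
      apply Rle_trans with ((K * r ^ S i) * K)%R.
      * apply Rmult_le_compat; auto; apply Cmod_ge_0.
      * replace (K * r ^ S i * K)%R with (K * K * r ^ S i)%R by ring.
        apply Rmult_le_compat_r; nra.
    + intros i v Hv. destruct (Hb (S i) v ltac:(lia) (near_Re v Hv)) as [N [B1 [B2 B3]]].
      unfold f2. apply poly_geom_step; [nra | lia |]. rewrite !Cmod_mult, He, Rmult_1_l.
      specialize (rn (S i)).
      assert (B4 : (Cmod (csch_n (INR (S i)) v) <= K)%R) by nra.
      apply Rle_trans with ((K * r ^ S i) * (K * K + K * K))%R.
      * apply Rmult_le_compat; auto; try apply Cmod_ge_0.
        eapply Rle_trans; [apply Cmod_triangle|]. rewrite !Cmod_mult.
        apply Rplus_le_compat; apply Rmult_le_compat; auto; apply Cmod_ge_0.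
      * apply Req_le. ring.
  - replace (- LU (S p) y) with ((-(1)) * LU (S p) y) by ring. unfold LU.
    rewrite <- CSer_scal with (K := fun i => ((K * K) * ((INR i + 1) ^ S p * r ^ i))%R).
    + apply CSer_ext. intros i. unfold f1. rewrite zb_nat, zc_nat. unfold csch_n, coth_n, e, Cdiv. ring.
    + intros i. rewrite zb_nat, zc_nat.
      destruct (Hb (S i) y ltac:(lia) ltac:(unfold s; lra)) as [N [B1 [B2 B3]]].
      apply poly_geom_step; [nra | lia |]. fold (coth_n (INR (S i)) y).
      unfold Cdiv. fold (csch_n (INR (S i)) y). rewrite !Cmod_mult.
      fold (e i). rewrite He, Rmult_1_l.
      replace (K * K * r ^ S i)%R with ((K * r ^ S i) * K)%R by ring.
      apply Rmult_le_compat; auto; apply Cmod_ge_0.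
    + apply ex_series_poly_geom. lra.
Qed.

Lemma LT_CD_aux : CD LT y (- LV y).
Proof.
  assert (Hrs : (0 < s)%R) by (unfold s; lra).
  set (f := fun i v => INR (S i) ^ 1 * (coth_n (INR (S i)) v - 1)).
  set (f1 := fun i v => INR (S i) ^ 2 * (- (csch_n (INR (S i)) v * csch_n (INR (S i)) v))).
  set (f2 := fun i v => INR (S i) ^ 3 *
    (2 * (csch_n (INR (S i)) v * csch_n (INR (S i)) v * coth_n (INR (S i)) v))).
  apply CD_ext with (fun v => CSer (fun i => f i v)).
  { intros v. unfold LT. apply CSer_ext. intros i. rewrite zc_nat. unfold f. rewrite Cpow_1_r. reflexivity. }
  assert (rn : forall n, (0 <= r ^ n <= 1)%R).
  { intros n. split; [apply pow_le; lra|]. rewrite <- (pow1 n). apply pow_incr. lra. }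
  apply CD_eq with (CSer (fun i => f1 i y)).
  - apply (CSer_CD f f1 f2 (fun i => (2 * K * K * K) * ((INR i + 1) ^ 3 * r ^ i))%R y s); auto.
    + apply ex_series_poly_geom. lra.
    + intros i v Hv. destruct (Hb (S i) v ltac:(lia) (near_Re v Hv)) as [N _].
      unfold f, f1. eapply CD_eq.
      * cd. apply coth_n_CD; auto.
      * cbv beta. ring.
    + intros i v Hv. destruct (Hb (S i) v ltac:(lia) (near_Re v Hv)) as [N _].
      unfold f1, f2. eapply CD_eq.
      * cd; apply csch_n_CD; auto.
      * cbv beta. ring.
    + intros i v Hv. destruct (Hb (S i) v ltac:(lia) (near_Re v Hv)) as [N [B1 [B2 B3]]].
      unfold f. apply poly_geom_step; [nra | lia |].
      specialize (rn (S i)). eapply Rle_trans; [apply B2|]. apply Rmult_le_compat_r; nra.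
    + intros i v Hv. destruct (Hb (S i) v ltac:(lia) (near_Re v Hv)) as [N [B1 [B2 B3]]].
      unfold f1. apply poly_geom_step; [nra | lia |]. rewrite Cmod_opp, !Cmod_mult.
      specialize (rn (S i)). assert (B4 : (Cmod (csch_n (INR (S i)) v) <= K)%R) by nra.
      apply Rle_trans with ((K * r ^ S i) * K)%R.
      * apply Rmult_le_compat; auto; apply Cmod_ge_0.
      * replace (K * r ^ S i * K)%R with (K * K * r ^ S i)%R by ring.
        apply Rmult_le_compat_r; nra.
    + intros i v Hv. destruct (Hb (S i) v ltac:(lia) (near_Re v Hv)) as [N [B1 [B2 B3]]].
      unfold f2. apply poly_geom_step; [nra | lia |].
      rewrite !Cmod_mult, Cmod_R, Rabs_pos_eq by lra.
      specialize (rn (S i)). assert (B4 : (Cmod (csch_n (INR (S i)) v) <= K)%R) by nra.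
      replace (2 * K * K * K * r ^ S i)%R with (2 * ((K * r ^ S i) * K * K))%R by ring.
      apply Rmult_le_compat_l; [lra|]. apply Rmult_le_compat; auto; try apply Cmod_ge_0.
      * apply Rmult_le_pos; apply Cmod_ge_0.
      * apply Rmult_le_compat; auto; apply Cmod_ge_0.
  - replace (- LV y) with ((-(1)) * LV y) by ring. unfold LV.
    assert (P1 : forall i, (-(1)) ^ i * (-(1)) ^ i = 1).
    { intros i. rewrite <- Cpow_mult_l. replace (-(1) * -(1)) with (RtoC 1) by ring. apply Cpow_1_l. }
    rewrite <- CSer_scal with (K := fun i => ((K * K) * ((INR i + 1) ^ 2 * r ^ i))%R).
    + apply CSer_ext. intros i. unfold f1. rewrite zb_nat. unfold csch_n, Cdiv.
      replace ((-(1)) ^ i * / Csinh (INR (S i) * y) * ((-(1)) ^ i * / Csinh (INR (S i) * y)))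
        with (((-(1)) ^ i * (-(1)) ^ i) * (/ Csinh (INR (S i) * y) * / Csinh (INR (S i) * y))) by ring.
      rewrite P1. ring.
    + intros i. rewrite zb_nat.
      destruct (Hb (S i) y ltac:(lia) ltac:(unfold s; lra)) as [N [B1 [B2 B3]]].
      apply poly_geom_step; [nra | lia |].
      unfold Cdiv. fold (csch_n (INR (S i)) y).
      replace ((-(1)) ^ i * csch_n (INR (S i)) y * ((-(1)) ^ i * csch_n (INR (S i)) y))
        with (((-(1)) ^ i * (-(1)) ^ i) * (csch_n (INR (S i)) y * csch_n (INR (S i)) y)) by ring.
      rewrite P1, Cmult_1_l, Cmod_mult. specialize (rn (S i)).
      assert (B4 : (Cmod (csch_n (INR (S i)) y) <= K)%R) by nra.
      replace (K * K * r ^ S i)%R with ((K * r ^ S i) * K)%R by ring.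
      apply Rmult_le_compat; auto; apply Cmod_ge_0.
    + apply ex_series_poly_geom. lra.
Qed.

End Derivative.

Lemma derivative_setup (y : C) : (0 < Re y)%R -> exists K r, (1 <= K)%R /\ (0 < r < 1)%R /\
  forall n v, (1 <= n)%nat -> (Re y / 2 <= Re v)%R ->
    Csinh (INR n * v) <> 0 /\
    (Cmod (csch_n (INR n) v) <= K * r ^ n)%R /\
    (Cmod (coth_n (INR n) v - 1) <= K * r ^ n)%R /\
    (Cmod (coth_n (INR n) v) <= K)%R.
Proof.
  intros H. destruct (csch_coth_bounds (Re y / 2) ltac:(lra)) as [K1 B].
  exists (csch_const (Re y / 2)), (exp (- (Re y / 2))). split; auto. split; [|exact B].
  split; [apply exp_pos|]. rewrite <- exp_0. apply exp_increasing. lra.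
Qed.

Lemma LS_1_CD y : (0 < Re y)%R -> CD (LS 1) y (- (2 * LS 1 y * LS 1 y + LS 3 y)).
Proof.
  intros H. destruct (derivative_setup y H) as [K [r [HK [Hr Hb]]]].
  rewrite <- LU_2_eq by auto. eapply LS_CD_aux; eauto.
Qed.

Lemma LS_3_CD y : (0 < Re y)%R -> CD (LS 3) y (- (LS 3 y * (8 * LS 1 y + Lkappa y))).
Proof.
  intros H. destruct (derivative_setup y H) as [K [r [HK [Hr Hb]]]].
  eapply CD_eq; [eapply LS_CD_aux; eauto|]. rewrite LU_4_eq, LS_5_eq by auto. ring.
Qed.

Lemma Lkappa_CD y : (0 < Re y)%R ->
  CD Lkappa y (- (4 * LS 1 y * Lkappa y - 16 * LS 3 y)).
Proof.
  intros H. destruct (derivative_setup y H) as [K [r [HK [Hr Hb]]]].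
  unfold Lkappa. eapply CD_eq.
  - cd; [eapply LT_CD_aux; eauto | apply LS_1_CD; auto].
  - cbv beta. rewrite LV_eq_eq by auto. field.
Qed.

(** * Behaviour for small nome *)

Lemma csch_const_le y : (0 < Re y)%R -> (exp (- Re y) <= 1 / 2)%R -> (csch_const (Re y) <= 4)%R.
Proof.
  intros H Hq. unfold csch_const. pose proof (exp_pos (- Re y)).
  assert (2 / (1 - exp (- Re y) * exp (- Re y)) <= 3)%R; [|lra].
  apply Rle_div_l; nra.
Qed.

Lemma tail_bound p (f : nat -> C) (q : R) : (0 <= q <= 1 / 2)%R ->
  (forall i, (Cmod (f i) <= 4 * (INR (S i) ^ p * q ^ (2 + i)))%R) ->
  (Cmod (CSer f) <= q * q * Series (fun i => 4 * ((INR i + 1) ^ p * (1 / 2) ^ i)))%R.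
Proof.
  intros Hq H. rewrite <- Series_scal_l.
  apply CSer_Cmod.
  - intros i. eapply Rle_trans; [apply H|]. rewrite S_INR, pow_add.
    assert (q ^ i <= (1 / 2) ^ i)%R by (apply pow_incr; lra).
    assert (0 <= (INR i + 1) ^ p)%R by (apply pow_le; pose proof (pos_INR i); lra).
    replace (4 * ((INR i + 1) ^ p * (q ^ 2 * q ^ i)))%R
      with (q * q * 4 * (INR i + 1) ^ p * q ^ i)%R by ring.
    replace (q * q * (4 * ((INR i + 1) ^ p * (1 / 2) ^ i)))%R
      with (q * q * 4 * (INR i + 1) ^ p * (1 / 2) ^ i)%R by ring.
    apply Rmult_le_compat_l; auto. apply Rmult_le_pos; auto. nra.
  - apply (ex_series_scal_l (K := R_AbsRing) (V := R_NormedModule)).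
    apply ex_series_poly_geom. lra.
Qed.

(** The first term is [2 E / (1 - E^2)] with [E = Cexp (- y)], which differs from [2 E] by a cubic
    term; all later terms carry [E^2]. The restriction to [1 / 2] makes [csch_const] at most 4. *)
Lemma LS_small p : exists A, (0 <= A)%R /\ forall y, (0 < Re y)%R -> (exp (- Re y) <= 1 / 2)%R ->
  (Cmod (LS p y - 2 * Cexp (- y)) <= A * (exp (- Re y) * exp (- Re y)))%R.
Proof.
  set (A := (2 ^ p * Series (fun i => 4 * ((INR i + 1) ^ p * (1 / 2) ^ i)))%R).
  exists (2 + Rabs A)%R. pose proof (Rabs_pos A) as HA. split; [lra|]. intros y H Hq.
  destruct (Lambert_setup y H) as [A1 [A2 [A3 [A4 [A5 A6]]]]].
  pose proof (csch_const_le y H Hq) as K4. set (q := exp (- Re y)) in *.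
  set (K := csch_const (Re y)) in *.
  set (f := fun i => INR (S i) ^ p * zb y (Z.of_nat (S i))).
  assert (Fb : forall i, (Cmod (f i) <= K * ((INR i + 1) ^ p * q ^ i))%R).
  { intros i. unfold f. apply poly_geom_step; auto; [lra|].
    rewrite zb_nat. unfold Cdiv. rewrite Cmod_mult, <- pm_nat, Cmod_pm, Rmult_1_l. apply A4. lia. }
  unfold LS. fold f. rewrite (CSer_shift f _ Fb) by (apply ex_series_poly_geom; lra).
  set (E := Cexp (- y)).
  assert (ME : Cmod E = q) by (unfold E; rewrite Cmod_Cexp; reflexivity).
  assert (F0 : f 0%nat = 2 * E / (1 - E * E)).
  { unfold f. rewrite zb_nat. change (INR 1) with 1%R. rewrite Cpow_1_l. simpl Cpow.
    assert (N0 : Csinh (1 * y) <> 0) by (apply (A3 1%nat); lia).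
    replace (1 * y) with y in * by ring. unfold Csinh in *.
    assert (Ey : Cexp y = / E) by (unfold E; rewrite Cexp_opp; field; apply Cexp_neq_0).
    fold E in N0 |- *. rewrite Ey in *.
    assert (NE : E <> 0) by apply Cexp_neq_0.
    assert (1 - E * E <> 0).
    { intros Q. apply N0. replace ((/ E - E) / 2) with ((1 - E * E) / (2 * E)) by (field; auto).
      rewrite Q. field. auto. }
    field. repeat split; auto. }
  rewrite F0.
  assert (D : (3 / 4 <= Cmod (1 - E * E))%R).
  { pose proof (Cmod_triangle_rev 1 (E * E)) as T. rewrite Cmod_1, Cmod_mult, ME in T. nra. }
  assert (ND : 1 - E * E <> 0) by (apply Cmod_gt_0; lra).
  replace (2 * E / (1 - E * E) + CSer (fun n => f (S n)) - 2 * E)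
    with (2 * (E * E * E) / (1 - E * E) + CSer (fun n => f (S n))) by (field; auto).
  eapply Rle_trans; [apply Cmod_triangle|]. rewrite Rmult_plus_distr_r.
  apply Rplus_le_compat.
  - rewrite Cmod_div, !Cmod_mult, ME, Cmod_R, Rabs_pos_eq by (auto; lra).
    apply Rle_div_l; [lra|]. assert (0 <= q * q)%R by nra. nra.
  - apply Rle_trans with (2 ^ p * (q * q * Series (fun i => 4 * ((INR i + 1) ^ p * (1 / 2) ^ i))))%R.
    + assert (P2 : (0 < 2 ^ p)%R) by (apply pow_lt; lra).
      (* The tail starts at index 2 while [tail_bound] expects weights starting at 1; [i + 2] is at
         most [2 (i + 1)], hence the scaling by [2 ^ p]. *)
      set (g := fun n => (/ 2 ^ p)%R * f (S n)).
      replace (CSer (fun n => f (S n))) with ((2 ^ p)%R * CSer g).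
      * rewrite Cmod_mult, Cmod_R, Rabs_pos_eq by lra. apply Rmult_le_compat_l; [lra|].
        apply tail_bound; [lra|]. intros i. unfold g. rewrite Cmod_mult, Cmod_R.
        rewrite Rabs_pos_eq by (left; apply Rinv_0_lt_compat; auto).
        unfold f. rewrite Cmod_mult, Cmod_pow, Cmod_R, Rabs_pos_eq by apply pos_INR.
        rewrite zb_nat. unfold Cdiv. rewrite Cmod_mult, <- pm_nat, Cmod_pm, Rmult_1_l.
        assert (B1 := A4 (S (S i)) ltac:(lia)). change (2 + i)%nat with (S (S i)).
        assert (Qp : (0 <= q ^ S (S i))%R) by (apply pow_le; lra).
        assert (B2 : (INR (S (S i)) ^ p <= 2 ^ p * INR (S i) ^ p)%R).
        { rewrite <- Rpow_mult_distr. apply pow_incr. rewrite !S_INR. pose proof (pos_INR i). lra. }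
        assert (B3 : (0 <= INR (S (S i)) ^ p)%R) by (apply pow_le, pos_INR).
        assert (B4 : (0 <= INR (S i) ^ p)%R) by (apply pow_le, pos_INR).
        apply Rmult_le_reg_l with (2 ^ p)%R; auto.
        rewrite <- Rmult_assoc, Rinv_r, Rmult_1_l by lra.
        replace (2 ^ p * (4 * (INR (S i) ^ p * q ^ S (S i))))%R
          with ((2 ^ p * INR (S i) ^ p) * (4 * q ^ S (S i)))%R by ring.
        apply Rmult_le_compat; auto; [apply Cmod_ge_0|].
        eapply Rle_trans; [apply B1|]. apply Rmult_le_compat_r; auto.
      * unfold g. rewrite CSer_scal with (K := fun n => (K * ((INR (S n) + 1) ^ p * q ^ S n))%R).
        -- rewrite Cmult_assoc, <- RtoC_mult, Rinv_r by lra. ring.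
        -- intros n. apply Fb.
        -- apply (ex_series_incr_1 (fun n => K * ((INR n + 1) ^ p * q ^ n))%R).
           apply ex_series_poly_geom. lra.
    + replace (2 ^ p * (q * q * Series (fun i => 4 * ((INR i + 1) ^ p * (1 / 2) ^ i))))%R
        with (A * (q * q))%R by (unfold A; ring).
      apply Rmult_le_compat_r; [nra|]. apply Rle_abs.
Qed.

Lemma LT_small : exists A, (0 <= A)%R /\ forall y, (0 < Re y)%R -> (exp (- Re y) <= 1 / 2)%R ->
  (Cmod (LT y) <= A * (exp (- Re y) * exp (- Re y)))%R.
Proof.
  set (A := Series (fun i => 4 * ((INR i + 1) ^ 1 * (1 / 2) ^ i))%R).
  exists (Rabs A). split; [apply Rabs_pos|]. intros y H Hq.
  destruct (Lambert_setup y H) as [A1 [A2 [A3 [A4 [A5 A6]]]]].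
  pose proof (csch_const_le y H Hq) as K4. set (q := exp (- Re y)) in *.
  set (K := csch_const (Re y)) in *.
  eapply Rle_trans; [apply (tail_bound 1) with (q := q); [lra|]|].
  - intros i. rewrite zc_nat, coth_minus_1 by (apply A3; lia).
    rewrite !Cmod_mult, Cmod_R, (Rabs_pos_eq _ (pos_INR _)).
    replace (- (INR (S i) * y)) with (INR (S i) * (- y)) by ring.
    rewrite Cexp_INR, Cmod_pow, Cmod_Cexp. change (Re (- y)) with (- Re y)%R. fold q.
    assert (B1 := A4 (S i) ltac:(lia)).
    assert (Qp : (0 <= q ^ i)%R) by (apply pow_le; lra).
    assert (Q1 : (q ^ i <= 1)%R) by (rewrite <- (pow1 i); apply pow_incr; lra).
    replace (4 * (INR (S i) ^ 1 * q ^ (2 + i)))%R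
      with (INR (S i) * (q ^ S i * (4 * q)))%R by (simpl; ring).
    apply Rmult_le_compat_l; [apply pos_INR|].
    apply Rmult_le_compat_l; [apply pow_le; lra|].
    eapply Rle_trans; [apply B1|]. assert (K * q ^ i <= 4 * 1)%R by (apply Rmult_le_compat; lra). simpl. nra.
  - fold A. rewrite Rmult_comm. apply Rmult_le_compat_r; [nra|]. apply Rle_abs.
Qed.

(** * Uniqueness for the differential system *)

Lemma Cmod_sq_derive f (t : R) l : CD f t l ->
  is_derive (fun t : R => Cmod (f t) * Cmod (f t))%R t
    (2 * (Re (f t) * Re l + Im (f t) * Im l))%R.
Proof.
  intros H.
  apply is_derive_ext with (fun t : R => Re (f t) * Re (f t) + Im (f t) * Im (f t))%R;
    [intros; symmetry; apply Cmod_sq|].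
  pose proof (CD_real_Re f t l H) as D1. pose proof (CD_real_Im f t l H) as D2.
  replace (2 * (Re (f t) * Re l + Im (f t) * Im l))%R with
    ((Re l * Re (f t) + Re (f t) * Re l) + (Im l * Im (f t) + Im (f t) * Im l))%R by ring.
  apply (is_derive_plus (V := R_NormedModule) (fun t : R => Re (f t) * Re (f t))%R
    (fun t : R => Im (f t) * Im (f t))%R).
  - apply (is_derive_mult (fun t : R => Re (f t)) (fun t : R => Re (f t))); auto.
    intros; apply Rmult_comm.
  - apply (is_derive_mult (fun t : R => Im (f t)) (fun t : R => Im (f t))); auto.
    intros; apply Rmult_comm.
Qed.

Lemma Re_Im_Cauchy_Schwarz u v : (Re u * Re v + Im u * Im v <= Cmod u * Cmod v)%R.
Proof.
  rewrite <- (Cmod_conj u), <- Cmod_mult.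
  replace (Re u * Re v + Im u * Im v)%R with (Re (Cconj u * v))
    by (unfold Re, Im, Cconj, Cmult; simpl; ring).
  eapply Rle_trans; [apply Rle_abs | apply re_le_Cmod].
Qed.

Lemma nonincreasing_of_derive (g g' : R -> R) (a b : R) : (a <= b)%R ->
  (forall t, (a <= t <= b)%R -> is_derive g t (g' t)) ->
  (forall t, (a <= t <= b)%R -> (g' t <= 0)%R) -> (g b <= g a)%R.
Proof.
  intros Hab D H.
  destruct (MVT_gen g a b g') as [c [Hc E]].
  - intros t Ht. rewrite Rmin_left, Rmax_right in Ht by auto. apply D. lra.
  - intros t Ht. rewrite Rmin_left, Rmax_right in Ht by auto.
    apply continuity_pt_filterlim. apply (ex_derive_continuous (V := R_NormedModule) g).
    exists (g' t). apply D. auto.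
  - rewrite Rmin_left, Rmax_right in Hc by auto. specialize (H c Hc). nra.
Qed.

(** [E / t^12] is nonincreasing and tends to [0] at [0]. *)
Lemma gronwall_singular (E E' : R -> R) (t0 A : R) : (0 < t0)%R ->
  (forall t, (0 < t <= t0)%R -> is_derive E t (E' t)) ->
  (forall t, (0 < t <= t0)%R -> (t * E' t <= 12 * E t)%R) ->
  (forall t, (0 < t <= t0)%R -> (0 <= E t)%R) ->
  (forall t, (0 < t <= t0)%R -> (E t <= A * t ^ 16)%R) ->
  forall t, (0 < t <= t0)%R -> E t = 0%R.
Proof.
  intros H0 D H1 H2 H3 t Ht.
  assert (A0 : (0 <= A)%R).
  { specialize (H2 t0 ltac:(lra)). specialize (H3 t0 ltac:(lra)).
    assert (0 < t0 ^ 16)%R by (apply pow_lt; auto). nra. }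
  set (g' := fun t => ((t * E' t - 12 * E t) / t ^ 13)%R).
  assert (Dg : forall s, (0 < s <= t0)%R -> is_derive (fun s => E s * / s ^ 12)%R s (g' s)).
  { intros s Hs. specialize (D s Hs). unfold g'.
    assert (P : (s ^ 12 <> 0)%R) by (apply pow_nonzero; lra).
    evar_last.
    - apply (is_derive_mult E (fun s => / s ^ 12)%R); [exact D| |intros; apply Rmult_comm].
      apply (is_derive_inv (fun s => s ^ 12)%R s (12 * s ^ 11)%R); auto.
      auto_derive; auto. ring.
    - unfold plus, mult; simpl. field. lra. }
  assert (M : forall s, (0 < s <= t)%R -> (E t * / t ^ 12 <= A * s ^ 4)%R).
  { intros s Hs. apply Rle_trans with (E s * / s ^ 12)%R.
    - apply (nonincreasing_of_derive (fun s => E s * / s ^ 12)%R g'); [lra| |].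
      + intros u Hu. apply Dg. lra.
      + intros u Hu. unfold g'. specialize (H1 u ltac:(lra)).
        assert (0 < / u ^ 13)%R by (apply Rinv_0_lt_compat, pow_lt; lra).
        unfold Rdiv. nra.
    - specialize (H3 s ltac:(lra)). assert (P : (0 < s ^ 12)%R) by (apply pow_lt; lra).
      apply Rle_div_l; auto. eapply Rle_trans; [apply H3|]. apply Req_le. ring. }
  assert (Z : (E t * / t ^ 12 <= 0)%R).
  { apply Rnot_lt_le. intros L. set (e := (E t * / t ^ 12)%R) in *.
    set (s := Rmin t (Rmin 1 (e / (2 * (A + 1))))).
    assert (S0 : (0 < s)%R).
    { repeat apply Rmin_pos; try lra. apply Rdiv_lt_0_compat; lra. }
    assert (S1 : (s <= t)%R) by apply Rmin_l.
    assert (S2 : (s <= 1)%R) by (eapply Rle_trans; [apply Rmin_r | apply Rmin_l]).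
    assert (S3 : (s <= e / (2 * (A + 1)))%R) by (eapply Rle_trans; [apply Rmin_r | apply Rmin_r]).
    specialize (M s ltac:(lra)).
    assert (s ^ 4 <= s)%R.
    { assert (s ^ 3 <= 1)%R by (rewrite <- (pow1 3); apply pow_incr; lra).
      change (s ^ 4)%R with (s * s ^ 3)%R. nra. }
    assert ((A + 1) * s <= e / 2)%R.
    { replace (e / 2)%R with ((A + 1) * (e / (2 * (A + 1))))%R by (field; lra).
      apply Rmult_le_compat_l; lra. }
    nra. }
  specialize (H2 t Ht). assert (P : (0 < / t ^ 12)%R) by (apply Rinv_0_lt_compat, pow_lt; lra). nra.
Qed.

(** The integrating factor [exp (- c t)] makes the product nonincreasing. *)
Lemma gronwall_regular (E E' : R -> R) (a b c : R) : (a <= b)%R ->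
  (forall t, (a <= t <= b)%R -> is_derive E t (E' t)) ->
  (forall t, (a <= t <= b)%R -> (E' t <= c * E t)%R) ->
  (forall t, (a <= t <= b)%R -> (0 <= E t)%R) ->
  E a = 0%R -> E b = 0%R.
Proof.
  intros Hab D H1 H2 Ha.
  set (g' := fun t => ((E' t - c * E t) * exp (- c * t))%R).
  assert (M : (E b * exp (- c * b) <= E a * exp (- c * a))%R).
  { apply (nonincreasing_of_derive (fun s => E s * exp (- c * s))%R g'); auto.
    - intros s Hs. unfold g'. evar_last.
      + apply (is_derive_mult E (fun s => exp (- c * s))%R); [apply D; auto| |intros; apply Rmult_comm].
        auto_derive; auto.
      + unfold plus, mult; simpl. ring.
    - intros s Hs. unfold g'. specialize (H1 s Hs). pose proof (exp_pos (- c * s)). nra. }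
  rewrite Ha, Rmult_0_l in M. pose proof (exp_pos (- c * b)). specialize (H2 b ltac:(lra)). nra.
Qed.

Lemma segment_bounded (f : C -> C) (a b : R) : (a <= b)%R ->
  (forall t, (a <= t <= b)%R -> CC f (RtoC t)) ->
  exists M, (0 <= M)%R /\ forall t, (a <= t <= b)%R -> (Cmod (f (RtoC t)) <= M)%R.
Proof.
  intros Hab K.
  destruct (continuity_ab_maj (fun t => Cmod (f (RtoC t))) a b) as [tm [Hm _]]; auto.
  - intros t Ht e He. destruct (K t Ht e He) as [d [Pd Hd]]. exists d. split; auto.
    intros s [_ Hs]. simpl in *. unfold Rdist in *.
    specialize (Hd (RtoC s)). rewrite <- RtoC_minus, Cmod_R in Hd. specialize (Hd Hs).
    eapply Rle_lt_trans; [|apply Hd]. apply Rabs_le.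
    pose proof (Cmod_triangle_rev (f (RtoC s)) (f (RtoC t))).
    pose proof (Cmod_triangle_rev (f (RtoC t)) (f (RtoC s))).
    rewrite (Cmod_minus_sym (f (RtoC t))) in H0. lra.
  - exists (Cmod (f (RtoC tm))). split; [apply Cmod_ge_0 | exact Hm].
Qed.

(** * Orders of vanishing along a ray *)

Definition bigO (k : nat) (f : R -> C) : Prop :=
  exists A d, (0 <= A)%R /\ (0 < d)%R /\ forall t, (0 < t < d)%R -> (Cmod (f t) <= A * t ^ k)%R.

Lemma bigO_plus k f g : bigO k f -> bigO k g -> bigO k (fun t => f t + g t).
Proof.
  intros [A [d [HA [Hd H]]]] [B [e [HB [He K]]]].
  exists (A + B)%R, (Rmin d e). split; [lra|]. split; [apply Rmin_pos; auto|].
  intros t Ht. pose proof (Rmin_l d e). pose proof (Rmin_r d e).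
  specialize (H t ltac:(lra)). specialize (K t ltac:(lra)).
  eapply Rle_trans; [apply Cmod_triangle|]. lra.
Qed.

Lemma bigO_mult k l f g : bigO k f -> bigO l g -> bigO (k + l) (fun t => f t * g t).
Proof.
  intros [A [d [HA [Hd H]]]] [B [e [HB [He K]]]].
  exists (A * B)%R, (Rmin d e). split; [nra|]. split; [apply Rmin_pos; auto|].
  intros t Ht. pose proof (Rmin_l d e). pose proof (Rmin_r d e).
  specialize (H t ltac:(lra)). specialize (K t ltac:(lra)).
  rewrite Cmod_mult, pow_add. replace (A * B * (t ^ k * t ^ l))%R with ((A * t ^ k) * (B * t ^ l))%R by ring.
  apply Rmult_le_compat; auto; apply Cmod_ge_0.
Qed.

Lemma bigO_const c : bigO 0 (fun _ => c).
Proof.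
  exists (Cmod c), 1%R. split; [apply Cmod_ge_0|]. split; [lra|]. intros. simpl. lra.
Qed.

Lemma bigO_mono k l f : (l <= k)%nat -> bigO k f -> bigO l f.
Proof.
  intros L [A [d [HA [Hd H]]]]. exists A, (Rmin d 1). split; auto.
  split; [apply Rmin_pos; lra|]. intros t Ht.
  pose proof (Rmin_l d 1). pose proof (Rmin_r d 1). specialize (H t ltac:(lra)).
  eapply Rle_trans; [apply H|]. apply Rmult_le_compat_l; auto.
  replace k with (l + (k - l))%nat by lia. rewrite pow_add.
  assert (0 <= t ^ l)%R by (apply pow_le; lra).
  assert (t ^ (k - l) <= 1)%R by (rewrite <- (pow1 (k - l)); apply pow_incr; lra). nra.
Qed.

Lemma bigO_ext k f g : (forall t, (0 < t < 1)%R -> f t = g t) -> bigO k f -> bigO k g.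
Proof.
  intros E [A [d [HA [Hd H]]]]. exists A, (Rmin d 1). split; auto.
  split; [apply Rmin_pos; lra|]. intros t Ht.
  pose proof (Rmin_l d 1). pose proof (Rmin_r d 1). rewrite <- E by lra. apply H. lra.
Qed.

Lemma bigO_scal k c f : bigO k f -> bigO k (fun t => c * f t).
Proof. intros H. apply (bigO_mult 0 k (fun _ => c) f); auto. apply bigO_const. Qed.

Lemma bigO_minus k f g : bigO k f -> bigO k g -> bigO k (fun t => f t - g t).
Proof.
  intros Hf Hg. apply bigO_ext with (fun t => f t + (-(1)) * g t); [intros; ring|].
  apply bigO_plus; auto. apply bigO_scal; auto.
Qed.

Lemma bigO_small k f (eta : R) : bigO (S k) f -> (0 < eta)%R ->
  exists d, (0 < d <= 1)%R /\ forall t, (0 < t < d)%R -> (Cmod (f t) <= eta)%R.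
Proof.
  intros H He. apply (bigO_mono (S k) 1) in H; [|lia]. destruct H as [A [d [HA [Hd H]]]].
  exists (Rmin (Rmin d 1) (eta / (A + 1))).
  pose proof (Rmin_l (Rmin d 1) (eta / (A + 1))). pose proof (Rmin_r (Rmin d 1) (eta / (A + 1))).
  pose proof (Rmin_l d 1). pose proof (Rmin_r d 1).
  split.
  { split; [|lra]. repeat apply Rmin_pos; try lra. apply Rdiv_lt_0_compat; lra. }
  intros t Ht. specialize (H t ltac:(lra)). rewrite pow_1 in H.
  assert ((A + 1) * t <= (A + 1) * (eta / (A + 1)))%R by (apply Rmult_le_compat_l; lra).
  replace ((A + 1) * (eta / (A + 1)))%R with eta in * by (field; lra). lra.
Qed.

Lemma hF_order1 : exists A d, (0 <= A)%R /\ (0 < d < 1)%R /\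
  forall u, (Cmod u < d)%R -> (Cmod (hF u - 1) <= A * Cmod u)%R.
Proof.
  destruct (hF_CD_0 1%R ltac:(lra)) as [d [Pd Hd]].
  exists (Cmod (1 / 4) + 1)%R, (Rmin d (1 / 2)).
  pose proof (Rmin_l d (1 / 2)). pose proof (Rmin_r d (1 / 2)).
  assert (0 < Rmin d (1 / 2))%R by (apply Rmin_pos; lra). pose proof (Cmod_ge_0 (1 / 4)).
  split; [lra|]. split; [lra|]. intros u Hu. specialize (Hd u).
  replace (u - 0) with u in Hd by ring. rewrite hF_0 in Hd. specialize (Hd ltac:(lra)).
  pose proof (Cmod_triangle (hF u - 1 - 1 / 4 * u) (1 / 4 * u)) as T.
  replace (hF u - 1 - 1 / 4 * u + 1 / 4 * u) with (hF u - 1) in T by ring.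
  rewrite (Cmod_mult (1 / 4)) in T. lra.
Qed.

Lemma ray_in_ball (u : C) d t : (Cmod u < d)%R -> (0 <= t <= 1)%R -> (Cmod (0 + t * u) <= Cmod u)%R.
Proof.
  intros H Ht. replace (0 + t * u) with (t * u) by ring.
  rewrite Cmod_mult, Cmod_R, Rabs_pos_eq by lra. pose proof (Cmod_ge_0 u). nra.
Qed.

Lemma hM_order2 : exists A d, (0 <= A)%R /\ (0 < d < 1)%R /\
  forall u, (Cmod u < d)%R -> (Cmod (hM u - u / 4) <= A * (Cmod u * Cmod u))%R.
Proof.
  destruct hF_order1 as [A [d [HA [Hd H]]]]. exists A, d. split; auto. split; auto.
  intros u Hu.
  pose proof (C_mean_value (fun v => hM v - v / 4) (fun v => (hF v - 1) / 4) 0 u (A * Cmod u)) as M.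
  cbv beta in M. replace (0 + u) with u in M by ring. rewrite hM_0 in M.
  replace (hM u - u / 4) with (hM u - u / 4 - (0 - 0 / 4)) by field.
  eapply Rle_trans; [apply M|].
  - intros t Ht. pose proof (ray_in_ball u d t Hu Ht). eapply CD_eq.
    + cd; [apply hM_CD; lra|]. intros E; injection E; lra.
    + cbv beta. field.
  - intros t Ht. pose proof (ray_in_ball u d t Hu Ht).
    assert (N4 : RtoC 4 <> 0) by (intros E; injection E; lra).
    rewrite Cmod_div, Cmod_R, Rabs_pos_eq by (auto; lra).
    specialize (H (0 + t * u) ltac:(lra)). pose proof (Cmod_ge_0 (hF (0 + t * u) - 1)).
    apply Rle_div_l; [lra|]. pose proof (Cmod_ge_0 u). nra.
  - lra.
Qed.

Lemma hF_order2 : exists A d, (0 <= A)%R /\ (0 < d < 1)%R /\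
  forall u, (Cmod u < d)%R -> (Cmod (hF u - (1 + u / 4)) <= A * (Cmod u * Cmod u))%R.
Proof.
  destruct hM_order2 as [A [d [HA [Hd H]]]].
  exists (2 * (A + 1))%R, (Rmin d (1 / 2)).
  pose proof (Rmin_l d (1 / 2)). pose proof (Rmin_r d (1 / 2)).
  assert (0 < Rmin d (1 / 2))%R by (apply Rmin_pos; lra).
  split; [lra|]. split; [lra|]. intros u Hu.
  set (l := fun v => if Ceq_dec v 0 then 1 / 4 else hM v / (v * (1 - v))).
  pose proof (C_mean_value (fun v => hF v - (1 + v / 4)) (fun v => l v - 1 / 4) 0 u
    (2 * (A + 1) * Cmod u)) as M.
  cbv beta in M. replace (0 + u) with u in M by ring. rewrite hF_0 in M.
  replace (hF u - (1 + u / 4)) with (hF u - (1 + u / 4) - (1 - (1 + 0 / 4))) by field.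
  assert (N4 : RtoC 4 <> 0) by (intros E; injection E; lra).
  eapply Rle_trans; [apply M|].
  - intros t Ht. pose proof (ray_in_ball u _ t Hu Ht). set (v := 0 + t * u) in *.
    assert (D : CD hF v (l v)).
    { unfold l. destruct (Ceq_dec v 0) as [->|N]; [apply hF_CD_0 | apply hF_CD; auto; lra]. }
    eapply CD_eq.
    + cd; [apply D|auto].
    + cbv beta. field.
  - intros t Ht. pose proof (ray_in_ball u _ t Hu Ht) as B. set (v := 0 + t * u) in *.
    pose proof (Cmod_ge_0 u) as Pu. pose proof (Cmod_ge_0 v) as Pv.
    unfold l. destruct (Ceq_dec v 0) as [->|N].
    + replace (1 / 4 - 1 / 4) with (RtoC 0) by ring. rewrite Cmod_0. nra.
    + assert (Hv1 : (Cmod v < 1)%R) by lra. pose proof (one_minus_neq_0 v Hv1) as N1.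
      specialize (H v ltac:(lra)).
      replace (hM v / (v * (1 - v)) - 1 / 4) with ((hM v - v / 4 + v * v / 4) / (v * (1 - v)))
        by (field; auto).
      assert (Pv' : (0 < Cmod v)%R) by (apply Cmod_gt_0; auto).
      assert (L1 : (1 / 2 <= Cmod (1 - v))%R).
      { pose proof (Cmod_triangle_rev 1 v) as T. rewrite Cmod_1 in T. lra. }
      rewrite Cmod_div, (Cmod_mult v (1 - v)) by (apply Cmult_neq_0; auto).
      apply Rle_div_l; [nra|].
      eapply Rle_trans; [apply Cmod_triangle|].
      assert (Q : (Cmod (v * v / 4) <= Cmod v * Cmod v)%R).
      { rewrite Cmod_div, Cmod_mult, Cmod_R, Rabs_pos_eq by (auto; lra).
        apply Rle_div_l; [lra|]. nra. }
      apply Rle_trans with ((A + 1) * (Cmod v * Cmod v))%R; [lra|].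
      replace (2 * (A + 1) * Cmod u * (Cmod v * Cmod (1 - v)))%R
        with ((A + 1) * (Cmod v * (Cmod u * (2 * Cmod (1 - v)))))%R by ring.
      apply Rmult_le_compat_l; [lra|]. apply Rmult_le_compat_l; auto. nra.
  - lra.
Qed.

(** * The two solutions along a ray *)

Section Ray.
Variable F : C -> C.
Hypothesis HF : is_hyp2F1 (1 / 2) (1 / 2) 1 F.
Variables (rho phi : R).
Hypotheses (Hrho : (0 < rho < 1)%R) (Hphi : (- (PI / 4) <= phi <= PI / 4)%R).

(** Along the ray [x = t^4 x(1)] with [t] in (0, 1]; the parameter is that of the fourth root, so
    negative [x] needs no separate treatment. [ray_A], [ray_B] and [ray_K] are the hypergeometric
    counterparts of S_1, S_3 and k, and [ray_m] is [- t dy/dt], with limit 4 at 0. *)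
Definition ray_x (t : C) : C := (t * (rho * cis phi)) ^ 4.
Definition ray_y (t : C) : C := hY (t * (rho * cis phi)).
Definition ray_A (t : C) : C := hM (ray_x t) * hF (ray_x t) / 2.
Definition ray_B (t : C) : C := ray_x t * (1 - ray_x t) * hF (ray_x t) ^ 4 / 8.
Definition ray_K (t : C) : C := (1 - 2 * ray_x t) * hF (ray_x t) ^ 2.
Definition ray_m (t : C) : C := 4 * hmu (ray_x t).

Lemma ray_polar (t : R) : t * (rho * cis phi) = (t * rho)%R * cis phi.
Proof. rewrite RtoC_mult. ring. Qed.

Lemma ray_half_disc (t : R) : (0 < t <= 1)%R -> half_disc (t * (rho * cis phi)).
Proof.
  intros Ht. pose proof PI_RGT_0. rewrite ray_polar.
  assert (0 < t * rho)%R by (apply Rmult_lt_0_compat; lra). split.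
  - rewrite Re_polar. apply Rmult_lt_0_compat; auto. apply cos_gt_0; lra.
  - rewrite Cmod_mult, Cmod_R, Cmod_cis, Rabs_pos_eq by lra. nra.
Qed.

Lemma ray_y_pos (t : R) : (0 < t <= 1)%R -> (0 < Re (ray_y t))%R.
Proof.
  intros Ht. unfold ray_y, hY. rewrite re_scal_l. apply Rmult_lt_0_compat; [apply PI_RGT_0|].
  rewrite ray_polar. apply (hG_hF_pos F HF); auto.
  assert (0 < t * rho)%R by (apply Rmult_lt_0_compat; lra). nra.
Qed.

Lemma ray_scale_CD (t : C) : CD (fun t => t * (rho * cis phi)) t (rho * cis phi).
Proof. eapply CD_eq; [cd|]. cbv beta. ring. Qed.

Lemma ray_facts (t : R) : (0 < t <= 1)%R ->
  RtoC t <> 0 /\ ray_x t <> 0 /\ 1 - ray_x t <> 0 /\ hF (ray_x t) <> 0 /\ (Cmod (ray_x t) < 1)%R.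
Proof.
  intros Ht. pose proof (ray_half_disc t Ht) as H.
  destruct (half_disc_facts _ H) as [N0 [N1 [N2 [N3 [N4 [N5 [L1 [L2 E]]]]]]]].
  split; [apply RtoC_neq_0; lra|]. split; [apply Cpow_nz; auto|]. split; [auto|].
  split; [apply (hF_neq_0 F HF); auto | auto].
Qed.

Lemma ray_neq_0 : rho * cis phi <> 0.
Proof. apply polar_neq_0. lra. Qed.

Lemma ray_x_CD (t : R) : (0 < t <= 1)%R -> CD ray_x t (4 * ray_x t / t).
Proof.
  intros Ht. destruct (ray_facts t Ht) as [Nt _]. unfold ray_x. eapply CD_eq.
  - apply CD_pow. apply ray_scale_CD.
  - simpl INR. replace (1 + 1 + 1 + 1)%R with 4%R by ring. simpl Nat.sub. field. auto.
Qed.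

Lemma ray_F_CD (t : R) : (0 < t <= 1)%R ->
  CD (fun t => hF (ray_x t)) t (4 * hM (ray_x t) / (t * (1 - ray_x t))).
Proof.
  intros Ht. destruct (ray_facts t Ht) as [Nt [Nx [N1 [NF L]]]]. eapply CD_eq.
  - apply (CD_comp ray_x hF); [apply ray_x_CD; auto | apply hF_CD; auto].
  - field. auto.
Qed.

Lemma ray_M_CD (t : R) : (0 < t <= 1)%R ->
  CD (fun t => hM (ray_x t)) t (ray_x t * hF (ray_x t) / t).
Proof.
  intros Ht. destruct (ray_facts t Ht) as [Nt [Nx [N1 [NF L]]]]. eapply CD_eq.
  - apply (CD_comp ray_x hM); [apply ray_x_CD; auto | apply hM_CD; auto].
  - field. auto.
Qed.

Lemma ray_y_CD (t : R) : (0 < t <= 1)%R -> CD ray_y t (- (ray_m t / t)).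
Proof.
  intros Ht. destruct (ray_facts t Ht) as [Nt [Nx [N1 [NF L]]]]. unfold ray_y. eapply CD_eq.
  - apply (CD_comp (fun t => t * (rho * cis phi)) hY); [apply ray_scale_CD|].
    apply (hY_CD F HF). apply ray_half_disc; auto.
  - rewrite (nome_const_1 F HF). unfold ray_m, ray_x. pose proof ray_neq_0.
    set (u := hmu ((t * (rho * cis phi)) ^ 4)). set (e := rho * cis phi) in *. field. auto.
Qed.

Definition ray_a (t : C) : C := LS 1 (ray_y t).
Definition ray_b (t : C) : C := LS 3 (ray_y t).
Definition ray_k (t : C) : C := Lkappa (ray_y t).

Lemma ray_a_CD (t : R) : (0 < t <= 1)%R ->
  CD ray_a t (ray_m t / t * (2 * ray_a t * ray_a t + ray_b t)).
Proof.
  intros Ht. unfold ray_a at 1. eapply CD_eq.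
  - apply (CD_comp ray_y (LS 1)); [apply ray_y_CD; auto | apply LS_1_CD, ray_y_pos; auto].
  - unfold ray_a, ray_b. ring.
Qed.

Lemma ray_b_CD (t : R) : (0 < t <= 1)%R ->
  CD ray_b t (ray_m t / t * (ray_b t * (8 * ray_a t + ray_k t))).
Proof.
  intros Ht. unfold ray_b at 1. eapply CD_eq.
  - apply (CD_comp ray_y (LS 3)); [apply ray_y_CD; auto | apply LS_3_CD, ray_y_pos; auto].
  - unfold ray_a, ray_b, ray_k. ring.
Qed.

Lemma ray_k_CD (t : R) : (0 < t <= 1)%R ->
  CD ray_k t (ray_m t / t * (4 * ray_a t * ray_k t - 16 * ray_b t)).
Proof.
  intros Ht. unfold ray_k at 1. eapply CD_eq.
  - apply (CD_comp ray_y Lkappa); [apply ray_y_CD; auto | apply Lkappa_CD, ray_y_pos; auto].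
  - unfold ray_a, ray_b, ray_k. ring.
Qed.

Lemma ray_A_CD (t : R) : (0 < t <= 1)%R ->
  CD ray_A t (ray_m t / t * (2 * ray_A t * ray_A t + ray_B t)).
Proof.
  intros Ht. destruct (ray_facts t Ht) as [Nt [Nx [N1 [NF L]]]]. unfold ray_A at 1. eapply CD_eq.
  - cd; [apply ray_M_CD; auto | apply ray_F_CD; auto | apply RtoC_neq_0; lra].
  - cbv beta. unfold ray_m, ray_A, ray_B, hmu. field. auto.
Qed.

Lemma ray_B_CD (t : R) : (0 < t <= 1)%R ->
  CD ray_B t (ray_m t / t * (ray_B t * (8 * ray_A t + ray_K t))).
Proof.
  intros Ht. destruct (ray_facts t Ht) as [Nt [Nx [N1 [NF L]]]]. unfold ray_B at 1. eapply CD_eq.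
  - cd; try (apply ray_x_CD; auto); [apply ray_F_CD; auto | apply RtoC_neq_0; lra].
  - cbv beta. simpl INR. replace (1 + 1 + 1 + 1)%R with 4%R by ring. simpl Nat.sub.
    unfold ray_m, ray_A, ray_B, ray_K, hmu. field. auto.
Qed.

Lemma ray_K_CD (t : R) : (0 < t <= 1)%R ->
  CD ray_K t (ray_m t / t * (4 * ray_A t * ray_K t - 16 * ray_B t)).
Proof.
  intros Ht. destruct (ray_facts t Ht) as [Nt [Nx [N1 [NF L]]]]. unfold ray_K at 1. eapply CD_eq.
  - cd; [apply ray_x_CD; auto | apply ray_F_CD; auto].
  - cbv beta. simpl INR. replace (1 + 1)%R with 2%R by ring. simpl Nat.sub.
    unfold ray_m, ray_A, ray_B, ray_K, hmu. field. auto.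
Qed.

Lemma ray_m_CD_ex (t : R) : (0 < t <= 1)%R -> exists l, CD ray_m t l.
Proof.
  intros Ht. destruct (ray_facts t Ht) as [Nt [Nx [N1 [NF L]]]].
  eexists. unfold ray_m, hmu. cd; [apply ray_x_CD; auto | apply ray_F_CD; auto | apply ray_F_CD; auto |].
  repeat apply Cmult_neq_0; auto.
Qed.

(** Differences of the two solutions, in coordinates in which the linearization at
    the singular point [t = 0] is almost diagonal. *)
Definition dp (t : C) : C := ray_b t - ray_B t.
Definition dal (t : C) : C := 8 * ((ray_a t - ray_A t) - dp t).
Definition dbe (t : C) : C := (ray_k t - ray_K t) + 12 * dp t.

(** The differences satisfy a linear system with these coefficients exactly. At [t = 0], where
    [a = A = B = 0] and [k = 1], only [c11 = 1] and [c32 = 1 / 2] are nonzero: subtracting [dp] in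
    [dal] and adding [12 * dp] in [dbe] kill [c21] and [c31], and the scaling by 8 reduces the
    coupling [4 k] to [k / 2]. *)
Definition c11 t := 8 * ray_a t + ray_k t - 4 * ray_B t.
Definition c21 t := 8 * (2 * (ray_a t + ray_A t) + 1 - 8 * ray_a t - ray_k t + 4 * ray_B t).
Definition c22 t := 2 * (ray_a t + ray_A t) - 8 * ray_B t.
Definition c31 t := 4 * ray_k t - 48 * ray_A t - 16 + 12 * (8 * ray_a t + ray_k t - 4 * ray_B t).
Definition c32 t := ray_k t / 2 + 12 * ray_B t.
Definition c33 t := 4 * ray_A t + 12 * ray_B t.

Definition dp' t := ray_m t / t * (c11 t * dp t + ray_B t * dal t + ray_B t * dbe t).
Definition dal' t := ray_m t / t * (c21 t * dp t + c22 t * dal t - 8 * ray_B t * dbe t).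
Definition dbe' t := ray_m t / t * (c31 t * dp t + c32 t * dal t + c33 t * dbe t).

Lemma dp_CD (t : R) : (0 < t <= 1)%R -> CD dp t (dp' t).
Proof.
  intros Ht. destruct (ray_facts t Ht) as [Nt _]. unfold dp. eapply CD_eq.
  - cd; [apply ray_b_CD; auto | apply ray_B_CD; auto].
  - unfold dp', c11, dal, dbe, dp. field. auto.
Qed.

Lemma dal_CD (t : R) : (0 < t <= 1)%R -> CD dal t (dal' t).
Proof.
  intros Ht. destruct (ray_facts t Ht) as [Nt _]. unfold dal. eapply CD_eq.
  - cd; [apply ray_a_CD; auto | apply ray_A_CD; auto | apply dp_CD; auto].
  - cbv beta. unfold dp', dal', c21, c22, c11, dal, dbe, dp. field. auto.
Qed.

Lemma dbe_CD (t : R) : (0 < t <= 1)%R -> CD dbe t (dbe' t).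
Proof.
  intros Ht. destruct (ray_facts t Ht) as [Nt _]. unfold dbe. eapply CD_eq.
  - cd; [apply ray_k_CD; auto | apply ray_K_CD; auto | apply dp_CD; auto].
  - cbv beta. unfold dp', dbe', c31, c32, c33, c11, dal, dbe, dp. field. auto.
Qed.

(** * The energy of the difference of the two solutions *)

Definition En (t : R) : R :=
  (Cmod (dp t) * Cmod (dp t) + Cmod (dal t) * Cmod (dal t) + Cmod (dbe t) * Cmod (dbe t))%R.

Definition En' (t : R) : R :=
  (2 * (Re (dp t) * Re (dp' t) + Im (dp t) * Im (dp' t))
   + 2 * (Re (dal t) * Re (dal' t) + Im (dal t) * Im (dal' t))
   + 2 * (Re (dbe t) * Re (dbe' t) + Im (dbe t) * Im (dbe' t)))%R.

Lemma En_derive (t : R) : (0 < t <= 1)%R -> is_derive En t (En' t).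
Proof.
  intros Ht. unfold En, En'.
  apply (is_derive_plus (V := R_NormedModule)
    (fun t : R => Cmod (dp t) * Cmod (dp t) + Cmod (dal t) * Cmod (dal t))%R
    (fun t : R => Cmod (dbe t) * Cmod (dbe t))%R).
  - apply (is_derive_plus (V := R_NormedModule)
      (fun t : R => Cmod (dp t) * Cmod (dp t))%R (fun t : R => Cmod (dal t) * Cmod (dal t))%R).
    + apply Cmod_sq_derive, dp_CD; auto.
    + apply Cmod_sq_derive, dal_CD; auto.
  - apply Cmod_sq_derive, dbe_CD; auto.
Qed.

Lemma linear_term_bound (v m a b c x y z : C) (t : R) (M A B D : R) : (0 < t)%R ->
  (Cmod m <= M)%R -> (Cmod a <= A)%R -> (Cmod b <= B)%R -> (Cmod c <= D)%R ->
  (t * (Re v * Re (m / t * (a * x + b * y + c * z)) + Im v * Im (m / t * (a * x + b * y + c * z)))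
   <= M * (Cmod v * (A * Cmod x + B * Cmod y + D * Cmod z)))%R.
Proof.
  intros Ht Hm Ha Hb Hc. set (l := a * x + b * y + c * z).
  assert (Hl : (Cmod l <= A * Cmod x + B * Cmod y + D * Cmod z)%R).
  { unfold l. eapply Rle_trans; [apply Cmod_triangle|].
    eapply Rle_trans; [apply Rplus_le_compat_r, Cmod_triangle|]. rewrite !Cmod_mult.
    pose proof (Cmod_ge_0 x). pose proof (Cmod_ge_0 y). pose proof (Cmod_ge_0 z).
    repeat apply Rplus_le_compat; apply Rmult_le_compat_r; auto. }
  pose proof (Re_Im_Cauchy_Schwarz v (m / t * l)) as CS.
  apply Rle_trans with (t * (Cmod v * Cmod (m / t * l)))%R; [apply Rmult_le_compat_l; lra|].
  rewrite Cmod_mult, Cmod_div, Cmod_R, Rabs_pos_eq by (try apply RtoC_neq_0; lra).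
  replace (t * (Cmod v * (Cmod m / t * Cmod l)))%R with (Cmod m * (Cmod v * Cmod l))%R by (field; lra).
  apply Rmult_le_compat; auto; try apply Cmod_ge_0.
  - apply Rmult_le_pos; apply Cmod_ge_0.
  - apply Rmult_le_compat_l; auto. apply Cmod_ge_0.
Qed.

(** With the limiting coefficients and [m = 4] the growth exponent would be [2 * 4 * 1 = 8]. The
    bounds 4.4, 1.1, 0.6 and 0.1 relax the limits, [eta] is small enough for all of them, and the
    resulting 12 stays below the order 16 to which [En] vanishes. *)
Lemma En_singular (t eta : R) : (0 < t <= 1)%R -> (0 <= eta <= 1 / 4000)%R ->
  (Cmod (ray_a t) <= eta)%R -> (Cmod (ray_A t) <= eta)%R -> (Cmod (ray_B t) <= eta)%R ->
  (Cmod (ray_k t - 1) <= eta)%R -> (Cmod (ray_m t) <= 4.4)%R ->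
  (t * En' t <= 12 * En t)%R.
Proof.
  intros Ht He Ha HA HB Hk Hm.
  assert (S : forall z : R, forall u : C, (Cmod u <= eta)%R -> (Cmod (z * u) <= Rabs z * eta)%R).
  { intros z u H. rewrite Cmod_mult, Cmod_R. apply Rmult_le_compat_l; auto. apply Rabs_pos. }
  set (k1 := ray_k t - 1) in *.
  assert (Ek : ray_k t = 1 + k1) by (unfold k1; ring).
  assert (B11 : (Cmod (c11 t) <= 1.1)%R).
  { unfold c11. rewrite Ek.
    replace (8 * ray_a t + (1 + k1) - 4 * ray_B t) with (1 + (8 * ray_a t + k1 + (-4) * ray_B t)) by ring.
    eapply Rle_trans; [apply Cmod_triangle|]. rewrite Cmod_1.
    eapply Rle_trans; [apply Rplus_le_compat_l; eapply Rle_trans; [apply Cmod_triangle|];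
      apply Rplus_le_compat_r, Cmod_triangle|].
    pose proof (S 8%R _ Ha). pose proof (S (-4)%R _ HB).
    rewrite Rabs_pos_eq in * by lra. rewrite (Rabs_left (-4)) in * by lra. lra. }
  assert (B12 : (Cmod (ray_B t) <= 0.1)%R) by lra.
  assert (B21 : (Cmod (c21 t) <= 0.1)%R).
  { unfold c21. rewrite Ek.
    replace (8 * (2 * (ray_a t + ray_A t) + 1 - 8 * ray_a t - (1 + k1) + 4 * ray_B t))
      with ((-48) * ray_a t + 16 * ray_A t + ((-8) * k1 + 32 * ray_B t)) by ring.
    eapply Rle_trans; [apply Cmod_triangle|].
    eapply Rle_trans; [apply Rplus_le_compat; apply Cmod_triangle|].
    pose proof (S (-48)%R _ Ha). pose proof (S 16%R _ HA). pose proof (S (-8)%R _ Hk).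
    pose proof (S 32%R _ HB).
    rewrite (Rabs_left (-48)), (Rabs_left (-8)), (Rabs_pos_eq 16), (Rabs_pos_eq 32) in * by lra. lra. }
  assert (B22 : (Cmod (c22 t) <= 0.1)%R).
  { unfold c22.
    replace (2 * (ray_a t + ray_A t) - 8 * ray_B t)
      with (2 * ray_a t + 2 * ray_A t + (-8) * ray_B t) by ring.
    eapply Rle_trans; [apply Cmod_triangle|].
    eapply Rle_trans; [apply Rplus_le_compat_r; apply Cmod_triangle|].
    pose proof (S 2%R _ Ha). pose proof (S 2%R _ HA). pose proof (S (-8)%R _ HB).
    rewrite (Rabs_left (-8)), (Rabs_pos_eq 2) in * by lra. lra. }
  assert (B23 : (Cmod (-8 * ray_B t) <= 0.1)%R).
  { pose proof (S (-8)%R _ HB). rewrite (Rabs_left (-8)) in * by lra. lra. }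
  assert (B31 : (Cmod (c31 t) <= 0.1)%R).
  { unfold c31. rewrite Ek.
    replace (4 * (1 + k1) - 48 * ray_A t - 16 + 12 * (8 * ray_a t + (1 + k1) - 4 * ray_B t))
      with (96 * ray_a t + (-48) * ray_A t + (16 * k1 + (-48) * ray_B t)) by ring.
    eapply Rle_trans; [apply Cmod_triangle|].
    eapply Rle_trans; [apply Rplus_le_compat; apply Cmod_triangle|].
    pose proof (S 96%R _ Ha). pose proof (S (-48)%R _ HA). pose proof (S 16%R _ Hk).
    pose proof (S (-48)%R _ HB).
    rewrite (Rabs_left (-48)), (Rabs_pos_eq 16), (Rabs_pos_eq 96) in * by lra. lra. }
  assert (B32 : (Cmod (c32 t) <= 0.6)%R).
  { unfold c32. rewrite Ek.
    replace ((1 + k1) / 2 + 12 * ray_B t) with ((1 / 2)%R + ((1 / 2)%R * k1 + 12 * ray_B t))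
      by (rewrite RtoC_div by lra; field).
    eapply Rle_trans; [apply Cmod_triangle|].
    eapply Rle_trans; [apply Rplus_le_compat_l; apply Cmod_triangle|].
    pose proof (S (1 / 2)%R _ Hk). pose proof (S 12%R _ HB).
    rewrite Cmod_R. rewrite (Rabs_pos_eq (1 / 2)), (Rabs_pos_eq 12) in * by lra. lra. }
  assert (B33 : (Cmod (c33 t) <= 0.1)%R).
  { unfold c33. eapply Rle_trans; [apply Cmod_triangle|].
    pose proof (S 4%R _ HA). pose proof (S 12%R _ HB).
    rewrite (Rabs_pos_eq 4), (Rabs_pos_eq 12) in * by lra. lra. }
  assert (T1 := linear_term_bound (dp t) (ray_m t) (c11 t) (ray_B t) (ray_B t) (dp t) (dal t) (dbe t)
    t 4.4 1.1 0.1 0.1 ltac:(lra) Hm B11 B12 B12).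
  assert (T2 := linear_term_bound (dal t) (ray_m t) (c21 t) (c22 t) (-8 * ray_B t) (dp t) (dal t) (dbe t)
    t 4.4 0.1 0.1 0.1 ltac:(lra) Hm B21 B22 B23).
  assert (T3 := linear_term_bound (dbe t) (ray_m t) (c31 t) (c32 t) (c33 t) (dp t) (dal t) (dbe t)
    t 4.4 0.1 0.6 0.1 ltac:(lra) Hm B31 B32 B33).
  replace (c21 t * dp t + c22 t * dal t + -8 * ray_B t * dbe t)
    with (c21 t * dp t + c22 t * dal t - 8 * ray_B t * dbe t) in T2 by ring.
  fold (dp' t) in T1. fold (dal' t) in T2. fold (dbe' t) in T3.
  unfold En, En'.
  set (P := Cmod (dp t)) in *. set (Q := Cmod (dal t)) in *. set (V := Cmod (dbe t)) in *.
  set (U1 := (Re (dp t) * Re (dp' t) + Im (dp t) * Im (dp' t))%R) in *.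
  set (U2 := (Re (dal t) * Re (dal' t) + Im (dal t) * Im (dal' t))%R) in *.
  set (U3 := (Re (dbe t) * Re (dbe' t) + Im (dbe t) * Im (dbe' t))%R) in *.
  clearbody P Q V U1 U2 U3.
  replace (t * (2 * U1 + 2 * U2 + 2 * U3))%R with (2 * (t * U1 + t * U2 + t * U3))%R by ring.
  (* After splitting the mixed products, the largest coefficient is that of [P * P], namely
     [2 * 4.4 * (1.1 + 0.1 + 0.1) = 11.44]. *)
  pose proof (Rle_0_sqr (P - Q)) as S1. pose proof (Rle_0_sqr (P - V)) as S2.
  pose proof (Rle_0_sqr (Q - V)) as S3.
  pose proof (Rle_0_sqr P). pose proof (Rle_0_sqr Q). pose proof (Rle_0_sqr V).
  unfold Rsqr in *. nra.
Qed.

Lemma En_regular (t W : R) : (0 < t <= 1)%R -> (0 <= W)%R ->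
  (Cmod (ray_m t) <= W)%R -> (Cmod (c11 t) <= W)%R -> (Cmod (ray_B t) <= W)%R ->
  (Cmod (c21 t) <= W)%R -> (Cmod (c22 t) <= W)%R -> (Cmod (-8 * ray_B t) <= W)%R ->
  (Cmod (c31 t) <= W)%R -> (Cmod (c32 t) <= W)%R -> (Cmod (c33 t) <= W)%R ->
  (t * En' t <= 6 * W * W * En t)%R.
Proof.
  intros Ht HW Hm B11 B12 B21 B22 B23 B31 B32 B33.
  assert (T1 := linear_term_bound (dp t) (ray_m t) (c11 t) (ray_B t) (ray_B t) (dp t) (dal t) (dbe t)
    t W W W W ltac:(lra) Hm B11 B12 B12).
  assert (T2 := linear_term_bound (dal t) (ray_m t) (c21 t) (c22 t) (-8 * ray_B t) (dp t) (dal t) (dbe t)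
    t W W W W ltac:(lra) Hm B21 B22 B23).
  assert (T3 := linear_term_bound (dbe t) (ray_m t) (c31 t) (c32 t) (c33 t) (dp t) (dal t) (dbe t)
    t W W W W ltac:(lra) Hm B31 B32 B33).
  replace (c21 t * dp t + c22 t * dal t + -8 * ray_B t * dbe t)
    with (c21 t * dp t + c22 t * dal t - 8 * ray_B t * dbe t) in T2 by ring.
  fold (dp' t) in T1. fold (dal' t) in T2. fold (dbe' t) in T3.
  unfold En, En'.
  set (P := Cmod (dp t)) in *. set (Q := Cmod (dal t)) in *. set (V := Cmod (dbe t)) in *.
  set (U1 := (Re (dp t) * Re (dp' t) + Im (dp t) * Im (dp' t))%R) in *.
  set (U2 := (Re (dal t) * Re (dal' t) + Im (dal t) * Im (dal' t))%R) in *.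
  set (U3 := (Re (dbe t) * Re (dbe' t) + Im (dbe t) * Im (dbe' t))%R) in *.
  clearbody P Q V U1 U2 U3.
  replace (t * (2 * U1 + 2 * U2 + 2 * U3))%R with (2 * (t * U1 + t * U2 + t * U3))%R by ring.
  apply Rle_trans with (2 * (W * W * ((P + Q + V) * (P + Q + V))))%R; [nra|].
  assert (Sq : ((P + Q + V) * (P + Q + V) <= 3 * (P * P + Q * Q + V * V))%R).
  { pose proof (Rle_0_sqr (P - Q)). pose proof (Rle_0_sqr (P - V)).
    pose proof (Rle_0_sqr (Q - V)). unfold Rsqr in *. nra. }
  assert (0 <= W * W)%R by nra. nra.
Qed.

(** * Behaviour at the singular point *)

Lemma ray_x_mod (t : R) : (0 < t < 1)%R -> (Cmod (ray_x t) <= t ^ 4)%R.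
Proof.
  intros Ht. unfold ray_x. rewrite Cmod_pow, ray_polar, Cmod_mult, Cmod_R, Cmod_cis.
  assert (0 < t * rho)%R by (apply Rmult_lt_0_compat; lra).
  rewrite Rabs_pos_eq by lra. apply pow_incr. nra.
Qed.

Lemma bigO_ray_x : bigO 4 (fun t : R => ray_x t).
Proof.
  exists 1%R, 1%R. split; [lra|]. split; [lra|]. intros t Ht. rewrite Rmult_1_l.
  apply ray_x_mod; auto.
Qed.

Lemma bigO_of_order1 (g : C -> C) A d : (0 <= A)%R -> (0 < d < 1)%R ->
  (forall u, (Cmod u < d)%R -> (Cmod (g u) <= A * Cmod u)%R) ->
  bigO 4 (fun t : R => g (ray_x t)).
Proof.
  intros HA Hd H. exists A, d. split; auto. split; [lra|]. intros t Ht.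
  pose proof (ray_x_mod t ltac:(lra)) as X.
  assert (t ^ 4 <= t)%R.
  { assert (t ^ 3 <= 1)%R by (rewrite <- (pow1 3); apply pow_incr; lra).
    change (t ^ 4)%R with (t * t ^ 3)%R. nra. }
  eapply Rle_trans; [apply H; lra|]. apply Rmult_le_compat_l; auto.
Qed.

Lemma bigO_of_order2 (g : C -> C) A d : (0 <= A)%R -> (0 < d < 1)%R ->
  (forall u, (Cmod u < d)%R -> (Cmod (g u) <= A * (Cmod u * Cmod u))%R) ->
  bigO 8 (fun t : R => g (ray_x t)).
Proof.
  intros HA Hd H. exists A, d. split; auto. split; [lra|]. intros t Ht.
  pose proof (ray_x_mod t ltac:(lra)) as X. pose proof (Cmod_ge_0 (ray_x t)).
  assert (t ^ 4 <= t)%R.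
  { assert (t ^ 3 <= 1)%R by (rewrite <- (pow1 3); apply pow_incr; lra).
    change (t ^ 4)%R with (t * t ^ 3)%R. nra. }
  eapply Rle_trans; [apply H; lra|]. apply Rmult_le_compat_l; auto.
  replace (t ^ 8)%R with (t ^ 4 * t ^ 4)%R by ring. apply Rmult_le_compat; auto.
Qed.

Definition ray_q (t : C) : C := Cexp (- ray_y t).

Lemma Cexp_minus_1_bound : exists d, (0 < d)%R /\
  forall v, (Cmod v < d)%R -> (Cmod (Cexp v - 1) <= 2 * Cmod v)%R.
Proof.
  destruct (CD_Cexp_0 1%R ltac:(lra)) as [d [Pd Hd]]. exists d. split; auto. intros v Hv.
  specialize (Hd v). replace (v - 0) with v in Hd by ring. rewrite Cexp_0 in Hd.
  specialize (Hd Hv). pose proof (Cmod_triangle (Cexp v - 1 - 1 * v) (1 * v)) as T.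
  replace (Cexp v - 1 - 1 * v + 1 * v) with (Cexp v - 1) in T by ring.
  rewrite (Cmod_mult 1), Cmod_1 in T. lra.
Qed.

(** The error in y is additive and of order x, so [q] is [x / 16] times a factor [1 + O(x)]; the
    difference gains a second factor [x], that is, order [t^8]. *)
Lemma bigO_ray_q : bigO 8 (fun t : R => ray_q t - ray_x t / 16).
Proof.
  destruct (hY_asymptotics F HF) as [K [d [HK [Hd H]]]].
  destruct Cexp_minus_1_bound as [d1 [Pd1 H1]].
  set (err := fun t : R => - (ray_y t + ((4 * ln (t * rho) - ln 16)%R, (4 * phi)%R))).
  assert (T4 : forall t, (0 < t < 1)%R -> (0 < t * rho < 1)%R /\ ((t * rho) ^ 4 <= t ^ 4)%R /\ (t ^ 4 <= t)%R).
  { intros t Ht. assert (0 < t * rho)%R by (apply Rmult_lt_0_compat; lra).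
    assert (t * rho <= t)%R by nra. split; [nra|]. split; [apply pow_incr; lra|].
    assert (t ^ 3 <= 1)%R by (rewrite <- (pow1 3); apply pow_incr; lra).
    change (t ^ 4)%R with (t * t ^ 3)%R. nra. }
  assert (Ob : bigO 4 (fun t : R => Cexp (err t) - 1)).
  { exists (2 * K)%R, (Rmin d (d1 / (K + 1))). split; [lra|].
    split; [apply Rmin_pos; [lra | apply Rdiv_lt_0_compat; lra]|].
    intros t Ht. pose proof (Rmin_l d (d1 / (K + 1))). pose proof (Rmin_r d (d1 / (K + 1))).
    destruct (T4 t ltac:(lra)) as [Q1 [Q2 Q3]].
    assert (Be : (Cmod (err t) <= K * t ^ 4)%R).
    { unfold err. rewrite Cmod_opp. unfold ray_y. rewrite ray_polar.
      eapply Rle_trans; [apply H; auto; lra|]. apply Rmult_le_compat_l; lra. }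
    assert ((K + 1) * t < d1)%R.
    { replace d1 with ((K + 1) * (d1 / (K + 1)))%R by (field; lra). apply Rmult_lt_compat_l; lra. }
    assert (0 < t ^ 4)%R by (apply pow_lt; lra).
    eapply Rle_trans; [apply H1; nra|]. lra. }
  apply bigO_ext with (fun t : R => (1 / 16) * (ray_x t * (Cexp (err t) - 1))).
  - intros t Ht. destruct (T4 t Ht) as [Q1 _].
    assert (E : ray_q t = Cexp (err t) * (ray_x t / 16)).
    { unfold ray_q.
      replace (- ray_y t) with (err t + ((4 * ln (t * rho) - ln 16)%R, (4 * phi)%R))
        by (unfold err; ring).
      rewrite Cexp_plus. f_equal. unfold ray_x. rewrite ray_polar, polar_pow4.
      unfold Cexp, Re, Im; simpl fst; simpl snd.
      replace (exp (4 * ln (t * rho) - ln 16)) with (t * rho * (t * rho) * (t * rho * (t * rho)) / 16)%R.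
      - fold (cis (4 * phi)). rewrite RtoC_div by lra. field.
      - unfold Rminus. rewrite exp_plus, exp_Ropp, exp_ln by lra.
        replace (4 * ln (t * rho))%R with (ln (t * rho) + ln (t * rho) + (ln (t * rho) + ln (t * rho)))%R
          by ring.
        rewrite !exp_plus, exp_ln by lra. reflexivity. }
    rewrite E. field.
  - apply bigO_scal. apply (bigO_mult 4 4); auto. apply bigO_ray_x.
Qed.

Lemma bigO_ray_q4 : bigO 4 (fun t : R => ray_q t).
Proof.
  apply bigO_ext with (fun t : R => (ray_q t - ray_x t / 16) + (1 / 16) * ray_x t);
    [intros; field|].
  apply bigO_plus; [apply (bigO_mono 8 4); [lia | apply bigO_ray_q] | apply bigO_scal, bigO_ray_x].
Qed.

Lemma bigO_of_q2 (g : C -> C) : (exists A, (0 <= A)%R /\ forall y, (0 < Re y)%R ->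
    (exp (- Re y) <= 1 / 2)%R -> (Cmod (g y) <= A * (exp (- Re y) * exp (- Re y)))%R) ->
  bigO 8 (fun t : R => g (ray_y t)).
Proof.
  intros [A [HA H]]. destruct bigO_ray_q4 as [B [d [HB [Hd K]]]].
  destruct (bigO_small 3 _ (1 / 2) bigO_ray_q4 ltac:(lra)) as [d1 [Hd1 S]].
  exists (A * (B * B))%R, (Rmin d d1). split; [nra|]. split; [apply Rmin_pos; lra|].
  intros t Ht. pose proof (Rmin_l d d1). pose proof (Rmin_r d d1).
  specialize (K t ltac:(lra)). specialize (S t ltac:(lra)).
  assert (E : Cmod (ray_q t) = exp (- Re (ray_y t))) by (unfold ray_q; rewrite Cmod_Cexp; reflexivity).
  rewrite E in K, S.
  eapply Rle_trans; [apply H; auto; apply ray_y_pos; lra|].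
  replace (A * (B * B) * t ^ 8)%R with (A * ((B * t ^ 4) * (B * t ^ 4)))%R by ring.
  apply Rmult_le_compat_l; auto. pose proof (exp_pos (- Re (ray_y t))).
  apply Rmult_le_compat; lra.
Qed.

Lemma bigO_LS p : bigO 8 (fun t : R => LS p (ray_y t) - 2 * ray_q t).
Proof. apply (bigO_of_q2 (fun y => LS p y - 2 * Cexp (- y))). apply LS_small. Qed.

Lemma bigO_LT : bigO 8 (fun t : R => LT (ray_y t)).
Proof. apply (bigO_of_q2 LT). apply LT_small. Qed.

Lemma bigO_F1 : bigO 4 (fun t : R => hF (ray_x t) - 1).
Proof.
  destruct hF_order1 as [A [d [HA [Hd H]]]]. apply (bigO_of_order1 (fun u => hF u - 1) A d); auto.
Qed.

Lemma bigO_F2 : bigO 8 (fun t : R => hF (ray_x t) - (1 + ray_x t / 4)).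
Proof.
  destruct hF_order2 as [A [d [HA [Hd H]]]].
  apply (bigO_of_order2 (fun u => hF u - (1 + u / 4)) A d); auto.
Qed.

Lemma bigO_M2 : bigO 8 (fun t : R => hM (ray_x t) - ray_x t / 4).
Proof.
  destruct hM_order2 as [A [d [HA [Hd H]]]].
  apply (bigO_of_order2 (fun u => hM u - u / 4) A d); auto.
Qed.

Lemma bigO_F0 : bigO 0 (fun t : R => hF (ray_x t)).
Proof.
  apply bigO_ext with (fun t : R => (hF (ray_x t) - 1) + 1); [intros; ring|].
  apply bigO_plus; [apply (bigO_mono 4 0); [lia | apply bigO_F1] | apply bigO_const].
Qed.

Lemma bigO_m : bigO 4 (fun t : R => ray_m t - 4).
Proof.
  destruct (hmu_bound) as [A [d [HA [Hd H]]]].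
  apply bigO_ext with (fun t : R => 4 * (hmu (ray_x t) - 1)); [intros; unfold ray_m; ring|].
  apply bigO_scal. apply (bigO_of_order1 (fun u => hmu u - 1) A d); auto. lra.
Qed.

Lemma bigO_x0 : bigO 0 (fun t : R => ray_x t).
Proof. apply (bigO_mono 4 0); [lia | apply bigO_ray_x]. Qed.

(** Both functions start with [x / 8]: S_3 is [2 q] up to O(q^2), and [q] is [x / 16] up to O(x^2).
    This is where the constant log 16 enters. *)
Lemma bigO_dp : bigO 8 (fun t : R => dp t).
Proof.
  (* The last bracket is [1 - (1 - x) z^4], with [1 - z^4] factored so that [z - 1] supplies the
     second factor of order x. *)
  apply bigO_ext with (fun t : R => (LS 3 (ray_y t) - 2 * ray_q t) + 2 * (ray_q t - ray_x t / 16)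
    + (1 / 8) * (ray_x t * (ray_x t * hF (ray_x t) ^ 4
       - (hF (ray_x t) - 1) * (1 + hF (ray_x t)) * (1 + hF (ray_x t) * hF (ray_x t))))).
  - intros t _. unfold dp, ray_b, ray_B. field.
  - apply bigO_plus; [apply bigO_plus; [apply bigO_LS | apply bigO_scal, bigO_ray_q]|].
    apply bigO_scal. apply (bigO_mult 4 4); [apply bigO_ray_x|].
    assert (F1 : bigO 0 (fun t : R => 1 + hF (ray_x t)))
      by (apply bigO_plus; [apply bigO_const | apply bigO_F0]).
    assert (FF : bigO 0 (fun t : R => hF (ray_x t) * hF (ray_x t)))
      by (apply (bigO_mult 0 0); apply bigO_F0).
    apply bigO_minus.
    + apply (bigO_mult 4 0); [apply bigO_ray_x|].
      apply bigO_ext with (fun t : R => hF (ray_x t) * hF (ray_x t) * (hF (ray_x t) * hF (ray_x t)));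
        [intros; ring|]. apply (bigO_mult 0 0); auto.
    + apply (bigO_mult 4 0); [apply (bigO_mult 4 0); auto; apply bigO_F1|].
      apply bigO_plus; [apply bigO_const | auto].
Qed.

Lemma bigO_da : bigO 8 (fun t : R => ray_a t - ray_A t).
Proof.
  apply bigO_ext with (fun t : R => (LS 1 (ray_y t) - 2 * ray_q t) + 2 * (ray_q t - ray_x t / 16)
    - (1 / 2) * ((hM (ray_x t) - ray_x t / 4) * hF (ray_x t))
    - (1 / 8) * (ray_x t * (hF (ray_x t) - 1))).
  - intros t _. unfold ray_a, ray_A. field.
  - apply bigO_minus; [apply bigO_minus; [apply bigO_plus|]|].
    + apply bigO_LS.
    + apply bigO_scal, bigO_ray_q.
    + apply bigO_scal. apply (bigO_mult 8 0); [apply bigO_M2 | apply bigO_F0].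
    + apply bigO_scal. apply (bigO_mult 4 4); [apply bigO_ray_x | apply bigO_F1].
Qed.

(** Both functions start with [1 - 3 x / 2]. The expansion of [hF] through its linear term is
    required here, since [(1 - 2 x) (1 + x / 4)^2 = 1 - 3 x / 2 - x^2 (15 / 16 + x / 8)]. *)
Lemma bigO_dk : bigO 8 (fun t : R => ray_k t - ray_K t).
Proof.
  set (g := fun t : R => hF (ray_x t) - (1 + ray_x t / 4)).
  apply bigO_ext with (fun t : R => (-12) * LT (ray_y t) - 12 * (LS 1 (ray_y t) - 2 * ray_q t)
     - 24 * (ray_q t - ray_x t / 16)
     + (ray_x t * ray_x t * (15 / 16 + ray_x t / 8)
        - (1 - 2 * ray_x t) * ((2 * (1 + ray_x t / 4) + g t) * g t))).
  - intros t _. unfold ray_k, ray_K, Lkappa, g. field.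
  - assert (G : bigO 8 g) by apply bigO_F2.
    assert (X : forall c d : C, bigO 0 (fun t : R => c + d * ray_x t)).
    { intros c d. apply bigO_plus; [apply bigO_const | apply bigO_scal, bigO_x0]. }
    apply bigO_plus; [apply bigO_minus; [apply bigO_minus|]|apply bigO_minus].
    + apply bigO_scal, bigO_LT.
    + apply bigO_scal, bigO_LS.
    + apply bigO_scal, bigO_ray_q.
    + apply (bigO_mult 8 0); [apply (bigO_mult 4 4); apply bigO_ray_x|].
      apply bigO_ext with (fun t : R => 15 / 16 + (1 / 8) * ray_x t); [intros; field|]. apply X.
    + apply (bigO_mult 0 8).
      * apply bigO_ext with (fun t : R => 1 + (-2) * ray_x t); [intros; ring|]. apply X.
      * apply (bigO_mult 0 8); auto. apply bigO_plus; [|apply (bigO_mono 8 0); [lia|auto]].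
        apply bigO_ext with (fun t : R => 2 + (1 / 2) * ray_x t); [intros; field|]. apply X.
Qed.

Lemma bigO_a : bigO 4 (fun t : R => ray_a t).
Proof.
  apply bigO_ext with (fun t : R => (LS 1 (ray_y t) - 2 * ray_q t) + 2 * ray_q t);
    [intros; unfold ray_a; ring|].
  apply bigO_plus; [apply (bigO_mono 8 4); [lia | apply bigO_LS] | apply bigO_scal, bigO_ray_q4].
Qed.

Lemma bigO_A : bigO 4 (fun t : R => ray_A t).
Proof.
  apply bigO_ext with (fun t : R => ray_a t - (ray_a t - ray_A t)); [intros; ring|].
  apply bigO_minus; [apply bigO_a | apply (bigO_mono 8 4); [lia | apply bigO_da]].
Qed.

Lemma bigO_B : bigO 4 (fun t : R => ray_B t).
Proof.
  apply bigO_ext with (fun t : R => (LS 3 (ray_y t) - 2 * ray_q t) + 2 * ray_q t - dp t);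
    [intros; unfold dp, ray_b; ring|].
  apply bigO_minus; [|apply (bigO_mono 8 4); [lia | apply bigO_dp]].
  apply bigO_plus; [apply (bigO_mono 8 4); [lia | apply bigO_LS] | apply bigO_scal, bigO_ray_q4].
Qed.

Lemma bigO_k : bigO 4 (fun t : R => ray_k t - 1).
Proof.
  apply bigO_ext with (fun t : R => (-12) * LT (ray_y t) + (-12) * ray_a t);
    [intros; unfold ray_k, Lkappa, ray_a; ring|].
  apply bigO_plus; [apply (bigO_mono 8 4); [lia | apply bigO_scal, bigO_LT] | apply bigO_scal, bigO_a].
Qed.

Lemma En_nonneg t : (0 <= En t)%R.
Proof. unfold En. pose proof (Cmod_ge_0 (dp t)). pose proof (Cmod_ge_0 (dal t)).
  pose proof (Cmod_ge_0 (dbe t)). nra. Qed.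

Lemma En_order : exists A d, (0 < d)%R /\ forall t, (0 < t < d)%R -> (En t <= A * t ^ 16)%R.
Proof.
  assert (Oal : bigO 8 (fun t : R => dal t)).
  { apply bigO_scal. apply bigO_minus; [apply bigO_da | apply bigO_dp]. }
  assert (Obe : bigO 8 (fun t : R => dbe t)).
  { apply bigO_plus; [apply bigO_dk | apply bigO_scal, bigO_dp]. }
  destruct bigO_dp as [A1 [d1 [HA1 [Hd1 H1]]]]. destruct Oal as [A2 [d2 [HA2 [Hd2 H2]]]].
  destruct Obe as [A3 [d3 [HA3 [Hd3 H3]]]].
  exists (A1 * A1 + A2 * A2 + A3 * A3)%R, (Rmin d1 (Rmin d2 d3)).
  split; [repeat apply Rmin_pos; auto|]. intros t Ht.
  pose proof (Rmin_l d1 (Rmin d2 d3)). pose proof (Rmin_r d1 (Rmin d2 d3)).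
  pose proof (Rmin_l d2 d3). pose proof (Rmin_r d2 d3).
  specialize (H1 t ltac:(lra)). specialize (H2 t ltac:(lra)). specialize (H3 t ltac:(lra)).
  unfold En. replace ((A1 * A1 + A2 * A2 + A3 * A3) * t ^ 16)%R with
    ((A1 * t ^ 8) * (A1 * t ^ 8) + (A2 * t ^ 8) * (A2 * t ^ 8) + (A3 * t ^ 8) * (A3 * t ^ 8))%R by ring.
  repeat apply Rplus_le_compat; apply Rmult_le_compat; auto; apply Cmod_ge_0.
Qed.

Lemma En_zero : En 1 = 0%R.
Proof.
  set (eta := (1 / 4000)%R).
  destruct (bigO_small 3 _ eta bigO_a ltac:(unfold eta; lra)) as [d1 [Hd1 S1]].
  destruct (bigO_small 3 _ eta bigO_A ltac:(unfold eta; lra)) as [d2 [Hd2 S2]].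
  destruct (bigO_small 3 _ eta bigO_B ltac:(unfold eta; lra)) as [d3 [Hd3 S3]].
  destruct (bigO_small 3 _ eta bigO_k ltac:(unfold eta; lra)) as [d4 [Hd4 S4]].
  (* The slack 0.4 turns the limit 4 of [ray_m] into the bound 4.4 of [En_singular]. *)
  destruct (bigO_small 3 _ 0.4 bigO_m ltac:(lra)) as [d5 [Hd5 S5]].
  destruct En_order as [A [d6 [Hd6 S6]]].
  set (d := Rmin d1 (Rmin d2 (Rmin d3 (Rmin d4 (Rmin d5 d6))))).
  assert (Pd : (0 < d)%R) by (repeat apply Rmin_pos; lra).
  assert (Ld : (d <= d1 /\ d <= d2 /\ d <= d3 /\ d <= d4 /\ d <= d5 /\ d <= d6)%R).
  { unfold d.
    pose proof (Rmin_l d1 (Rmin d2 (Rmin d3 (Rmin d4 (Rmin d5 d6))))).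
    pose proof (Rmin_r d1 (Rmin d2 (Rmin d3 (Rmin d4 (Rmin d5 d6))))).
    pose proof (Rmin_l d2 (Rmin d3 (Rmin d4 (Rmin d5 d6)))).
    pose proof (Rmin_r d2 (Rmin d3 (Rmin d4 (Rmin d5 d6)))).
    pose proof (Rmin_l d3 (Rmin d4 (Rmin d5 d6))). pose proof (Rmin_r d3 (Rmin d4 (Rmin d5 d6))).
    pose proof (Rmin_l d4 (Rmin d5 d6)). pose proof (Rmin_r d4 (Rmin d5 d6)).
    pose proof (Rmin_l d5 d6). pose proof (Rmin_r d5 d6). lra. }
  (* Up to [t0] the singular estimate applies; from [t0] to 1 the coefficients are bounded by
     compactness and the ordinary Gronwall estimate finishes. *)
  clearbody d. set (t0 := (d / 2)%R).
  assert (Z0 : En t0 = 0%R).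
  { apply (gronwall_singular En En' t0 A); unfold t0; try lra.
    - intros t Ht. apply En_derive. lra.
    - intros t Ht. apply (En_singular t eta); unfold eta; try lra;
      [apply S1 | apply S2 | apply S3 | apply S4 |]; try lra.
      specialize (S5 t ltac:(lra)).
      pose proof (Cmod_triangle (ray_m t - 4) 4) as T.
      replace (ray_m t - 4 + 4) with (ray_m t) in T by ring.
      rewrite Cmod_R, Rabs_pos_eq in T by lra. lra.
    - intros; apply En_nonneg.
    - intros t Ht. apply S6. lra. }
  assert (CCt : forall t, (t0 <= t <= 1)%R ->
    CC ray_a t /\ CC ray_A t /\ CC ray_B t /\ CC ray_k t /\ CC ray_m t).
  { intros t Ht. assert (Ht' : (0 < t <= 1)%R) by (unfold t0 in *; lra).
    destruct (ray_m_CD_ex t Ht') as [l Hl].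
    repeat split; eapply CD_CC;
    [apply ray_a_CD | apply ray_A_CD | apply ray_B_CD | apply ray_k_CD | apply Hl]; auto. }
  assert (Ht01 : (t0 <= 1)%R) by (unfold t0; lra).
  assert (CK : forall c u, CC (fun _ => c) u) by apply CC_const.
  assert (Bd : forall f, (forall t, (t0 <= t <= 1)%R -> CC f (RtoC t)) ->
    exists M, (0 <= M)%R /\ forall t, (t0 <= t <= 1)%R -> (Cmod (f (RtoC t)) <= M)%R)
    by (intros; apply segment_bounded; auto).
  assert (Cc : forall f (c u : C), CC f u -> CC (fun v => c * f v) u)
    by (intros; apply CC_mult; auto).
  assert (Cm : forall f g u, CC f u -> CC g u -> CC (fun v => f v - g v) u).
  { intros f g u Hf Hg. assert (Q : CC (fun v => f v + (-(1)) * g v) u) by (apply CC_plus; auto).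
    intros e He. destruct (Q e He) as [x [Px Hx]]. exists x. split; auto. intros v Hv.
    specialize (Hx v Hv).
    replace (f v - g v - (f u - g u)) with (f v + (-(1)) * g v - (f u + (-(1)) * g u)) by ring. auto. }
  destruct (Bd ray_m) as [M1 [P1 N1]]; [intros; apply CCt; auto|].
  destruct (Bd ray_B) as [M2 [P2 N2]]; [intros; apply CCt; auto|].
  destruct (Bd c11) as [M3 [P3 N3]].
  { intros t Ht. destruct (CCt t Ht) as [X1 [X2 [X3 [X4 X5]]]].
    apply Cm; [apply CC_plus; auto | auto]. }
  destruct (Bd c21) as [M4 [P4 N4]].
  { intros t Ht. destruct (CCt t Ht) as [X1 [X2 [X3 [X4 X5]]]].
    apply Cc, CC_plus; auto. apply Cm; auto. apply Cm; auto. apply CC_plus; auto.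
    apply Cc, CC_plus; auto. }
  destruct (Bd c22) as [M5 [P5 N5]].
  { intros t Ht. destruct (CCt t Ht) as [X1 [X2 [X3 [X4 X5]]]].
    apply Cm; auto. apply Cc, CC_plus; auto. }
  destruct (Bd (fun t => -8 * ray_B t)) as [M6 [P6 N6]].
  { intros t Ht. destruct (CCt t Ht) as [X1 [X2 [X3 [X4 X5]]]]. auto. }
  destruct (Bd c31) as [M7 [P7 N7]].
  { intros t Ht. destruct (CCt t Ht) as [X1 [X2 [X3 [X4 X5]]]].
    apply CC_plus; [apply Cm; [apply Cm|]|]; auto. apply Cc, Cm; auto. apply CC_plus; auto. }
  destruct (Bd c32) as [M8 [P8 N8]].
  { intros t Ht. destruct (CCt t Ht) as [X1 [X2 [X3 [X4 X5]]]].
    apply CC_plus; auto. apply CC_mult; auto. }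
  destruct (Bd c33) as [M9 [P9 N9]].
  { intros t Ht. destruct (CCt t Ht) as [X1 [X2 [X3 [X4 X5]]]]. apply CC_plus; auto. }
  set (W := (M1 + M2 + M3 + M4 + M5 + M6 + M7 + M8 + M9)%R).
  assert (PW : (0 <= W)%R) by (unfold W; lra).
  apply (gronwall_regular En En' t0 1 (6 * W * W / t0)); auto.
  - intros t Ht. apply En_derive. unfold t0 in *; lra.
  - intros t Ht. assert (Pt0 : (0 < t0)%R) by (unfold t0; lra).
    assert (K : (t * En' t <= 6 * W * W * En t)%R).
    { specialize (N1 t Ht). specialize (N2 t Ht). specialize (N3 t Ht). specialize (N4 t Ht).
      specialize (N5 t Ht). specialize (N6 t Ht). specialize (N7 t Ht). specialize (N8 t Ht).
      specialize (N9 t Ht). apply En_regular; unfold W in *; lra. }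
    pose proof (En_nonneg t) as En0.
    assert (0 <= 6 * W * W * En t)%R by (repeat apply Rmult_le_pos; lra).
    replace (6 * W * W / t0 * En t)%R with (6 * W * W * En t / t0)%R by (field; lra).
    (* Replacing [t] by the smaller [t0] is legitimate only for a positive derivative; otherwise the
       bound is trivial because [En] is nonnegative. *)
    apply Rle_div_r; auto. destruct (Rle_dec (En' t) 0); nra.
  - intros; apply En_nonneg.
Qed.

Lemma ray_end : LS 3 (ray_y 1) = ray_B 1 /\ Lkappa (ray_y 1) = ray_K 1.
Proof.
  pose proof En_zero as Z. unfold En in Z.
  pose proof (Cmod_ge_0 (dp 1)). pose proof (Cmod_ge_0 (dal 1)). pose proof (Cmod_ge_0 (dbe 1)).
  assert (E1 : dp 1 = 0) by (apply Cmod_eq_0; nra).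
  assert (E3 : dbe 1 = 0) by (apply Cmod_eq_0; nra).
  split; apply Ceq_minus.
  - exact E1.
  - replace (Lkappa (ray_y 1) - ray_K 1) with (dbe 1 - 12 * dp 1)
      by (unfold dbe, ray_k; ring).
    rewrite E1, E3. ring.
Qed.

End Ray.

Theorem theorem3p2 (F : C -> C) (HF : is_hyp2F1 (1 / 2) (1 / 2) 1 F)
    (x : C) (hx0 : (0 < Cmod x)%R) (hx1 : (Cmod x < 1)%R)
    (z : C) (hz : z = F x)
    (w : C) (hw : principal_value F (1 - x) w)
    (y : C) (hy : y = PI * (w / z)) :
  is_alt_sinh_sum 3 y (1 / 8 * x * (1 - x) * z ^ 4) /\
  is_alt_sinh_sum 5 y (1 / 8 * x * (1 - x) * (1 - 2 * x) * z ^ 6) /\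
  is_alt_sinh_sum 7 y
    (1 / 16 * x * (1 - x) * (2 - 17 * x + 17 * x ^ 2) * z ^ 8).
Proof.
  destruct (principal_value_hG F HF x w hx0 hx1 hw) as [rho [phi [Hr [Hp [Ex Ew]]]]].
  assert (Ez : z = hF x) by (rewrite hz; apply hyp2F1_disc; auto).
  assert (E1 : 1 * (rho * cis phi) = rho * cis phi) by ring.
  assert (Ey : y = ray_y rho phi 1).
  { unfold ray_y, hY. rewrite E1, <- Ex, <- Ew, <- Ez. auto. }
  assert (Exx : ray_x rho phi 1 = x) by (unfold ray_x; rewrite E1; auto).
  pose proof (ray_y_pos F HF rho phi Hr Hp 1 ltac:(lra)) as Py. rewrite <- Ey in Py.
  destruct (ray_end F HF rho phi Hr Hp) as [E3 Ek].
  rewrite <- Ey in E3, Ek. unfold ray_B in E3. unfold ray_K in Ek. rewrite Exx, <- Ez in E3, Ek.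
  pose proof (LS_sum 3 y Py) as S3. pose proof (LS_sum 5 y Py) as S5. pose proof (LS_sum 7 y Py) as S7.
  rewrite LS_7_eq in S7 by auto. rewrite LS_5_eq, Ek, E3 in * by auto.
  split; [|split].
  - replace (1 / 8 * x * (1 - x) * z ^ 4) with (x * (1 - x) * z ^ 4 / 8) by field. auto.
  - replace (1 / 8 * x * (1 - x) * (1 - 2 * x) * z ^ 6)
      with ((1 - 2 * x) * z ^ 2 * (x * (1 - x) * z ^ 4 / 8)) by field. auto.
  (* The polynomial arises from [(1 - 2 x)^2 - 36 x (1 - x) / 8 = (2 - 17 x + 17 x^2) / 2]. *)
  - replace (1 / 16 * x * (1 - x) * (2 - 17 * x + 17 * x ^ 2) * z ^ 8)
      with ((1 - 2 * x) * z ^ 2 * ((1 - 2 * x) * z ^ 2 * (x * (1 - x) * z ^ 4 / 8))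
        - 36 * (x * (1 - x) * z ^ 4 / 8) * (x * (1 - x) * z ^ 4 / 8)) by field. auto.
Qed.
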